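(* Let $\mathcal{A}\subset\mathbb{A}^d$ be a bounded Borel set with $m(\partial\mathcal{A})=0$. For every $M\in\mathrm{SL}_d(\mathbb{A})$, every $r\in\mathbb{Z}_{\ge0}$ and every Borel probability measure $\lambda$ on $\mathbb{R}^{d-1}$ absolutely continuous with respect to Lebesgue measure, $$\lambda\big(\{\bm x\in\mathbb{R}^{d-1} : \#(\mathcal{A}\,\iota(\Phi^{-t}n(\bm x))\cap\delta(\mathbb{Q})^dM\setminus\{\mathbf 0\})\ge r\}\big)$$ has a limit as $t\to\infty$, equal to $$\mu\big(\{g\in\mathrm{SL}_d(\mathbb{Q})\backslash\mathrm{SL}_d(\mathbb{A}) : \#(\mathcal{A}\cap\delta(\mathbb{Q})^dg\setminus\{\mathbf 0\})\ge r\}\big).$$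
   Context: $d\ge2$; $\mathbb{A}$ is the ring of adeles of $\mathbb{Q}$, $\delta$ the diagonal embedding of $\mathbb{Q}$ (componentwise on $\mathbb{Q}^d$), $\iota\colon\mathrm{SL}_d(\mathbb{R})\to\mathrm{SL}_d(\mathbb{A})$, $M\mapsto(M,I_d,I_d,\ldots)$. $\mathrm{SL}_d(\mathbb{A})$ acts on row vectors in $\mathbb{A}^d$ on the right; $\mathcal{A}g=\{\bm xg:\bm x\in\mathcal{A}\}$, and $\delta(\mathbb{Q})^dg$ is well defined for a coset $g\in\mathrm{SL}_d(\mathbb{Q})\backslash\mathrm{SL}_d(\mathbb{A})$. $n(\bm x)=\begin{pmatrix}1&\bm x\\ {}^t\mathbf 0&I_{d-1}\end{pmatrix}$, $\Phi^t=\mathrm{diag}(e^{-(d-1)t},e^t,\ldots,e^t)$. $m$ is a Haar measure on $\mathbb{A}^d$ and $\mu$ the invariant probability measure on $\mathrm{SL}_d(\mathbb{Q})\backslash\mathrm{SL}_d(\mathbb{A})$. *)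

(* Defs.v *)
From HB Require Import structures.
From mathcomp Require Import all_boot all_order all_algebra.
From mathcomp Require Import all_classical all_reals all_analysis.
From mathcomp Require Import ring_quotient measurable_realfun.
From mathcomp Require Import ring.
Import numFieldNormedType.Exports.
Import Order.TTheory GRing.Theory Num.Theory.

Set Implicit Arguments.
Unset Strict Implicit.
Unset Printing Implicit Defensive.

Local Open Scope classical_set_scope.
Local Open Scope ring_scope.
Local Open Scope quotient_scope.

(* [padic_abs p x] is |x|_p = p ^ (- v_p x) on the rationals, v_p being the
   p-adic valuation. *)
Definition padic_abs (p : nat) (x : rat) : rat :=
  if x == 0 then 0
  else (p%:R : rat) ^ ((logn p `|denq x|)%:Z - (logn p `|numq x|)%:Z).

Section PadicAbs.
Variable p : nat.
Hypothesis p_pr : prime p.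
Local Notation abs := (padic_abs p).

Let p_gt0 : (0 : rat) < p%:R. Proof. by rewrite ltr0n prime_gt0. Qed.
Let p_neq0 : (p%:R : rat) != 0. Proof. by rewrite gt_eqF. Qed.
Let p_ge1 : (1 : rat) <= p%:R. Proof. by rewrite ler1n prime_gt0. Qed.

Lemma padic_abs0 : abs 0 = 0. Proof. by rewrite /padic_abs eqxx. Qed.

Lemma padic_abs_ge0 x : 0 <= abs x.
Proof. by rewrite /padic_abs; case: ifP => // _; rewrite exprz_ge0// ltW. Qed.

Lemma padic_abs_frac (a b : int) : a != 0 -> b != 0 ->
  abs (a%:~R / b%:~R) = (p%:R : rat) ^ ((logn p `|b|)%:Z - (logn p `|a|)%:Z).
Proof.
move=> a0 b0; set x := _ / _.
have x0 : x != 0 by rewrite mulf_neq0 ?invr_eq0 ?intr_eq0.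
rewrite /padic_abs (negPf x0).
have nx0 : numq x != 0 by rewrite numq_eq0.
have E : numq x * b = a * denq x.
  apply: (@intr_inj rat); rewrite !rmorphM/=.
  have := divq_num_den x; rewrite {3}/x => /eqP.
  by rewrite eqr_div ?intr_eq0 ?denq_neq0// => /eqP.
have := congr1 (fun z : int => logn p `|z|%N) E.
rewrite !abszM !lognM ?absz_gt0 ?denq_neq0// => E2.
congr (_ ^ _); have := congr1 Posz E2; rewrite !PoszD => E3.
by apply/eqP; rewrite subr_eq addrAC eq_sym subr_eq addrC E3 addrC.
Qed.

Lemma padic_absM x y : abs (x * y) = abs x * abs y.
Proof.
have [->|x0] := eqVneq x 0; first by rewrite mul0r padic_abs0 mul0r.
have [->|y0] := eqVneq y 0; first by rewrite mulr0 padic_abs0 mulr0.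
have nx0 : numq x != 0 by rewrite numq_eq0.
have ny0 : numq y != 0 by rewrite numq_eq0.
have -> : x * y = (numq x * numq y)%:~R / (denq x * denq y)%:~R.
  by rewrite -{1}[x]divq_num_den -{1}[y]divq_num_den mulf_div !rmorphM.
rewrite padic_abs_frac ?mulf_neq0 ?denq_neq0//.
rewrite /padic_abs (negPf x0) (negPf y0) -expfzDr//; congr (_ ^ _).
by rewrite !abszM !lognM ?absz_gt0 ?denq_neq0// !PoszD opprD addrACA.
Qed.

Lemma padic_absN x : abs (- x) = abs x.
Proof. by rewrite /padic_abs oppr_eq0 numqN denqN abszN. Qed.

Lemma padic_abs_int (a : int) : abs a%:~R <= 1.
Proof.
have [->|a0] := eqVneq a 0; first by rewrite padic_abs0.
have -> : (a%:~R : rat) = a%:~R / 1%:~R by rewrite divr1.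
rewrite padic_abs_frac// logn1 sub0r -invr_expz invf_le1 ?exprz_gt0//.
by rewrite -exprnP exprn_ege1.
Qed.

Lemma padic_absD1 x : abs x <= 1 -> abs (1 + x) <= 1.
Proof.
have [->|x0 xle] := eqVneq x 0; first by rewrite addr0 (padic_abs_int 1).
have nx0 : numq x != 0 by rewrite numq_eq0.
have pden : logn p `|denq x| = 0%N.
  apply/eqP; rewrite -leqn0 leqNgt logn_gt0 mem_primes p_pr absz_gt0 denq_neq0 /=.
  apply/negP => pd.
  have pn : logn p `|numq x| = 0%N.
    apply/eqP; rewrite -leqn0 leqNgt logn_gt0 mem_primes p_pr absz_gt0 nx0 /=.
    apply/negP => pn; have := coprime_num_den x => /eqP g1.
    have : (p %| gcdn `|numq x| `|denq x|)%N by rewrite dvdn_gcd pn pd.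
    by rewrite g1 dvdn1 => /eqP p1; move: p_pr; rewrite p1.
  move: xle; rewrite /padic_abs (negPf x0) pn subr0 -exprnP leNgt.
  rewrite exprn_egt1 ?ltr1n ?prime_gt1//.
  by rewrite -lt0n logn_gt0 mem_primes p_pr absz_gt0 denq_neq0 pd.
have -> : 1 + x = (denq x + numq x)%:~R / (denq x)%:~R.
  rewrite rmorphD/= mulrDl divff ?intr_eq0 ?denq_neq0//.
  by rewrite divq_num_den.
rewrite padic_absM -[leRHS]mulr1 ler_pM ?padic_abs_ge0 ?padic_abs_int//.
have -> : ((denq x)%:~R : rat)^-1 = 1%:~R / (denq x)%:~R by rewrite div1r.
by rewrite padic_abs_frac ?denq_neq0// pden logn1 subrr expr0z.
Qed.

Lemma padic_abs_eq0 x : (abs x == 0) = (x == 0).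
Proof.
have [->|x0] := eqVneq x 0; first by rewrite padic_abs0 eqxx.
by rewrite /padic_abs (negPf x0) gt_eqF// exprz_gt0.
Qed.

Lemma padic_absD x y : abs (x + y) <= Num.max (abs x) (abs y).
Proof.
wlog xy : x y / abs y <= abs x => [hw|].
  case/orP: (le_total (abs y) (abs x)) => [/hw//|yx].
  by rewrite addrC; have := hw _ _ yx; rewrite maxC.
rewrite le_max; apply/orP; left.
have [x0|x0] := eqVneq x 0.
  by rewrite x0 add0r -x0.
have ax : 0 < abs x by rewrite lt_neqAle eq_sym padic_abs_eq0 x0 padic_abs_ge0.
have -> : x + y = x * (1 + y / x) by rewrite mulrDr mulr1 mulrC divfK.
rewrite padic_absM ler_piMr ?padic_abs_ge0// padic_absD1//.
rewrite -(ler_pM2l ax) -padic_absM mulrC divfK// mulr1//.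
Qed.

Lemma padic_absB x y : abs (x - y) <= Num.max (abs x) (abs y).
Proof. by rewrite -(padic_absN y); exact: padic_absD. Qed.

Lemma padic_abs1 : abs 1 = 1.
Proof. by rewrite /padic_abs /= logn1 subrr expr0z. Qed.

End PadicAbs.

Definition primeT := {p : nat | prime p}.
HB.instance Definition _ := Choice.on primeT.

Definition padic_cauchy (p : primeT) : {pred nat -> rat} := fun u =>
  `[< forall e : rat, 0 < e -> exists N : nat, forall i j : nat,
        (N <= i)%N -> (N <= j)%N -> padic_abs (val p) (u i - u j) < e >].

Section PadicCauchy.
Variable p : primeT.
Local Notation abs := (padic_abs (val p)).
Let pP := valP p.

Lemma padic_cauchy_bounded u : u \in padic_cauchy p ->
  exists2 C, 0 < C & exists N, forall i, (N <= i)%N -> abs (u i) <= C.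
Proof.
move=> /asboolP/(_ 1 ltr01)[N uN]; exists (Num.max (abs (u N)) 1).
  by rewrite lt_max ltr01 orbT.
exists N => i Ni; have -> : u i = u N + (u i - u N) by rewrite addrC subrK.
apply: (le_trans (padic_absD pP _ _)).
by rewrite ge_max !le_max lexx /= (ltW (uN _ _ Ni (leqnn N))) orbT.
Qed.

Lemma padic_cauchy_subring_closed : subring_closed (padic_cauchy p).
Proof.
split=> [|u v uC vC|u v uC vC]; apply/asboolP => e e0.
- by exists 0 => i j _ _; rewrite subrr padic_abs0.
- move/asboolP: uC => /(_ _ e0)[N uN]; move/asboolP: vC => /(_ _ e0)[M vM].
  exists (maxn N M) => i j; rewrite !geq_max => /andP[Ni Mi] /andP[Nj Mj].
  have -> : (u - v) i - (u - v) j = (u i - u j) - (v i - v j).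
    by change ((u i - v i) - (u j - v j) = (u i - u j) - (v i - v j)); ring.
  apply: (le_lt_trans (padic_absB pP _ _)).
  by rewrite gt_max uN// vM.
- have [C C0 [N1 uC1]] := padic_cauchy_bounded uC.
  have [D D0 [N2 vD1]] := padic_cauchy_bounded vC.
  move/asboolP: uC => /(_ _ (divr_gt0 e0 D0))[N uN].
  move/asboolP: vC => /(_ _ (divr_gt0 e0 C0))[M vM].
  exists (maxn (maxn N M) (maxn N1 N2)) => i j; rewrite !geq_max.
  move=> /andP[/andP[Ni Mi] /andP[N1i N2i]] /andP[/andP[Nj Mj] /andP[N1j N2j]].
  have -> : (u * v) i - (u * v) j = u i * (v i - v j) + (u i - u j) * v j.
    by change ((u i * v i) - (u j * v j) =
               u i * (v i - v j) + (u i - u j) * v j); ring.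
  apply: (le_lt_trans (padic_absD pP _ _)).
  rewrite gt_max !padic_absM//; apply/andP; split.
    have := vM _ _ Mi Mj; rewrite ltr_pdivlMr// mulrC; apply: le_lt_trans.
    by rewrite ler_wpM2r ?padic_abs_ge0// uC1.
  have := uN _ _ Ni Nj; rewrite ltr_pdivlMr//; apply: le_lt_trans.
  by rewrite ler_wpM2l ?padic_abs_ge0// vD1.
Qed.

HB.instance Definition _ :=
  GRing.isSubringClosed.Build (nat -> rat) (padic_cauchy p)
    padic_cauchy_subring_closed.

End PadicCauchy.

Definition padic_seq (p : primeT) := {u : nat -> rat | u \in padic_cauchy p}.
HB.instance Definition _ p := SubChoice.on (padic_seq p).
HB.instance Definition _ p :=
  [SubChoice_isSubComNzRing of padic_seq p by <:].

Definition padic_null (p : primeT) : {pred padic_seq p} := fun u =>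
  `[< forall e : rat, 0 < e -> exists N : nat, forall i : nat,
        (N <= i)%N -> padic_abs (val p) (val u i) < e >].

Section PadicNull.
Variable p : primeT.
Local Notation abs := (padic_abs (val p)).
Let pP := valP p.

Lemma padic_null_idealr_closed : idealr_closed (@padic_null p).
Proof.
split=> [||a u v uN vN].
- by apply/asboolP => e e0; exists 0 => i _; rewrite padic_abs0.
- apply/negP => /asboolP/(_ 1 ltr01)[N /(_ N (leqnn N))].
  by rewrite [padic_abs _ _]padic_abs1 ltxx.
apply/asboolP => e e0.
have [C C0 [N1 aC]] := padic_cauchy_bounded (valP a).
move/asboolP: uN => /(_ _ (divr_gt0 e0 C0))[N uN].
move/asboolP: vN => /(_ _ e0)[M vM].
exists (maxn N1 (maxn N M)) => i; rewrite !geq_max => /and3P[N1i Ni Mi].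
change (abs (val a i * val u i + val v i) < e).
apply: (le_lt_trans (padic_absD pP _ _)).
rewrite gt_max vM// andbT padic_absM//.
have := uN _ Ni; rewrite ltr_pdivlMr// mulrC; apply: le_lt_trans.
by rewrite ler_wpM2r ?padic_abs_ge0// aC.
Qed.

HB.instance Definition _ :=
  isIdealr.Build (padic_seq p) (@padic_null p) padic_null_idealr_closed.

End PadicNull.

(* Q_p: the completion of the rationals for the p-adic absolute value, as
   Cauchy sequences modulo null sequences. *)
Definition Qp (p : primeT) := {ideal_quot (@padic_null p)}.
HB.instance Definition _ p := GRing.ComNzRing.on (Qp p).
HB.instance Definition _ p := Choice.on (Qp p).

(* |x|_p is the limit of |u_i|_p for any Cauchy sequence u representing x; it
   takes rational values. *)
Definition is_padic_norm (p : primeT) (u : nat -> rat) (c : rat) :=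
  forall e : rat, 0 < e -> exists N : nat, forall i : nat,
    (N <= i)%N -> `|padic_abs (val p) (u i) - c| < e.

Definition padic_norm (p : primeT) (x : Qp p) : rat :=
  xget 0 (is_padic_norm p (val (repr x : padic_seq p))).

Section PadicNorm.
Variable p : primeT.
Local Notation abs := (padic_abs (val p)).
Let pP := valP p.
Implicit Types u v : padic_seq p.

Lemma padic_abs_isosceles (x y : rat) : abs (x - y) < abs y -> abs x = abs y.
Proof.
move=> xy; apply/eqP; rewrite eq_le; apply/andP; split.
  have := padic_absD pP (x - y) y; rewrite subrK => /le_trans; apply.
  by rewrite ge_max lexx ltW.
rewrite leNgt; apply/negP => lt; have := padic_absB pP x (x - y).
have -> : x - (x - y) = y by ring.
by rewrite leNgt gt_max lt xy.
Qed.

Lemma is_padic_norm_ex u : exists c, is_padic_norm p (val u) c.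
Proof.
have [u0|/asboolP/existsNP[e /not_implyP[e0 uN0]]] := boolP (u \in @padic_null p).
  exists 0 => e e0; move/asboolP: u0 => /(_ e e0)[N uN]; exists N => i Ni.
  by rewrite subr0 ger0_norm ?padic_abs_ge0// uN.
have /asboolP/(_ e e0)[N uN] := valP u.
have [i Ni ei] : exists2 i, (N <= i)%N & e <= abs (val u i).
  apply: contrapT => H; apply: uN0; exists N => i Ni.
  by rewrite ltNge; apply/negP => ei; apply: H; exists i.
exists (abs (val u i)) => d d0; exists N => j Nj.
by rewrite (@padic_abs_isosceles _ (val u i)) ?subrr ?normr0//
  (lt_le_trans (uN _ _ Nj Ni)).
Qed.

Lemma padic_normP u : is_padic_norm p (val u) (padic_norm (\pi_(Qp p) u)).
Proof.
set x := \pi_(Qp p) u.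
have : is_padic_norm p (val (repr x : padic_seq p)) (padic_norm x).
  by apply: (@xgetPex _ 0 (is_padic_norm p _)); exact: is_padic_norm_ex.
have /asboolP uN : u - repr x \in @padic_null p.
  by rewrite Quotient.idealrBE reprK.
move=> xN e e0.
have [N1 {}xN] := xN _ (divr_gt0 e0 (ltr0Sn _ 1)).
have [N2 {}uN] := uN _ (divr_gt0 e0 (ltr0Sn _ 1)).
exists (maxn N1 N2) => i; rewrite geq_max => /andP[N1i N2i].
have {}uN := uN _ N2i; have {}xN := xN _ N1i.
rewrite -[val _ _]/(val u i - val (repr x : padic_seq p) i) in uN.
move: uN xN; set a := val u i; set b := val (repr x : padic_seq p) i => ab bx.
have ab' : `|abs a - abs b| <= abs (a - b).
  have h (y z : rat) : abs y - abs z <= abs (y - z).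
    have := padic_absD pP (y - z) z; rewrite subrK => yz.
    rewrite lerBlDr; apply: (le_trans yz); rewrite ge_max lerDl lerDr.
    by rewrite !padic_abs_ge0.
  by rewrite ler_norml h andbT lerNl opprB -(padic_absN _ (a - b)) opprB h.
have -> : abs a - padic_norm x = (abs a - abs b) + (abs b - padic_norm x).
  by ring.
rewrite (le_lt_trans (ler_normD _ _))// (splitr e) ler_ltD//.
by rewrite (le_trans ab')// ltW.
Qed.

Lemma padic_norm_le u c :
  (exists N, forall i, (N <= i)%N -> abs (val u i) <= c) ->
  padic_norm (\pi_(Qp p) u) <= c.
Proof.
move=> [N uN]; rewrite leNgt; apply/negP => lt.
have e0 : 0 < padic_norm (\pi_(Qp p) u) - c by rewrite subr_gt0.
have [M uM] := padic_normP u e0.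
have := uM (maxn N M) (leq_maxr _ _); have := uN (maxn N M) (leq_maxl _ _).
rewrite ltr_norml => uc /andP[+ _]; rewrite ltrBrDl opprB addrC subrK.
by rewrite ltNge uc.
Qed.

Lemma padic_norm_eventually u c d : padic_norm (\pi_(Qp p) u) <= c -> c < d ->
  exists N, forall i, (N <= i)%N -> abs (val u i) < d.
Proof.
move=> uc cd; have e0 : 0 < d - c by rewrite subr_gt0.
have [N uN] := padic_normP u e0.
exists N => i /uN; rewrite ltr_norml => /andP[_].
rewrite ltrBlDr => /lt_le_trans; apply.
by rewrite -lerBrDl opprB addrC subrK.
Qed.

Lemma padic_norm_leP u c : 0 < c -> padic_norm (\pi_(Qp p) u) <= c ->
  exists N, forall i, (N <= i)%N -> abs (val u i) <= c.
Proof.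
move=> c0 uc; have /asboolP/(_ c c0)[N uN] := valP u; exists N => i Ni.
rewrite leNgt; apply/negP => ci.
have [M uM] := padic_norm_eventually uc ci.
have := uM (maxn N M) (leq_maxr _ _).
rewrite (@padic_abs_isosceles _ (val u i)) ?ltxx//.
by rewrite (lt_trans _ ci)// uN// leq_maxl.
Qed.

Lemma padic_norm_cst (u : padic_seq p) (q : rat) : val u = (fun=> q) ->
  padic_norm (\pi_(Qp p) u) <= abs q.
Proof. by move=> uq; apply: padic_norm_le; exists 0 => i _; rewrite uq. Qed.


Lemma padic_normB (x y : Qp p) c : 0 < c ->
  padic_norm x <= c -> padic_norm y <= c -> padic_norm (x - y) <= c.
Proof.
move=> c0; rewrite -[x]reprK -[y]reprK; set u := repr x; set v := repr y.
move=> /(padic_norm_leP c0)[N uN] /(padic_norm_leP c0)[M vM].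
have -> : \pi_(Qp p) u - \pi_(Qp p) v = \pi_(Qp p) (u - v) by rewrite !piE.
apply: padic_norm_le; exists (maxn N M) => i; rewrite geq_max => /andP[Ni Mi].
rewrite [val _ _]/(val u i - val v i) (le_trans (padic_absB pP _ _))//.
by rewrite ge_max uN// vM.
Qed.

Lemma padic_normM_le1 (x y : Qp p) :
  padic_norm x <= 1 -> padic_norm y <= 1 -> padic_norm (x * y) <= 1.
Proof.
rewrite -[x]reprK -[y]reprK; set u := repr x; set v := repr y.
move=> /(padic_norm_leP ltr01)[N uN] /(padic_norm_leP ltr01)[M vM].
have -> : \pi_(Qp p) u * \pi_(Qp p) v = \pi_(Qp p) (u * v) by rewrite !piE.
apply: padic_norm_le; exists (maxn N M) => i; rewrite geq_max => /andP[Ni Mi].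
rewrite [val _ _]/(val u i * val v i) padic_absM//.
by rewrite mulr_ile1 ?padic_abs_ge0 ?uN ?vM.
Qed.

End PadicNorm.

Section PadicTopology.
Variable p : primeT.

Definition padic_open (U : set (Qp p)) : Prop :=
  forall x, U x -> exists2 e : rat, 0 < e &
    [set y | padic_norm (y - x) < e] `<=` U.

Let padic_openT : padic_open setT.
Proof. by move=> x _; exists 1. Qed.

Let padic_openI : setI_closed padic_open.
Proof.
move=> U V oU oV x [/oU[e e0 eU] /oV[d d0 dV]].
exists (Num.min e d); first by rewrite lt_min e0.
by move=> y /=; rewrite lt_min => /andP[ye yd]; split; [exact: eU|exact: dV].
Qed.

Let padic_open_bigU (I : Type) (f : I -> set (Qp p)) :
  (forall i, padic_open (f i)) -> padic_open (\bigcup_i f i).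
Proof.
move=> of_ x [i _ /of_[e e0 ei]]; exists e => // y /ei fy.
by exists i.
Qed.

HB.instance Definition _ := isOpenTopological.Build (Qp p)
  padic_openT padic_openI padic_open_bigU.
HB.instance Definition _ := isPointed.Build (Qp p) 0.

Definition padic_int : {pred Qp p} := fun x => padic_norm x <= 1.

Lemma padic_int_subring_closed : subring_closed padic_int.
Proof.
split=> [|x y xZ yZ|x y xZ yZ].
- rewrite /in_mem /= /padic_int.
  have -> : (1 : Qp p) = \pi_(Qp p) 1 by rewrite piE.
  apply: (@le_trans _ _ (padic_abs (val p) 1)); last by rewrite padic_abs1.
  exact: padic_norm_cst.
- exact: padic_normB.
- exact: padic_normM_le1.
Qed.

HB.instance Definition _ := GRing.isSubringClosed.Build (Qp p) padic_int
  padic_int_subring_closed.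

Lemma open_padic_int : open [set x : Qp p | x \in padic_int].
Proof.
move=> x /= xZ; exists 1 => // y /= yx.
rewrite -(subrK x y) rpredD//; exact: ltW.
Qed.

End PadicTopology.

Definition padic_prod := forall p : primeT, Qp p.
HB.instance Definition _ := Choice.on padic_prod.

Section PadicProd.
Implicit Types x y z : padic_prod.

Let add x y : padic_prod := fun p => x p + y p.
Let opp x : padic_prod := fun p => - x p.
Let mul x y : padic_prod := fun p => x p * y p.

Let addA : associative add.
Proof. by move=> x y z; apply: functional_extensionality_dep => p; exact: addrA. Qed.
Let addC : commutative add.
Proof. by move=> x y; apply: functional_extensionality_dep => p; exact: addrC. Qed.
Let add0 : left_id (fun=> 0) add.
Proof. by move=> x; apply: functional_extensionality_dep => p; exact: add0r. Qed.
Let addN : left_inverse (fun=> 0) opp add.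
Proof. by move=> x; apply: functional_extensionality_dep => p; exact: addNr. Qed.
HB.instance Definition _ := GRing.isZmodule.Build padic_prod addA addC add0 addN.

Let mulA : associative mul.
Proof. by move=> x y z; apply: functional_extensionality_dep => p; exact: mulrA. Qed.
Let mulC : commutative mul.
Proof. by move=> x y; apply: functional_extensionality_dep => p; exact: mulrC. Qed.
Let mul1 : left_id (fun=> 1) mul.
Proof. by move=> x; apply: functional_extensionality_dep => p; exact: mul1r. Qed.
Let mulD : left_distributive mul add.
Proof. by move=> x y z; apply: functional_extensionality_dep => p; exact: mulrDl. Qed.
Let one_neq0 : (fun=> 1 : Qp _) != 0 :> padic_prod.
Proof.
apply/eqP => /(congr1 (fun f : padic_prod => f (exist _ 2%N isT))) /eqP.
by rewrite [X in _ == X]/(0 : Qp _) oner_eq0.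
Qed.
HB.instance Definition _ := GRing.Zmodule_isComNzRing.Build padic_prod
  mulA mulC mul1 mulD one_neq0.

End PadicProd.

(* The adele ring of Q is the restricted product of R and the Q_p with respect
   to the Z_p. *)
Definition restricted (R : realType) : {pred (R * padic_prod)%type} := fun x =>
  `[< finite_set [set p | x.2 p \notin @padic_int p] >].

Section Restricted.
Variable R : realType.

Lemma restricted_subring_closed : subring_closed (@restricted R).
Proof.
split=> [|x y /asboolP xZ /asboolP yZ|x y /asboolP xZ /asboolP yZ]; apply/asboolP.
- apply: (sub_finite_set _ (finite_set0 _)) => p /= /negP; apply.
  exact: (rpred1 (@padic_int p)).
- have xyZ : finite_set ([set p | x.2 p \notin @padic_int p] `|`
                         [set p | y.2 p \notin @padic_int p]) by rewrite finite_setU.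
  apply: sub_finite_set xyZ => p /=; apply: contraPP => /not_orP[].
  move=> /negP/negPn xp /negP/negPn yp; apply/negP/negPn.
  exact: (rpredB xp yp).
- have xyZ : finite_set ([set p | x.2 p \notin @padic_int p] `|`
                         [set p | y.2 p \notin @padic_int p]) by rewrite finite_setU.
  apply: sub_finite_set xyZ => p /=; apply: contraPP => /not_orP[].
  move=> /negP/negPn xp /negP/negPn yp; apply/negP/negPn.
  exact: (rpredM xp yp).
Qed.

HB.instance Definition _ := GRing.isSubringClosed.Build (R * padic_prod)%type
  (@restricted R) restricted_subring_closed.

Definition adele := {x : (R * padic_prod)%type | x \in @restricted R}.
HB.instance Definition _ := SubChoice.on adele.
HB.instance Definition _ := [SubChoice_isSubComNzRing of adele by <:].
HB.instance Definition _ := isPointed.Build adele 0.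

Definition adele_real (x : adele) : R := (val x).1.
Definition adele_padic (p : primeT) (x : adele) : Qp p := (val x).2 p.

Lemma adele_eq (x y : adele) : adele_real x = adele_real y ->
  (forall p, adele_padic p x = adele_padic p y) -> x = y.
Proof.
move=> xy1 xy2; apply: val_inj; rewrite [val x]surjective_pairing.
rewrite [val y]surjective_pairing; congr (_, _) => //.
by apply: functional_extensionality_dep => p; exact: xy2.
Qed.

Let adele_real_additive : zmod_morphism adele_real. Proof. by []. Qed.
HB.instance Definition _ :=
  GRing.isZmodMorphism.Build adele R adele_real adele_real_additive.
Let adele_real_monoid : monoid_morphism adele_real. Proof. by []. Qed.
HB.instance Definition _ :=
  GRing.isMonoidMorphism.Build adele R adele_real adele_real_monoid.

Let adele_padic_additive p : zmod_morphism (adele_padic p). Proof. by []. Qed.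
HB.instance Definition _ p :=
  GRing.isZmodMorphism.Build adele (Qp p) (adele_padic p)
    (adele_padic_additive p).
Let adele_padic_monoid p : monoid_morphism (adele_padic p). Proof. by []. Qed.
HB.instance Definition _ p :=
  GRing.isMonoidMorphism.Build adele (Qp p) (adele_padic p)
    (adele_padic_monoid p).

(* Base of the restricted product topology. *)
Definition adele_base : set (set adele) :=
  [set B | exists U : set R, exists V : forall p, set (Qp p),
    [/\ open U, forall p, open (V p),
        finite_set [set p | V p != [set x | x \in @padic_int p]] &
        B = [set x | U (adele_real x) /\ forall p, V p (adele_padic p x)]]].

Let adele_base_cover : \bigcup_(B in adele_base) B = setT.
Proof.
apply/seteqP; split=> // x _.
pose V (p : primeT) : set (Qp p) := [set y | (y \in @padic_int p) ||
  (adele_padic p x \notin @padic_int p)].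
have VE p : adele_padic p x \in @padic_int p -> V p = [set x | x \in @padic_int p].
  by move=> xp; rewrite /V xp; apply/seteqP; split=> y /=; rewrite orbF.
exists [set x | [set: R] (adele_real x) /\ forall p, V p (adele_padic p x)].
  exists setT, V; split=> //; [exact: openT|move=> p|].
    have [/VE ->|xp] := boolP (adele_padic p x \in @padic_int p); first exact: open_padic_int.
    have -> : V p = setT.
      by apply/seteqP; split=> y //= _; rewrite /V /= xp orbT.
    exact: openT.
  have /asboolP xr := valP x; apply: sub_finite_set xr => p /=.
  by apply: contra => /VE ->.
split=> // p; rewrite /V /=; exact: orbN.
Qed.

Let adele_base_join (B C : set adele) x : adele_base B -> adele_base C ->
  B x -> C x -> exists D, [/\ adele_base D, D x & D `<=` B `&` C].
Proof.
move=> [U1 [V1 [oU1 oV1 f1 ->]]] [U2 [V2 [oU2 oV2 f2 ->]]] [xU1 xV1] [xU2 xV2].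
exists [set x | (U1 `&` U2) (adele_real x) /\
                forall p, (V1 p `&` V2 p) (adele_padic p x)]; split.
- exists (U1 `&` U2), (fun p => V1 p `&` V2 p); split=> //; first exact: openI.
    by move=> p; exact: openI.
  have f12 : finite_set ([set p | V1 p != [set x | x \in @padic_int p]] `|`
      [set p | V2 p != [set x | x \in @padic_int p]]) by rewrite finite_setU.
  apply: sub_finite_set f12 => p /=; apply: contraPP => /not_orP[].
  move=> /negP/negPn/eqP -> /negP/negPn/eqP ->.
  by apply/negP/negPn/eqP; rewrite setIid.
- by split=> // p; split.
- by move=> y [[yU1 yU2] yV]; split; split=> // p; have [] := yV p.
Qed.

HB.instance Definition _ := @isBaseTopological.Build adele (set adele)
  adele_base id adele_base_cover adele_base_join.

End Restricted.

Lemma padic_cauchy_cst (p : primeT) (q : rat) :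
  (fun=> q) \in padic_cauchy p.
Proof. by apply/asboolP => e e0; exists 0 => i j _ _; rewrite subrr padic_abs0. Qed.

Definition rat_Qp (p : primeT) (q : rat) : Qp p :=
  \pi_(Qp p) (exist _ (fun=> q) (padic_cauchy_cst p q) : padic_seq p).

Section DiagonalEmbedding.
Variable R : realType.

Lemma rat_Qp_restricted (q : rat) :
  (ratr q, (fun p => rat_Qp p q)) \in @restricted R.
Proof.
apply/asboolP.
have fq : finite_set ((val : primeT -> nat) @^-1` `I_(`|denq q|).+1).
  apply: finite_preimage; last exact: finite_II.
  by move=> x y _ _; exact: val_inj.
apply: sub_finite_set fq => p /=; apply: contraPP => pq.
apply/negP/negPn.
apply: (@le_trans _ _ (padic_abs (val p) q)); first exact: padic_norm_cst.
have [->|q0] := eqVneq q 0; first by rewrite padic_abs0.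
rewrite /padic_abs (negPf q0).
have -> : logn (val p) `|denq q| = 0%N.
  apply/eqP; rewrite -leqn0 leqNgt logn_gt0 mem_primes absz_gt0 denq_neq0 /=.
  apply/negP => /andP[_ /dvdn_leq]; rewrite absz_gt0 denq_neq0 => /(_ isT) pd.
  by apply: pq; rewrite /= ltnS.
rewrite sub0r -invr_expz invf_le1 ?exprz_gt0// ?ltr0n ?prime_gt0 ?(valP p)//.
by rewrite -exprnP exprn_ege1// ler1n prime_gt0// (valP p).
Qed.

Definition delta (q : rat) : adele R :=
  exist (fun x => x \in @restricted R) _ (rat_Qp_restricted q).

Let delta_additive : zmod_morphism delta.
Proof.
move=> x y; apply: adele_eq => [|p]; first exact: (rmorphB ratr).
change (rat_Qp p (x - y) = rat_Qp p x - rat_Qp p y).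
rewrite /rat_Qp !piE; congr (\pi_(Qp p) _); exact: val_inj.
Qed.
HB.instance Definition _ :=
  GRing.isZmodMorphism.Build rat (adele R) delta delta_additive.

Let delta_monoid : monoid_morphism delta.
Proof.
split=> [|x y]; apply: adele_eq => [|p].
- exact: (rmorph1 ratr).
- change (rat_Qp p 1 = 1).
  rewrite /rat_Qp !piE; congr (\pi_(Qp p) _); exact: val_inj.
- exact: (rmorphM ratr).
- change (rat_Qp p (x * y) = rat_Qp p x * rat_Qp p y).
  rewrite /rat_Qp !piE; congr (\pi_(Qp p) _); exact: val_inj.
Qed.
HB.instance Definition _ :=
  GRing.isMonoidMorphism.Build rat (adele R) delta delta_monoid.

Lemma with_real_restricted (x : R) (y : adele R) :
  (x, (val y).2) \in @restricted R.
Proof. by have /asboolP yr := valP y; apply/asboolP. Qed.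

Definition with_real (x : R) (y : adele R) : adele R :=
  exist (fun x => x \in @restricted R) _ (with_real_restricted x y).

End DiagonalEmbedding.

Definition SL (K : comNzRingType) (d : nat) := {M : 'M[K]_d | \det M == 1}.

Section SLGroup.
Variables (K : comNzRingType) (d : nat).
HB.instance Definition _ := SubChoice.on (SL K d).
Implicit Types M N : SL K d.

Let one_proof : \det (1%:M : 'M[K]_d) == 1.
Proof. by rewrite det1. Qed.
Let mul_proof M N : \det (val M *m val N) == 1.
Proof. by rewrite det_mulmx (eqP (valP M)) (eqP (valP N)) mulr1. Qed.
Let inv_proof M : \det (\adj (val M)) == 1.
Proof.
have := congr1 determinant (mul_mx_adj (val M)).
by rewrite (eqP (valP M)) det_mulmx det1 (eqP (valP M)) mul1r => ->.
Qed.

Let one : SL K d := Sub (1%:M : 'M[K]_d) one_proof.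
Let mul M N : SL K d := Sub (val M *m val N) (mul_proof M N).
Let inv M : SL K d := Sub (\adj (val M)) (inv_proof M).

Let mulA : associative mul.
Proof. by move=> M N P; apply: val_inj; rewrite /= mulmxA. Qed.
Let mul1 : left_id one mul.
Proof. by move=> M; apply: val_inj; rewrite /= mul1mx. Qed.
Let mulr1 : right_id one mul.
Proof. by move=> M; apply: val_inj; rewrite /= mulmx1. Qed.
Let mulV : left_inverse one inv mul.
Proof.
by move=> M; apply: val_inj; rewrite /= mul_adj_mx (eqP (valP M)).
Qed.
Let mulrV : right_inverse one inv mul.
Proof.
by move=> M; apply: val_inj; rewrite /= mul_mx_adj (eqP (valP M)).
Qed.

HB.instance Definition _ := isGroup.Build (SL K d) mulA mul1 mulr1 mulV mulrV.

End SLGroup.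

Section SLMap.
Variables (K L : comNzRingType) (f : {rmorphism K -> L}) (d : nat).

Lemma SL_map_proof (M : SL K d) : \det (map_mx f (val M)) == 1.
Proof. by rewrite det_map_mx (eqP (valP M)) rmorph1. Qed.

Definition SL_map (M : SL K d) : SL L d := Sub (map_mx f (val M)) (SL_map_proof M).

Lemma SL_map1 : SL_map 1%g = 1%g.
Proof. by apply: val_inj; rewrite /= map_mx1. Qed.

Lemma SL_mapM M N : SL_map (M * N)%g = (SL_map M * SL_map N)%g.
Proof. by apply: val_inj; rewrite /= map_mxM. Qed.

End SLMap.

Section AdelicGroup.
Variables (R : realType) (d : nat).

HB.instance Definition _ := Topological.copy (SL (adele R) d)
  (initial_topology (val : SL (adele R) d -> 'M[adele R]_d)).
HB.instance Definition _ := isPointed.Build (SL (adele R) d) 1%g.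

Lemma iotaSL_proof (M : SL R d) :
  \det (\matrix_(i, j) with_real (val M i j) ((1%:M : 'M[adele R]_d) i j)) == 1.
Proof.
apply/eqP/adele_eq => [|p].
  rewrite -det_map_mx rmorph1 -[RHS](eqP (valP M)); congr (\det _).
  by apply/matrixP => i j; rewrite !mxE.
rewrite -det_map_mx; transitivity (\det (1%:M : 'M[Qp p]_d)); last first.
  by rewrite det1 (rmorph1 (adele_padic p)).
congr (\det _); apply/matrixP => i j; rewrite !mxE.
exact: (rmorph_nat (adele_padic p)).
Qed.

(* [with_real] puts the entries of M at the real place and those of the
   identity matrix at every p. *)
Definition iotaSL (M : SL R d) : SL (adele R) d :=
  exist (fun N : 'M[adele R]_d => \det N == 1) _ (iotaSL_proof M).

Definition SLQ_rel (g h : SL (adele R) d) : bool :=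
  `[< exists gam : SL rat d, h = (SL_map (delta R) gam * g)%g >].

Lemma SLQ_rel_refl : reflexive SLQ_rel.
Proof. by move=> g; apply/asboolP; exists 1%g; rewrite SL_map1 mul1g. Qed.

Lemma SLQ_rel_sym : symmetric SLQ_rel.
Proof.
move=> g h; apply/asboolP/asboolP => -[gam ->]; exists (gam^-1)%g;
  by rewrite mulgA -SL_mapM mulVg SL_map1 mul1g.
Qed.

Lemma SLQ_rel_trans : transitive SLQ_rel.
Proof.
move=> h g k /asboolP[gam ->] /asboolP[gam' ->].
by apply/asboolP; exists (gam' * gam)%g; rewrite SL_mapM mulgA.
Qed.

Canonical SLQ_equiv := EquivRel SLQ_rel SLQ_rel_refl SLQ_rel_sym SLQ_rel_trans.

Definition SLQ_SLA := quotient_topology {eq_quot SLQ_rel}.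

(* Multiplication on the right, computed on a representative: coset_actE. *)
Definition coset_act (c : SLQ_SLA) (h : SL (adele R) d) : SLQ_SLA :=
  \pi_SLQ_SLA ((repr c : SL (adele R) d) * h)%g.

Definition Qlattice (M : SL (adele R) d) : set 'rV[adele R]_d :=
  range (fun q : 'rV[rat]_d => map_mx (delta R) q *m val M).

(* Independent of the representative: coset_latticeE. *)
Definition coset_lattice (c : SLQ_SLA) : set 'rV[adele R]_d :=
  Qlattice (repr c).

Lemma SLQ_relP g h : SLQ_rel g h <-> \pi_SLQ_SLA g = \pi_SLQ_SLA h.
Proof. by split => [|/eqmodP]//; move=> /(@eqmodP _ SLQ_equiv). Qed.

Lemma Qlattice_left gam M : Qlattice (SL_map (delta R) gam * M)%g = Qlattice M.
Proof.
apply/seteqP; split => _ [q _ <-] /=.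
  by exists (q *m val gam) => //; rewrite map_mxM mulmxA.
exists (q *m val (gam^-1)%g) => //; rewrite mulmxA -map_mxM -mulmxA.
by rewrite -[_ *m val gam]/(val (gam^-1 * gam)%g) mulVg mulmx1.
Qed.

Lemma coset_latticeE M : coset_lattice (\pi_SLQ_SLA M) = Qlattice M.
Proof.
have /SLQ_relP/asboolP[gam {2}->] : \pi_SLQ_SLA (repr (\pi_SLQ_SLA M)) = \pi_SLQ_SLA M.
  by rewrite reprK.
by rewrite Qlattice_left.
Qed.

Lemma coset_actE M h :
  coset_act (\pi_SLQ_SLA M) h = \pi_SLQ_SLA (M * h)%g.
Proof.
have /SLQ_relP/asboolP[gam {2}->] : \pi_SLQ_SLA (repr (\pi_SLQ_SLA M)) = \pi_SLQ_SLA M.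
  by rewrite reprK.
by apply/SLQ_relP/asboolP; exists gam; rewrite mulgA.
Qed.

End AdelicGroup.

Notation borel T := (g_sigma_algebraType (@open T)).

Definition boundary (T : topologicalType) (A : set T) := closure A `\` A°.

(* A Haar measure as a nonzero translation-invariant Borel measure, finite on
   compact sets: regularity is automatic because A^d is locally compact and
   second countable. *)
Definition is_haar (R : realType) (d : nat)
    (m : {measure set (borel 'rV[adele R]_d) -> \bar R}) : Prop :=
  [/\ m setT <> 0%E,
      forall K : set 'rV[adele R]_d, compact K -> (m K < +oo)%E &
      forall (v : 'rV[adele R]_d) (B : set (borel 'rV[adele R]_d)),
        measurable B -> m [set x + v | x in B] = m B].

Definition is_invariant (R : realType) (d : nat)
    (mu : probability (borel (SLQ_SLA R d)) R) : Prop :=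
  forall (h : SL (adele R) d) (B : set (borel (SLQ_SLA R d))),
    measurable B -> mu [set coset_act c h | c in B] = mu B.

(* Lebesgue measure on R^n, with the formula that defines product measures in
   the library: the one-dimensional integral of the measures of the sections.
   It is meant for Borel sets only. *)
Fixpoint lebesgue_rV (R : realType) (n : nat) : set (borel 'rV[R]_n) -> \bar R :=
  match n with
  | 0 => fun B => (\1_B (0 : 'rV[R]_0))%:E
  | n'.+1 => fun B => (\int[@lebesgue_measure R]_x
      @lebesgue_rV R n' [set v : 'rV[R]_n' | B (row_mx x%:M v : 'rV[R]_(1 + n'))])%E
  end.

Section LebesgueBox.
Variable R : realType.
Local Open Scope ereal_scope.

Lemma lebesgue_rV0 n : lebesgue_rV (set0 : set 'rV[R]_n) = 0.
Proof.
elim: n => [|n IH] /=; first by rewrite indic0.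
by apply: integral0_eq => x _; exact: IH.
Qed.

Lemma lebesgue_rV_box n (B : 'I_n -> set R) : (forall i, measurable (B i)) ->
  lebesgue_rV [set v : 'rV[R]_n | forall i, B i (v ord0 i)] =
  \prod_(i < n) lebesgue_measure (B i).
Proof.
elim: n B => [|n IH] B mB.
  rewrite big_ord0 /= indicE mem_set//; by case.
rewrite big_ord_recl /= -IH//; set c := lebesgue_rV _.
have rE (x : R) (v : 'rV[R]_n) i : (row_mx x%:M v : 'rV[R]_(1 + n)) ord0 (lift ord0 i) = v ord0 i.
  by rewrite (_ : lift ord0 i = rshift 1 i) ?row_mxEr//; exact: val_inj.
have r0 (x : R) (v : 'rV[R]_n) : (row_mx x%:M v : 'rV[R]_(1 + n)) ord0 ord0 = x.
  transitivity ((row_mx x%:M v) ord0 (lshift n (ord0 : 'I_1))).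
    by congr (fun_of_matrix _ _ _); exact: val_inj.
  by rewrite row_mxEl mxE eqxx mulr1n.
transitivity (\int[lebesgue_measure]_x ((\1_(B ord0) x)%:E * c)).
  apply: eq_integral => x _; rewrite indicE; have [xB|xB] := boolP (x \in B ord0).
    rewrite mul1e; congr lebesgue_rV; apply/seteqP; split=> v /= vB i.
      by have := vB (lift ord0 i); rewrite rE.
    have [j ->|->] := unliftP ord0 i; first by rewrite rE.
    by rewrite r0; exact: set_mem.
  rewrite mul0e -[RHS](lebesgue_rV0 n); congr lebesgue_rV; apply/seteqP.
  split=> v //= /(_ ord0); rewrite r0 => /mem_set xB'.
  by rewrite xB' in xB.
have c0 : 0 <= c.
  rewrite /c (IH (fun i => B (lift ord0 i)))//; apply: prode_ge0 => i _; exact: measure_ge0.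
rewrite ge0_integralZr//.
  congr (_ * _); rewrite integral_indic; [by rewrite setIT| exact: measurableT | exact: mB].
by apply/measurable_EFinP; exact: measurable_indic (mB ord0).
Qed.

End LebesgueBox.

(* Here d = n.+1, so that vectors in R^(d-1) are rows of length n. *)
Section Flow.
Variables (R : realType) (n : nat).

Lemma unip_mx_proof (x : 'rV[R]_n) :
  \det (block_mx 1 x 0 1%:M : 'M[R]_(1 + n)) == 1.
Proof. by rewrite det_ublock det1 det1 mulr1. Qed.

Definition unip_mx (x : 'rV[R]_n) : SL R n.+1 :=
  exist (fun N : 'M[R]_n.+1 => \det N == 1) _ (unip_mx_proof x).

Lemma Phi_proof (t : R) :
  \det (diag_mx (row_mx (expR (- (n%:R * t)))%:M (const_mx (expR t)))
        : 'M[R]_(1 + n)) == 1.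
Proof.
rewrite det_diag big_split_ord /= big_ord1 row_mxEl !mxE eqxx mulr1n.
under eq_bigr do rewrite row_mxEr mxE.
by rewrite prodr_const card_ord -expRM_natl -expRD mulr_natl addNr expR0.
Qed.

Definition Phi (t : R) : SL R n.+1 :=
  exist (fun N : 'M[R]_n.+1 => \det N == 1) _ (Phi_proof t).

End Flow.

(* Main.v *)
(* Multiplying by the inverse of [iota (Phi^-t n(x))] turns the count into the number of nonzero
   points in [A] of the lattice attached to the point [M iota (n(-x) Phi^t)] of
   [SL_d(Q)\SL_d(A)], so the theorem is an equidistribution statement for expanding horospheres,
   tested against the indicator function of having at least [r] lattice points in [A].

   Equidistribution is first shown for test functions with values in [0, 1] that are invariant under a
   congruence subgroup and uniformly continuous along the real directions. Let [Psi_t] be the average of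
   such a function over the translates by [U(w) Phi^t], where [w] runs over a fine grid in a box of
   R^d and [U(w) = n(-w'/w_0)]. A small real translation amounts to a small shear of the grid, so the
   [Psi_t] are equicontinuous. Comparing [Psi_t] with a near-minimizer of the L^2 norm among the
   finite averages of unipotent translates, the parallelogram law makes [Psi_t] asymptotically
   L^2-invariant under the unipotents [n(y)]; a word in these and in one small lower unipotent is
   diagonal up to a small factor, and Mautner's argument extends the invariance to SL_d(R). By strong approximation and
   equicontinuity [Psi_t] is asymptotically constant, hence tends to the mean of the test function at
   every point. Shrinking the range of [w_0] to a point, grids become Riemann sums and boxes become
   arbitrary densities.

   The sharp count is squeezed between two test functions, obtained by replacing the indicator of [A]
   by Lipschitz bumps around [A] and below [A]; they agree as soon as the lattice misses the boundary
   of [A]. That a closed bounded null set is missed by almost every lattice follows by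
   covering it by few small boxes (congruence classes times small cubes, whose Haar measure is known
   by tiling) and bounding the mass of the lattices that meet a box through equidistribution of the
   horospheres based at [Q^d], along which rational points are counted by hand. *)
From HB Require Import structures.
Require Import Defs.
From mathcomp Require Import all_boot all_order all_algebra.
From mathcomp Require Import all_classical all_reals all_analysis.
From mathcomp Require Import measurable_realfun.
From mathcomp Require Import ring lra zify.
Import numFieldNormedType.Exports.
Import Order.TTheory GRing.Theory Num.Theory.

Set Implicit Arguments.
Unset Strict Implicit.
Unset Printing Implicit Defensive.

Local Open Scope classical_set_scope.
Local Open Scope ring_scope.
Local Open Scope quotient_scope.

(** * p-adic numbers and adeles *)

(** About [mu] only its invariance is known, so neither a Siegel mean value formula nor an ergodic
    theorem is at hand. Two devices make up for this. Horospheres are parametrized projectively: [w]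
    in R^d stands for the line it spans, and right translation by [g] becomes the linear action of
    [g] on [w], up to factors that conjugation by [Phi] does not expand. An elementary matrix then
    translates each fibre of the grid along one axis, and an average of values in [0, 1] changes
    only by boundary terms. This is why both SL_d(R) and SL_d(A) are handled through words in
    elementary matrices. Secondly, equicontinuity under small real translations, uniform over the
    whole quotient, upgrades L^2 statements to statements at every point, so that the limit holds at
    the given [M] and not merely almost everywhere. The same pointwise statement at the base point
    Q^d expresses the mean of a test function as a limit of counts of rational vectors. Only test
    functions enter there, so the treatment of the boundary is not circular. *)

Section PadicFacts.
Variable p : primeT.
Local Notation abs := (padic_abs (val p)).
Let pP := valP p.

Definition rat_seq (q : rat) : padic_seq p := exist _ (fun=> q) (padic_cauchy_cst p q).

Lemma Qp_piP (u v : padic_seq p) : u - v \in @padic_null p -> \pi_(Qp p) u = \pi_(Qp p) v.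
Proof. by rewrite Quotient.idealrBE => /eqP. Qed.

Lemma padic_norm_rat (q : rat) : padic_norm (rat_Qp p q) = abs q.
Proof.
apply/eqP; rewrite -subr_eq0 -normr_eq0 eq_le normr_ge0 andbT leNgt; apply/negP => lt.
have [N /(_ N (leqnn N))] := @padic_normP p (exist _ (fun=> q) (padic_cauchy_cst p q)) _ lt.
by rewrite distrC ltxx.
Qed.

Lemma rat_Qp_int (q : rat) : (rat_Qp p q \in @padic_int p) = (abs q <= 1).
Proof. by rewrite /in_mem/= /padic_int padic_norm_rat. Qed.

Lemma Qp_approx (x : Qp p) : exists q : rat, x - rat_Qp p q \in @padic_int p.
Proof.
rewrite -[x]reprK; set u := repr x.
have /asboolP/(_ 1 ltr01)[N uN] := valP (u : padic_seq p).
exists (val (u : padic_seq p) N).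
have -> : \pi_(Qp p) u - rat_Qp p (val (u : padic_seq p) N) =
   \pi_(Qp p) ((u : padic_seq p) - rat_seq (val (u : padic_seq p) N)).
  by rewrite /rat_Qp !piE.
apply: padic_norm_le; exists N => i Ni.
by rewrite -[val _ _]/(val (u : padic_seq p) i - val (u : padic_seq p) N) ltW// uN.
Qed.

Lemma padic_abs_frac_le1 (a b : int) : b != 0 -> ~~ (val p %| `|b|)%N ->
  abs (a%:~R / b%:~R) <= 1.
Proof.
move=> b0 pb; have [->|a0] := eqVneq a 0; first by rewrite mul0r padic_abs0.
have lb : logn (val p) `|b| = 0%N.
  by apply/eqP; rewrite -leqn0 leqNgt logn_gt0 mem_primes (negPf pb) !andbF.
rewrite padic_abs_frac// lb sub0r -invr_expz invf_le1 ?exprz_gt0// ?ltr0n ?prime_gt0//.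
by rewrite -exprnP exprn_ege1// ler1n prime_gt0.
Qed.

(** Partial fractions: the denominator of a rational approximation [q] of [x] splits as [b * p ^ k],
    and Bezout's identity isolates the part with denominator [p ^ k]. The bound at the other primes
    lets [adele_split] correct one place without disturbing the others. *)
Lemma Qp_frac (x : Qp p) : exists2 r : rat, x - rat_Qp p r \in @padic_int p &
  forall l : primeT, l != p -> padic_abs (val l) r <= 1.
Proof.
have [q xq] := Qp_approx x.
have d0 : (0 < `|denq q|)%N by rewrite absz_gt0 denq_neq0.
have [b pb db] := pfactor_coprime pP d0.
have cob : coprimez b%:Z ((val p ^ logn (val p) `|denq q|)%N : int).
  by rewrite -[coprimez _ _]/(coprime b (val p ^ _)) coprime_sym coprimeXl.
set k := logn _ _ in db cob.
have [[u v] /= uv] := coprimezP _ _ cob.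
pose c := numq q * u; exists (c%:~R / (val p ^ k)%N%:R).
  rewrite -(subrKA (rat_Qp p q)) rpredD//.
  have -> : rat_Qp p q - rat_Qp p (c%:~R / (val p ^ k)%N%:R) = rat_Qp p (q - c%:~R / (val p ^ k)%N%:R).
    by rewrite /rat_Qp !piE; congr (\pi_(Qp p) _); exact: val_inj.
  rewrite rat_Qp_int.
  have b0 : b%:Z != 0 by apply/eqP => -[b0]; move: d0; rewrite db b0 mul0n.
  have -> : q - c%:~R / (val p ^ k)%N%:R = (numq q * v)%:~R / (b%:Z)%:~R.
    rewrite -{1}[q]divq_num_den -[denq q]gez0_abs; last exact: ltW.
    rewrite db PoszM rmorphM/= /c !rmorphM/=.
    have P0 : ((val p ^ k)%N%:R : rat) != 0 by rewrite pnatr_eq0 expn_eq0 negb_and -lt0n prime_gt0.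
    have B0 : (b%:R : rat) != 0 by rewrite pnatr_eq0.
    have uv' : u%:~R * (b%:R : rat) + v%:~R * (val p ^ k)%N%:R = 1.
      by have := congr1 (fun z : int => z%:~R : rat) uv; rewrite rmorphD !rmorphM.
    have E (A U V B P : rat) : P != 0 -> B != 0 -> U * B + V * P = 1 ->
        A / (B * P) - A * U / P = A * V / B.
      by move=> h1 h2 h3; rewrite -[in A / (B * P)](mulr1 A) -h3; field; rewrite h1 h2.
    exact: E.
  apply: padic_abs_frac_le1 => //=.
  by rewrite -prime_coprime.
move=> l lp; have [->|c0] := eqVneq c 0; first by rewrite mul0r padic_abs0.
have := @padic_abs_frac (val l) c (val p ^ k)%N c0; rewrite -!pmulrn => -> /=; last first.
  by rewrite -lt0n expn_gt0 prime_gt0.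
rewrite (_ : logn (val l) (val p ^ k) = 0%N).
  by rewrite sub0r -invr_expz invf_le1 ?exprz_gt0// ?ltr0n ?prime_gt0 ?(valP l)// -exprnP exprn_ege1// ler1n prime_gt0 ?(valP l).
rewrite lognX logn_prime// (_ : (_ == _) = false) ?muln0//.
by apply/negbTE; rewrite (inj_eq val_inj).
Qed.

(** The absolute value of a Cauchy sequence that is not null is eventually constant, so the
    hypothesis covers every nonzero element. Termwise inverses are Cauchy because
    [v i - v j = (u j - u i) * v i * v j]. *)
Lemma Qp_seq_inv (u : padic_seq p) (c : rat) : 0 < c ->
  (exists N, forall i, (N <= i)%N -> abs (val u i) = c) ->
  exists2 y : Qp p, \pi_(Qp p) u * y = 1 & padic_norm y <= c^-1.
Proof.
move=> c0 [N uN].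
pose v i := if (N <= i)%N then (val u i)^-1 else 0.
have u0 i : (N <= i)%N -> val u i != 0.
  by move=> /uN uc; rewrite -(padic_abs_eq0 pP) uc gt_eqF.
have vabs i : (N <= i)%N -> abs (v i) = c^-1.
  move=> Ni; rewrite /v Ni; apply: (@mulfI _ c); first by rewrite gt_eqF.
  by rewrite -{1}(uN _ Ni) -padic_absM// divff ?u0// (padic_abs1 _) divff// gt_eqF.
have vC : v \in padic_cauchy p.
  apply/asboolP => e e0; have /asboolP/(_ (e * c * c))[|M uM] := valP u.
    by rewrite !mulr_gt0.
  exists (maxn N M) => i j; rewrite !geq_max => /andP[Ni Mi] /andP[Nj Mj].
  have -> : v i - v j = (val u j - val u i) * (v i * v j).
    by rewrite /v Ni Nj; field; rewrite !u0.
  have -> : e = e * c * c * (c^-1 * c^-1) by field; rewrite gt_eqF.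
  rewrite !padic_absM// !vabs// ltr_pM2r ?mulr_gt0 ?invr_gt0//; exact: uM.
exists (\pi_(Qp p) (exist _ v vC : padic_seq p)); last first.
  by apply: padic_norm_le; exists N => i Ni; rewrite /= vabs.
have -> : (1 : Qp p) = \pi_(Qp p) 1 by rewrite piE.
have -> : \pi_(Qp p) u * \pi_(Qp p) (exist _ v vC : padic_seq p) = \pi_(Qp p) (u * (exist _ v vC : padic_seq p)).
  by rewrite !piE.
apply: Qp_piP; apply/asboolP => e e0; exists N => i Ni.
rewrite -[val _ _]/(val u i * v i - 1) /v Ni divff ?u0// subrr padic_abs0//.
Qed.

Lemma Qp_inv (x : Qp p) : x != 0 -> exists y, x * y = 1.
Proof.
rewrite -[x]reprK; set u : padic_seq p := repr x => x0.
have : ~ (u \in @padic_null p).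
  move=> u0; case/eqP: x0.
  have -> : (0 : Qp p) = \pi_(Qp p) 0 by rewrite piE.
  by apply: Qp_piP; rewrite subr0.
move=> /negP/asboolP/existsNP[e /not_implyP[e0 uN0]].
have /asboolP/(_ e e0)[N uN] := valP u.
have [i Ni ei] : exists2 i, (N <= i)%N & e <= abs (val u i).
  apply: contrapT => H; apply: uN0; exists N => i Ni.
  by rewrite ltNge; apply/negP => ei; apply: H; exists i.
have [||y xy _] := @Qp_seq_inv u (abs (val u i)).
- exact: lt_le_trans ei.
- exists N => j Nj; apply: (@padic_abs_isosceles p).
  exact: lt_le_trans (uN _ _ Nj Ni) ei.
- by exists y.
Qed.

(** [Z_p] is local: if [|x| = 1], termwise inversion stays integral; if [|x| < 1], then [1 + x * y]
    has absolute value 1. The second alternative says that [x] lies in the Jacobson radical. *)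
Lemma padic_int_local (x : Qp p) : x \in @padic_int p ->
  (exists2 y, y \in @padic_int p & x * y = 1) \/
  (forall y, y \in @padic_int p -> exists2 z, z \in @padic_int p & (1 + x * y) * z = 1).
Proof.
rewrite -[x]reprK; set u : padic_seq p := repr x => xZ.
have [N uN] := padic_norm_leP ltr01 xZ.
have /asboolP/(_ 1 ltr01)[M uM] := valP u.
pose K := maxn N M; have NK : (N <= K)%N := leq_maxl _ _.
have MK : (M <= K)%N := leq_maxr _ _.
have [u1|u1] := eqVneq (abs (val u K)) 1.
  left; have [|y xy] := @Qp_seq_inv u 1 ltr01.
    exists K => i Ki; rewrite -u1; apply: (@padic_abs_isosceles p).
    by rewrite u1; apply: uM => //; exact: leq_trans Ki.
  by rewrite invr1 => yZ; exists y.
right => y; rewrite -[y]reprK; set v : padic_seq p := repr y => yZ.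
have [L vL] := padic_norm_leP ltr01 yZ.
have uK i : (K <= i)%N -> abs (val u i) < 1.
  move=> Ki; rewrite lt_neqAle uN ?andbT; last exact: leq_trans Ki.
  apply: contraNneq u1 => u1; rewrite -u1; apply/eqP.
  apply: (@padic_abs_isosceles p); rewrite u1.
  by apply: uM => //; exact: leq_trans Ki.
have [|z xyz] := @Qp_seq_inv (1 + u * v) 1 ltr01.
  exists (maxn K L) => i; rewrite geq_max => /andP[Ki Li].
  rewrite -[val _ _]/(1 + val u i * val v i) -[RHS](padic_abs1 (val p)).
  apply: (@padic_abs_isosceles p); rewrite padic_abs1 addrC addKr padic_absM//.
  rewrite (le_lt_trans _ (uK _ Ki))// ler_piMr ?padic_abs_ge0 ?vL//.
rewrite invr1 => zZ; exists z => //; rewrite -[RHS]xyz; congr (_ * _).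
set w := _ + _; have -> : w = \pi_(Qp p) (1 + u * v) by rewrite /w !piE. by [].
Qed.

End PadicFacts.

Section AdeleFacts.
Variable R : realType.
Implicit Types a b : adele R.
Local Notation delta := (@delta R).

Lemma adele_padicD p a b : adele_padic p (a + b) = adele_padic p a + adele_padic p b. Proof. by []. Qed.
Lemma adele_padicB p a b : adele_padic p (a - b) = adele_padic p a - adele_padic p b. Proof. by []. Qed.
Lemma adele_padicN p a : adele_padic p (- a) = - adele_padic p a. Proof. by []. Qed.
Lemma adele_padicM p a b : adele_padic p (a * b) = adele_padic p a * adele_padic p b. Proof. by []. Qed.
Lemma adele_padic1 p : adele_padic p (1 : adele R) = 1. Proof. by []. Qed.
Lemma adele_padic0 p : adele_padic p (0 : adele R) = 0. Proof. by []. Qed.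
Lemma adele_realD a b : adele_real (a + b) = adele_real a + adele_real b. Proof. by []. Qed.
Lemma adele_realB a b : adele_real (a - b) = adele_real a - adele_real b. Proof. by []. Qed.
Lemma adele_realM a b : adele_real (a * b) = adele_real a * adele_real b. Proof. by []. Qed.
Lemma adele_real1 : adele_real (1 : adele R) = 1. Proof. by []. Qed.
Lemma adele_real0 : adele_real (0 : adele R) = 0. Proof. by []. Qed.

(** Integrality at the finite places only; the real component is unconstrained. *)
Definition Zhat a := forall p, adele_padic p a \in @padic_int p.

Lemma Zhat0 : Zhat 0. Proof. by move=> p; rewrite adele_padic0 rpred0. Qed.
Lemma Zhat1 : Zhat 1. Proof. by move=> p; rewrite adele_padic1 rpred1. Qed.
Lemma ZhatD a b : Zhat a -> Zhat b -> Zhat (a + b).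
Proof. by move=> aZ bZ p; rewrite adele_padicD rpredD ?aZ ?bZ. Qed.
Lemma ZhatN a : Zhat a -> Zhat (- a).
Proof. by move=> aZ p; rewrite adele_padicN rpredN ?aZ. Qed.
Lemma ZhatM a b : Zhat a -> Zhat b -> Zhat (a * b).
Proof. by move=> aZ bZ p; rewrite adele_padicM rpredM ?aZ ?bZ. Qed.
Lemma Zhat_sum (I : Type) (r : seq I) (P : pred I) (F : I -> adele R) :
  (forall i, P i -> Zhat (F i)) -> Zhat (\sum_(i <- r | P i) F i).
Proof. by move=> h; elim/big_ind: _ => //; [exact: Zhat0|exact: ZhatD]. Qed.
Lemma Zhat_int (z : int) : Zhat (delta z%:~R).
Proof. by move=> p; rewrite rmorph_int rmorph_int rpred_int. Qed.
Lemma Zhat_nat (k : nat) : Zhat (delta k%:R).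
Proof. by rewrite pmulrn; exact: Zhat_int. Qed.

Lemma adele_padic_delta p q : adele_padic p (delta q) = rat_Qp p q.
Proof. by []. Qed.

Lemma adele_real_delta q : adele_real (delta q) = ratr q.
Proof. by []. Qed.

Lemma delta_inj : injective delta.
Proof. by move=> x y /(congr1 (@adele_real R)) /(fmorph_inj (@ratr R)). Qed.

Lemma Zhat_delta (q : rat) : Zhat (delta q) -> exists z : int, q = z%:~R.
Proof.
move=> qZ; exists (numq q); rewrite -[LHS]divq_num_den.
have [->|q0] := eqVneq q 0; first by rewrite (_ : numq 0 = 0) ?mul0r//.
suff -> : denq q = 1 by rewrite divr1.
rewrite -[denq q]gez0_abs ?(ltW (denq_gt0 _))//.
have : (0 < `|denq q|)%N by rewrite absz_gt0 denq_neq0.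
rewrite leq_eqVlt => /orP[/eqP<-//|/pdivP[p p_pr pd]].
have := qZ (exist _ p p_pr); rewrite adele_padic_delta rat_Qp_int /padic_abs (negPf q0) /=.
have -> : logn p `|numq q| = 0%N.
  apply/eqP; rewrite -leqn0 leqNgt logn_gt0 mem_primes p_pr absz_gt0 numq_eq0 q0 /=.
  apply/negP => pn; have := coprime_num_den q => /eqP g1.
  have : (p %| gcdn `|numq q| `|denq q|)%N by rewrite dvdn_gcd pn pd.
  by rewrite g1 dvdn1 => /eqP p1; move: p_pr; rewrite p1.
rewrite subr0 -exprnP leNgt exprn_egt1 ?ltr1n ?prime_gt1//.
by rewrite -lt0n logn_gt0 mem_primes p_pr absz_gt0 denq_neq0 pd.
Qed.

Lemma adele_bad_seq a : exists s : seq primeT, forall p, p \notin s -> adele_padic p a \in @padic_int p.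
Proof.
have /asboolP/finite_seqP[s sE] := valP a; exists s => p ps.
have [//|pN] := boolP (_ \in _); have : [set` s] p by rewrite -sE.
by rewrite /= (negPf ps).
Qed.

Lemma adele_den a : exists2 D : nat, (0 < D)%N & Zhat (delta D%:R * a).
Proof.
have [s sP] := adele_bad_seq a.
suff [D D0 DP] : exists2 D : nat, (0 < D)%N & forall p, p \in s -> adele_padic p (delta D%:R * a) \in @padic_int p.
  exists D => // p; have [|/sP ap] := boolP (p \in s); first exact: DP.
  by rewrite adele_padicM rpredM//; exact: Zhat_nat.
elim: s {sP} => [|p s [D D0 DP]]; first by exists 1%N.
have [q qP] := Qp_approx (adele_padic p (delta D%:R * a)).
exists (`|denq q| * D)%N; first by rewrite muln_gt0 D0 absz_gt0 denq_neq0.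
move=> l; rewrite natrM (rmorphM delta) -mulrA adele_padicM inE => /orP[/eqP->|ls]; last first.
  by rewrite rpredM ?DP//; exact: Zhat_nat.
rewrite -[X in _ * X](subrK (rat_Qp p q)) mulrDr rpredD//.
  by rewrite rpredM//; exact: Zhat_nat.
rewrite -(adele_padic_delta p q) -adele_padicM -(rmorphM delta).
rewrite (_ : _ * q = (numq q)%:~R); first exact: Zhat_int.
rewrite [X in X * _](_ : _ = (denq q)%:~R); first by rewrite mulrC numqE.
by rewrite pmulrn gez0_abs ?(ltW (denq_gt0 _)).
Qed.

(** Principal parts are removed prime by prime over the finitely many bad primes. Each of them is
    integral at all other primes, so the corrections do not interfere. *)
Lemma adele_split a : exists q : rat, Zhat (a - delta q).
Proof.
have [s sP] := adele_bad_seq a.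
suff [q qP1 qP2] : exists2 q : rat, (forall p, p \in s -> adele_padic p (a - delta q) \in @padic_int p) &
    (forall p, p \notin s -> rat_Qp p q \in @padic_int p).
  exists q => p; have [|ps] := boolP (p \in s); first exact: qP1.
  by rewrite adele_padicB rpredB//; [exact: sP|exact: qP2].
elim: s {sP} => [|p s [q qP1 qP2]]; first by exists 0 => // p _; rewrite rat_Qp_int padic_abs0.
have [r rP1 rP2] := Qp_frac (adele_padic p (a - delta q)).
have rZ l : l != p -> rat_Qp l r \in @padic_int l by move=> /rP2; rewrite rat_Qp_int.
exists (q + r) => l; rewrite inE.
  have -> : a - delta (q + r) = (a - delta q) - delta r by rewrite rmorphD; ring.
  move=> /orP[/eqP->|ls]; first by rewrite adele_padicB.
  have [->|lp] := eqVneq l p; first by rewrite adele_padicB.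
  by rewrite adele_padicB rpredB ?qP1// rZ.
rewrite negb_or => /andP[lp ls].
by rewrite -adele_padic_delta (rmorphD delta) adele_padicD rpredD ?rZ ?qP2.
Qed.

End AdeleFacts.

(** Congruence modulo [N] at the finite places, blind to the real place. For [N = 0] the inverse is
    0 and all adeles are congruent, whence the positivity hypotheses below. Locked to keep
    conversion from unfolding it. *)
HB.lock Definition cong (R : realType) (N : nat) (a b : adele R) : Prop :=
  Zhat (delta R N%:R^-1 * (a - b)).
Arguments cong {R} N a b.

Section Congruence.
Variable R : realType.
Implicit Types a b c : adele R.
Local Notation delta := (@delta R).

Lemma congE N a b : cong N a b = Zhat (delta N%:R^-1 * (a - b)).
Proof. by rewrite cong.unlock. Qed.

Lemma adele_density N a : (0 < N)%N -> exists q : rat, cong N a (delta q).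
Proof.
move=> N0; have [q qP] := adele_split (delta N%:R^-1 * a).
exists (N%:R * q); rewrite congE mulrBr -(rmorphM delta) mulKf//.
by rewrite pnatr_eq0 -lt0n.
Qed.

Lemma cong_refl N a : cong N a a.
Proof. by rewrite congE subrr mulr0; exact: Zhat0. Qed.
Lemma cong_sym N a b : cong N a b -> cong N b a.
Proof. by rewrite !congE => /ZhatN; rewrite -mulrN opprB. Qed.
Lemma cong_trans N a b c : cong N a b -> cong N b c -> cong N a c.
Proof. by rewrite !congE => /ZhatD h /h; rewrite -mulrDr subrKA. Qed.

Lemma cong_dvd N M a b : (0 < M)%N -> (N %| M)%N -> cong M a b -> cong N a b.
Proof.
move=> M0 /dvdnP[k kE]; rewrite !congE => /(ZhatM (Zhat_nat R k)).
rewrite mulrA -(rmorphM delta)/=; congr Zhat; congr (delta _ * _).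
rewrite kE natrM invfM mulrA mulfV ?mul1r// pnatr_eq0.
by move: M0; rewrite kE; case: (k).
Qed.

Lemma delta_natV N : (0 < N)%N -> delta N%:R * delta N%:R^-1 = 1.
Proof. by move=> N0; rewrite -(rmorphM delta) mulfV ?rmorph1// pnatr_eq0 -lt0n. Qed.

(* Q_p is a local ring or a field at every place, so adding a multiple [s * (1 - c * a)]
   with [s] equal to 0 or 1 at each place turns [a] into an idele. *)
Lemma adele_stable_range a c : exists s u v, u = a + s * (1 - c * a) /\ u * v = 1.
Proof.
pose sr : bool := adele_real a == 0.
pose su p (x : Qp p) := `[< exists2 y, y \in @padic_int p & x * y = 1 >].
pose sp p : bool := (adele_padic p a == 0) ||
  [&& adele_padic p a \in @padic_int p, adele_padic p c \in @padic_int p & ~~ su p (adele_padic p a)].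
have bZ p (b : bool) : (if b then 1 else 0 : Qp p) \in @padic_int p.
  by case: b; rewrite ?rpred1 ?rpred0.
have sP : (sr%:R : R, (fun p => if sp p then 1 else 0 : Qp p)) \in @restricted R.
  apply/asboolP; apply: (sub_finite_set _ (finite_set0 _)) => p /= /negP; apply.
  exact: bZ.
pose s : adele R := exist (fun x => x \in @restricted R) _ sP.
pose u := a + s * (1 - c * a).
have up p : adele_padic p u = if sp p then 1 + adele_padic p a * (1 - adele_padic p c) else adele_padic p a.
  rewrite /u adele_padicD adele_padicM adele_padicB adele_padicM adele_padic1.
  rewrite (_ : adele_padic p s = if sp p then 1 else 0)//.
  case: (sp p); last by rewrite mul0r addr0.
  by rewrite mul1r mulrBr mulr1 addrCA [_ * adele_padic p c]mulrC.
have ur : adele_real u != 0.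
  rewrite /u adele_realD adele_realM adele_realB adele_realM adele_real1.
  rewrite (_ : adele_real s = sr%:R)// /sr.
  have [->|] := eqVneq (adele_real a) 0; last by rewrite mul0r addr0.
  by rewrite mul1r mulr0 subr0 add0r oner_neq0.
have unit_p p : exists y, adele_padic p u * y = 1 /\
    (adele_padic p a \in @padic_int p -> adele_padic p c \in @padic_int p -> y \in @padic_int p).
  rewrite up /sp; have [->|a0] := eqVneq (adele_padic p a) 0.
    by exists 1; rewrite mul0r addr0 mulr1 rpred1.
  have [|/Qp_inv] := eqVneq (adele_padic p u) 0; last first.
    rewrite up /sp (negPf a0) /=; case: ifP => [/and3P[aZ cZ /asboolPn nu] _|].
      have [//|/(_ (1 - adele_padic p c))[|z zZ E]] := padic_int_local aZ.
        by rewrite rpredB ?rpred1.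
      by exists z.
    move=> /negbT; rewrite !negb_and negbK => h [y xy].
    case/or3P : h => [aZ|cZ|/asboolP[z zZ az]]; last by exists z.
      by exists y; split=> //; rewrite (negPf aZ).
    by exists y; split=> // _; rewrite (negPf cZ).
  rewrite up /sp (negPf a0) /=; case: ifP => [/and3P[aZ cZ /asboolPn nu] _|_ /eqP]; last first.
    by rewrite (negPf a0).
  have [//|/(_ (1 - adele_padic p c))[|z zZ E]] := padic_int_local aZ.
    by rewrite rpredB ?rpred1.
  by exists z.
pose vp p := projT1 (cid (unit_p p)).
have vP : ((adele_real u)^-1, vp) \in @restricted R.
  apply/asboolP; have ac : finite_set ([set p | adele_padic p a \notin @padic_int p] `|`
      [set p | adele_padic p c \notin @padic_int p]).
    rewrite finite_setU; split; [exact/asboolP/(valP a)|exact/asboolP/(valP c)].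
  apply: sub_finite_set ac => p /= vpN; apply: contrapT => /not_orP[/negP/negPn aZ /negP/negPn cZ].
  by move: vpN; rewrite /vp; case: cid => y /= [_ /(_ aZ cZ)->].
exists s, u, (exist (fun x => x \in @restricted R) _ vP); split=> //; apply: adele_eq => [|p].
  by rewrite adele_realM (_ : adele_real (exist _ _ _) = (adele_real u)^-1)// mulfV.
rewrite adele_padicM (_ : adele_padic p (exist _ _ _) = vp p)// /vp.
by case: cid => y [].
Qed.

End Congruence.

Section PadicScale.
Variable p : primeT.
Local Notation abs := (padic_abs (val p)).
Let pP := valP p.

Lemma padic_abs_gt0 (q : rat) : q != 0 -> 0 < abs q.
Proof. by move=> q0; rewrite lt_neqAle padic_abs_ge0// andbT eq_sym padic_abs_eq0. Qed.

Lemma padic_absV (q : rat) : q != 0 -> abs q^-1 = (abs q)^-1.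
Proof.
move=> q0; apply: (@mulfI _ (abs q)); first by rewrite padic_abs_eq0.
by rewrite -padic_absM// !divff ?padic_abs1 ?padic_abs_eq0.
Qed.

Lemma rat_Qp_pi_mul (q : rat) (u : padic_seq p) :
  rat_Qp p q * \pi_(Qp p) u = \pi_(Qp p) (rat_seq p q * u).
Proof. by rewrite /rat_Qp !piE. Qed.

Lemma padic_scale_int (q : rat) (x : Qp p) : q != 0 ->
  (rat_Qp p q^-1 * x \in @padic_int p) = (padic_norm x <= abs q).
Proof.
move=> q0; rewrite -[x]reprK; set u : padic_seq p := repr x; rewrite rat_Qp_pi_mul.
have E i : abs (val (rat_seq p q^-1 * u) i) = (abs q)^-1 * abs (val u i).
  by rewrite [val _ i]/(q^-1 * val u i) padic_absM// padic_absV.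
apply/idP/idP => [/(padic_norm_leP ltr01)|/(padic_norm_leP (padic_abs_gt0 q0))] [N uN].
  apply: padic_norm_le; exists N => i /uN; rewrite E.
  by rewrite mulrC ler_pdivrMr ?mul1r// padic_abs_gt0.
apply: padic_norm_le; exists N => i /uN ui; rewrite E.
by rewrite mulrC ler_pdivrMr ?mul1r// padic_abs_gt0.
Qed.

Lemma padic_abs_fact (e : rat) : 0 < e -> exists k, forall l, (k <= l)%N -> abs (l`!%:R) < e.
Proof.
(* Any [l >= p ^ j] has [p ^ j] dividing [l!], so the valuation of [l!] is at least [j > 1 / e], and
   [p] to that valuation is larger still. *)
move=> e0; pose j := (Num.truncn e^-1).+1.
have je : e^-1 < j%:R by exact: truncnS_gt.
exists (val p ^ j)%N => l kl.
have -> : (l`!%:R : rat) = (l`!%:Z)%:~R / 1%:~R by rewrite divr1.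
rewrite padic_abs_frac//; last by rewrite eqz_nat -lt0n fact_gt0.
rewrite logn1 sub0r -invr_expz -exprnP.
have jl : (j <= logn (val p) l`!)%N.
  by rewrite -pfactor_dvdn ?fact_gt0//; apply: dvdn_fact; rewrite kl expn_gt0 prime_gt0.
have pj : (j%:R : rat) < (val p)%:R ^+ logn (val p) l`!.
  rewrite -natrX ltr_nat (leq_ltn_trans jl)// ltn_expl// prime_gt1//.
rewrite -[e]invrK ltf_pV2 ?posrE ?invr_gt0//; last by rewrite exprn_gt0// ltr0n prime_gt0.
exact: lt_trans pj.
Qed.

Lemma open_padic_scale (q : rat) (x : Qp p) : q != 0 ->
  open [set y : Qp p | rat_Qp p q^-1 * (y - x) \in @padic_int p].
Proof.
move=> q0; change (padic_open [set y : Qp p | rat_Qp p q^-1 * (y - x) \in @padic_int p]) => y /= yx; exists (abs q); first exact: padic_abs_gt0.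
move=> z /= zy; rewrite -(subrKA y) mulrDr rpredD// padic_scale_int// ltW//.
Qed.

End PadicScale.

(* The factorial, sealed: conversion would otherwise unfold it. *)
Lemma fct_subproof : {f : nat -> nat | f = factorial}.
Proof. by exists factorial. Qed.
Definition fct := sval fct_subproof.

Lemma fctE k : fct k = k`!.
Proof. by rewrite /fct; case: fct_subproof => f /= ->. Qed.
Lemma fct_gt0 k : (0 < fct k)%N.
Proof. by rewrite fctE fact_gt0. Qed.
Lemma fct_dvd k l : (k <= l)%N -> (fct k %| fct l)%N.
Proof.
rewrite !fctE => kl; rewrite -(subnK kl) addnC; elim: (l - k)%N => [|m IH]; first by rewrite addn0.
by rewrite addnS factS dvdn_mull.
Qed.
Lemma leq_fct k l : (k <= l)%N -> (fct k <= fct l)%N.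
Proof. by move=> /fct_dvd /dvdn_leq; apply; exact: fct_gt0. Qed.
Lemma fct_ge k : (k <= fct k)%N.
Proof. by rewrite fctE; case: k => // m; rewrite factS leq_pmulr// fact_gt0. Qed.
Lemma dvdn_fct d k : (0 < d <= k)%N -> (d %| fct k)%N.
Proof. by rewrite fctE => /dvdn_fact. Qed.
Lemma double_fct k : (2 * fct k.+1 <= fct k.+2)%N.
Proof. by rewrite !fctE [k.+2`!]factS leq_mul2r orbT. Qed.
Lemma padic_abs_fct p (e : rat) : 0 < e ->
  exists k, forall l, (k <= l)%N -> padic_abs (val (p : primeT)) ((fct l)%:R) < e.
Proof. by move=> /(padic_abs_fact p)[k kP]; exists k => l; rewrite fctE; exact: kP. Qed.

(** * Neighbourhoods of adeles and of adelic matrices *)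

Section AdeleTopology.
Variable R : realType.
Implicit Types a b c : adele R.
Local Notation delta := (@delta R).

(* These sets form a neighbourhood basis: 1/k! tends to 0 and k! tends to 0 at
   every prime. *)
Definition aclose k a b :=
  `|adele_real a - adele_real b| < (fct k)%:R^-1 /\ cong (fct k) a b.

Lemma fct_ratN0 (k : nat) : ((fct k)%:R : rat) != 0.
Proof. by rewrite pnatr_eq0 -lt0n fct_gt0. Qed.

Lemma factrV_gt0 k : (0 : R) < (fct k)%:R^-1.
Proof. by rewrite invr_gt0 ltr0n fct_gt0. Qed.

Lemma close_refl k a : aclose k a a.
Proof. by split; [rewrite subrr normr0 factrV_gt0|exact: cong_refl]. Qed.

Lemma close_mono k l a b : (k <= l)%N -> aclose l a b -> aclose k a b.
Proof.
move=> kl [r c]; split; last by apply: (cong_dvd _ _ c); rewrite ?fct_gt0 ?fct_dvd.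
by apply: (lt_le_trans r); rewrite lef_pV2 ?posrE ?ltr0n ?fct_gt0// ler_nat leq_fct.
Qed.

Lemma nbhs_close a k : nbhs a [set b | aclose k a b].
Proof.
pose q : rat := (fct k)%:R.
pose V p : set (Qp p) := [set y | rat_Qp p q^-1 * (y - adele_padic p a) \in @padic_int p].
pose U : set R := [set r | `|adele_real a - r| < (fct k)%:R^-1].
have [s sP] := adele_bad_seq a.
have [s' sP'] := adele_bad_seq (delta q^-1).
rewrite nbhsE; exists [set b | U (adele_real b) /\ forall p, V p (adele_padic p b)]; last first.
  by move=> b /= [Ub Vb]; split=> //; apply: cong_sym; rewrite congE => p; exact: (Vb p).
split; last first.
  split=> [|p]; rewrite /U /V/=.
    by rewrite subrr normr0 factrV_gt0.
  by rewrite subrr mulr0 rpred0.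
exists [set [set b | U (adele_real b) /\ forall p, V p (adele_padic p b)]]; last by rewrite bigcup_set1.
move=> _ ->; exists U, V; split=> //.
- exact: (@ball_open _ R^o (adele_real a) (fct k)%:R^-1).
- by move=> p; apply: open_padic_scale; exact: fct_ratN0.
(* Where [a] and [1 / k!] are both integral, [V p] is [Z_p] itself. *)
- apply: (sub_finite_set _ (finite_seq (s ++ s'))) => p /=; apply: contraR.
  rewrite mem_cat negb_or => /andP[/sP aZ /sP' qZ]; apply/eqP/seteqP; split => y; rewrite /V /=.
    move=> yZ; rewrite -[y](subrK (adele_padic p a)) rpredD//.
    rewrite -[y - _]mul1r -(adele_padic1 R) -(@delta_natV R (fct k)) ?fct_gt0//.
    by rewrite adele_padicM -mulrA rpredM//; exact: Zhat_nat.
  by move=> yZ; rewrite rpredM// rpredB.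
Qed.

Lemma close_nbhs a (P : set (adele R)) : nbhs a P -> exists k, [set b | aclose k a b] `<=` P.
Proof.
rewrite nbhsE => -[_ [[D' DD <-] [B D'B Ba]] BP].
have [U [V [oU oV fV BE]]] := DD _ D'B; move: Ba; rewrite BE => -[Ua Va].
suff [k kP] : exists k, [set b | aclose k a b] `<=` B.
  by exists k => b /kP Bb; apply: BP; exists B.
have [e e0 eU] : exists2 e : R, 0 < e & forall r, `|adele_real a - r| < e -> U r.
  have /nbhs_ballP[e /= e0 eU] : nbhs (adele_real a) U by apply: open_nbhs_nbhs.
  by exists e.
have [k0 k0P] : exists k0, forall l, (k0 <= l)%N -> ((fct l)%:R^-1 : R) < e.
  exists (Num.truncn e^-1).+1 => l kl; rewrite -[e]invrK ltf_pV2 ?posrE ?ltr0n ?fct_gt0 ?invr_gt0//.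
  rewrite (lt_le_trans (truncnS_gt _))// ler_nat (leq_trans kl)//.
  exact: fct_ge.
have [s sE] := (finite_seqP _).1 fV.
have [k1 k1P] : exists k1, forall l p y, (k1 <= l)%N -> p \in s ->
    rat_Qp p (fct l)%:R^-1 * (y - adele_padic p a) \in @padic_int p -> V p y.
  elim: s {sE fV} => [|p s [k1 k1P]]; first by exists 0%N.
  have [ep ep0 epV] := oV p _ (Va p).
  have [k2 k2P] := padic_abs_fct p ep0.
  exists (maxn k1 k2) => l p' y; rewrite geq_max => /andP[l1 l2]; rewrite inE => /orP[/eqP pE|/k1P]; last exact.
  move: y; rewrite pE => y; rewrite padic_scale_int ?fct_ratN0// => h; apply: epV => /=.
  exact: (le_lt_trans h (k2P _ l2)).
exists (maxn k0 k1) => b [br bc]; rewrite BE; split.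
  by apply: eU; apply: (lt_trans br); apply: k0P; exact: leq_maxl.
move=> p; have [ps|ps] := boolP (p \in s).
  by apply: (k1P (maxn k0 k1)) => //; [exact: leq_maxr|have := cong_sym bc; rewrite congE; exact].
have VZ : V p = [set x | x \in @padic_int p].
  apply/eqP; apply: contraNT ps => ps.
  have : [set p | V p != [set x | x \in @padic_int p]] p by [].
  by rewrite sE.
have := Va p; rewrite VZ /= => aZ.
rewrite -[adele_padic p b](subrK (adele_padic p a)) rpredD// -adele_padicB.
rewrite -[b - a]mul1r -(@delta_natV R (fct (maxn k0 k1))) ?fct_gt0// -mulrA adele_padicM.
by rewrite rpredM//; [exact: Zhat_nat|have := cong_sym bc; rewrite congE; exact].
Qed.

Lemma Zhat_natV_mul (N : nat) a : (0 < N)%N -> Zhat (delta N%:R^-1 * a) -> Zhat a.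
Proof.
move=> N0 /(ZhatM (Zhat_nat R N)); congr Zhat.
have := @delta_natV R N N0; move: (delta _) (delta _) => x y xy.
by rewrite mulrA xy mul1r.
Qed.

Lemma congD N a b c d : cong N a b -> cong N c d -> cong N (a + c) (b + d).
Proof. by rewrite !congE => /ZhatD h /h; rewrite -mulrDr addrACA -opprD. Qed.

Lemma cong_sum (I : Type) (r : seq I) (P : pred I) (F G : I -> adele R) N :
  (forall i, P i -> cong N (F i) (G i)) -> cong N (\sum_(i <- r | P i) F i) (\sum_(i <- r | P i) G i).
Proof.
move=> h; elim/big_ind2: _ => //; [exact: cong_refl|by move=> *; exact: congD].
Qed.

Lemma cong_mul D N a b c : (0 < D)%N -> (0 < N)%N -> Zhat (delta D%:R * a) -> cong (D * N) b c -> cong N (a * b) (a * c).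
Proof.
move=> D0 N0 aZ; rewrite !congE => /(ZhatM aZ); congr Zhat.
rewrite natrM invfM; have := @delta_natV R D D0.
have -> : delta (D%:R^-1 * N%:R^-1) = delta D%:R^-1 * delta N%:R^-1 by exact: rmorphM.
set x := delta D%:R; set y := delta D%:R^-1; set z := delta N%:R^-1; move: x y z => x y z xy.
have -> : x * a * (y * z * (b - c)) = (x * y) * (z * (a * b - a * c)) by ring.
by rewrite xy mul1r.
Qed.

Lemma close_mul k a : exists l, forall b c, aclose l b c -> aclose k (a * b) (a * c).
Proof.
have [D D0 aZ] := adele_den a.
pose K := (Num.truncn `|adele_real a|).+1.
(* [K] bounds the real part of [a] and [D] clears its denominators; [l!] is at least [l] and
   divisible by [D * k!]. *)
exists (K * (D * (fct k)))%N => b c [br bc]; split.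
  rewrite !adele_realM -mulrBr normrM.
  have aK : `|adele_real a| < K%:R by exact: truncnS_gt.
  have := ltr_pM (normr_ge0 _) (normr_ge0 _) aK br; move=> /lt_le_trans; apply.
  rewrite ler_pdivrMr ?ltr0n ?fct_gt0// mulrC ler_pdivlMr ?ltr0n ?fct_gt0//.
  rewrite -natrM ler_nat (leq_trans _ (fct_ge _))// leq_mul2l orbC leq_pmull//.
apply: (@cong_mul D) => //; first exact: fct_gt0.
apply: (cong_dvd _ _ bc); rewrite ?fct_gt0//.
apply: (@dvdn_trans (K * (D * (fct k)))); first exact: dvdn_mull.
by apply: dvdn_fct; rewrite leqnn !muln_gt0 /= D0 fct_gt0.
Qed.

(** Halving the real distance needs [2 * k.+1! <= k.+2!]. The shift by one avoids the pair 0, 1,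
    whose factorials coincide. *)
Lemma close_add k a b c d : aclose k.+2 a b -> aclose k.+2 c d -> aclose k.+1 (a + c) (b + d).
Proof.
move=> [r1 c1] [r2 c2]; split; last first.
  by apply: congD; [apply: (cong_dvd _ _ c1)|apply: (cong_dvd _ _ c2)]; rewrite ?fct_gt0 ?fct_dvd.
rewrite !adele_realD opprD addrACA (le_lt_trans (ler_normD _ _))//.
apply: (lt_le_trans (ltrD r1 r2)); rewrite -mulr2n -[_ *+ 2]mulr_natr.
rewrite ler_pdivrMl ?ltr0n ?fct_gt0// ler_pdivlMr ?ltr0n ?fct_gt0//.
by rewrite -natrM ler_nat double_fct.
Qed.

Lemma close_sum n k (F G : 'I_n -> adele R) : (forall i, aclose (k.+1 + n) (F i) (G i)) ->
  aclose k.+1 (\sum_i F i) (\sum_i G i).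
Proof.
elim: n k F G => [|n IH] k F G h; first by rewrite !big_ord0; exact: close_refl.
rewrite !big_ord_recl; apply: close_add.
  by apply: close_mono (h _); rewrite addnS ltnS leq_addr.
by apply: IH => i; apply: close_mono (h _); rewrite addnS.
Qed.

Definition closeM m n k (V W : 'M[adele R]_(m, n)) := forall i j, aclose k (V i j) (W i j).

Lemma nbhs_closeM m n k (V : 'M[adele R]_(m, n)) : nbhs V [set W | closeM k V W].
Proof. by exists (fun i j => [set b | aclose k (V i j) b]) => // i j; exact: nbhs_close. Qed.

Lemma closeM_nbhs m n (V : 'M[adele R]_(m, n)) (P : set 'M[adele R]_(m, n)) : nbhs V P ->
  exists k, [set W | closeM k V W] `<=` P.
Proof.
move=> [Q Q0 QP].
have kP i j : exists k, [set b | aclose k (V i j) b] `<=` Q i j by exact: close_nbhs (Q0 i j).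
pose k i j := projT1 (cid (kP i j)).
exists (\max_i \max_j k i j)%N => W VW; apply: QP => i j.
apply: (projT2 (cid (kP i j))); apply: close_mono (VW i j).
by apply: leq_trans (leq_bigmax i); exact: (leq_bigmax j).
Qed.

Lemma closeM_refl m n k (V : 'M[adele R]_(m, n)) : closeM k V V.
Proof. by move=> i j; exact: close_refl. Qed.

Lemma closeM_mull m n l k (V : 'M[adele R]_(m, n)) : exists k',
  forall W W' : 'M[adele R]_(n, l), closeM k' W W' -> closeM k (V *m W) (V *m W').
Proof.
have kP i j : exists k', forall b c, aclose k' b c -> aclose (k.+1 + n) (V i j * b) (V i j * c).
  exact: close_mul.
pose k' i j := projT1 (cid (kP i j)).
exists (\max_i \max_j k' i j)%N => W W' WW i j; rewrite !mxE.
apply: (@close_mono _ k.+1) => //; apply: close_sum => h.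
apply: (projT2 (cid (kP i h))); apply: close_mono (WW h j).
by apply: leq_trans (leq_bigmax i); exact: (leq_bigmax h).
Qed.

Lemma closeM_mulr m n l k (V : 'M[adele R]_(m, n)) : exists k',
  forall W W' : 'M[adele R]_(l, m), closeM k' W W' -> closeM k (W *m V) (W' *m V).
Proof.
have [k' kP] := closeM_mull l k V^T; exists k' => W W' WW i j.
have /kP/(_ j i) : closeM k' W^T W'^T by move=> i' j'; rewrite !mxE.
by rewrite -!trmx_mul !mxE.
Qed.

End AdeleTopology.

(** * Strong approximation *)

Section Elementary.
Variables (K : comNzRingType) (d : nat).
Implicit Types (M N : 'M[K]_d) (g h : SL K d) (P : K -> Prop).

(** The guard [i != j] makes [elem_mx i i s] the identity, so the determinant is 1 without a side
    condition. *)
Definition elem_mx (i j : 'I_d) (s : K) : 'M[K]_d :=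
  \matrix_(a, b) ((a == b)%:R + ((i != j) && (a == i) && (b == j))%:R * s).

Lemma det_elem_mx i j s : \det (elem_mx i j s) == 1.
Proof.
wlog ij : i j / (i <= j)%N => [hw|].
  case/orP: (leq_total i j) => [/hw//|ji]; have := hw _ _ ji; rewrite -det_tr.
  suff -> : (elem_mx j i s)^T = elem_mx i j s by [].
  by apply/matrixP => a b; rewrite !mxE [b == a]eq_sym [i == j]eq_sym andbAC.
rewrite -det_tr det_trig.
  apply/eqP; apply: big1 => a _; rewrite !mxE eqxx.
  have [->|ai] := eqVneq a i; last by rewrite !(andbF, andFb) mul0r addr0.
  by rewrite andbT andNb mul0r addr0.
apply/is_trig_mxP => a b ab; rewrite !mxE.
have -> : (b == a) = false by apply/negbTE; rewrite neq_ltn ab orbT.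
rewrite (_ : _ && _ = false) ?mul0r ?addr0//; apply/negP => /andP[/andP[/= nij /eqP E1] /eqP E2].
by move: ab; rewrite E1 E2 ltnNge ij.
Qed.

Definition mkSL M (h : \det M == 1) : SL K d := exist (fun N : 'M[K]_d => \det N == 1) M h.

Definition elemSL i j s : SL K d := exist (fun N : 'M[K]_d => \det N == 1) _ (det_elem_mx i j s).

Lemma SL_valM g h : val (g * h)%g = val g *m val h. Proof. by []. Qed.
Lemma SL_val1 : val (1%g : SL K d) = 1%:M. Proof. by []. Qed.

Lemma mulmx_elem m (M : 'M[K]_(m, d)) i j s a b : i != j ->
  (M *m elem_mx i j s) a b = M a b + (b == j)%:R * M a i * s.
Proof.
move=> ij; rewrite !mxE; under eq_bigr do rewrite mxE mulrDr.
rewrite big_split /= (bigD1 b)//= eqxx mulr1 big1 ?addr0; last first.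
  by move=> c /negPf ->; rewrite mulr0.
congr (_ + _); rewrite (bigD1 i)//= eqxx ij/= big1 ?addr0; last first.
  by move=> c /negPf ->; rewrite ?(andbF, andFb) /= ?(mul0r, mulr0).
by ring.
Qed.

Lemma elem_mulmx M i j s a b : i != j ->
  (elem_mx i j s *m M) a b = M a b + (a == i)%:R * s * M j b.
Proof.
move=> ij; rewrite !mxE; under eq_bigr do rewrite mxE mulrDl.
rewrite big_split /= (bigD1 a)//= eqxx mul1r big1 ?addr0; last first.
  by move=> c; rewrite eq_sym => /negPf ->; rewrite mul0r.
congr (_ + _); rewrite (bigD1 j)//= eqxx ij/= big1 ?addr0; last first.
  by move=> c /negPf ->; rewrite ?(andbF, andFb) /= ?(mul0r, mulr0).
by rewrite andbT.
Qed.

Lemma elemSLD i j s t : (elemSL i j s * elemSL i j t)%g = elemSL i j (s + t).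
Proof.
apply: val_inj; rewrite SL_valM /=; have [<-|ij] := eqVneq i j.
  have E r : elem_mx i i r = 1%:M by apply/matrixP => a b; rewrite !mxE eqxx mul0r addr0.
  by rewrite !E mulmx1.
apply/matrixP => a b; rewrite mulmx_elem// !mxE ij /=.
rewrite !mulrDr mulrDl; have [->|] := eqVneq b j; last by rewrite !andbF /= !mul0r !addr0.
rewrite andbT !mul1r; have [->|ai] := eqVneq a i; last by rewrite /= !mul0r !addr0.
rewrite (negPf ij) /=; ring.
Qed.

Lemma elemSL0 i j : elemSL i j 0 = 1%g.
Proof. by apply: val_inj; apply/matrixP => a b; rewrite !mxE mulr0 addr0. Qed.

Lemma elemSLV i j s : (elemSL i j s)^-1%g = elemSL i j (- s).
Proof. by apply: (mulgI (elemSL i j s)); rewrite mulgV elemSLD subrr elemSL0. Qed.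

(* Products of at most [l] elementary matrices with parameters in [P]. *)
Inductive word P : nat -> SL K d -> Prop :=
| word1 l : word P l 1%g
| wordS l i j s g : i != j -> P s -> word P l g -> word P l.+1 (elemSL i j s * g)%g.

Lemma word_mono P l m g : (l <= m)%N -> word P l g -> word P m g.
Proof.
move=> lm w; elim: w m lm => {l g} [l m _|l i j s g ij Ps w IH [//|m] lm]; first exact: word1.
by apply: wordS => //; exact: IH.
Qed.

Lemma wordM P l m g h : word P l g -> word P m h -> word P (l + m) (g * h)%g.
Proof.
move=> w; elim: w => {l g} [l|l i j s g ij Ps w IH] wh.
  by rewrite mul1g; apply: word_mono wh; exact: leq_addl.
by rewrite -mulgA addSn; apply: wordS => //; exact: IH.
Qed.

Lemma word_elem P i j s : i != j -> P s -> word P 1 (elemSL i j s).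
Proof. by move=> ij Ps; rewrite -[elemSL _ _ _]mulg1; apply: wordS => //; exact: word1. Qed.

Lemma wordV P l g : (forall s, P s -> P (- s)) -> word P l g -> word P l (g^-1)%g.
Proof.
move=> PN; elim=> {l g} [l|l i j s g ij Ps _ IH]; first by rewrite invg1; exact: word1.
by rewrite invgM elemSLV -addn1; apply: wordM => //; apply: word_elem => //; exact: PN.
Qed.

Definition colshear_mx (k : 'I_d) (c : 'I_d -> K) : 'M[K]_d :=
  \matrix_(i, j) ((i == j)%:R + ((j == k) && (i != k))%:R * c i).
Definition rowshear_mx (k : 'I_d) (r : 'I_d -> K) : 'M[K]_d :=
  \matrix_(i, j) ((i == j)%:R + ((i == k) && (j != k))%:R * r j).

Lemma colshear_word P k c : (forall i, i != k -> P (c i)) ->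
  exists2 g : SL K d, val g = colshear_mx k c & word P d g.
Proof.
move=> Pc.
suff h (s : seq 'I_d) : uniq s -> exists2 g : SL K d,
    (forall i j, val g i j = (i == j)%:R + [&& j == k, i != k & i \in s]%:R * c i) & word P (size s) g.
  have [g gE gw] := h (enum 'I_d) (enum_uniq _); exists g.
    by apply/matrixP => i j; rewrite gE mxE mem_enum andbT.
  by rewrite size_enum_ord in gw.
elim: s => [|a s IH /= /andP[as_ us]].
  by exists 1%g; [move=> i j; rewrite SL_val1 mxE !andbF mul0r addr0|exact: word1].
have [g gE gw] := IH us; have [ak|ak] := eqVneq a k.
  exists g => [i j|]; last by apply: word_mono gw.
  by rewrite gE inE ak; case: (eqVneq i k) => //=; rewrite ?andbF.
exists (elemSL a k (c a) * g)%g; last by apply: wordS => //; exact: Pc.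
move=> i j; rewrite SL_valM elem_mulmx// !gE eqxx /= andbF mul0r addr0 inE.
have [->|ia] := eqVneq i a; last by rewrite mul0r mul0r addr0.
rewrite (negPf as_) ak !andbF /= mul0r addr0 mul1r andbT [k == j]eq_sym; ring.
Qed.

Lemma rowshear_word P k r : (forall i, i != k -> P (r i)) ->
  exists2 g : SL K d, val g = rowshear_mx k r & word P d g.
Proof.
move=> Pr.
suff h (s : seq 'I_d) : uniq s -> exists2 g : SL K d,
    (forall i j, val g i j = (i == j)%:R + [&& i == k, j != k & j \in s]%:R * r j) & word P (size s) g.
  have [g gE gw] := h (enum 'I_d) (enum_uniq _); exists g.
    by apply/matrixP => i j; rewrite gE mxE mem_enum andbT.
  by rewrite size_enum_ord in gw.
elim: s => [|a s IH /= /andP[as_ us]].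
  by exists 1%g; [move=> i j; rewrite SL_val1 mxE !andbF mul0r addr0|exact: word1].
have [g gE gw] := IH us; have [ak|ak] := eqVneq a k.
  exists g => [i j|]; last by apply: word_mono gw.
  by rewrite gE inE ak; case: (eqVneq j k) => //=; rewrite ?andbF.
exists (elemSL k a (r a) * g)%g; last by apply: wordS; rewrite 1?eq_sym//; exact: Pr.
move=> i j; rewrite SL_valM elem_mulmx 1?eq_sym// !gE (negPf ak) /= mul0r addr0 inE.
have [->|ja] := eqVneq j a; last first.
  by rewrite mulr0 addr0 [k == i]eq_sym.
rewrite (negPf as_) ak !andbF /= andbT mul0r addr0 mulr1 [k == i]eq_sym; ring.
Qed.

Definition trivial_upto k M := forall i j : 'I_d, ((i < k) || (j < k))%N -> M i j = (i == j)%:R.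

Lemma trivial_upto_last k g : (d <= k.+1)%N -> trivial_upto k (val g) -> g = 1%g.
Proof.
move=> dk tg; apply: val_inj => /=.
have diag : is_diag_mx (val g).
  apply/is_diag_mxP => i j ij; rewrite tg.
    by rewrite (_ : (i == j) = false)//; apply/negbTE.
  apply: contraR ij; rewrite negb_or -!leqNgt => /andP[ki kj].
  have := ltn_ord i; have := ltn_ord j; lia.
apply/matrixP => i j; rewrite mxE; have [ij|] := boolP ((i < k) || (j < k))%N; first exact: tg.
rewrite negb_or -!leqNgt => /andP[ki kj].
have ji : i = j by apply: val_inj => /=; have := ltn_ord i; have := ltn_ord j; lia.
rewrite -ji eqxx; have := eqP (valP g); rewrite det_trig; last first.
  by apply: is_diag_mx_is_trig.
rewrite (bigD1 i)//= big1 ?mulr1// => a ai; rewrite tg ?eqxx// orbb.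
by have := ltn_ord a; have := ltn_ord i; move: ai; rewrite -val_eqE /=; lia.
Qed.

(** A unit at [(k, l)] with inverse [v] is used to turn the entry [(k, k)] into 1, by adding [t]
    times column [l] to column [k]. Two shears then clear row and column [k] and leave the Schur
    complement as [h]. The predicate [P] records which parameters occur, so that the same step
    serves both without constraint and near the identity. *)
Lemma reduce_step P (k l : 'I_d) g v : (k < l)%N -> trivial_upto k (val g) ->
  let M := val g in
  let t := (1 - M k k) * v in
  let c i := M i k + M i l * t in
  M k l * v = 1 -> P (- t) -> (forall j, j != k -> P (M k j)) -> (forall i, i != k -> P (c i)) ->
  exists2 h : SL K d, trivial_upto k.+1 (val h) /\
     (forall i j, i != k -> j != k -> val h i j = M i j - c i * M k j) &
   forall L, (word P L h -> word P (d + L + d + 1) g).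
Proof.
move=> kl tg M t c uv Pt Pr Pc; have tM : trivial_upto k M := tg.
have lk : l != k by rewrite -val_eqE /= gtn_eqF.
have [C CE Cw] := colshear_word Pc.
have [Rr RE Rw] := rowshear_word Pr.
pose M3 : 'M[K]_d := \matrix_(i, j) if (i == k) || (j == k) then (i == j)%:R else M i j - c i * M k j.
have E : val (g * elemSL l k t)%g = val C *m M3 *m val Rr.
  apply/matrixP => i j; rewrite SL_valM mulmx_elem// CE RE.
  have XR (X : 'M[K]_d) a b : (X *m rowshear_mx k (fun j => M k j)) a b = X a b + (b != k)%:R * X a k * M k b.
    rewrite !mxE; under eq_bigr do rewrite mxE mulrDr.
    rewrite big_split /= (bigD1 b)//= eqxx mulr1 big1 ?addr0; last by move=> e /negPf ->; rewrite mulr0.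
    congr (_ + _); rewrite (bigD1 k)//= eqxx big1 ?addr0 /=; last by move=> e /negPf ->; rewrite mul0r mulr0.
    ring.
  have CX (X : 'M[K]_d) a b : (colshear_mx k c *m X) a b = X a b + (a != k)%:R * c a * X k b.
    rewrite !mxE; under eq_bigr do rewrite mxE mulrDl.
    rewrite big_split /= (bigD1 a)//= eqxx mul1r big1 ?addr0; last first.
      by move=> e; rewrite eq_sym => /negPf ->; rewrite mul0r.
    congr (_ + _); rewrite (bigD1 k)//= eqxx big1 ?addr0 /=; last by move=> e /negPf ->; rewrite !mul0r.
    ring.
  rewrite XR !CX !mxE !eqxx /= orbT mulr1 [k == j]eq_sym.
  have [->|ik] := eqVneq i k; have [->|jk] := eqVneq j k; rewrite ?eqxx /= ?mulr1n ?mulr0n.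
  - rewrite /t -/M; have -> : 1 * M k l * ((1 - M k k) * v) = (M k l * v) * (1 - M k k) by ring.
    rewrite uv; ring.
  - by rewrite -/M; ring.
  - by rewrite (negPf ik) /c -/M /=; ring.
  - by rewrite -/M; ring.
have det3 : \det M3 == 1.
  have := valP (g * elemSL l k t)%g; rewrite E !det_mulmx.
  by rewrite (eqP (valP C)) (eqP (valP Rr)) mulr1 mul1r.
exists (mkSL det3).
  split=> [i j ijk|i j ik jk] /=; rewrite !mxE; last by rewrite (negPf ik) (negPf jk).
  case: ifP => // /negbT; rewrite negb_or => /andP[ik jk].
  have [ilk|] := boolP (i < k)%N.
    rewrite (tM i j) ?ilk// /c (tM i k) ?ilk// (tM i l) ?ilk// (negPf ik).
    rewrite (_ : (i == l) = false) ?mul0r ?addr0 ?mul0r ?subr0//.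
    by apply/negbTE; rewrite -val_eqE /=; lia.
  have [jlk|] := boolP (j < k)%N.
    by rewrite (tM i j) ?jlk ?orbT// (tM k j) ?jlk ?orbT// [k == j]eq_sym (negPf jk) mulr0 subr0.
  by move: ijk ik jk; rewrite -!val_eqE /=; lia.
move=> L wL; have -> : g = (C * mkSL det3 * Rr * elemSL l k (- t))%g.
  rewrite -[elemSL l k (- t)]elemSLV; apply/eqP; rewrite eq_sym -[X in _ == X]mulg1 -(mulgV (elemSL l k t)) mulgA.
  apply/eqP; congr (_ * _)%g; apply: val_inj; rewrite E.
  by rewrite !SL_valM.
apply: wordM; last by apply: word_elem.
by do 2 ?[apply: wordM => //].
Qed.

Lemma trivial_upto_mulr k (M C : 'M[K]_d) : trivial_upto k M -> trivial_upto k C -> trivial_upto k (M *m C).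
Proof.
move=> tM tC i j ijk; rewrite mxE; have [ik|ik] := boolP (i < k)%N.
  rewrite (bigD1 i)//= tM ?ik// eqxx mul1r big1 ?addr0; first by rewrite tC.
  by move=> a ai; rewrite tM ?ik// eq_sym (negPf ai) mul0r.
have jk : (j < k)%N by move: ijk; rewrite (negPf ik).
rewrite (bigD1 j)//= (tC j)  ?jk// eqxx mulr1 big1 ?addr0; first by rewrite tM ?jk ?orbT.
by move=> a aj; rewrite (tC a) ?jk ?orbT// (negPf aj) mulr0.
Qed.

(** Bass's stable range condition of rank one: if [c * a + b = 1], then some [a + s * b] is a unit.
    It holds for fields as well as for adeles, and implies generation by elementary matrices. *)
Definition stable_range := forall a c : K, exists s u v, u = a + s * (1 - c * a) /\ u * v = 1.

Lemma stable_range_word (SR : stable_range) g : exists L, word (fun=> True) L g.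
Proof.
suff h m k : (d <= k.+1 + m)%N -> forall g, trivial_upto k (val g) -> exists L, word (fun=> True) L g.
  by apply: (h d 0%N) => [|i j]; rewrite ?leqW ?ltn0.
elim: m k => [|m IH] k dk {}g tg.
  by rewrite addn0 in dk; exists 0%N; rewrite (trivial_upto_last dk tg); exact: word1.
have [dk1|dk1] := leqP d k.+1; first by exists 0%N; rewrite (trivial_upto_last dk1 tg); exact: word1.
have kd : (k < d)%N by exact: ltnW.
pose k' := Ordinal kd; pose l := Ordinal dk1.
pose adj := \adj (val g).
(* Row [k] of [g] times column [k] of the adjugate is 1, so the row is unimodular. Adding
   [s * adj i k] times column [i] to column [l] for all [i != l] puts the unit [u] at [(k, l)].
   Indices below [k] are left out to keep the triviality already reached. *)
have [s [u [v [uE uv]]]] := SR (val g k' l) (adj l k').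
have [C CE Cw] := @colshear_word (fun=> True) l (fun i => (k <= i)%N%:R * (s * adj i k')) (fun _ _ => I).
have gl : val (g * C)%g k' l = u.
  rewrite SL_valM CE mxE; under eq_bigr do rewrite mxE mulrDr.
  rewrite big_split /= (bigD1 l)//= eqxx mulr1 big1 ?addr0; last by move=> e /negPf ->; rewrite mulr0.
  rewrite uE; congr (_ + _).
  have := congr1 (fun X : 'M[K]_d => X k' k') (mul_mx_adj (val g)).
  rewrite (eqP (valP g)) !mxE eqxx mulr1n => h1.
  rewrite (_ : 1 - _ = \sum_(i | i != l) val g k' i * adj i k'); last first.
    by apply/eqP; rewrite subr_eq addrC -[X in X == _]h1 (bigD1 l)//= mulrC /adj ?mxE.
  rewrite mulr_sumr (bigD1 l)//= eqxx /= mul0r mulr0 add0r; apply: eq_bigr => i il.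
  rewrite il mul1r; have [ki|] := leqP k i; first by rewrite mul1r mulrCA.
  by move=> ik; rewrite tg ?ik ?orbT// (_ : (k' == i) = false) ?(mul0r, mulr0)// -val_eqE /= gtn_eqF.
have tC : trivial_upto k (val C).
  move=> i j ijk; rewrite CE mxE; have [ki|] := leqP k i; last by rewrite mul0r mulr0 addr0.
  rewrite (_ : (j == l) = false) ?mul0r ?addr0//; apply/negbTE; rewrite -val_eqE /=.
  by move: ijk; lia.
have tgC : trivial_upto k (val (g * C)%g) by rewrite SL_valM; exact: trivial_upto_mulr.
have := @reduce_step (fun=> True) k' l (g * C)%g v _ tgC; rewrite /= gl uv.
move=> /(_ (ltnSn _) erefl I (fun _ _ => I) (fun _ _ => I))[h [th _] hL].
have [L wL] : exists L, word (fun=> True) L h.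
  apply: (IH k.+1) => //; by rewrite addSnnS.
exists (d + L + d + 1 + d)%N.
rewrite -[g](mulgK C); apply: wordM; [exact: hL|exact: wordV].
Qed.

End Elementary.

Lemma field_stable_range (F : fieldType) : stable_range F.
Proof.
move=> a c; have [->|a0] := eqVneq a 0.
  by exists 1, 1, 1; rewrite mulr0 subr0 add0r !mul1r.
by exists 0, a, a^-1; rewrite mul0r addr0 divff.
Qed.

Section NearIdentity.
Variables (R : realFieldType) (d : nat).
Implicit Types g h : SL R d.

Definition near1 (e : R) g := forall i j, `|val g i j - (i == j)%:R| <= e.

(** Quantitative elimination. Near the identity the entry [(k, k + 1)] is too small to be a pivot,
    so a preliminary elementary factor makes it of size about [eta]. When [g] is within
    [eta * z / 100] of the identity, division by this pivot still leaves parameters bounded by [e].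
    The length [L] does not depend on [e], and [equi] relies on that. *)
Lemma near1_word k : exists L, forall e, 0 < e -> exists2 e', 0 < e' &
  forall g, trivial_upto k (val g) -> near1 e' g -> word (fun s => `|s| <= e) L g.
Proof.
have [m dk] : exists m, (d <= k.+1 + m)%N by exists d; rewrite leq_addl.
elim: m k dk => [|m IH] k dk.
  rewrite addn0 in dk; exists 0%N => e e0; exists 1 => // g tg _.
  by rewrite (trivial_upto_last dk tg); exact: word1.
have [dk1|dk1] := leqP d k.+1.
  by exists 0%N => e e0; exists 1 => // g tg _; rewrite (trivial_upto_last dk1 tg); exact: word1.
have kd : (k < d)%N by exact: ltnW.
pose k' := Ordinal kd; pose l := Ordinal dk1.
have kl : k' != l by rewrite -val_eqE /= ltn_eqF.
have [|L hL] := IH k.+1; first by rewrite addSnnS.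
exists (d + L + d + 1 + 1)%N => e e0.
have [e1 e10 he1] := hL e e0.
pose eta := Num.min (e / 4) (1/2).
have eta0 : 0 < eta by rewrite lt_min; apply/andP; split; lra.
have eta1 : eta <= e / 4 by rewrite ge_min lexx.
have eta2 : eta <= 1/2 by rewrite ge_min lexx orbT.
pose z := Num.min (Num.min e e1) 1.
have z0 : 0 < z by rewrite !lt_min e0 e10 ltr01.
have ze : z <= e by rewrite !ge_min lexx.
have ze1 : z <= e1 by rewrite !ge_min lexx orbT.
have z1 : z <= 1 by rewrite !ge_min lexx orbT.
pose del := eta * z / 100.
have del0 : 0 < del by rewrite divr_gt0// mulr_gt0.
have delE : 100 * del = eta * z by rewrite /del mulrC divfK.
have etaz : eta * z <= eta by rewrite ler_piMr// ltW.
have etaz' : eta * z <= z / 2.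
  by rewrite mulrC ler_pM2l// (le_trans eta2)//; lra.
exists del => // g tg ng.
pose g' := (g * elemSL k' l eta)%g.
have g'E i j : val g' i j = val g i j + (j == l)%:R * val g i k' * eta by rewrite SL_valM mulmx_elem.
have tg' : trivial_upto k (val g').
  rewrite SL_valM; apply: trivial_upto_mulr => // i j ijk.
  rewrite !mxE kl /= (_ : _ && _ = false) ?mul0r ?addr0//.
  by apply/negP => /andP[/eqP E1 /eqP E2]; move: ijk; rewrite E1 E2 /= ltnn ltnNge leqnSn.
have nd i j : i != j -> `|val g i j| <= del.
  by move=> ij; have := ng i j; rewrite (negPf ij) subr0.
have ndd i : `|val g i i - 1| <= del by have := ng i i; rewrite eqxx.
have gkk : val g' k' k' = val g k' k' by rewrite g'E (negPf kl) !mul0r addr0.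
have gkl : val g' k' l = val g k' l + val g k' k' * eta by rewrite g'E eqxx mul1r.
have del1 : del <= 1 / 100 by move: delE etaz' z1; clear; lra.
have dele : del <= eta / 100 by move: delE etaz; clear; lra.
have mb (b : bool) x : `|b%:R * x * eta| <= `|x| * eta.
  by rewrite normrM (gtr0_norm eta0) ler_pM2r//; case: b; rewrite ?mul1r ?mul0r ?normr0.
have m1 i : i != k' -> `|val g i k'| * eta <= del.
  by move=> ik; rewrite (le_trans _ (nd _ _ ik))// ler_piMr// (le_trans eta2)//; clear; lra.
have m2 : `|val g k' k'| * eta <= 101 / 100 * eta.
  rewrite ler_pM2r//; have := ndd k'; have := ler_normD (val g k' k' - 1) 1.
  by rewrite subrK normr1; move: del1; clear; lra.
have uge : eta / 2 <= val g' k' l.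
  have := nd _ _ kl; rewrite gkl ler_norml => /andP[h1 _].
  have : 99 / 100 * eta <= val g k' k' * eta.
    by rewrite ler_pM2r//; have := ndd k'; rewrite ler_norml => /andP[h2 _]; move: h2 del1; clear; lra.
  move: h1 dele eta0; clear; lra.
have u0 : 0 < val g' k' l by move: uge eta0; clear; lra.
pose v := (val g' k' l)^-1.
have v2 : v <= 2 / eta by rewrite /v -[2 / eta]invrK lef_pV2 ?posrE ?invr_gt0 ?divr_gt0// invfM invrK mulrC.
have v0 : 0 < v by rewrite invr_gt0.
pose t := (1 - val g' k' k') * v.
have tb : `|t| <= z / 50.
  rewrite /t normrM (gtr0_norm v0) gkk distrC.
  have : `|val g k' k' - 1| * v <= del * (2 / eta) by apply: ler_pM => //; exact: ltW.
  move=> /le_trans; apply; rewrite /del.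
  rewrite (_ : _ * _ = z / 50)//; field; exact: lt0r_neq0.
pose c i := val g' i k' + val g' i l * t.
have cb i : i != k' -> `|c i| <= z / 20.
  move=> ik; rewrite /c g'E (negPf kl) !mul0r addr0.
  have h1 := nd _ _ ik.
  have h2 : `|val g' i l| <= 2.
    rewrite g'E; have := mb (l == l) (val g i k'); have := m1 _ ik; have := ng i l.
    have := ler_normD (val g i l - (i == l)%:R) (i == l)%:R; rewrite subrK.
    have : `|(i == l)%:R| <= 1 :> R by case: (i == l); rewrite ?normr1 ?normr0.
    have := ler_normD (val g i l) ((l == l)%:R * val g i k' * eta); move: del1; clear; lra.
  apply: (le_trans (ler_normD _ _)); rewrite normrM.
  have : `|val g' i l| * `|t| <= 2 * (z / 50) by apply: ler_pM.
  move: h1 delE etaz' z0; clear; lra.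
have rb j : j != k' -> `|val g' k' j| <= 2 * eta.
  move=> jk; rewrite g'E; have := nd k' j; rewrite eq_sym jk => /(_ isT) h1.
  have := mb (j == l) (val g k' k').
  have := ler_normD (val g k' j) ((j == l)%:R * val g k' k' * eta); move: h1 dele m2 eta0; clear; lra.
have uv : val g' k' l * v = 1 by rewrite /v mulfV// gt_eqF.
have := @reduce_step _ _ (fun s => `|s| <= e) k' l g' v _ tg'.
move=> /(_ (ltnSn _) uv).
have te : `|- ((1 - val g' k' k') * v)| <= e by rewrite normrN -/t (le_trans tb)//; move: ze z0; clear; lra.
have rbe j : j != k' -> `|val g' k' j| <= e by move=> /rb/le_trans; apply; move: eta1 e0; clear; lra.
have cbe j : j != k' -> `|c j| <= e by move=> /cb/le_trans; apply; move: ze z0; clear; lra.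
move=> /(_ te rbe cbe)[h [th hE] hw].
have wh : word (fun s => `|s| <= e) L h.
  apply: he1 => // i j.
  have [/orP ik|] := boolP ((i < k.+1) || (j < k.+1))%N.
    by rewrite th; [rewrite subrr normr0 ltW|apply/orP].
  rewrite negb_or -!leqNgt => /andP[ki kj].
  have ik : i != k' by rewrite -val_eqE /= gtn_eqF.
  have jk : j != k' by rewrite -val_eqE /= gtn_eqF.
  rewrite (hE _ _ ik jk).
  have h1 : `|val g' i j - (i == j)%:R| <= 2 * del.
    rewrite g'E addrAC; have := mb (j == l) (val g i k'); have := m1 _ ik; have := ng i j.
    have := ler_normD (val g i j - (i == j)%:R) ((j == l)%:R * val g i k' * eta); clear; lra.
  have h2 : `|c i * val g' k' j| <= z / 20 * 1.
    rewrite normrM; apply: ler_pM => //; first exact: cb.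
    apply: (le_trans (rb _ jk)); move: eta2; clear; lra.
  rewrite addrAC; apply: (le_trans (ler_normB _ _)); move: h1 h2 delE etaz' ze1 z0; clear; lra.
have := hw L wh => wg'.
rewrite -[g](mulgK (elemSL k' l eta)); apply: wordM => //.
rewrite elemSLV; apply: word_elem => //; rewrite normrN gtr0_norm//; move: eta1 e0; clear; lra.
Qed.

End NearIdentity.

Section StrongApproximation.
Variables (R : realType) (d : nat).
Implicit Types g h : SL (adele R) d.
Local Notation delta := (@delta R).

(** The principal congruence subgroup at the finite places; the real component of [g] is
    arbitrary. *)
Definition fnear (N : nat) g := forall i j, cong N (val g i j) (i == j)%:R.

Lemma cong_mull_int N (a b c : adele R) : Zhat a -> cong N b c -> cong N (a * b) (a * c).
Proof.
move=> aZ; rewrite !congE => /(ZhatM aZ); congr Zhat.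
by set x := delta _; clearbody x; ring.
Qed.

Lemma cong_Zhat N (a b : adele R) : (0 < N)%N -> cong N a b -> Zhat b -> Zhat a.
Proof.
move=> N0; rewrite congE => /(Zhat_natV_mul N0) h bZ.
by rewrite -(subrK b a); exact: ZhatD.
Qed.

Lemma Zhat_bool (b : bool) : Zhat (b%:R : adele R).
Proof. by case: b; [exact: Zhat1|exact: Zhat0]. Qed.

Lemma fnearM N g h : (0 < N)%N -> fnear N g -> fnear N h -> fnear N (g * h)%g.
Proof.
move=> N0 gN hN i j; have -> : (i == j)%:R = (1%:M *m 1%:M : 'M[adele R]_d) i j by rewrite mulmx1 mxE.
rewrite SL_valM !mxE; apply: cong_sum => k _; rewrite !mxE.
apply: (@cong_trans _ _ _ (val g i k * (k == j)%:R)).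
  by apply: cong_mull_int => //; apply: (cong_Zhat N0 (gN i k)); exact: Zhat_bool.
by rewrite ![_ * (k == j)%:R]mulrC; apply: cong_mull_int; [exact: Zhat_bool|exact: gN].
Qed.

Lemma SL_den g : exists2 D : nat, (0 < D)%N & forall i j, Zhat (delta D%:R * val g i j).
Proof.
pose D i j := s2val (cid2 (adele_den (val g i j))).
have D0 i j : (0 < D i j)%N by rewrite /D; case: cid2.
have DZ i j : Zhat (delta (D i j)%:R * val g i j) by rewrite /D; case: cid2.
exists (\prod_i \prod_j D i j)%N; first by rewrite prodn_gt0// => i; rewrite prodn_gt0.
move=> i j; have /dvdnP[k ->] : (D i j %| \prod_i \prod_j D i j)%N.
  by rewrite (bigD1 i)//= dvdn_mulr// (bigD1 j)//= dvdn_mulr.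
rewrite natrM; have -> : delta (k%:R * (D i j)%:R) = delta k%:R * delta (D i j)%:R by exact: rmorphM.
by rewrite -mulrA; apply: ZhatM; [exact: Zhat_nat|exact: DZ].
Qed.

Lemma fnear_conj N g : (0 < N)%N -> exists2 N', (0 < N')%N &
  forall h, fnear N' h -> fnear N (g^-1 * h * g)%g.
Proof.
move=> N0; have [D D0 gD] := SL_den g; have [D' D'0 gD'] := SL_den g^-1%g.
exists (D * (D' * N))%N; first by rewrite !muln_gt0 D0 D'0.
move=> h hN i j.
have -> : (i == j)%:R = val (g^-1 * 1 * g)%g i j by rewrite mulg1 mulVg SL_val1 mxE.
rewrite !SL_valM !mxE; apply: cong_sum => k _.
rewrite ![_ * val g k j]mulrC.
apply: (@cong_mul _ D) => //; rewrite !mxE; apply: cong_sum => l _.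
by apply: (@cong_mul _ D') => //; [rewrite muln_gt0 D0|rewrite mulnCA; have := hN l k; rewrite SL_val1 mxE].
Qed.

Lemma fnear_elem N i j (a b : adele R) : i != j -> cong N a b -> fnear N (elemSL i j (a - b)).
Proof.
move=> ij ab k l /=; rewrite !mxE ij /=.
rewrite -[X in cong _ _ X]addr0; apply: congD; first exact: cong_refl.
rewrite -[X in cong _ _ X](mulr0 ((k == i) && (l == j))%:R).
apply: cong_mull_int; first exact: Zhat_bool.
by rewrite -(subrr b); apply: congD => //; exact: cong_refl.
Qed.

Lemma SL_map_elem (K L : comNzRingType) (f : {rmorphism K -> L}) i j (s : K) :
  SL_map f (elemSL (d := d) i j s) = elemSL i j (f s).
Proof.
apply: val_inj; apply/matrixP => a b; rewrite !mxE rmorphD rmorphM !rmorph_nat //.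
Qed.

(** Elementary generation reduces the claim to the density of Q in the finite adeles: each parameter
    is replaced by a rational so close to it that the error survives conjugation by the rest of the
    word. *)
Lemma strong_approx N h : (0 < N)%N -> exists gam : SL rat d, fnear N ((SL_map delta gam)^-1 * h)%g.
Proof.
have [L wh] := stable_range_word (@adele_stable_range R) h.
elim: wh N => {L h} [l|l i j a h ij _ wh IH] N N0.
  exists 1%g; rewrite SL_map1 invg1 mulg1 => i j; rewrite SL_val1 mxE; exact: cong_refl.
have [N' N'0 hN'] := fnear_conj h N0.
have [q aq] := adele_density a N'0.
have [gam gamN] := IH N N0.
exists (elemSL i j q * gam)%g; rewrite SL_mapM invgM SL_map_elem elemSLV.
have -> : ((SL_map delta gam)^-1 * elemSL i j (- delta q) * (elemSL i j a * h) =
  ((SL_map delta gam)^-1 * h) * (h^-1 * elemSL i j (a - delta q) * h))%g.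
  have E (x y z t : SL (adele R) d) : (x * y * (z * t) = x * t * (t^-1 * (y * z) * t))%g.
    by rewrite !mulgA mulgK.
  by rewrite [a - _]addrC -elemSLD; exact: E.
apply: fnearM; [exact: N0|exact: gamN|apply: hN']; exact: (@fnear_elem N' i j a (delta q) ij aq).
Qed.

(** A congruence subgroup together with SL_d(R) acts transitively on the quotient, so that a
    function of level [N] is determined by its values along a single real orbit. *)
Lemma transitive_mod N (M M' : SL (adele R) d) : (0 < N)%N ->
  exists gam h, M' = (SL_map delta gam * M * h)%g /\ fnear N h.
Proof.
move=> N0; have [N' N'0 hN'] := fnear_conj M N0.
have [gam gamN] := @strong_approx N' (M' * M^-1)%g N'0.
exists gam, (M^-1 * ((SL_map delta gam)^-1 * (M' * M^-1)) * M)%g; split; last exact: hN'.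
have E (x y z : SL (adele R) d) : (z = x * y * (y^-1 * (x^-1 * (z * y^-1)) * y))%g.
  by rewrite !mulgA mulgK mulgV mul1g mulgVK.
exact: E.
Qed.

Definition re_SL h : SL R d := SL_map (@adele_real R) h.

End StrongApproximation.

Section RealApproximation.
Variables (R : realType) (d : nat).
Implicit Types g h : SL R d.

Lemma near1_weak (e e' : R) g : e <= e' -> near1 e g -> near1 e' g.
Proof. by move=> ee gN i j; exact: le_trans (gN i j) ee. Qed.

Lemma near1M (e : R) : 0 < e -> exists2 e', 0 < e' &
  forall g h, near1 e' g -> near1 e' h -> near1 e (g * h)%g.
Proof.
move=> e0; pose D : R := d%:R + 1; have D0 : 0 < D by rewrite ltr_wpDl.
pose e' := Num.min 1 (e / (3 * D)).
have e'0 : 0 < e' by rewrite lt_min ltr01 divr_gt0// mulr_gt0.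
exists e' => // g h gN hN i j.
have -> : val (g * h)%g i j - (i == j)%:R =
    (val g i j - (i == j)%:R) + (val h i j - (i == j)%:R) +
    \sum_k (val g i k - (i == k)%:R) * (val h k j - (k == j)%:R).
  rewrite SL_valM mxE; under [in RHS]eq_bigr do rewrite mulrBr mulrBl mulrBl.
  rewrite !sumrB.
  rewrite [X in _ - X - _](bigD1 i)//= eqxx mul1r [X in _ - (_ + X) - _]big1 ?addr0; last first.
    by move=> k; rewrite eq_sym => /negPf ->; rewrite mul0r.
  rewrite [X in _ - (X - _)](bigD1 j)//= eqxx mulr1 [X in _ - (_ + X - _)]big1 ?addr0; last first.
    by move=> k /negPf ->; rewrite mulr0.
  rewrite [X in _ - (_ - X)](bigD1 i)//= eqxx mul1r [X in _ - (_ - (_ + X))]big1 ?addr0; last first.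
    by move=> k; rewrite eq_sym => /negPf ->; rewrite mul0r.
  by move: (\sum_i0 _) => S; ring.
have e1 : e' <= 1 by rewrite ge_min lexx.
have e2 : 3 * D * e' <= e by rewrite mulrC -ler_pdivlMr ?mulr_gt0// ge_min lexx orbT.
have h1 := gN i j; have h2 := hN i j.
have h3 : `|\sum_k (val g i k - (i == k)%:R) * (val h k j - (k == j)%:R)| <= d%:R * e'.
  apply: (le_trans (ler_norm_sum _ _ _)).
  apply: (@le_trans _ _ (\sum_(k < d) e')); last by rewrite sumr_const card_ord mulr_natl.
  apply: ler_sum => k _; rewrite normrM -[leRHS]mulr1; apply: ler_pM => //; exact: le_trans (hN k j) e1.
apply: (le_trans (ler_normD _ _)).
have := ler_normD (val g i j - (i == j)%:R) (val h i j - (i == j)%:R).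
have d0 : 0 <= d%:R :> R by [].
have : D * e' = d%:R * e' + e' by rewrite mulrDl mul1r.
have : 0 <= d%:R * e' by rewrite mulr_ge0// ltW.
move: h1 h2 h3 e2 e'0; rewrite -mulrA; clear; lra.
Qed.

Lemma near1_conj_bounded (e B : R) : 0 < e -> 0 <= B -> exists2 e', 0 < e' &
  forall g h, (forall i j, `|val g i j| <= B) -> (forall i j, `|val g^-1%g i j| <= B) ->
  near1 e' h -> near1 e (g * h * g^-1)%g.
Proof.
move=> e0 B0; pose D : R := d%:R * d%:R * (B * B) + 1.
have D0 : 0 < D by rewrite ltr_wpDl// !mulr_ge0.
exists (e / D); first by rewrite divr_gt0.
move=> g h gB gB' hN i j.
have -> : val (g * h * g^-1)%g i j - (i == j)%:R =
    \sum_k \sum_l val g i l * (val h l k - (l == k)%:R) * val g^-1%g k j.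
  have -> : (i == j)%:R = val (g * 1%g * g^-1)%g i j by rewrite mulg1 mulgV mxE.
  rewrite !SL_valM !mxE -sumrB; apply: eq_bigr => k _.
  rewrite !mxE -mulrBl -sumrB mulr_suml; apply: eq_bigr => l _.
  by rewrite -mulrBr mxE.
apply: (@le_trans _ _ (\sum_(k < d) \sum_(l < d) B * (e / D) * B)).
  apply: (le_trans (ler_norm_sum _ _ _)); apply: ler_sum => k _.
  apply: (le_trans (ler_norm_sum _ _ _)); apply: ler_sum => l _.
  by rewrite !normrM; apply: ler_pM => //; apply: ler_pM.
rewrite !sumr_const card_ord -mulr_natr -[X in X * _]mulr_natr.
rewrite (_ : _ * _ * _ * d%:R * d%:R = e * ((d%:R * d%:R * (B * B)) / D)); last by ring.
by rewrite ler_piMr ?(ltW e0)// ler_pdivrMr// mul1r /D lerDl.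
Qed.

Lemma near1_conj (e : R) g : 0 < e -> exists2 e', 0 < e' &
  forall h, near1 e' h -> near1 e (g * h * g^-1)%g.
Proof.
move=> e0; pose B := \sum_i \sum_j `|val g i j| + \sum_i \sum_j `|val g^-1%g i j|.
have S0 (h : SL R d) : 0 <= \sum_i \sum_j `|val h i j|.
  by rewrite sumr_ge0// => i _; rewrite sumr_ge0.
have SB (h : SL R d) i j : `|val h i j| <= \sum_i \sum_j `|val h i j|.
  rewrite (bigD1 i)//= (bigD1 j)//= -addrA lerDl addr_ge0// ?sumr_ge0// => k _.
  by rewrite sumr_ge0.
have [e' e'0 he'] := @near1_conj_bounded e B e0 (addr_ge0 (S0 _) (S0 _)).
exists e' => // h; apply: he' => i j; apply: (le_trans (SB _ i j)); rewrite /B.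
  by rewrite lerDl.
by rewrite lerDr.
Qed.

Lemma near1_elem (i j : 'I_d) (s : R) : near1 `|s| (elemSL i j s).
Proof.
move=> a b /=; rewrite mxE addrC addKr normrM.
by case: (_ && _); rewrite ?normr1 ?normr0 ?mul1r ?mul0r.
Qed.

(** The induction of [strong_approx] on an elementary word, carried out at the real place. *)
Lemma SLQ_dense (e : R) g : 0 < e -> exists gam : SL rat d,
  near1 e (g * (SL_map (ratr : {rmorphism rat -> R}) gam)^-1)%g.
Proof.
have [L wg] := stable_range_word (@field_stable_range R) g.
elim: wg e => {L g} [l|l i j s g ij _ wg IH] e e0.
  by exists 1%g => i j; rewrite SL_map1 invg1 mulg1 SL_val1 mxE subrr normr0 ltW.
have [e1 e10 he1] := near1M e0.
have [e2 e20 he2] := near1_conj (elemSL i j s) e10.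
have [gam gamN] := IH e2 e20.
have [q sq] : exists q : rat, `|s - ratr q| < e1.
  have [|q] := @rat_in_itvoo R (s - e1) (s + e1); first by rewrite ltrD2l gtrN.
  by move=> qi; exists q; move: qi; rewrite in_itv /= => /andP[a b]; rewrite ltr_norml; lra.
exists (elemSL i j q * gam)%g; rewrite SL_mapM SL_map_elem invgM elemSLV.
have -> : (elemSL i j s * g * ((SL_map (ratr : {rmorphism rat -> R}) gam)^-1 * elemSL i j (- ratr q)) =
  (elemSL i j s * (g * (SL_map (ratr : {rmorphism rat -> R}) gam)^-1) * (elemSL i j s)^-1) * elemSL i j (s - ratr q))%g.
  by rewrite -elemSLD !mulgA mulgVK.
apply: he1; first exact: he2.
by apply: near1_weak (near1_elem _ _ _); exact: ltW.
Qed.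

End RealApproximation.

(** * Functions on the homogeneous space *)

Section BoundedMeasurable.
Context d (T : measurableType d) (R : realType).
Implicit Types f g : T -> R.

Definition bmf f := measurable_fun setT f /\ exists C, forall x, `|f x| <= C.

Lemma bmf_cst (c : R) : bmf (fun=> c).
Proof. by split; [exact: measurable_cst|exists `|c|]. Qed.

Lemma bmfD f g : bmf f -> bmf g -> bmf (fun x => f x + g x).
Proof.
move=> [mf [C fC]] [mg [D gD]]; split; first exact: measurable_funD.
by exists (C + D) => x; rewrite (le_trans (ler_normD _ _))// lerD.
Qed.

Lemma bmfM f g : bmf f -> bmf g -> bmf (fun x => f x * g x).
Proof.
move=> [mf [C fC]] [mg [D gD]]; split; first exact: measurable_funM.
by exists (C * D) => x; rewrite normrM ler_pM.
Qed.

Lemma bmfZ (c : R) f : bmf f -> bmf (fun x => c * f x).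
Proof. by move=> bf; apply: bmfM => //; exact: bmf_cst. Qed.

Lemma bmfB f g : bmf f -> bmf g -> bmf (fun x => f x - g x).
Proof.
move=> bf bg; have := bmfD bf (bmfZ (-1) bg).
by under eq_fun do rewrite mulN1r.
Qed.

Lemma bmf_sum (I : Type) (s : seq I) (F : I -> T -> R) : (forall i, bmf (F i)) ->
  bmf (fun x => \sum_(i <- s) F i x).
Proof.
move=> h; elim: s => [|i s IH].
  by under eq_fun do rewrite big_nil; exact: bmf_cst.
by under eq_fun do rewrite big_cons; exact: bmfD.
Qed.

Lemma bmf_comp d' (T' : measurableType d') (phi : T' -> T) f : measurable_fun setT phi -> bmf f -> 
  measurable_fun setT (f \o phi) /\ exists C, forall x, `|f (phi x)| <= C.
Proof.
move=> mphi [mf [C fC]]; split; last by exists C => x; exact: fC.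
exact: measurableT_comp.
Qed.

Section Integral.
Variables (mu : {measure set T -> \bar R}) (D : set T).
Hypotheses (mD : measurable D) (muD : (mu D < +oo)%E).
Local Notation E f := (\int[mu]_(x in D) f x).

Lemma bmf_integrable f : bmf f -> mu.-integrable D (EFin \o f).
Proof.
move=> [mf [C fC]]; apply: measurable_bounded_integrable => //.
  exact: measurable_funS mf.
exists `|C|; split; first exact: num_real.
by move=> x Cx y _; rewrite /= (le_trans (fC y))// (le_trans (ler_norm _))// ltW.
Qed.

Lemma meanD f g : bmf f -> bmf g -> E (fun x => f x + g x) = E f + E g.
Proof. by move=> /bmf_integrable fi /bmf_integrable gi; rewrite RintegralD. Qed.
Lemma meanB f g : bmf f -> bmf g -> E (fun x => f x - g x) = E f - E g.
Proof. by move=> /bmf_integrable fi /bmf_integrable gi; rewrite RintegralB. Qed.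
Lemma meanZ c f : bmf f -> E (fun x => c * f x) = c * E f.
Proof. by move=> /bmf_integrable fi; rewrite RintegralZl. Qed.
Lemma mean_le f g : bmf f -> bmf g -> (forall x, D x -> f x <= g x) -> E f <= E g.
Proof. by move=> /bmf_integrable fi /bmf_integrable gi; exact: le_Rintegral. Qed.
Lemma mean_cst c : E (fun=> c) = c * fine (mu D).
Proof. by rewrite Rintegral_cst. Qed.
Lemma mean_sum (I : Type) (s : seq I) (F : I -> T -> R) : (forall i, bmf (F i)) ->
  E (fun x => \sum_(i <- s) F i x) = \sum_(i <- s) E (F i).
Proof.
move=> h; elim: s => [|i s IH].
  by rewrite big_nil; under eq_fun do rewrite big_nil; rewrite mean_cst mul0r.
rewrite big_cons -IH -meanD//; last exact: bmf_sum.
by apply: eq_Rintegral => x _; rewrite big_cons.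
Qed.

Lemma mean_abs_le f C : bmf f -> (forall x, D x -> `|f x| <= C) -> `|E f| <= C * fine (mu D).
Proof.
move=> bf fC; rewrite ler_norml -mulNr -!mean_cst; apply/andP; split; apply: mean_le => //; try exact: bmf_cst;
 by move=> x /fC; rewrite ler_norml => /andP[].
Qed.

Lemma mean_cvg (f_ : nat -> T -> R) f C : (forall j, bmf (f_ j)) -> measurable_fun setT f ->
  (forall j x, `|f_ j x| <= C) -> (forall x, D x -> f_ j x @[j --> \oo] --> f x) ->
  E (f_ j) @[j --> \oo] --> E f.
Proof.
move=> bf mf fC fcvg.
have [] := @dominated_convergence _ _ _ mu D mD (fun j x => (f_ j x)%:E) (fun x => (f x)%:E) (fun=> C%:E).
- by move=> j; apply/measurable_EFinP; apply: measurable_funS (bf j).1.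
- by apply/measurable_EFinP; exact: measurable_funS mf.
- by apply: aeW => x Dx; apply/cvg_EFin; [exact: nearW|exact: fcvg].
- exact: (@bmf_integrable (fun=> C) (bmf_cst _)).
- by apply: aeW => x j _; rewrite lee_fin.
move=> fi _ cv; rewrite /Rintegral; apply: fine_cvg.
by rewrite fineK ?integrable_fin_num//; exact: cv.
Qed.

End Integral.
End BoundedMeasurable.

Section SpaceAction.
Variables (R : realType) (n : nat).
Local Notation d := n.+1.
Local Notation G := (SL (adele R) d).
Local Notation X := (SLQ_SLA R d).
Implicit Types (x y : X) (g h : G).

Local Notation "x ** h" := (coset_act x h) (at level 40, left associativity).
Definition piX (g : G) : X := \pi_X g.

Lemma piX_repr x : exists g, x = piX g.
Proof. by exists (repr x); rewrite /piX reprK. Qed.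

Lemma piX_act g h : piX g ** h = piX (g * h)%g.
Proof. exact: coset_actE. Qed.

Lemma piX_left gam g : piX (SL_map (delta R) gam * g)%g = piX g.
Proof. by apply/esym/SLQ_relP/asboolP; exists gam. Qed.

Lemma act1 x : x ** 1%g = x.
Proof. by have [g ->] := piX_repr x; rewrite piX_act mulg1. Qed.

Lemma actM x g h : x ** (g * h)%g = x ** g ** h.
Proof. by have [k ->] := piX_repr x; rewrite !piX_act mulgA. Qed.

Lemma actK h x : x ** h ** h^-1%g = x.
Proof. by rewrite -actM mulgV act1. Qed.
Lemma actVK h x : x ** h^-1%g ** h = x.
Proof. by rewrite -actM mulVg act1. Qed.

Lemma SL_closeP (g : G) (P : set G) : nbhs g P <->
  exists k, forall h, closeM k (val g) (val h) -> P h.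
Proof.
split.
  rewrite nbhsE => -[B [[A oA AB] Bg] BP].
  have : nbhs (val g) A by apply: open_nbhs_nbhs; split => //; rewrite -AB in Bg.
  by move=> /closeM_nbhs[k kA]; exists k => h /kA Ah; apply: BP; rewrite -AB.
move=> [k kP]; have := @initial_continuous G _ (val : G -> 'M[adele R]_d) g _ (nbhs_closeM k (val g)).
apply: (@filterS _ (nbhs g) _) => h; exact: kP.
Qed.

Lemma continuous_piX : continuous piX.
Proof. exact: pi_continuous. Qed.

Lemma continuous_mulr h : continuous (fun g : G => (g * h)%g).
Proof.
move=> g P /SL_closeP[k kP]; apply/SL_closeP.
have [k' k'P] := closeM_mulr d k (val h); exists k' => g' gg'; apply: kP.
exact: k'P.
Qed.

Lemma continuous_act h : continuous (fun x : X => x ** h).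
Proof.
apply/quotient_continuous; rewrite (_ : _ \o _ = piX \o (fun g : G => (g * h)%g)); last first.
  by apply/funext => g; exact: piX_act.
move=> g; apply: continuous_comp; [exact: continuous_mulr|exact: continuous_piX].
Qed.

Lemma continuous_borel (T T' : ptopologicalType) (f : T -> T') : continuous f ->
  measurable_fun (setT : set (borel T)) (f : borel T -> borel T').
Proof.
move=> /continuousP cf; apply: (@measurability _ _ _ (borel T') _ _ (@open T')) => //.
by move=> _ [A oA <-]; rewrite setTI; apply: sub_sigma_algebra; exact: cf.
Qed.

Lemma continuous_borelR (T : ptopologicalType) (f : T -> R) : continuous f ->
  measurable_fun (setT : set (borel T)) (f : borel T -> R).
Proof.
move=> /continuousP cf; apply: (measurability _ (RGenOpens.measurableE R)) => //.
move=> _ [_ [a [b ->]] <-]; rewrite setTI; apply: sub_sigma_algebra; apply: cf.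
exact: interval_open.
Qed.

Section Invariant.
Variable mu : probability (borel X) R.
Hypothesis mu_inv : is_invariant mu.
Local Notation E f := (\int[mu]_x f x).

Lemma mu_fin : (mu setT < +oo)%E.
Proof. by rewrite probability_setT ltry. Qed.

Lemma act_preimage h (B : set X) : (fun x => x ** h) @^-1` B = [set coset_act c h^-1%g | c in B].
Proof.
apply/seteqP; split => [x Bx|_ [y By <-]] /=; last by rewrite actVK.
by exists (x ** h) => //; rewrite actK.
Qed.

Lemma mu_act h (B : set (borel X)) : measurable B -> mu ((fun x => x ** h) @^-1` B) = mu B.
Proof. by move=> mB; rewrite act_preimage mu_inv. Qed.

Lemma measurable_act h : measurable_fun (setT : set (borel X)) ((fun x : X => x ** h) : borel X -> borel X).
Proof. exact: (continuous_borel (@continuous_act h)). Qed.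

Lemma bmf_act h (f : borel X -> R) : bmf f -> bmf (fun x : borel X => f (x ** h)).
Proof. exact: (bmf_comp (measurable_act h)). Qed.

Lemma mean_act h (f : borel X -> R) : bmf f -> E (fun x => f (x ** h)) = E f.
Proof.
move=> bf; have mh := measurable_act h.
rewrite /Rintegral; congr fine.
have mf : measurable_fun setT (EFin \o f) by apply/measurable_EFinP; case: bf.
have fi := bmf_integrable measurableT mu_fin (bmf_act h bf).
have <- := integral_pushforward mh mf fi measurableT.
by apply: eq_measure_integral => A mA _; rewrite /pushforward; exact: mu_act.
Qed.

End Invariant.

End SpaceAction.
Notation "x ** h" := (coset_act x h) (at level 40, left associativity).

Section Iota.
Variables (R : realType) (d : nat).
Implicit Types g h : SL R d.

Lemma mx_adele_eq m l (V W : 'M[adele R]_(m, l)) :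
  map_mx (@adele_real R) V = map_mx (@adele_real R) W ->
  (forall p, map_mx (@adele_padic R p) V = map_mx (@adele_padic R p) W) -> V = W.
Proof.
move=> h1 h2; apply/matrixP => i j; apply: adele_eq => [|p].
  by have := congr1 (fun M => fun_of_matrix M i j) h1; rewrite !mxE.
by have := congr1 (fun M => fun_of_matrix M i j) (h2 p); rewrite !mxE.
Qed.

Lemma iota_real g : map_mx (@adele_real R) (val (iotaSL g)) = val g.
Proof. by apply/matrixP => i j; rewrite !mxE. Qed.

Lemma iota_padic g p : map_mx (@adele_padic R p) (val (iotaSL g)) = 1%:M.
Proof.
apply/matrixP => i j; rewrite !mxE -[LHS]/(adele_padic p ((i == j)%:R)).
by case: (i == j).
Qed.

Lemma iotaM g h : iotaSL (g * h)%g = (iotaSL g * iotaSL h)%g.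
Proof.
apply: val_inj; apply: mx_adele_eq => [|p]; rewrite SL_valM map_mxM.
  by rewrite !iota_real.
by rewrite !iota_padic mulmx1.
Qed.

Lemma iota1 : iotaSL (1%g : SL R d) = 1%g.
Proof.
apply: val_inj; apply: mx_adele_eq => [|p]; rewrite SL_val1 map_mx1 ?iota_real//.
by rewrite iota_padic.
Qed.

Lemma iotaV g : iotaSL g^-1%g = (iotaSL g)^-1%g.
Proof. by apply: (mulgI (iotaSL g)); rewrite mulgV -iotaM mulgV iota1. Qed.

Lemma re_iota g : re_SL (iotaSL g) = g.
Proof. by apply: val_inj; rewrite /= iota_real. Qed.

Lemma re_SLM (g h : SL (adele R) d) : re_SL (g * h)%g = (re_SL g * re_SL h)%g.
Proof. exact: SL_mapM. Qed.

Lemma fnear_iota N g : fnear N (iotaSL g).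
Proof.
move=> i j; rewrite congE => p; rewrite adele_padicM adele_padicB.
have := congr1 (fun M => fun_of_matrix M i j) (iota_padic g p); rewrite !mxE => ->.
rewrite (_ : adele_padic p (i == j)%:R = (i == j)%:R) ?subrr ?mulr0 ?rpred0//.
by case: (i == j).
Qed.

End Iota.

Section Nice.
Variables (R : realType) (n : nat).
Local Notation d := n.+1.
Local Notation G := (SL (adele R) d).
Local Notation X := (SLQ_SLA R d).
Implicit Types (x y : X) (f : X -> R).

(** [del] does not depend on [x]: uniformity over the whole quotient replaces compactness. *)
Definition real_unif_continuous f := forall e, 0 < e -> exists2 del, 0 < del &
  forall g : SL R d, near1 del g -> forall x, `|f (x ** iotaSL g) - f x| <= e.

Definition level_invariant (N : nat) f :=
  forall (k : G), fnear N k -> re_SL k = 1%g -> forall x, f (x ** k) = f x.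

Definition nice f := [/\ forall x, 0 <= f x <= 1, real_unif_continuous f &
  exists2 N, (0 < N)%N & level_invariant N f].

Lemma level_re N f h x : (0 < N)%N -> level_invariant N f -> fnear N h -> f (x ** h) = f (x ** iotaSL (re_SL h)).
Proof.
move=> N0 fN hN; pose k := ((iotaSL (re_SL h))^-1 * h)%g.
have -> : x ** h = x ** iotaSL (re_SL h) ** k by rewrite -actM mulVKg.
apply: fN; last by rewrite /k re_SLM -iotaV re_iota mulVg.
by apply: fnearM => //; rewrite -iotaV; exact: fnear_iota.
Qed.

Lemma nice_continuous f : nice f -> continuous f.
Proof.
move=> [_ uf [N N0 Nf]]; apply/quotient_continuous => g.
move=> P /nbhs_ballP[e /= e0 eP]; have [del del0 hdel] := uf _ (divr_gt0 e0 (ltr0Sn _ 1)).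
pose k := maxn N (Num.truncn del^-1).+1.
have kdel : (fct k)%:R^-1 <= del.
  rewrite -[del]invrK lef_pV2 ?posrE ?invr_gt0 ?ltr0n ?fct_gt0//.
  rewrite (le_trans (ltW (truncnS_gt _)))// ler_nat (leq_trans _ (fct_ge _))//; exact: leq_maxr.
have [l lP] := closeM_mull d k (val g^-1%g).
apply/SL_closeP; exists l => h /lP gh; apply: eP => /=; apply: (@le_lt_trans _ _ (e / 2)); last by rewrite ltr_pdivrMr// ltr_pMr// ltr1n.
have {gh}[kf kr] : fnear N (g^-1 * h)%g /\ near1 del (re_SL (g^-1 * h)%g).
  have gh' : closeM k (val (1%g : G)) (val (g^-1 * h)%g) by rewrite -(mulVg g).
  split=> i j; have [r c] := gh' i j; move: r c; rewrite SL_val1 mxE => r c.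
    apply: cong_sym; apply: (cong_dvd (fct_gt0 k) _ c); apply: dvdn_fct; rewrite N0; exact: leq_maxl.
  rewrite /= mxE distrC; apply: le_trans kdel; apply: le_trans (ltW r).
  by rewrite /=; case: (i == j).
have -> : f (piX h) = f (piX g ** (g^-1 * h)%g) by rewrite piX_act mulVKg.
by rewrite (level_re _ N0 Nf kf) distrC; exact: hdel.
Qed.

Lemma nice_bmf f : nice f -> bmf (f : borel X -> R).
Proof.
move=> nf; split; first exact: (continuous_borelR (nice_continuous nf)).
by exists 1 => x; have [/(_ x)/andP[f0 f1] _ _] := nf; rewrite ger0_norm.
Qed.

Section PositiveMeasure.
Variable mu : probability (borel X) R.
Hypothesis mu_inv : is_invariant mu.

(* Countably many translates of a neighbourhood cover the space, so invariance
   forces it to have positive measure. *)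
Lemma open_positive (B : set (borel X)) x N del : measurable B -> (0 < N)%N -> 0 < del ->
  (forall h : G, fnear N h -> near1 del (re_SL h) -> B (x ** h)) -> (0 < mu B)%E.
Proof.
move=> mB N0 del0 hB; rewrite lt_neqAle measure_ge0 andbT; apply/eqP => B0.
pose tr (gam : SL rat d) : G := (iotaSL (SL_map (ratr : {rmorphism rat -> R}) gam))^-1%g.
pose F k : set (borel X) := if (unpickle k : option 'M[rat]_d) is Some Q then
  (if (insub Q : option (SL rat d)) is Some gam then (fun y : X => y ** tr gam) @^-1` B else set0) else set0.
have mF k : measurable (F k).
  rewrite /F; case: unpickle => [Q|]; last exact: measurable0.
  case: insub => [gam|]; last exact: measurable0.
  by rewrite -[X in measurable X]setTI; exact: (measurable_act (tr gam)).
have muF k : mu (F k) = 0%E.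
  rewrite /F; case: unpickle => [Q|]; last exact: measure0.
  by case: insub => [gam|]; [rewrite mu_act|exact: measure0].
have cover : (setT : set (borel X)) `<=` \bigcup_k F k.
  move=> y _; have [g xE] := piX_repr x; have [g' yE] := piX_repr y.
  have [gam [h [g'E hN]]] := transitive_mod g g' N0.
  have yx : y = x ** h by rewrite yE g'E xE piX_act -mulgA piX_left.
  have [q qN] := SLQ_dense (re_SL h) del0.
  exists (pickle (val q)) => //; rewrite /F pickleK valK /= yx -actM.
  apply: hB; first by apply: fnearM => //; rewrite /tr -iotaV; exact: fnear_iota.
  by rewrite re_SLM /tr -iotaV re_iota.
have : (mu setT <= \sum_(k <oo) mu (F k))%E by apply: measure_sigma_subadditive.
rewrite eseries0; last by move=> k _ _; exact: muF.
by rewrite probability_setT lee_fin ler10.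
Qed.

End PositiveMeasure.
End Nice.

(** * Unipotent and diagonal elements *)

Section FlowFacts.
Variables (R : realType) (n : nat).
Local Notation d := n.+1.
Implicit Types (g b : SL R d) (x z : 'rV[R]_n) (w y : 'rV[R]_d).

Lemma unip_block x (i j : 'I_d) (i' j' : 'I_(1 + n)) : i = i' :> nat -> j = j' :> nat ->
  val (unip_mx x) i j = (block_mx 1 x 0 1%:M : 'M[R]_(1 + n)) i' j'.
Proof. by move=> ii jj; congr (fun_of_matrix _ _ _); exact: val_inj. Qed.

Lemma unip00 x : val (unip_mx x) ord0 ord0 = 1.
Proof. by rewrite (@unip_block x _ _ (lshift n ord0) (lshift n ord0))// block_mxEul mxE. Qed.
Lemma unip0j x (j : 'I_n) : val (unip_mx x) ord0 (lift ord0 j) = x ord0 j.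
Proof. by rewrite (@unip_block x _ _ (lshift n ord0) (rshift 1 j))// block_mxEur. Qed.
Lemma unipi0 x (i : 'I_n) : val (unip_mx x) (lift ord0 i) ord0 = 0.
Proof. by rewrite (@unip_block x _ _ (rshift 1 i) (lshift n ord0))// block_mxEdl mxE. Qed.
Lemma unipij x (i j : 'I_n) : val (unip_mx x) (lift ord0 i) (lift ord0 j) = (i == j)%:R.
Proof. by rewrite (@unip_block x _ _ (rshift 1 i) (rshift 1 j))// block_mxEdr mxE. Qed.

Lemma unipD x z : (unip_mx x * unip_mx z)%g = unip_mx (x + z).
Proof.
apply: val_inj; rewrite SL_valM [LHS](mulmx_block 1 x 0 1%:M 1 z 0 1%:M).
by rewrite !mulmx1 !mul1mx !mul0mx !mulmx0 !addr0 !add0r addrC.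
Qed.

Lemma unip0 : unip_mx (0 : 'rV[R]_n) = 1%g.
Proof. by apply: val_inj; rewrite SL_val1 /= -scalar_mx_block. Qed.

Lemma unipN x : unip_mx (- x) = (unip_mx x)^-1%g.
Proof. by apply: (mulgI (unip_mx x)); rewrite mulgV unipD subrr unip0. Qed.

Lemma near1_unip e x : 0 <= e -> (forall j, `|x ord0 j| <= e) -> near1 e (unip_mx x).
Proof.
move=> e0 xe i j; have [i' ->|->] := unliftP ord0 i; have [j' ->|->] := unliftP ord0 j.
- by rewrite unipij (inj_eq (@lift_inj _ _)) subrr normr0.
- by rewrite unipi0 eq_sym (negPf (neq_lift _ _)) subr0 normr0.
- by rewrite unip0j (negPf (neq_lift _ _)) subr0.
- by rewrite unip00 eqxx subrr normr0.
Qed.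

Definition phi (t : R) (i : 'I_d) : R := if i == ord0 then expR (- (n%:R * t)) else expR t.

Lemma PhiE t i j : val (Phi n t) i j = (i == j)%:R * phi t i.
Proof.
rewrite /= mxE /phi eq_sym; have [->|ij] := eqVneq i j; last by rewrite mulr0n mul0r.
rewrite mulr1n mul1r.
have rE (v : 'rV[R]_(1 + n)) (a : 'I_d) (b : 'I_(1 + n)) : a = b :> nat -> v 0 a = v 0 b.
  by move=> ab; congr (fun_of_matrix _ _ _); exact: val_inj.
have [j' ->|->] := unliftP ord0 j.
  by rewrite (rE _ _ (rshift 1 j'))// row_mxEr mxE eq_sym (negPf (neq_lift _ _)).
by rewrite (rE _ _ (lshift n ord0))// row_mxEl mxE eqxx mulr1n.
Qed.

Lemma mulmx_Phi g t i j : val (g * Phi n t)%g i j = val g i j * phi t j.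
Proof.
rewrite SL_valM mxE; under eq_bigr do rewrite PhiE.
rewrite (bigD1 j)//= big1 ?addr0; first by rewrite eqxx mul1r.
by move=> k kj; rewrite (negPf kj) mul0r mulr0.
Qed.

Lemma Phi_mulmx g t i j : val (Phi n t * g)%g i j = phi t i * val g i j.
Proof.
rewrite SL_valM mxE; under eq_bigr do rewrite PhiE.
rewrite (bigD1 i)//= big1 ?addr0; first by rewrite eqxx mul1r.
by move=> k ki; rewrite eq_sym (negPf ki) !mul0r.
Qed.

Lemma phiN t i : phi t i * phi (- t) i = 1.
Proof. by rewrite /phi; case: ifP => _; rewrite -expRD ?mulrN ?opprK ?addNr ?subrr expR0. Qed.

Lemma PhiN t : @Phi R n (- t) = (@Phi R n t)^-1%g.
Proof.
apply: (mulgI (Phi n t)); rewrite mulgV; apply: val_inj; apply/matrixP => i j.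
rewrite mulmx_Phi PhiE SL_val1 mxE; have [->|] := eqVneq i j; last by rewrite !mul0r.
by rewrite mul1r phiN.
Qed.

(** The factor by which conjugation by [Phi n t] expands the horospherical directions, as [unip_Phi]
    shows. *)
Definition lam (t : R) : R := expR (d%:R * t).

Lemma lam_gt0 t : 0 < lam t. Proof. exact: expR_gt0. Qed.

Lemma unip_Phi z t : (unip_mx z * Phi n t = Phi n t * unip_mx (lam t *: z))%g.
Proof.
apply: val_inj; apply/matrixP => i j; rewrite mulmx_Phi Phi_mulmx.
have [i' ->|->] := unliftP ord0 i; have [j' ->|->] := unliftP ord0 j.
- rewrite !unipij mulrC; have [->//|] := eqVneq i' j'; by rewrite !mulr0.
- by rewrite !unipi0 mul0r mulr0.
- rewrite !unip0j /phi eqxx eq_sym (negPf (neq_lift _ _)) mxE mulrA -expRD mulrC; congr (expR _ * _).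
  rewrite -[d]addn1 natrD; ring.
- by rewrite !unip00 mul1r mulr1.
Qed.

(* Phi^-t b Phi^t contracts everything except the top row, which is assumed to vanish off the diagonal. *)
Lemma near1_contract e t b : 0 <= t -> (forall j, val b ord0 (lift ord0 j) = 0) ->
  near1 e b -> near1 e (Phi n (- t) * b * Phi n t)%g.
Proof.
move=> t0 b0 be i j; rewrite mulmx_Phi Phi_mulmx.
have be' : `|val b i j - (i == j)%:R| <= e := be i j.
have [i' iE|iE] := unliftP ord0 i; have [j' jE|jE] := unliftP ord0 j.
- rewrite mulrAC (_ : phi t j = phi t i); first by rewrite [phi (- t) i * _]mulrC phiN mul1r.
  by rewrite /phi iE jE ![lift _ _ == _]eq_sym !(negPf (neq_lift _ _)).
- have ij : (i == j) = false by rewrite iE jE eq_sym (negPf (neq_lift _ _)).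
  move: be'; rewrite ij !subr0 => be'; apply: le_trans be'.
  rewrite mulrAC normrM ler_piMl//.
  rewrite /phi iE jE eqxx eq_sym (negPf (neq_lift _ _)) -expRD ger0_norm ?expR_ge0// -[leRHS]expR0 ler_expR.
  by rewrite -opprD oppr_le0 addr_ge0// mulr_ge0.
- rewrite iE jE b0 mulr0 mul0r (negPf (neq_lift _ _)) subr0 normr0.
  exact: le_trans be'.
- by rewrite mulrAC (_ : phi t j = phi t i) ?iE ?jE// [phi (- t) _ * _]mulrC phiN mul1r; move: be'; rewrite iE jE.
Qed.

(** Affine coordinates of the line spanned by [w]: the top row of [unip_mx (xw w)] is proportional
    to [w]. The action of SL_d(R) on these coordinates is fractional linear, but it is linear on
    [w]. *)
Definition xw w : 'rV[R]_n := \row_j (w ord0 (lift ord0 j) / w ord0 ord0).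
Definition Uw w : SL R d := unip_mx (- xw w).

Lemma row0_unip_xw w : w ord0 ord0 != 0 -> row ord0 (val (unip_mx (xw w))) = (w ord0 ord0)^-1 *: w.
Proof.
move=> w0; apply/rowP => j; rewrite [LHS]mxE [RHS]mxE; have [j' ->|->] := unliftP ord0 j.
  by rewrite unip0j mxE mulrC.
by rewrite unip00 mulVf.
Qed.

Lemma mulmx_Uw w j : w ord0 ord0 != 0 -> (w *m val (Uw w)) ord0 (lift ord0 j) = 0.
Proof.
move=> w0; have {1}-> : w = (w ord0 ord0) *: row ord0 (val (unip_mx (xw w))).
  by rewrite row0_unip_xw// scalerA divff// scale1r.
rewrite -scalemxAl mxE -row_mul mxE -SL_valM /Uw unipN mulgV SL_val1 mxE.
by rewrite (negPf (neq_lift _ _)) mulr0.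
Qed.

(** The top row of [(Uw y)^-1] is a multiple of [y], which [g] sends to [w] and [Uw w] to a multiple
    of the first basis vector. The conclusion is the hypothesis of [near1_contract]. *)
Lemma lower_parabolic g w y j : w ord0 ord0 != 0 -> y ord0 ord0 != 0 -> y *m val g = w ->
  val ((Uw y)^-1 * g * Uw w)%g ord0 (lift ord0 j) = 0.
Proof.
move=> w0 y0 yg.
have -> : val ((Uw y)^-1 * g * Uw w)%g ord0 (lift ord0 j) =
    (row ord0 (val (unip_mx (xw y))) *m val g *m val (Uw w)) ord0 (lift ord0 j).
  by rewrite -!row_mul [RHS]mxE /Uw -unipN opprK.
by rewrite row0_unip_xw// -!scalemxAl mxE yg mulmx_Uw// mulr0.
Qed.

Definition reg (al rho : R) w := al <= w ord0 ord0 /\ forall j, `|w ord0 j| <= rho.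

Lemma xw_lip al rho w y k : 0 < al -> reg al rho w -> reg al rho y ->
  (forall j, `|y ord0 j - w ord0 j| <= k) -> forall j, `|xw y ord0 j - xw w ord0 j| <= 2 * rho / (al * al) * k.
Proof.
move=> al0 [w0 wr] [y0 yr] yw j; rewrite !mxE.
have w00 : 0 < w ord0 ord0 by exact: lt_le_trans w0.
have y00 : 0 < y ord0 ord0 by exact: lt_le_trans y0.
set a := y ord0 _; set c := w ord0 _; set p := y ord0 ord0; set q := w ord0 ord0.
have -> : a / p - c / q = ((a - c) * q + c * (q - p)) / (p * q).
  by field; rewrite !gt_eqF.
have k0 : 0 <= k by apply: le_trans (yw ord0).
have rho0 : 0 <= rho by apply: le_trans (wr ord0).
rewrite normrM normfV (ger0_norm (ltW (mulr_gt0 y00 w00))).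
rewrite [leRHS](_ : _ = (2 * rho * k) / (al * al)); last by ring.
apply: ler_pM => //; first by rewrite invr_ge0 ltW// mulr_gt0.
  apply: (le_trans (ler_normD _ _)); rewrite !normrM.
  have h1 : `|a - c| * `|q| <= k * rho by apply: ler_pM => //; [exact: yw|exact: wr].
  have h2 : `|c| * `|q - p| <= rho * k by apply: ler_pM => //; [exact: wr|rewrite distrC; exact: yw].
  move: h1 h2; clear; lra.
by rewrite lef_pV2 ?posrE ?mulr_gt0//; apply: ler_pM => //; exact: ltW.
Qed.

Lemma Uw_bound al rho w i j : 0 < al -> reg al rho w -> `|val (Uw w) i j| <= 1 + rho / al /\ `|val (Uw w)^-1%g i j| <= 1 + rho / al.
Proof.
move=> al0 [w0 wr].
have w00 : 0 < w ord0 ord0 by exact: lt_le_trans w0.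
have rho0 : 0 <= rho by apply: le_trans (wr ord0).
have ra : 0 <= rho / al by rewrite divr_ge0// ltW.
have xb (k : 'I_n) : `|xw w ord0 k| <= rho / al.
  rewrite mxE normrM normfV (gtr0_norm w00); apply: ler_pM => //; first by rewrite invr_ge0 ltW.
  by rewrite lef_pV2.
have h (x : 'rV[R]_n) : (forall k, `|x ord0 k| <= rho / al) -> `|val (unip_mx x) i j| <= 1 + rho / al.
  move=> xb'; have := near1_unip ra xb' i j.
  have := ler_normD (val (unip_mx x) i j - (i == j)%:R) (i == j)%:R; rewrite subrK.
  have : `|(i == j)%:R| <= 1 :> R by case: (i == j); rewrite ?normr1 ?normr0.
  clear; lra.
split; first by apply: h => k; rewrite mxE normrN.
by rewrite /Uw unipN invgK; exact: h.
Qed.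

Section FlowNice.
Local Notation X := (SLQ_SLA R d).
Variable f : X -> R.
Hypothesis uf : real_unif_continuous f.

Definition Hc (t : R) w (x : X) := f (x ** iotaSL (Uw w * Phi n t)%g).

(** Moving the difference of the two unipotents past [Phi n t] stretches it by [lam t], so [Hc t]
    varies on the scale [1 / lam t]. *)
Lemma Hc_close e al rho : 0 < e -> 0 < al -> exists2 del, 0 < del &
  forall t w y, reg al rho w -> reg al rho y -> (forall j, `|y ord0 j - w ord0 j| <= del / lam t) ->
  forall x : X, `|Hc t y x - Hc t w x| <= e.
Proof.
move=> e0 al0; have [d1 d10 hd1] := uf e0.
(* The absolute value is taken because [del] is chosen before any regular point forces [0 <= rho];
   the summand 1 keeps [C] positive. *)
pose C := 2 * `|rho| / (al * al) + 1.
have C0 : 0 < C by rewrite ltr_wpDl// divr_ge0 ?mulr_ge0// ltW.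
exists (d1 / C); first by rewrite divr_gt0.
move=> t w y rw ry yw x; rewrite /Hc.
have rho0 : 0 <= rho by have [_ /(_ ord0)] := rw; apply: le_trans.
pose z := lam t *: (xw w - xw y).
have -> : (Uw y * Phi n t = Uw w * Phi n t * unip_mx z)%g.
  rewrite -mulgA -unip_Phi mulgA /Uw unipD; congr (unip_mx _ * _)%g.
  by apply/rowP => k; rewrite !mxE; ring.
rewrite iotaM actM; apply: hd1; apply: near1_unip; first exact: ltW.
move=> j; rewrite mxE normrM (gtr0_norm (lam_gt0 t)).
have := xw_lip al0 rw ry yw j; rewrite distrC !mxE => h.
rewrite mulrC -ler_pdivlMr ?lam_gt0//; apply: (le_trans h).
have E (A B C' D' : R) : A * (B * C' * D') = (A * C') * (B * D') by ring.
rewrite E.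
rewrite ler_piMl ?divr_ge0 ?ltW ?lam_gt0// ltr_pdivrMr// mul1r /C (ger0_norm rho0) ltrDl//.
Qed.

(** With [y *m g = w] one has [g * Uw w = Uw y * b], where [b] is lower parabolic and near the
    identity. Conjugation by [Phi n t] with [0 <= t] keeps it near the identity, so [del] does not
    depend on [t]. *)
Lemma Hc_act e al rho : 0 < e -> 0 < al -> exists2 del, 0 < del &
  forall t w y g, 0 <= t -> reg al rho w -> reg al rho y -> near1 del g -> y *m val g = w ->
   (forall j, `|y ord0 j - w ord0 j| <= del) ->
  forall x : X, `|Hc t w (x ** iotaSL g) - Hc t y x| <= e.
Proof.
move=> e0 al0; have [d1 d10 hd1] := uf e0.
have [d2 d20 hd2] := near1M d d10.
have B0 : 0 <= 1 + `|rho| / al by rewrite addr_ge0// divr_ge0// ltW.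
have [d3 d30 hd3] := near1_conj_bounded d d20 B0.
pose C := 2 * `|rho| / (al * al) + 1.
have C0 : 0 < C by rewrite ltr_wpDl// divr_ge0 ?mulr_ge0// ltW.
exists (Num.min d3 (d2 / C)); first by rewrite lt_min d30 divr_gt0.
move=> t w y g t0 rw ry ng yg yw x.
have rho0 : 0 <= rho by have [_ /(_ ord0)] := rw; apply: le_trans.
have w0 : w ord0 ord0 != 0 by rewrite gt_eqF// (lt_le_trans al0)//; case: rw.
have y0 : y ord0 ord0 != 0 by rewrite gt_eqF// (lt_le_trans al0)//; case: ry.
pose b := ((Uw y)^-1 * g * Uw w)%g.
rewrite /Hc -actM -iotaM.
have -> : (g * (Uw w * Phi n t) = Uw y * Phi n t * (Phi n (- t) * b * Phi n t))%g.
  by rewrite PhiN /b !mulgA mulgK mulgV mul1g.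
rewrite [iotaSL (_ * (_ * b * _))%g]iotaM actM; apply: hd1; apply: near1_contract => //.
  by move=> j; exact: lower_parabolic.
have -> : b = (((Uw y)^-1 * Uw w) * ((Uw w)^-1 * g * Uw w))%g by rewrite /b !mulgA mulgK.
apply: hd2.
  rewrite /Uw -unipN unipD; apply: near1_unip; first exact: ltW.
  move=> j; rewrite opprK !mxE; have := xw_lip al0 rw ry yw j; rewrite !mxE.
  move=> /le_trans; apply.
  have : Num.min d3 (d2 / C) <= d2 / C by rewrite ge_min lexx orbT.
  move=> /(ler_wpM2l (divr_ge0 (mulr_ge0 (ler0n _ 2) rho0) (ltW (mulr_gt0 al0 al0)))) /le_trans; apply.
  rewrite mulrCA ler_piMr ?ltW// ltr_pdivrMr// mul1r /C (ger0_norm rho0) ltrDl//.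
have := hd3 (Uw w)^-1%g g; rewrite invgK; apply.
- by move=> i j; rewrite -(ger0_norm rho0) -{1}(ger0_norm rho0) in rw *; have [] := Uw_bound i j al0 rw.
- by move=> i j; rewrite -{1}(ger0_norm rho0) in rw; have [] := Uw_bound i j al0 rw.
- by apply: near1_weak ng; rewrite ge_min lexx.
Qed.

End FlowNice.
End FlowFacts.

(** * Sums over grids and their shifts *)

Section Grid.
Variables (R : realType) (d m : nat).
Hypothesis m0 : (0 < m)%N.
Local Notation idx := {ffun 'I_d -> 'I_m}.

(** Each unit step exchanges a single value at either end of the window; the rest telescopes. *)
Lemma shift_sum_nat (F : int -> R) (c : nat) : (forall z, 0 <= F z <= 1) ->
  `|\sum_(q < m) (F (q%:Z + c%:Z) - F q%:Z)| <= c%:R.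
Proof.
move=> F01; elim: c => [|c IH].
  by rewrite big1 ?normr0// => q _; rewrite addr0 subrr.
have -> : \sum_(q < m) (F (q%:Z + c.+1%:Z) - F q%:Z) =
   \sum_(q < m) (F (q%:Z + c%:Z) - F q%:Z) + (F (m%:Z + c%:Z) - F c%:Z).
  have -> : F (m%:Z + c%:Z) - F c%:Z = \sum_(q < m) (F (q.+1%:Z + c%:Z) - F (q%:Z + c%:Z)).
    by rewrite -(big_mkord xpredT (fun q : nat => F (q.+1%:Z + c%:Z) - F (q%:Z + c%:Z))) telescope_sumr// add0r.
  rewrite -big_split /=; apply: eq_bigr => q _.
  have -> : q%:Z + c.+1%:Z = q.+1%:Z + c%:Z by rewrite -!PoszD addnS addSn.
  by rewrite addrC subrKA.
rewrite -natr1 (le_trans (ler_normD _ _))// lerD// ler_norml.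
by have /andP[a1 a2] := F01 (m%:Z + c%:Z); have /andP[a3 a4] := F01 c%:Z; apply/andP; split; lra.
Qed.

Lemma shift_sum (F : int -> R) (c : int) : (forall z, 0 <= F z <= 1) ->
  `|\sum_(q < m) (F (q%:Z + c) - F q%:Z)| <= `|c|%:~R.
Proof.
case: c => c F01; first exact: shift_sum_nat.
have := @shift_sum_nat (fun z => F (z - c.+1%:Z)) c.+1 (fun z => F01 _).
have -> : `|Negz c|%:~R = c.+1%:R :> R by [].
rewrite -normrN -sumrN NegzE; congr (`|_| <= _); apply: eq_bigr => q _.
by rewrite addrK opprB.
Qed.

Definition upd (i : idx) (l : 'I_d) (q : 'I_m) : idx := [ffun a => if a == l then q else i a].

(** Resampling one coordinate visits every grid point [m] times: the involution [sw] exchanges that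
    coordinate with the extra index. It allows averaging along a single axis first. *)
Lemma sum_upd (F : idx -> R) (l : 'I_d) : \sum_i \sum_q F (upd i l q) = m%:R * \sum_i F i.
Proof.
rewrite pair_big /=; pose sw (p : idx * 'I_m) := (upd p.1 l p.2, p.1 l).
have swK : involutive sw.
  move=> [i q]; rewrite /sw /=; congr (_, _); last by rewrite ffunE eqxx.
  by apply/ffunP => a; rewrite !ffunE; case: eqVneq => // ->.
rewrite (reindex_inj (inv_inj swK)) /=.
transitivity (\sum_(p : idx * 'I_m) F p.1).
  apply: eq_bigr => p _; congr F.
  by apply/ffunP => a; rewrite !ffunE; case: eqVneq => // ->.
rewrite -(pair_big xpredT xpredT (fun i (q : 'I_m) => F i)) /=.
rewrite mulr_sumr; apply: eq_bigr => i _.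
by rewrite sumr_const card_ord mulr_natl.
Qed.

(* [gpt a s i] is the grid point with integer coordinates [i] in the box of corner [a] and sides [s]. *)
Definition gpt (a s : 'rV[R]_d) (i : 'I_d -> int) : 'rV[R]_d :=
  \row_k (a ord0 k + s ord0 k * ((i k)%:~R / m%:R)).

Definition cellmean (F : idx -> R) : R := #|{: idx}|%:R^-1 * \sum_i F i.

Lemma card_idx_gt0 : (0 : R) < #|{: idx}|%:R.
Proof. by rewrite ltr0n card_ffun !card_ord expn_gt0 m0. Qed.

Lemma cellmean_le (F : idx -> R) (e : R) : (forall i, `|F i| <= e) -> `|cellmean F| <= e.
Proof.
move=> Fe; rewrite /cellmean normrM gtr0_norm ?invr_gt0 ?card_idx_gt0//.
rewrite mulrC ler_pdivrMr ?card_idx_gt0//; apply: (le_trans (ler_norm_sum _ _ _)).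
apply: (le_trans (ler_sum _ (fun i _ => Fe i))).
by rewrite sumr_const mulr_natr.
Qed.

Lemma cellmeanB (F H : idx -> R) : cellmean F - cellmean H = cellmean (fun i => F i - H i).
Proof. by rewrite /cellmean -mulrBr sumrB. Qed.

(** The displacement [c] may vary with the point but not along the axis [l], so each fibre of the
    grid moves rigidly and [shift_sum] applies to it. This is the discrete form of the invariance of
    volume under shears. *)
Lemma cellmean_shift (H : 'rV[R]_d -> R) (a s : 'rV[R]_d) (l : 'I_d) (c : idx -> int) (C : R) :
  (forall w, 0 <= H w <= 1) -> (forall i q, c (upd i l q) = c i) -> (forall i, `|c i|%:~R <= C * m%:R) ->
  `|cellmean (fun i => H (gpt a s (fun k => if k == l then (i k)%:Z + c i else (i k)%:Z))) -
    cellmean (fun i => H (gpt a s (fun k => (i k)%:Z)))| <= C.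
Proof.
move=> H01 cu cC; rewrite cellmeanB /cellmean; set F := (X in \sum_i X i).
have mR : (0 : R) < m%:R by rewrite ltr0n.
have -> : \sum_i F i = m%:R^-1 * \sum_i \sum_q F (upd i l q).
  by rewrite sum_upd mulrA mulVf ?mul1r// gt_eqF.
rewrite mulrA normrM gtr0_norm ?mulr_gt0 ?invr_gt0 ?card_idx_gt0//.
rewrite -invfM mulrC ler_pdivrMr ?mulr_gt0 ?card_idx_gt0//.
apply: (le_trans (ler_norm_sum _ _ _)).
apply: (@le_trans _ _ (\sum_(i : idx) C * m%:R)); last first.
  rewrite sumr_const -[X in X <= _]mulr_natr (_ : #|_| = #|{: idx}|)//.
  by rewrite mulrAC mulrA.
apply: ler_sum => i _; apply: le_trans (cC i).
pose E (z : int) := H (gpt a s (fun k => if k == l then z else (i k)%:Z)).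
have := @shift_sum E (c i) (fun z => H01 _).
congr (`|_| <= _); apply: eq_bigr => q _; rewrite /F cu /E; congr (H _ - H _).
  by apply/rowP => k; rewrite !mxE ffunE; case: ifP.
by apply/rowP => k; rewrite !mxE ffunE; case: ifP.
Qed.

End Grid.

(** * Equidistribution of grid averages *)

Section Core.
Variables (R : realType) (n : nat).
Local Notation d := n.+1.
Local Notation G := (SL (adele R) d).
Local Notation X := (SLQ_SLA R d).
Variables (a s : 'rV[R]_d) (smin : R).
Hypotheses (a_gt0 : 0 < a ord0 ord0) (smin_gt0 : 0 < smin) (s_ge : forall k, smin <= s ord0 k).
Variables (t_ : nat -> R) (m_ : nat -> nat).
Hypothesis m_gt0 : forall j, (0 < m_ j)%N.
(** The last bound makes the mesh of the grid small compared with [1 / lam], the scale on which [Hc]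
    varies. *)
Hypothesis t_large : forall e : R, 0 < e ->
  \forall j \near \oo, [/\ 0 <= t_ j, (lam n (t_ j))^-1 <= e & lam n (t_ j) / (m_ j)%:R <= e].
Variable f : X -> R.
Hypothesis f_nice : nice f.
Let idx j := {ffun 'I_d -> 'I_(m_ j)}.
Let pt j (i : idx j) := gpt (m_ j) a s (fun k => (i k)%:Z).
Let f01 x : 0 <= f x <= 1. Proof. by case: f_nice. Qed.
Let fu : real_unif_continuous f. Proof. by case: f_nice. Qed.

Definition gridmean j (x : X) : R := cellmean (fun i : idx j => Hc f (t_ j) (pt i) x).
Local Notation Psi := gridmean.

Lemma cellmean01 m (F : {ffun 'I_d -> 'I_m} -> R) : (0 < m)%N -> (forall i, 0 <= F i <= 1) -> 0 <= cellmean F <= 1.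
Proof.
move=> m0 F01; have c0 := card_idx_gt0 R d m0; apply/andP; split.
  by rewrite /cellmean mulr_ge0 ?invr_ge0 ?(ltW c0)// sumr_ge0// => i _; have /andP[] := F01 i.
have := @cellmean_le R d m m0 F 1 (fun i => _); rewrite ler_norml => H.
suff /H/andP[] : forall i, `|F i| <= 1 by [].
by move=> i; have /andP[h1 h2] := F01 i; rewrite ger0_norm.
Qed.

Lemma gridmean01 j x : 0 <= Psi j x <= 1.
Proof. by apply: cellmean01 => // i; exact: f01. Qed.

Let rho : R := \sum_k (`|a ord0 k| + `|s ord0 k|) + 1.

Let as_rho k : `|a ord0 k| + `|s ord0 k| + 1 <= rho.
Proof.
rewrite /rho lerD2r (bigD1 k)//= lerDl sumr_ge0// => i _; rewrite addr_ge0.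
Qed.

Let rho_gt0 : 0 < rho.
Proof. by apply: lt_le_trans (as_rho ord0); rewrite ltr_wpDl// addr_ge0. Qed.

Let s_gt0 k : 0 < s ord0 k. Proof. exact: lt_le_trans (s_ge k). Qed.

Let pt_frac j (i : idx j) k : 0 <= ((i k)%:Z%:~R / (m_ j)%:R : R) < 1.
Proof.
have mR : (0 : R) < (m_ j)%:R by rewrite ltr0n.
by rewrite divr_ge0 ?ler0n//= ltr_pdivrMr// mul1r ltr_nat.
Qed.

Let pt_bound j (i : idx j) k : a ord0 k <= pt i ord0 k /\ `|pt i ord0 k| <= rho - 1.
Proof.
rewrite !mxE; have /andP[h0 h1] := pt_frac i k; have sk := s_gt0 k.
split; first by rewrite lerDl mulr_ge0// ltW.
have := as_rho k; rewrite -lerBrDr; apply: le_trans.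
rewrite (le_trans (ler_normD _ _))// lerD2l normrM ler_piMr// ger0_norm//.
exact: ltW.
Qed.

Let al := a ord0 ord0 / 2.
Let al_gt0 : 0 < al. Proof. by rewrite divr_gt0. Qed.

Let near_reg j (i : idx j) (y : 'rV[R]_d) : (forall k, `|y ord0 k - pt i ord0 k| <= Num.min al 1) -> reg al rho y.
Proof.
move=> h; split.
  have [h1 _] := pt_bound i ord0; have := h ord0; rewrite le_min ler_norml => /andP[/andP[h2 _] _].
  move: h1 h2; rewrite /al; move: (a ord0 ord0) (pt i ord0 ord0) (y ord0 ord0); move=> u v z h1 h2; lra.
move=> k; have [_ h1] := pt_bound i k; have := h k; rewrite le_min => /andP[_ h2].
have -> : y ord0 k = (y ord0 k - pt i ord0 k) + pt i ord0 k by rewrite subrK.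
by apply: (le_trans (ler_normD _ _)); rewrite addrC -[leRHS](subrK 1) lerD.
Qed.

(** Translation by the elementary matrix shears the grid along the axis [k] by an amount
    proportional to [w_l]. Three errors of [e / 3] arise: [Hc_act] turns the translation into a
    shear, [Hc_close] rounds the shear to whole cells, and [cellmean_shift] absorbs the displacement
    of the fibres. *)
Lemma equi_elem (e : R) : 0 < e -> exists2 del, 0 < del & \forall j \near \oo,
  forall (l k : 'I_d) sig, l != k -> `|sig| <= del -> forall x, `|Psi j (x ** iotaSL (elemSL l k sig)) - Psi j x| <= e.
Proof.
move=> e0; have e30 : 0 < e / 3 by rewrite divr_gt0.
have [d1 d10 H1] := Hc_act fu rho e30 al_gt0.
have [d2 d20 H2] := Hc_close fu rho e30 al_gt0.
pose c0 := Num.min (Num.min al 1) d1.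
have c00 : 0 < c0 by rewrite !lt_min al_gt0 d10 ltr01.
pose S := \sum_k s ord0 k.
have sS k : s ord0 k <= S by rewrite /S (bigD1 k)//= lerDl sumr_ge0// => i _; exact: ltW.
have S0 : 0 < S by exact: lt_le_trans (sS ord0).
pose del := Num.min d1 (Num.min (c0 / (2 * rho)) (e / 6 * smin / rho)).
have del0 : 0 < del by rewrite !lt_min d10 !divr_gt0 ?mulr_gt0.
have c02 : c0 / 2 <= c0 by rewrite ler_pdivrMr// ler_peMr ?(ltW c00)// ler1n.
exists del => //.
pose e2 := Num.min (e / 6) (Num.min (d2 / S) (Num.min 1 (c0 / (2 * S)))).
have e20 : 0 < e2 by rewrite !lt_min ltr01 !divr_gt0// mulr_gt0.
apply: filterS (t_large e20) => j [t0 lamV lamm] l k sig lk sigd x.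
have mR : (0 : R) < (m_ j)%:R by rewrite ltr0n.
have lam1 : 1 <= lam n (t_ j).
  by rewrite -[leLHS]expR0 ler_expR mulr_ge0.
have mV : (m_ j)%:R^-1 <= e2.
  by apply: le_trans lamm; rewrite ler_peMl// invr_ge0 ltW.
have : sig \is Num.real by exact: num_real.
move=> _.
pose w (i : idx j) := pt i.
pose sh (i : idx j) : R := - (w i ord0 l * sig).
(* The shear in units of grid cells, rounded down. It depends on the point through coordinate [l]
   only, hence is constant along the axis [k], as [cellmean_shift] requires. *)
pose c (i : idx j) : int := Num.floor (sh i * (m_ j)%:R / s ord0 k).
pose y (i : idx j) : 'rV[R]_d := \row_b (w i ord0 b + (b == k)%:R * sh i).
pose y' (i : idx j) := gpt (m_ j) a s (fun b => if b == k then (i b)%:Z + c i else (i b)%:Z).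
have shb i : `|sh i| <= rho * del.
  rewrite normrN normrM ler_pM//.
  by have [_ h] := pt_bound i l; apply: (le_trans h); rewrite lerBlDr lerDl.
have shb2 i : `|sh i| <= c0 / 2.
  apply: (le_trans (shb i)); rewrite mulrC -ler_pdivlMr// -mulrA -invfM.
  by rewrite /del !ge_min lexx orbT.
have cE i : `|s ord0 k * ((c i)%:~R / (m_ j)%:R) - sh i| <= s ord0 k / (m_ j)%:R.
  have f1 : (c i)%:~R <= sh i * (m_ j)%:R / s ord0 k by rewrite /c floor_le_tmp.
  have f2 : sh i * (m_ j)%:R / s ord0 k < (c i)%:~R + 1 by have := lt_succ_floor (sh i * (m_ j)%:R / s ord0 k); rewrite intrD.
  move: f1 f2; rewrite ler_pdivlMr// ltr_pdivrMr// => f1 f2.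
  have -> : s ord0 k * ((c i)%:~R / (m_ j)%:R) - sh i = ((c i)%:~R * s ord0 k - sh i * (m_ j)%:R) / (m_ j)%:R.
    by field; rewrite gt_eqF.
  rewrite normrM normfV (gtr0_norm mR) ler_pM2r ?invr_gt0//.
  rewrite ler_norml; move: f1 f2 (s_gt0 k); move: (s ord0 k) (_ * _)  (_%:~R); move=> u v z f1' f2' f3.
  by apply/andP; split; lra.
have yw i b : `|y i ord0 b - w i ord0 b| <= c0 / 2.
  rewrite mxE addrC addKr; case: (b == k); last by rewrite mul0r normr0 divr_ge0// ltW.
  by rewrite mul1r.
have y'y i b : `|y' i ord0 b - y i ord0 b| <= s ord0 k / (m_ j)%:R.
  rewrite !mxE; have [->|bk] := eqVneq b k; last first.
    by rewrite mul0r addr0 subrr normr0 divr_ge0// ltW.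
  apply: le_trans (cE i); rewrite le_eqVlt; apply/orP; left; apply/eqP; congr `|_|.
  by rewrite mul1r intrD; field; rewrite gt_eqF.
have sm : s ord0 k / (m_ j)%:R <= c0 / 2.
  have h : (m_ j)%:R^-1 <= c0 / (2 * S) by apply: (le_trans mV); rewrite /e2 !ge_min lexx !orbT.
  apply: (@le_trans _ _ (S * (m_ j)%:R^-1)); first by rewrite ler_pM2r ?invr_gt0.
  rewrite mulrC -ler_pdivlMr//; apply: (le_trans h); rewrite invfM mulrA//.
have c0al : c0 <= Num.min al 1 by rewrite /c0 ge_min lexx.
have regw i : reg al rho (w i).
  by apply: (@near_reg j i) => b; rewrite subrr normr0 (le_trans _ c0al)// ltW.
have regy i : reg al rho (y i).
  apply: (@near_reg j i) => b; apply: (le_trans (yw i b)); apply: le_trans c0al.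
  exact: c02.
have regy' i : reg al rho (y' i).
  apply: (@near_reg j i) => b; apply: le_trans c0al.
  have -> : y' i ord0 b - pt i ord0 b = (y' i ord0 b - y i ord0 b) + (y i ord0 b - w i ord0 b) by rewrite subrKA.
  apply: (le_trans (ler_normD _ _)); rewrite [leRHS](splitr c0) lerD//.
  exact: le_trans (y'y i b) sm.
have p1 : `|cellmean (fun i : idx j => Hc f (t_ j) (w i) (x ** iotaSL (elemSL l k sig))) -
            cellmean (fun i : idx j => Hc f (t_ j) (y i) x)| <= e / 3.
  rewrite cellmeanB; apply: cellmean_le => // i; apply: (H1) => //.
  - by apply: near1_weak (near1_elem l k sig); apply: (le_trans sigd); rewrite /del ge_min lexx.
  - apply/rowP => b; rewrite mulmx_elem// !mxE (negPf lk) mul0r addr0 /sh /w /pt !mxE; ring.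
  - move=> b; apply: (le_trans (yw i b)); apply: (@le_trans _ _ c0); last by rewrite /c0 ge_min lexx orbT.
    exact: c02.
have p2 : `|cellmean (fun i : idx j => Hc f (t_ j) (y i) x) -
            cellmean (fun i : idx j => Hc f (t_ j) (y' i) x)| <= e / 3.
  rewrite cellmeanB; apply: cellmean_le => // i; apply: (H2) => // b.
  rewrite distrC; apply: (le_trans (y'y i b)).
  have h : lam n (t_ j) / (m_ j)%:R <= d2 / S by apply: (le_trans lamm); rewrite /e2 !ge_min lexx !orbT.
  rewrite ler_pdivlMr ?lam_gt0// mulrAC -mulrA.
  apply: (@le_trans _ _ (S * (lam n (t_ j) / (m_ j)%:R))).
    by rewrite ler_pM2r// divr_gt0// lam_gt0.
  by rewrite mulrC -ler_pdivlMr.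
have p3 : `|cellmean (fun i : idx j => Hc f (t_ j) (y' i) x) -
            cellmean (fun i : idx j => Hc f (t_ j) (w i) x)| <= e / 3.
  apply: (@cellmean_shift R d (m_ j) (m_gt0 j) (fun z => Hc f (t_ j) z x) a s k c).
  - by move=> z; exact: f01.
  - move=> i q; rewrite /c /sh /w /pt !mxE ffunE (negPf lk)//.
  move=> i; have h := cE i.
  have h2 : `|s ord0 k * ((c i)%:~R / (m_ j)%:R)| <= rho * del + s ord0 k / (m_ j)%:R.
    rewrite -[X in `|X|](subrK (sh i)); apply: (le_trans (ler_normD _ _)).
    by rewrite addrC lerD.
  rewrite normrM gtr0_norm// normrM normfV (gtr0_norm mR) in h2.
  rewrite -ler_pdivrMr// intr_norm.
  have h3 : rho * del <= s ord0 k * (e / 6).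
    apply: (@le_trans _ _ (smin * (e / 6))); last by rewrite ler_pM2r// divr_gt0.
    rewrite mulrC -ler_pdivlMr// mulrC [smin * _]mulrC; by rewrite /del mulrC !ge_min [_ * smin]mulrC lexx !orbT.
  have h4 : s ord0 k / (m_ j)%:R <= s ord0 k * (e / 6).
    rewrite ler_pM2l//; apply: (le_trans mV); by rewrite /e2 ge_min lexx.
  rewrite -(ler_pM2l (s_gt0 k)); apply: (le_trans h2).
  have -> : s ord0 k * (e / 3) = s ord0 k * (e / 6) + s ord0 k * (e / 6) by field.
  exact: lerD h3 h4.
rewrite /Psi; move: p1 p2 p3; rewrite -/w.
set A1 := cellmean _; set A2 := cellmean _; set A3 := cellmean _; set A4 := cellmean _.
rewrite !ler_norml; move: A1 A2 A3 A4 => p1 p2 p3 p4; lra.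
Qed.

Lemma equi (e : R) : 0 < e -> exists2 del, 0 < del & \forall j \near \oo,
  forall g, near1 del g -> forall x, `|Psi j (x ** iotaSL g) - Psi j x| <= e.
Proof.
move=> e0; have [L HL] := @near1_word R d 0.
(* The number [L] of factors is known before the accuracy, so each factor may be granted the error
   [e / L.+1]. *)
have eL : 0 < e / L.+1%:R by rewrite divr_gt0.
have [d1 d10 H1] := equi_elem eL; have [d2 d20 H2] := HL _ d10.
exists d2 => //; apply: filterS H1 => j H1 g /(H2 g _)wg x.
have {wg} : word (fun s0 => `|s0| <= d1) L g by apply: wg.
suff H l h : word (fun s0 => `|s0| <= d1) l h -> forall x, `|Psi j (x ** iotaSL h) - Psi j x| <= e / L.+1%:R * l%:R.
  move=> /H/(_ x)/le_trans; apply.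
  by rewrite mulrAC -mulrA ler_piMr ?(ltW e0)// ler_pdivrMr// mul1r ler_nat.
elim=> {l h} [l|l i k sig h ik sd wh IH] y.
  by rewrite iota1 act1 subrr normr0 mulr_ge0// ltW.
have -> : e / L.+1%:R * l.+1%:R = e / L.+1%:R + e / L.+1%:R * l%:R by rewrite -[l.+1%:R]natr1; ring.
rewrite iotaM actM.
rewrite -[X in `|X|](subrKA (Psi j (y ** iotaSL (elemSL i k sig)))).
by apply: (le_trans (ler_normD _ _)); rewrite addrC; apply: lerD; [exact: H1|exact: IH].
Qed.

Variable mu : probability (borel X) R.
Hypothesis mu_inv : is_invariant mu.
Local Notation E F := (\int[mu]_x F x).
Local Notation S2 F := (\int[mu]_x (F x ^+ 2)).

Let bf : bmf (f : borel X -> R). Proof. exact: nice_bmf. Qed.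

Lemma bmf_gridmean j : bmf (Psi j : borel X -> R).
Proof. by apply: bmfZ; apply: bmf_sum => i; exact: bmf_act. Qed.

Lemma bmf_sqr (F : borel X -> R) : bmf F -> bmf (fun x => F x ^+ 2).
Proof. by move=> bF; exact: bmfM. Qed.

Definition savg (zs : seq 'rV[R]_n) (x : X) : R :=
  (size zs)%:R^-1 * \sum_(z <- zs) f (x ** iotaSL (unip_mx z)).

Lemma bmf_savg zs : bmf (savg zs : borel X -> R).
Proof. by apply: bmfZ; apply: bmf_sum => i; exact: bmf_act. Qed.

Lemma jensen_sqr m (F : {ffun 'I_d -> 'I_m} -> R) : (0 < m)%N ->
  cellmean F ^+ 2 <= cellmean (fun i => F i ^+ 2).
Proof.
move=> m0; have c0 := card_idx_gt0 R d m0; rewrite /cellmean.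
set N := #|_|%:R in c0 *; set S := \sum_i F i.
have : 0 <= \sum_i (F i - N^-1 * S) ^+ 2 by apply: sumr_ge0 => i _; exact: sqr_ge0.
under eq_bigr do rewrite sqrrB.
rewrite big_split sumrB /= sumr_const -[_ *+ #|_|]mulr_natr -/N.
under [X in _ - X]eq_bigr do rewrite -mulrnAr.
rewrite -mulr_suml -/S => h.
rewrite -(ler_pM2l c0) [leRHS]mulrA divff ?gt_eqF// mul1r -subr_ge0.
apply: le_trans h _; rewrite le_eqVlt; apply/orP; left; apply/eqP.
by field; rewrite gt_eqF.
Qed.

Lemma savg_cat zs zs' x : size zs = size zs' -> zs != [::] ->
  savg (zs ++ zs') x = (savg zs x + savg zs' x) / 2.
Proof.
move=> sz zs0; have s0 : (0 : R) < (size zs)%:R by rewrite ltr0n lt0n size_eq0.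
rewrite /savg size_cat -sz big_cat natrD /=; field.
by rewrite gt_eqF//= -natrD gt_eqF// natrD addr_gt0.
Qed.

Lemma muT : fine (mu setT) = 1.
Proof. by rewrite probability_setT. Qed.

(** By equicontinuity [Psi j] hardly changes when averaged over its translates by [z / lam], with
    [z] in [zs]. Commuted past [Phi] these become translates by [z] itself, so every grid point
    contributes [savg zs] at a translated point. Jensen's inequality and the invariance of [mu]
    conclude. *)
Lemma S2_gridmean_le zs (e : R) : zs != [::] -> 0 < e ->
  \forall j \near \oo, S2 (Psi j) <= S2 (savg zs) + e.
Proof.
move=> zs0 e0; have e20 : 0 < e / 2 by rewrite divr_gt0.
have s0 : (0 : R) < (size zs)%:R by rewrite ltr0n lt0n size_eq0.
have [del del0 HE] := equi e20.
pose B := 1 + \sum_(z <- zs) \sum_k `|z ord0 k|.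
have Bz z k : z \in zs -> `|z ord0 k| <= B.
  move=> zz; rewrite /B (big_rem z)//= (bigD1 k)//=.
  set p := \sum_(i | _) _; set q := \sum_(i <- _) _.
  have p0 : 0 <= p by exact: sumr_ge0.
  have q0 : 0 <= q by apply: sumr_ge0 => z' _; exact: sumr_ge0.
  by rewrite addrCA -addrA lerDl !addr_ge0.
have B0 : 0 < B.
  by rewrite /B ltr_pwDl// sumr_ge0// => z _; rewrite sumr_ge0.
have dB : 0 < del / B by rewrite divr_gt0.
apply: filterS2 HE (t_large dB) => j HE [t0 lamV _].
have l0 := lam_gt0 n (t_ j).
pose H x := (size zs)%:R^-1 * \sum_(z <- zs) Psi j (x ** iotaSL (unip_mx ((lam n (t_ j))^-1 *: z))).
have bH : bmf (H : borel X -> R).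
  by apply: bmfZ; apply: bmf_sum => z; apply: bmf_act; exact: bmf_gridmean.
have HPsi x : `|Psi j x - H x| <= e / 2.
  have -> : Psi j x - H x = (size zs)%:R^-1 * \sum_(z <- zs) (Psi j x - Psi j (x ** iotaSL (unip_mx ((lam n (t_ j))^-1 *: z)))).
    rewrite sumrB mulrBr; congr (_ - _).
    by rewrite big_const_seq count_predT iter_addr_0 -[Psi j x *+ _]mulr_natl mulrA mulVf ?mul1r// gt_eqF.
  rewrite normrM gtr0_norm ?invr_gt0// mulrC ler_pdivrMr//.
  apply: (le_trans (ler_norm_sum _ _ _)).
  apply: (@le_trans _ _ (\sum_(z <- zs) e / 2)); last first.
    by rewrite big_const_seq count_predT iter_addr_0 mulr_natr.
  rewrite big_seq [leRHS]big_seq; apply: ler_sum => z zz.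
  rewrite distrC; apply: HE; apply: near1_unip; first exact: ltW.
  move=> k; rewrite mxE normrM gtr0_norm ?invr_gt0//.
  apply: (@le_trans _ _ (del / B * B)); last by rewrite divfK// gt_eqF.
  by apply: ler_pM => //; [rewrite invr_ge0 ltW|exact: Bz].
have H01 x : 0 <= H x <= 1.
  rewrite /H mulr_ge0 ?invr_ge0 ?(ltW s0)//= ?sumr_ge0//; last first.
    by move=> z _; have /andP[] := gridmean01 j (x ** iotaSL (unip_mx ((lam n (t_ j))^-1 *: z))).
  rewrite mulrC ler_pdivrMr// mul1r.
  apply: (@le_trans _ _ (\sum_(z <- zs) 1)).
    by apply: ler_sum => z _; have /andP[] := gridmean01 j (x ** iotaSL (unip_mx ((lam n (t_ j))^-1 *: z))).
  by rewrite big_const_seq count_predT iter_addr_0.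
have step1 : S2 (Psi j) <= S2 H + e.
  have -> : S2 H + e = E (fun x => H x ^+ 2 + e).
    rewrite meanD//; [|exact: mu_fin|exact: bmf_sqr|exact: bmf_cst].
    by rewrite mean_cst// muT mulr1.
  apply: mean_le => //; first exact: mu_fin.
  - by apply: bmf_sqr; exact: bmf_gridmean.
  - by apply: bmfD; [exact: bmf_sqr|exact: bmf_cst].
  move=> x _; move: (HPsi x) (gridmean01 j x) (H01 x); move: (Psi j x) (H x) => p h.
  rewrite ler_norml => /andP[h1 h2] /andP[h3 h4] /andP[h5 h6].
  nra.
apply: (le_trans step1); rewrite lerD2r.
pose K x (i : idx j) := savg zs (x ** iotaSL (Uw (pt i) * Phi n (t_ j))%g).
have HK x : H x = cellmean (K x).
  rewrite /H /K /cellmean /savg /gridmean /cellmean /Hc.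
  rewrite -[X in _ * X = _]mulr_sumr -[X in _ = _ * X]mulr_sumr mulrCA exchange_big /=.
  congr (_ * (_ * _)); apply: eq_bigr => i _; apply: eq_bigr => z _.
  rewrite -!actM -!iotaM; congr (f (_ ** iotaSL _)).
  have {2}-> : z = lam n (t_ j) *: ((lam n (t_ j))^-1 *: z) by rewrite scalerA divff ?scale1r// gt_eqF.
  rewrite -[RHS]mulgA -unip_Phi !mulgA; congr (_ * _)%g.
  by rewrite /Uw !unipD addrC.
have bK (i : idx j) : bmf (fun x : borel X => K x i) by apply: bmf_act => //; exact: bmf_savg.
have step2 : S2 H <= E (fun x => cellmean (fun i => K x i ^+ 2)).
  apply: mean_le => //; [exact: mu_fin|exact: bmf_sqr| |].
    by apply: bmfZ; apply: bmf_sum => i; exact: bmf_sqr.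
  by move=> x _; rewrite HK; exact: jensen_sqr.
apply: (le_trans step2); rewrite meanZ//; [|exact: mu_fin|by apply: bmf_sum => i; exact: bmf_sqr].
rewrite mean_sum//; [|exact: mu_fin|by move=> i; exact: bmf_sqr].
have -> : \sum_i E (fun x => K x i ^+ 2) = \sum_(i : idx j) S2 (savg zs).
  apply: eq_bigr => i _.
  apply: (@mean_act R n mu mu_inv _ (fun x => savg zs x ^+ 2)).
  by apply: bmf_sqr; exact: bmf_savg.
rewrite sumr_const -[S2 _ *+ _]mulr_natl mulrA mulVf ?mul1r// gt_eqF//.
exact: card_idx_gt0.
Qed.

Definition defect j (g : SL R d) : R := E (fun x => (Psi j (x ** iotaSL g) - Psi j x) ^+ 2).

Lemma bmf_defect1 j g : bmf (fun x : borel X => (Psi j (x ** iotaSL g) - Psi j x) ^+ 2).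
Proof. by apply: bmf_sqr; apply: bmfB; [apply: bmf_act|]; exact: bmf_gridmean. Qed.

(** Up to a common translation by [Phi], both [Psi j] and its translate are averages [savg] over
    lists of equal length, and their half sum is the average over the concatenation, whose square
    mean is at least [I]. Since [Psi j] nearly attains [I], the parallelogram law bounds the defect,
    uniformly in [y]. *)
Lemma defect_unip (e : R) : 0 < e -> \forall j \near \oo, forall y, defect j (unip_mx y) <= e.
Proof.
move=> e0.
pose I := inf [set S2 (savg zs) | zs in [set zs | zs != [::]]].
have hI : has_inf [set S2 (savg zs) | zs in [set zs | zs != [::]]].
  split; first by exists (S2 (savg [:: 0])), [:: 0].
  exists 0 => _ [zs _ <-]; by apply: Rintegral_ge0 => x _; exact: sqr_ge0.
(* The square mean of [Psi j] exceeds [I] by at most two eighths of [e], and the parallelogram law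
   multiplies this excess by 4. *)
have e8 : 0 < e / 8 by rewrite divr_gt0.
have [_ [zs zs0 <-] zsI] := inf_adherent e8 hI.
apply: filterS (S2_gridmean_le zs0 e8) => j hj y.
(* The factor [lam] arises from commuting the unipotents past [Phi]. *)
pose zsj (y : 'rV[R]_n) := [seq lam n (t_ j) *: (y - xw (pt i)) | i <- enum {: idx j}].
have szj y' : size (zsj y') = #|{: idx j}| by rewrite size_map -cardE.
have zsj0 y' : zsj y' != [::].
  by rewrite -size_eq0 szj -lt0n -(ltr0n R); exact: card_idx_gt0.
have savgE y' x : savg (zsj y') (x ** iotaSL (Phi n (t_ j))) = Psi j (x ** iotaSL (unip_mx y')).
  rewrite /savg szj /gridmean /cellmean big_map big_enum /=; congr (_ * _).
  apply: eq_bigr => i _; rewrite /Hc -!actM -!iotaM; congr (f (_ ** iotaSL _)).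
  by rewrite -unip_Phi mulgA /Uw unipD.
have pE x : Psi j x = savg (zsj 0) (x ** iotaSL (Phi n (t_ j))).
  by rewrite savgE unip0 iota1 act1.
have IL : I <= S2 (savg (zsj y ++ zsj 0)).
  apply: ge_inf; first by case: hI.
  by exists (zsj y ++ zsj 0) => //=; rewrite -size_eq0 size_cat addn_eq0 negb_and size_eq0 zsj0.
have par x : (Psi j (x ** iotaSL (unip_mx y)) - Psi j x) ^+ 2 =
   (2 * Psi j (x ** iotaSL (unip_mx y)) ^+ 2 + 2 * Psi j x ^+ 2) -
   4 * savg (zsj y ++ zsj 0) (x ** iotaSL (Phi n (t_ j))) ^+ 2.
  by rewrite savg_cat ?szj// savgE -pE; field.
have bP := bmf_gridmean j.
have b1 : bmf (fun x : borel X => Psi j x ^+ 2) by exact: bmf_sqr.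
have b2 : bmf (fun x : borel X => Psi j (x ** iotaSL (unip_mx y)) ^+ 2).
  by apply: bmf_sqr; exact: bmf_act.
have b3' : bmf (fun x : borel X => savg (zsj y ++ zsj 0) x ^+ 2) by apply: bmf_sqr; exact: bmf_savg.
have b3 : bmf (fun x : borel X => savg (zsj y ++ zsj 0) (x ** iotaSL (Phi n (t_ j))) ^+ 2).
  by apply: bmf_sqr; apply: bmf_act; exact: bmf_savg.
rewrite /defect; under eq_Rintegral do rewrite par.
rewrite meanB//; [|exact: mu_fin|by apply: bmfD; exact: bmfZ|exact: bmfZ].
rewrite meanD//; [|exact: mu_fin|exact: bmfZ|exact: bmfZ].
rewrite !meanZ//; try exact: mu_fin.
rewrite (@mean_act R n mu mu_inv (iotaSL (unip_mx y)) (fun x => Psi j x ^+ 2) b1).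
rewrite (@mean_act R n mu mu_inv (iotaSL (Phi n (t_ j))) (fun x => savg (zsj y ++ zsj 0) x ^+ 2) b3').
move: hj zsI IL; rewrite -/I.
move: (\int[mu]_x (Psi j x ^+ 2)) (S2 (savg zs)) (S2 (savg (zsj y ++ zsj 0))) I => A B C D h1 h2 h3.
lra.
Qed.

Lemma defectM j g h : defect j (g * h)%g <= 2 * defect j g + 2 * defect j h.
Proof.
rewrite /defect -(@mean_act R n mu mu_inv (iotaSL g) (fun x => (Psi j (x ** iotaSL h) - Psi j x) ^+ 2)); last exact: bmf_defect1.
have bd : bmf (fun x : borel X => (Psi j (x ** iotaSL g ** iotaSL h) - Psi j (x ** iotaSL g)) ^+ 2).
  by apply: (@bmf_act R n (iotaSL g) (fun x => (Psi j (x ** iotaSL h) - Psi j x) ^+ 2)); exact: bmf_defect1.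
rewrite -meanZ//; [|exact: mu_fin|exact: bmf_defect1].
rewrite -meanZ//; [|exact: mu_fin].
rewrite -meanD//; [|exact: mu_fin|by apply: bmfZ; exact: bmf_defect1|exact: bmfZ].
apply: mean_le => //; [exact: mu_fin|exact: bmf_defect1| |].
  by apply: bmfD; [apply: bmfZ; exact: bmf_defect1|exact: bmfZ].
move=> x _; rewrite iotaM actM.
move: (Psi j _) (Psi j _) (Psi j _) => A B C.
rewrite -subr_ge0.
have -> : 2 * (A - B) ^+ 2 + 2 * (C - A) ^+ 2 - (C - B) ^+ 2 = (A - B - (C - A)) ^+ 2 by ring.
exact: sqr_ge0.
Qed.

Lemma defectV j g : defect j g^-1%g = defect j g.
Proof.
rewrite /defect -(@mean_act R n mu mu_inv (iotaSL g) (fun x => (Psi j (x ** iotaSL g^-1%g) - Psi j x) ^+ 2)); last exact: bmf_defect1.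
apply: eq_Rintegral => x _; rewrite iotaV actK.
by rewrite -sqrrN opprB.
Qed.

Lemma defect_near1 (e : R) : 0 < e -> exists2 del, 0 < del &
  \forall j \near \oo, forall g, near1 del g -> defect j g <= e.
Proof.
(* A difference bounded by both [e] and 1 has its square bounded by [e]. *)
move=> e0; have e10 : 0 < Num.min e 1 by rewrite lt_min e0 ltr01.
have [del del0 HE] := equi e10; exists del => //.
apply: filterS HE => j HE g /HE {}HE.
apply: (le_trans (ler_norm _)); rewrite -[leRHS]mulr1 -muT.
apply: mean_abs_le => //; [exact: mu_fin|exact: bmf_defect1|].
move=> x _; rewrite ger0_norm ?sqr_ge0// -real_normK ?num_real//; have := HE x; rewrite le_min => /andP[h1 h2].
by rewrite expr2; apply: le_trans h1; rewrite ler_piMr.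
Qed.

Definition asymp_inv g := forall e : R, 0 < e -> \forall j \near \oo, defect j g <= e.

Lemma asymp_invM g h : asymp_inv g -> asymp_inv h -> asymp_inv (g * h)%g.
Proof.
move=> hg hh e e0; have e4 : 0 < e / 4 by rewrite divr_gt0.
apply: filterS2 (hg _ e4) (hh _ e4) => j h1 h2; apply: (le_trans (defectM _ _ _)).
by move: (defect _ _) (defect _ _) h1 h2 => A B h1 h2; lra.
Qed.

Lemma upper_elem (k : 'I_n) (y : R) : elemSL ord0 (lift ord0 k) y = unip_mx (y *: delta_mx 0 k).
Proof.
apply: val_inj; apply/matrixP => i j; rewrite [LHS]mxE neq_lift /=.
have [i' ->|->] := unliftP ord0 i; have [j' ->|->] := unliftP ord0 j.
- by rewrite [RHS]unipij (inj_eq (@lift_inj _ _)) [lift _ i' == ord0]eq_sym (negPf (neq_lift _ _)) mul0r addr0.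
- by rewrite [RHS]unipi0 [lift _ i' == ord0]eq_sym (negPf (neq_lift _ _)) mul0r addr0.
- rewrite [RHS]unip0j (negPf (neq_lift _ _)) (inj_eq (@lift_inj _ _)) !mxE eqxx add0r.
  by rewrite mulrC.
- by rewrite [RHS]unip00 eqxx (negPf (neq_lift _ _)) mul0r addr0.
Qed.

Lemma asymp_inv_upper (k : 'I_d) (y : R) : k != ord0 -> asymp_inv (elemSL ord0 k y).
Proof.
have [k' ->|->] := unliftP ord0 k; last by rewrite eqxx.
move=> _ e e0; rewrite upper_elem; apply: filterS (defect_unip e0) => j; exact.
Qed.

(** In the coordinates [o], [k] the product of the first three factors is lower triangular with
    diagonal [a], [1 / a], where [a = 1 + y * sig]. Conjugating [elemSL k o s'] by it divides the
    parameter by [a ^+ 2]. *)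
Lemma mautner_id (o k : 'I_d) (y y' sig S s' : R) : o != k ->
  1 + y * sig != 0 -> y' = - y / (1 + y * sig) -> s' = S * (1 + y * sig) ^+ 2 ->
  (elemSL o k y * elemSL k o sig * elemSL o k y' * elemSL k o s' =
   elemSL k o S * (elemSL o k y * elemSL k o sig * elemSL o k y'))%g.
Proof.
move=> ok a0 -> ->; rewrite -[LHS]mul1g -[RHS]mul1g !mulgA.
apply: val_inj; apply/matrixP => a' b'; rewrite !SL_valM SL_val1 /=.
have ko : k != o by rewrite eq_sym.
rewrite !mulmx_elem// !mxE !eqxx ?(negPf ok) ?(negPf ko) !(mul0r, addr0, mul1r).
have [->|bk] := eqVneq b' k; first by rewrite (negPf ko); field.
by have [->|bo] := eqVneq b' o; field.
Qed.

Lemma commutator_id (o j k : 'I_d) (s' : R) : j != o -> k != o -> j != k ->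
  (elemSL j o s' * elemSL o k 1 = elemSL j k s' * elemSL o k 1 * elemSL j o s')%g.
Proof.
move=> jo ko jk; rewrite -[LHS]mul1g -[RHS]mul1g !mulgA.
have ok : o != k by rewrite eq_sym.
apply: val_inj; apply/matrixP => a' b'; rewrite !SL_valM SL_val1 /=.
rewrite !mulmx_elem// !mxE !eqxx ?(negPf ok) ?(negPf ko) ?(negPf jo) ?(negPf jk) !(mul0r, addr0, mul1r, mulr1).
by ring.
Qed.

Lemma asymp_invV g : asymp_inv g -> asymp_inv g^-1%g.
Proof. by move=> h e e0; apply: filterS (h e e0) => j; rewrite defectV. Qed.

(** An arbitrary [S] is reached by conjugating a small parameter: [al'] is chosen so that
    [sig = S * al' ^+ 2] is small, and [y] so that [1 + y * sig = al']. Then [mautner_id] applies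
    with [s' = sig], and the conjugator consists of two upper unipotents and the same small lower
    one. *)
Lemma asymp_inv_lower (k : 'I_d) (S : R) : k != ord0 -> asymp_inv (elemSL k ord0 S).
Proof.
move=> k0; have ok : ord0 != k by rewrite eq_sym.
(* Set apart because [y] below divides by [sig], a multiple of [S]. *)
have [->|S0] := eqVneq S 0.
  move=> e e0; apply: filterS (defect_unip e0) => j /(_ 0).
  by rewrite unip0 elemSL0.
(* By [defectM], if all three factors of [D] have defect at most [e / 64], then [D] has at most 10
   times as much; a conjugate by [D] has at most 6 times the defect of [D] plus 4 times that of the
   middle factor, and 6 * 10 + 4 = 64. *)
move=> e e0; have e64 : 0 < e / 64 by rewrite divr_gt0.
have [del del0 H] := defect_near1 e64.
pose al' := Num.min 1 (del / `|S|).
have nS : 0 < `|S| by rewrite normr_gt0.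
have al'0 : 0 < al' by rewrite lt_min ltr01 divr_gt0.
pose sig := S * al' ^+ 2; pose y := (al' - 1) / sig.
have sig0 : sig != 0 by rewrite mulf_neq0// expf_neq0// gt_eqF.
have ay : 1 + y * sig = al' by rewrite /y divfK// subrKC.
have sigd : `|sig| <= del.
  rewrite normrM normrX (gtr0_norm al'0) expr2.
  apply: (@le_trans _ _ (`|S| * (1 * (del / `|S|)))).
    by rewrite ler_pM2l//; apply: ler_pM; rewrite ?(ltW al'0)// /al' ge_min lexx ?orbT.
  by rewrite mul1r mulrC divfK// gt_eqF.
pose y' := - y / al'.
pose D := (elemSL ord0 k y * elemSL k ord0 sig * elemSL ord0 k y')%g.
have SE : elemSL k ord0 S = (D * elemSL k ord0 sig * D^-1)%g.
  rewrite /D (@mautner_id ord0 k y y' sig S sig) ?ay ?mulgK//.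
  by rewrite gt_eqF.
apply: filterS3 (asymp_inv_upper y k0 e64) (asymp_inv_upper y' k0 e64) H => j h1 h2 H.
have h3 := H _ (near1_weak sigd (near1_elem k ord0 sig)).
rewrite SE; apply: (le_trans (defectM _ _ _)); rewrite defectV.
have := defectM j D (elemSL k ord0 sig).
have := defectM j (elemSL ord0 k y * elemSL k ord0 sig)%g (elemSL ord0 k y').
have := defectM j (elemSL ord0 k y) (elemSL k ord0 sig).
rewrite -/D; move: h1 h2 h3 {H}.
move: (defect j _) (defect j _) (defect j _) (defect j _) (defect j D) (defect j _).
move=> d1 d2 d3 d4 d5 d6 h1 h2 h3 h4 h5 h6; lra.
Qed.

Lemma asymp_inv_all g : asymp_inv g.
Proof.
have [L] := @stable_range_word R d (@field_stable_range R) g.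
elim=> {g L} [_|l i j s' g ij _ wg IH].
  move=> e e0; apply: filterS (defect_unip e0) => j /(_ 0).
  by rewrite unip0.
apply: asymp_invM IH.
case: (eqVneq i ord0) ij => [->|i0] ij; first by apply: asymp_inv_upper; rewrite eq_sym.
have [->|j0] := eqVneq j ord0; first exact: asymp_inv_lower.
(* Away from row and column 0, an elementary matrix is a commutator of a lower and an upper one. *)
have -> : elemSL i j s' = (elemSL i ord0 s' * elemSL ord0 j 1 * (elemSL i ord0 s')^-1 * (elemSL ord0 j 1)^-1)%g.
  by rewrite commutator_id// !mulgK.
have h1 := asymp_inv_lower s' i0; have h2 := asymp_inv_upper 1 j0.
exact: asymp_invM (asymp_invM (asymp_invM h1 h2) (asymp_invV h1)) (asymp_invV h2).
Qed.

(** An element with trivial real part commutes with the image of [iotaSL]. *)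
Lemma gridmean_level N : level_invariant N f -> forall j, level_invariant N (Psi j).
Proof.
move=> fN j k Nk rk x; rewrite /gridmean; congr cellmean; apply/funext => i; rewrite /Hc.
set u := (Uw (pt i) * Phi n (t_ j))%g.
suff ku : (k * iotaSL u = iotaSL u * k)%g by rewrite -!actM ku actM fN.
apply: val_inj; apply: mx_adele_eq; rewrite !SL_valM.
  have rk' : map_mx (@adele_real R) (val k) = 1%:M by rewrite -[LHS]/(val (re_SL k)) rk.
  by rewrite !map_mxM rk' mul1mx mulmx1.
by move=> p; rewrite !map_mxM iota_padic mul1mx mulmx1.
Qed.

(** By [transitive_mod] the point [y] is a real translate of [x] as far as [Psi j] can see. Were the
    difference above [e] for arbitrarily large [j], equicontinuity would keep it above [e / 3] on a
    neighbourhood of [x] common to all those [j]. This set has positive measure, against the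
    vanishing defect of [g]. *)
Lemma gridmean_diff (x y : X) (e : R) : 0 < e -> \forall j \near \oo, `|Psi j x - Psi j y| <= e.
Proof.
move=> e0; have e30 : 0 < e / 3 by rewrite divr_gt0.
have [_ _ [N N0 fN]] := f_nice.
have [g1 gE] := piX_repr x; have [g2 g2E] := piX_repr y.
have [gam [h [hE Nh]]] := transitive_mod g1 g2 N0.
have yE : y = x ** h by rewrite g2E gE hE piX_act -mulgA piX_left.
pose g := re_SL h.
have [del del0 HE] := equi e30.
have [del' del'0 Hc'] := near1_conj (g^-1)%g del0.
have PN j z k : fnear N k -> Psi j (z ** k) = Psi j (z ** iotaSL (re_SL k)).
  by move=> Nk; exact: (level_re _ N0 (gridmean_level fN j) Nk).
have yP j : Psi j y = Psi j (x ** iotaSL g) by rewrite yE PN.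
have [J _ HJ] := HE.
pose bad := [set j | (J <= j)%N /\ e < `|Psi j x - Psi j y|].
(* An intersection over all bad [j] at once, so that its measure is a lower bound independent of
   [j]. *)
pose B : set (borel X) := \bigcap_(j in bad) [set z | (e / 3) ^+ 2 <= (Psi j (z ** iotaSL g) - Psi j z) ^+ 2].
have mB : measurable B.
  apply: bigcap_measurableType => j _.
  have [mf _] := bmf_defect1 j g.
  rewrite -[X in measurable X]setTI.
  have := mf measurableT _ (measurable_itv `[(e / 3) ^+ 2, +oo[).
  by congr (measurable (_ `&` _)); apply/seteqP; split=> z /=; rewrite in_itv/= andbT.
pose dm := Num.min del del'.
have dm0 : 0 < dm by rewrite lt_min del0.
have Bpos : (0 < mu B)%E.
  apply: (@open_positive _ _ _ mu_inv B x N dm) => // k Nk rk j [Jj xy].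
  have h1 : `|Psi j (x ** k) - Psi j x| <= e / 3.
    rewrite PN//; apply: HJ => //; apply: near1_weak rk.
    by rewrite /dm ge_min lexx.
  have h2 : `|Psi j (x ** k ** iotaSL g) - Psi j y| <= e / 3.
    rewrite yP -actM PN; last by apply: fnearM => //; exact: fnear_iota.
    rewrite re_SLM re_iota.
    have -> : (re_SL k * g = g * (g^-1 * re_SL k * g))%g by rewrite !mulgA mulgV mul1g.
    rewrite iotaM actM; apply: HJ => //.
    have := Hc' (re_SL k); rewrite invgK; apply.
    by apply: near1_weak rk; rewrite /dm ge_min lexx orbT.
  rewrite /= -[leRHS]real_normK ?num_real// ler_pXn2r ?nnegrE ?(ltW e30)//.
  move: h1 h2 xy; rewrite distrC => h1 h2 xy.
  have := ler_distD (Psi j (x ** k)) (Psi j x) (Psi j y).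
  have := ler_distD (Psi j (x ** k ** iotaSL g)) (Psi j (x ** k)) (Psi j y).
  rewrite [`|Psi j (x ** k) - Psi j (x ** k ** iotaSL g)|]distrC.
  move: h1 h2 xy; move: `|_| `|_| `|_| `|_| `|_| => p1 p2 p3 p4 p5 h1 h2 h3 h4 h5; lra.
have mBf : (mu B < +oo)%E by apply: le_lt_trans (mu_fin mu); apply: le_measure; rewrite ?inE.
have mB0 : 0 < fine (mu B) by rewrite fine_gt0// Bpos.
pose eta := (e / 3) ^+ 2 * fine (mu B) / 2.
have eta0 : 0 < eta by rewrite divr_gt0// mulr_gt0// exprn_gt0.
have HJ' : \forall j \near \oo, (J <= j)%N by exists J.
apply: filterS2 (asymp_inv_all g eta0) HJ' => j hj Jj.
rewrite leNgt; apply/negP => xy.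
suff h2 : 2 * eta <= eta.
  by have := ltr_pMl 2 eta0; rewrite ltNge h2 ltr1n.
apply: le_trans hj; rewrite /eta mulrC divfK//.
rewrite -(@mean_cst _ _ _ mu B); last exact: mB.
apply: (@le_trans _ _ (\int[mu]_(x in B) (Psi j (x ** iotaSL g) - Psi j x) ^+ 2)).
  apply: mean_le => //; [exact: bmf_cst|exact: bmf_defect1|].
  by move=> z /(_ j); apply.
rewrite /defect /Rintegral; apply: fine_le.
- by apply: integrable_fin_num => //; apply: bmf_integrable => //; exact: bmf_defect1.
- by apply: integrable_fin_num => //; apply: bmf_integrable => //; [exact: mu_fin|exact: bmf_defect1].
apply: ge0_subset_integral => //.
  by apply/measurable_EFinP; have [] := bmf_defect1 j g.
by move=> z _; rewrite lee_fin sqr_ge0.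
Qed.

(** Every [Psi j] has the mean of [f] by invariance. Since [Psi j y - Psi j x] tends to 0 for each
    [y], integrating over [y] yields the limit at [x]. *)
Theorem gridmean_cvg (x : X) : Psi j x @[j --> \oo] --> \int[mu]_x f x.
Proof.
pose F j y := Psi j y - Psi j x.
have bF j : bmf (F j : borel X -> R) by apply: bmfB; [exact: bmf_gridmean|exact: bmf_cst].
have EF j : E (F j) = E f - Psi j x.
  rewrite /F meanB//; [|exact: mu_fin|exact: bmf_gridmean|exact: bmf_cst].
  rewrite mean_cst// muT mulr1; congr (_ - _).
  rewrite /gridmean /cellmean meanZ//; [|exact: mu_fin|by apply: bmf_sum => i; exact: bmf_act].
  rewrite mean_sum//; [|exact: mu_fin|by move=> i; exact: bmf_act].
  under eq_bigr do rewrite (@mean_act R n mu mu_inv _ f bf).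
  rewrite sumr_const -[E f *+ _]mulr_natl mulrA mulVf ?mul1r// gt_eqF//; exact: card_idx_gt0.
have F0 : E (F j) @[j --> \oo] --> E (fun=> 0 : R).
  apply: (@mean_cvg _ _ _ mu setT _ _ F (fun=> 0) 1) => //.
  - exact: mu_fin.
  - by move=> j y; rewrite /F; have := gridmean01 j x; have := gridmean01 j y;
      move: (Psi j x) (Psi j y) => p q /andP[h1 h2] /andP[h3 h4]; rewrite ler_norml; apply/andP; split; lra.
  - move=> y _; apply/cvgr0Pnorm_le => e e0; apply: filterS (gridmean_diff y x e0) => j; exact.
have -> : (fun j => Psi j x) = (fun j => E f - E (F j)).
  by apply/funext => j; rewrite EF subKr.
rewrite -[X in _ --> X]subr0; apply: cvgB; first exact: cvg_cst.
by move: F0; rewrite mean_cst ?mul0r//; exact: mu_fin.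
Qed.

End Core.

(** * Lebesgue measure on R^n *)

Section SigmaFinitePack.
Context d (T : measurableType d) (R : realType) (m : {measure set T -> \bar R}).
Hypothesis m_sf : sigma_finite setT m.
Let m' : set T -> \bar R := m.
HB.instance Definition _ := Measure.on m'.
HB.instance Definition _ := Measure_isSigmaFinite.Build d T R m' m_sf.
Definition sigma_finite_measure_of : {sigma_finite_measure set T -> \bar R} := m'.
End SigmaFinitePack.

Section EuclideanBorel.
Variable R : realType.

Definition hbox N (a b : 'rV[R]_N) : set 'rV[R]_N := [set v | forall i, a ord0 i <= v ord0 i < b ord0 i].

Lemma hboxI N (a b a' b' : 'rV[R]_N) : hbox a b `&` hbox a' b' =
  hbox (\row_i Num.max (a ord0 i) (a' ord0 i)) (\row_i Num.min (b ord0 i) (b' ord0 i)).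
Proof.
apply/seteqP; split=> v /=; rewrite /hbox /=.
  by move=> [h h'] i; rewrite !mxE ge_max lt_min; have /andP[-> ->] := h i; have /andP[-> ->] := h' i.
move=> h; split=> i; have := h i; rewrite !mxE ge_max lt_min => /andP[/andP[h1 h2] /andP[h3 h4]].
  by rewrite h1.
by rewrite h2.
Qed.

Lemma open_hboxes N (U : set 'rV[R]_N) : open U -> exists F : nat -> set 'rV[R]_N,
  (forall k, F k = set0 \/ exists a b, F k = hbox a b) /\ U = \bigcup_k F k.
Proof.
move=> oU; pose bx (p : 'rV[rat]_N * 'rV[rat]_N) := hbox (map_mx ratr p.1) (map_mx ratr p.2 : 'rV[R]_N).
exists (fun k => if unpickle k is Some p then if `[< bx p `<=` U >] then bx p else set0 else set0); split.
  move=> k; case: (unpickle k) => [p|]; last by left.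
  by case: asboolP => _; [right; exists (map_mx ratr p.1), (map_mx ratr p.2)|left].
apply/seteqP; split=> x; last first.
  by move=> [k _]; case: (unpickle k) => [p|//]; case: asboolP => // pU /pU.
move=> Ux; have /nbhs_ballP[e /= e0 eU] : nbhs x U by exact: open_nbhs_nbhs.
have ca i : exists q : rat, x ord0 i - e < ratr q < x ord0 i.
  have /rat_in_itvoo[q] : x ord0 i - e < x ord0 i by rewrite ltrBlDr ltrDl.
  by rewrite in_itv /= => h; exists q.
have cb i : exists q : rat, x ord0 i < ratr q < x ord0 i + e.
  have /rat_in_itvoo[q] : x ord0 i < x ord0 i + e by rewrite ltrDl.
  by rewrite in_itv /= => h; exists q.
have [qa qaP] := choice ca; have [qb qbP] := choice cb.
exists (pickle (\row_i qa i, \row_i qb i)) => //; rewrite pickleK.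
have -> : `[< bx (\row_i qa i, \row_i qb i) `<=` U >].
  apply/asboolP => v vb; apply: eU; split=> // i j; rewrite ord1.
  have := vb j; rewrite !mxE /= => /andP[v1 v2].
  have /andP[a1 a2] := qaP j; have /andP[b1 b2] := qbP j.
  rewrite /ball /= ltr_distlC.
  by rewrite (lt_le_trans a1 v1) (lt_trans v2 b2).
by move=> i; rewrite !mxE /=; have /andP[a1 a2] := qaP i; have /andP[b1 b2] := qbP i; rewrite (ltW a2) b1.
Qed.

Definition hboxes N := [set B : set 'rV[R]_N | exists a b, B = hbox a b].

Lemma borel_hboxes N (B : set (borel 'rV[R]_N)) : measurable B -> (<<s @hboxes N >>) B.
Proof.
move: B; apply: smallest_sub; first exact: smallest_sigma_algebra.
move=> U /open_hboxes[F [FP ->]].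
have [s0 _ sU] := smallest_sigma_algebra setT (@hboxes N).
apply: sU => k; have [->|[a [b ->]]] := FP k; first exact: s0.
by apply: sub_sigma_algebra; exists a, b.
Qed.

Lemma measurable_coord N i : measurable_fun setT (fun v : borel 'rV[R]_N => v ord0 i : R).
Proof. by apply: continuous_borelR; exact: coord_continuous. Qed.

Lemma measurable_rV d (T : measurableType d) N (g : T -> 'rV[R]_N) :
  (forall i, measurable_fun setT (fun x => g x ord0 i)) ->
  measurable_fun setT (g : T -> borel 'rV[R]_N).
Proof.
move=> mg; apply: (@measurability _ _ T (borel 'rV[R]_N) setT _ (@open 'rV[R]_N)) => //.
move=> _ [U /open_hboxes[F [FP ->]] <-]; rewrite setTI preimage_bigcup.
apply: bigcupT_measurable => k; have [->|[a [b ->]]] := FP k; first by rewrite preimage_set0.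
have -> : g @^-1` hbox a b = \bigcap_(i in [set: 'I_N]) (fun x => g x ord0 i) @^-1` `[a ord0 i, b ord0 i[.
  apply/seteqP; split=> x /=.
    by move=> h i _; rewrite /= in_itv /=; exact: h.
  by move=> h i; have := h i I; rewrite /= in_itv.
apply: fin_bigcap_measurable => [|i _]; first exact: finite_finset.
by rewrite -[X in measurable X]setTI; apply: mg => //; exact: measurable_itv.
Qed.

Lemma measurable_hbox N (a b : 'rV[R]_N) : measurable (hbox a b : set (borel 'rV[R]_N)).
Proof.
have -> : hbox a b = \bigcap_(i in [set: 'I_N]) (fun x : 'rV[R]_N => x ord0 i) @^-1` `[a ord0 i, b ord0 i[.
  apply/seteqP; split=> x /=.
    by move=> h i _; rewrite /= in_itv /=; exact: h.
  by move=> h i; have := h i I; rewrite /= in_itv.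
apply: fin_bigcap_measurable => [|i _]; first exact: finite_finset.
by rewrite -[X in measurable X]setTI; apply: measurable_coord => //; exact: measurable_itv.
Qed.

Lemma row_mx_hd N (x : R) (v : 'rV[R]_N) : (row_mx x%:M v : 'rV[R]_N.+1) ord0 ord0 = x.
Proof.
transitivity ((row_mx x%:M v) ord0 (lshift N (ord0 : 'I_1))).
  by congr (fun_of_matrix _ _ _); exact: val_inj.
by rewrite row_mxEl mxE eqxx mulr1n.
Qed.

Lemma row_mx_tl N (x : R) (v : 'rV[R]_N) i : (row_mx x%:M v : 'rV[R]_N.+1) ord0 (lift ord0 i) = v ord0 i.
Proof.
transitivity ((row_mx x%:M v) ord0 (rshift 1 i)); last by rewrite row_mxEr.
by congr (fun_of_matrix _ _ _); exact: val_inj.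
Qed.

Definition pcons N (p : measurableTypeR R * borel 'rV[R]_N) : borel 'rV[R]_N.+1 := row_mx p.1%:M p.2.

Lemma measurable_pcons N : measurable_fun setT (@pcons N).
Proof.
apply: measurable_rV => i; rewrite /pcons; have [j ->|->] := unliftP ord0 i.
  under eq_fun do rewrite row_mx_tl.
  exact: (measurableT_comp (measurable_coord j) measurable_snd).
under eq_fun do rewrite row_mx_hd.
exact: measurable_fst.
Qed.

Lemma hbox_lebesgue N (a b : 'rV[R]_N) : (forall i, a ord0 i <= b ord0 i) ->
  lebesgue_rV (hbox a b) = (\prod_i (b ord0 i - a ord0 i))%:E.
Proof.
move=> ab; transitivity (\prod_(i < N) lebesgue_measure (`[a ord0 i, b ord0 i[%classic : set (measurableTypeR R)))%E.
  rewrite -lebesgue_rV_box => [|i]; last exact: measurable_itv.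
  by congr lebesgue_rV; apply/seteqP; split=> v h i /=; have := h i; rewrite /= in_itv.
rewrite -prodEFin; apply: eq_bigr => i _; rewrite lebesgue_measure_itv /= lte_fin.
by have := ab i; rewrite le_eqVlt => /orP[/eqP ->|->]; rewrite ?ltxx ?subrr// EFinB.
Qed.

(** The recursion in [lebesgue_rV] is the integral formula for a product measure, transported by
    [pcons]. Sigma-finiteness is carried along because the next product needs it. *)
Lemma lebesgue_rV_measure N : exists L : {sigma_finite_measure set (borel 'rV[R]_N) -> \bar R},
  forall B, measurable B -> L B = lebesgue_rV B.
Proof.
have cover K : [set: 'rV[R]_K] = \bigcup_k hbox (const_mx (- k%:R)) (const_mx k%:R).
  apply/seteqP; split=> // v _; pose k := (Num.truncn (\sum_i `|v ord0 i|)).+1.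
  exists k => // i; rewrite !mxE.
  have h : `|v ord0 i| < k%:R.
    apply: le_lt_trans (truncnS_gt _); rewrite (bigD1 i)//= lerDl.
    by rewrite sumr_ge0.
  by move: h; rewrite ltr_norml => /andP[/ltW -> ->].
have mk K (L0 : {measure set (borel 'rV[R]_K) -> \bar R}) :
    (forall B, measurable B -> L0 B = lebesgue_rV B) ->
    exists L : {sigma_finite_measure set (borel 'rV[R]_K) -> \bar R}, forall B, measurable B -> L B = lebesgue_rV B.
  move=> L0E.
  have sf : sigma_finite setT L0.
    exists (fun k => hbox (const_mx (- k%:R)) (const_mx k%:R)) => [|k]; first exact: cover.
    split; first exact: measurable_hbox.
    rewrite L0E; last exact: measurable_hbox.
    rewrite hbox_lebesgue; first exact: ltry.
    by move=> i; rewrite !mxE; apply: (@le_trans _ _ 0); rewrite ?oppr_le0 ler0n.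
  by exists (sigma_finite_measure_of sf).
elim: N => [|N [L LE]].
  by apply: (mk 0%N (@dirac _ (borel 'rV[R]_0) 0 R)) => B mB; rewrite /= diracE indicE.
pose P := measure_function_pushforward__canonical__measure_function_Measure
  (@lebesgue_measure R \x L)%E (@measurable_pcons N).
apply: (mk _ P) => B mB.
rewrite /P /= /pushforward /product_measure1 /=; apply: eq_integral => x _ /=.
have E : xsection (@pcons N @^-1` B) x = [set v : 'rV[R]_N | B (row_mx x%:M v)].
  by apply/seteqP; split=> v /=; rewrite /xsection /= inE.
rewrite E LE// -E; apply: measurable_xsection; rewrite -[X in measurable X]setTI.
exact: measurable_pcons.
Qed.

End EuclideanBorel.

Section Sections.
Variable R : realType.

Lemma measurable_row_section N x (C : set (borel 'rV[R]_N.+1)) : measurable C ->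
  measurable ([set v | C (row_mx x%:M v)] : set (borel 'rV[R]_N)).
Proof.
move=> mC; have -> : [set v : 'rV[R]_N | C (row_mx x%:M v)] = xsection (@pcons R N @^-1` C) x.
  by apply/seteqP; split=> v /=; rewrite /xsection /= inE.
apply: measurable_xsection; rewrite -[X in measurable X]setTI; exact: measurable_pcons.
Qed.

Lemma measurable_section_volume N (C : set (borel 'rV[R]_N.+1)) : measurable C ->
  measurable_fun setT (fun x : measurableTypeR R => lebesgue_rV [set v : 'rV[R]_N | C (row_mx x%:M v)]).
Proof.
move=> mC; have [L LE] := lebesgue_rV_measure R N.
have -> : (fun x : measurableTypeR R => lebesgue_rV [set v : 'rV[R]_N | C (row_mx x%:M v)]) = L \o xsection (@pcons R N @^-1` C).
  apply/funext => x; rewrite /= -LE; last exact: measurable_row_section.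
  by congr (L _); apply/seteqP; split=> v /=; rewrite /xsection /= inE.
apply: measurable_fun_xsection; rewrite -[X in measurable X]setTI; exact: measurable_pcons.
Qed.

Lemma lebesgue_rV_ge0 N (C : set (borel 'rV[R]_N)) : measurable C -> (0 <= lebesgue_rV C)%E.
Proof. by have [L LE] := lebesgue_rV_measure R N => mC; rewrite -LE. Qed.

Lemma lebesgue_rV_null_sections N (B : set (borel 'rV[R]_N.+1)) : measurable B -> lebesgue_rV B = 0%E ->
  exists Z : set (measurableTypeR R), [/\ measurable Z, lebesgue_measure Z = 0%E &
    forall x, ~ Z x -> lebesgue_rV [set v : 'rV[R]_N | B (row_mx x%:M v)] = 0%E].
Proof.
move=> mB; pose G (x : measurableTypeR R) := lebesgue_rV [set v : 'rV[R]_N | B (row_mx x%:M v)].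
have mG : measurable_fun setT G by exact: measurable_section_volume.
have G0 x : (0 <= G x)%E by apply: lebesgue_rV_ge0; exact: measurable_row_section.
rewrite [lebesgue_rV B]/(\int[lebesgue_measure]_x G x)%E => BG.
have /ae_eq_integral_abs : (\int[@lebesgue_measure R]_(x in setT) `|G x|)%E = 0%E.
  by rewrite -[RHS]BG; apply: eq_integral => x _; rewrite gee0_abs.
move=> /(_ measurableT mG) [Z [mZ Z0 sZ]]; exists Z; split=> // x Zx.
by apply: contrapT => Gx; apply: Zx; apply: sZ => /=; move=> /(_ I).
Qed.

End Sections.

Section NullScale.
Variables (R : realType) (c : R).
Hypothesis c_gt0 : 0 < c.

(** By uniqueness of Lebesgue measure: [c] times its image under multiplication by [c] has the right
    values on intervals. *)
Lemma lebesgue_null_scale (A : set (measurableTypeR R)) : measurable A -> lebesgue_measure A = 0%E ->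
  lebesgue_measure [set x : measurableTypeR R | A (c * x)] = 0%E.
Proof.
move=> mA A0.
have mc : measurable_fun setT (fun x : measurableTypeR R => c * x : measurableTypeR R) by exact: measurable_funM.
pose P := measure_function_pushforward__canonical__measure_function_Measure (@lebesgue_measure R) mc.
have := @lebesgue_measure_unique R (mscale (NngNum (ltW c_gt0)) P) _ A mA.
rewrite A0 /mscale /P /= /pushforward => /(_ _)/esym/eqP.
rewrite mule_eq0 eqe gt_eqF//= => h; apply/eqP; apply: h => _ [[a b] /= _ <-].
rewrite /mscale /= /pushforward.
have -> : (fun x : R => c * x) @^-1` `]a, b]%classic = `]a / c, b / c]%classic.
  by apply/seteqP; split=> x /=; rewrite !in_itv/= ltr_pdivrMr// ler_pdivlMr// mulrC.
rewrite !lebesgue_measure_itv /= !lte_fin ltr_pM2r ?invr_gt0//.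
case: ifP => _; last by rewrite mule0.
by rewrite -!EFinB -EFinM -mulrBl mulrC divfK// gt_eqF.
Qed.

Lemma lebesgue_rV_null_scale N (B : set (borel 'rV[R]_N)) : measurable B -> lebesgue_rV B = 0%E ->
  lebesgue_rV [set v : 'rV[R]_N | B (c *: v)] = 0%E.
Proof.
elim: N B => [|N IH] B mB.
  have E : [set v : 'rV[R]_0 | B (c *: v)] = B.
    by apply/seteqP; split=> v /=; have -> : c *: v = v by apply/rowP => -[].
  by rewrite E.
have mc K : measurable_fun setT (fun v : borel 'rV[R]_K => c *: v : borel 'rV[R]_K).
  apply: measurable_rV => i; under eq_fun do rewrite mxE.
  by apply: measurable_funM => //; exact: measurable_coord.
move=> /(lebesgue_rV_null_sections mB)[Z [mZ Z0 BZ]].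
have Zc := lebesgue_null_scale mZ Z0.
have mC : measurable ([set v : 'rV[R]_N.+1 | B (c *: v)] : set (borel _)).
  by rewrite -[X in measurable X]setTI; exact: mc.
pose H (x : measurableTypeR R) := lebesgue_rV [set v : 'rV[R]_N | B (c *: row_mx x%:M v)].
rewrite -[LHS]/(\int[lebesgue_measure]_x H x)%E.
have HE x : ~ Z (c * x) -> H x = 0%E.
  move=> /BZ Gx; have := IH [set v : 'rV[R]_N | B (row_mx (c * x)%:M v)] (measurable_row_section _ mB) Gx.
  by congr (_ = _); congr lebesgue_rV; apply/seteqP; split=> v /=; rewrite scale_row_mx scale_scalar_mx.
rewrite -(integral0 (@lebesgue_measure R) setT); apply: ge0_ae_eq_integral => //.
- exact: measurable_section_volume mC.
- by move=> x _; apply: lebesgue_rV_ge0; exact: (measurable_row_section x mC).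
exists [set x : measurableTypeR R | Z (c * x)]; split=> //.
  rewrite -[X in measurable X]setTI; exact: (@measurable_funM _ _ _ _ (cst c) id).
by move=> x /= /not_implyP[_ Hx]; apply: contrapT => /HE.
Qed.

End NullScale.

(** * Averages over horospheres *)

Section Riemann.
Variables (R : realType) (d : nat) (L : {measure set (borel 'rV[R]_d) -> \bar R}).
Hypothesis LE : forall B, measurable B -> L B = lebesgue_rV B.
Variables (a s : 'rV[R]_d) (m : nat).
Hypotheses (s_gt0 : forall k, 0 < s ord0 k) (m_gt0 : (0 < m)%N).
Local Notation idx := {ffun 'I_d -> 'I_m}.
Let lo (i : idx) := gpt m a s (fun k => (i k)%:Z).
Let hi (i : idx) := gpt m a s (fun k => (i k).+1%:Z).
Let vol : R := \prod_k s ord0 k.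
Let mR : (0 : R) < m%:R. Proof. by rewrite ltr0n. Qed.

Let cellP (i : idx) w : hbox (lo i) (hi i) w <-> forall k, (i k)%:R <= (w ord0 k - a ord0 k) * m%:R / s ord0 k < (i k).+1%:R.
Proof.
have E k : (lo i ord0 k <= w ord0 k < hi i ord0 k) = ((i k)%:R <= (w ord0 k - a ord0 k) * m%:R / s ord0 k < (i k).+1%:R).
  rewrite !mxE -!pmulrn -lerBrDl -ltrBlDl.
  rewrite ler_pdivlMr// ltr_pdivrMr// !mulrA ler_pdivrMr// ltr_pdivlMr//.
  by rewrite ![s ord0 k * _]mulrC.
by split=> h k; have := h k; rewrite E.
Qed.

Lemma cell_sub (i : idx) : hbox (lo i) (hi i) `<=` hbox a (a + s).
Proof.
move=> w /cellP h k; have /andP[h1 h2] := h k; rewrite mxE.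
have p : 0 <= (w ord0 k - a ord0 k) * m%:R / s ord0 k by apply: le_trans h1.
have q : (w ord0 k - a ord0 k) * m%:R / s ord0 k < m%:R.
  by apply: (lt_le_trans h2); rewrite ler_nat.
move: p q; rewrite ler_pdivlMr// mul0r pmulr_lge0// subr_ge0 => ->.
by rewrite ltr_pdivrMr// mulrC ltr_pM2l// ltrBlDl.
Qed.

Let cell_vol (i : idx) : L (hbox (lo i) (hi i)) = (vol / #|{: idx}|%:R)%:E.
Proof.
rewrite LE; last exact: measurable_hbox.
have E k : hi i ord0 k - lo i ord0 k = s ord0 k / m%:R.
  rewrite !mxE -!pmulrn -[(i k).+1%:R]natr1; field; exact: lt0r_neq0.
rewrite hbox_lebesgue => [|k]; last by rewrite -subr_ge0 E divr_ge0// ltW.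
congr EFin; under eq_bigr do rewrite E.
by rewrite big_split /= -/vol prodr_const card_ord card_ffun !card_ord natrX exprVn.
Qed.

Lemma hbox_vol : L (hbox a (a + s)) = vol%:E.
Proof.
rewrite LE; last exact: measurable_hbox.
rewrite hbox_lebesgue => [|k]; last by rewrite mxE lerDl ltW.
by congr EFin; apply: eq_bigr => k _; rewrite mxE; ring.
Qed.

Lemma riemann (F : borel 'rV[R]_d -> R) (e : R) : bmf F ->
  (forall i w, hbox (lo i) (hi i) w -> `|F w - F (lo i)| <= e) ->
  `|\int[L]_(w in hbox a (a + s)) F w - vol * cellmean (fun i => F (lo i))| <= e * vol.
Proof.
move=> bF Fe; have mD := measurable_hbox a (a + s).
have LD : (L (hbox a (a + s)) < +oo)%E by rewrite hbox_vol ltry.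
pose G w := \sum_(i : idx) F (lo i) * \1_(hbox (lo i) (hi i)) w.
have b1 (i : idx) : bmf (fun w : borel 'rV[R]_d => \1_(hbox (lo i) (hi i)) w : R).
  split; first by apply: measurable_indic; exact: measurable_hbox.
  by exists 1 => x; rewrite indicE; case: (_ \in _); rewrite ?normr1 ?normr0.
have bG : bmf (G : borel 'rV[R]_d -> R) by apply: bmf_sum => i; exact: bmfZ.
have intG : \int[L]_(w in hbox a (a + s)) G w = vol * cellmean (fun i => F (lo i)).
  rewrite mean_sum//; last by move=> i; exact: bmfZ.
  rewrite /cellmean mulrCA mulrA [_ * vol]mulrC mulr_sumr; apply: eq_bigr => i _.
  transitivity (F (lo i) * (vol / #|{: idx}|%:R)); last by ring.
  rewrite meanZ//; congr (_ * _).
  rewrite /Rintegral integral_indic//; last exact: measurable_hbox.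
  by rewrite setIidl ?cell_vol//; exact: cell_sub.
rewrite -intG -meanB//.
have -> : e * vol = e * fine (L (hbox a (a + s))) by rewrite hbox_vol.
apply: mean_abs_le => //; first exact: bmfB.
move=> w Dw; pose y k := (w ord0 k - a ord0 k) * m%:R / s ord0 k.
have y0 k : 0 <= y k.
  by rewrite divr_ge0 ?(ltW (s_gt0 k))// mulr_ge0// subr_ge0; have /andP[] := Dw k.
have ym k : (Num.truncn (y k) < m)%N.
  rewrite -(ltr_nat R); have /andP[/le_lt_trans-> //] := truncn_itv (y0 k).
  rewrite /y ltr_pdivrMr// mulrC ltr_pM2l// ltrBlDl.
  by have := Dw k; rewrite mxE => /andP[].
pose iw : idx := [ffun k => Ordinal (ym k)].
have wi : hbox (lo iw) (hi iw) w by apply/cellP => k; rewrite ffunE /=; exact: truncn_itv.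
rewrite /G (bigD1 iw)//= big1 ?addr0 => [|i iiw]; last first.
  rewrite indicE; case: (boolP (w \in _)) => [|_]; last by rewrite mulr0.
  rewrite inE => /cellP wi'; case/eqP: iiw; apply/ffunP => k; apply: val_inj.
  by rewrite ffunE /= (truncn_def (wi' k)).
by rewrite indicE mem_set// mulr1; exact: Fe.
Qed.

End Riemann.

Section BoxLimit.
Variables (R : realType) (n : nat).
Local Notation d := n.+1.
Local Notation X := (SLQ_SLA R d).
Variable f : X -> R.
Hypothesis f_nice : nice f.
Variable x0 : X.
Let fu : real_unif_continuous f. Proof. by case: f_nice. Qed.

Definition horo (t : R) (x : 'rV[R]_n) : R := f (x0 ** iotaSL (unip_mx (- x) * Phi n t)%g).

Lemma horo01 t x : 0 <= horo t x <= 1. Proof. by case: f_nice => h _ _; exact: h. Qed.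

Lemma continuous_horo t : continuous (horo t).
Proof.
move=> x; apply/(@cvgrPdist_le _ _ _ (nbhs x) (nbhs_filter x)) => e e0; have [del del0 H] := fu e0.
have dl : 0 < del / lam n t by rewrite divr_gt0// lam_gt0.
have /= := @nbhsx_ballx _ _ x _ dl.
apply: filterS => y [_ xy]; rewrite /horo.
have -> : (unip_mx (- x) * Phi n t = unip_mx (- y) * Phi n t * unip_mx (lam n t *: (y - x)))%g.
  rewrite -mulgA -unip_Phi mulgA unipD; congr (unip_mx _ * _)%g.
  by apply/rowP => k; rewrite !mxE; ring.
rewrite iotaM actM; apply: H; apply: near1_unip; first exact: ltW.
move=> j; rewrite !mxE normrM gtr0_norm ?lam_gt0//.
have := xy ord0 j; rewrite /ball /= distrC => /ltW.
by rewrite ler_pdivlMr ?lam_gt0// mulrC.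
Qed.

Lemma bmf_horo t : bmf (horo t : borel 'rV[R]_n -> R).
Proof.
split; first by apply: continuous_borelR; exact: continuous_horo.
by exists 1 => x; have /andP[h1 h2] := horo01 t x; rewrite ger0_norm.
Qed.

Lemma measurable_inv : measurable_fun setT (fun x : measurableTypeR R => x^-1 : measurableTypeR R).
Proof.
(* Inversion is continuous away from 0; at 0 it takes the conventional value 0, and a single point
   is harmless. *)
have -> : [set: measurableTypeR R] = [set 0] `|` [set~ 0] by rewrite setUv.
have o0 : open [set~ (0 : R)].
  have -> : [set~ 0] = [set x : R | x < 0] `|` [set x : R | 0 < x].
    by apply/seteqP; split=> x /=; [move/eqP; rewrite neq_lt => /orP[]; [left|right]|case=> h E; move: h; rewrite E ltxx].
  by apply: openU; [exact: open_lt|exact: open_gt].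
apply/measurable_funU; [exact: measurable_set1|exact: open_measurable|].
split; first exact: measurable_fun_set1.
apply: open_continuous_measurable_fun => // x /[!inE] /eqP x0'.
exact: inv_continuous.
Qed.

Lemma measurable_xw : measurable_fun setT (@xw R n : borel 'rV[R]_d -> borel 'rV[R]_n).
Proof.
apply: measurable_rV => j; under eq_fun do rewrite mxE.
apply: measurable_funM; first exact: measurable_coord.
exact: (measurableT_comp measurable_inv (measurable_coord ord0)).
Qed.

Lemma HcE t w : Hc f t w x0 = horo t (xw w). Proof. by []. Qed.

Lemma bmf_Hc t : bmf (fun w : borel 'rV[R]_d => Hc f t w x0).
Proof.
have [m1 [C hC]] := bmf_horo t; split; last by exists C => w; exact: hC.
exact: (measurableT_comp m1 measurable_xw).
Qed.

Variable mu : probability (borel X) R.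
Hypothesis mu_inv : is_invariant mu.
Variable L : {measure set (borel 'rV[R]_d) -> \bar R}.
Hypothesis LE : forall B, measurable B -> L B = lebesgue_rV B.
Variable t_ : nat -> R.
Hypothesis t_oo : t_ j @[j --> \oo] --> +oo.

Lemma box_limit (a s : 'rV[R]_d) : 0 < a ord0 ord0 -> (forall k, 0 < s ord0 k) ->
  \int[L]_(w in hbox a (a + s)) Hc f (t_ j) w x0 @[j --> \oo] -->
  (\prod_k s ord0 k) * \int[mu]_x f x.
Proof.
move=> a0 s0; set vol := \prod_k _.
(* Since [m_ j] exceeds [lam ^+ 2], the ratio [lam / m_ j] is below [1 / lam], and one bound settles
   both conditions. *)
pose m_ j := (Num.truncn (lam n (t_ j) ^+ 2)).+1.
have l0 j : 0 < lam n (t_ j) := lam_gt0 n (t_ j).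
have t_large (e : R) : 0 < e -> \forall j \near \oo, [/\ 0 <= t_ j, (lam n (t_ j))^-1 <= e & lam n (t_ j) / (m_ j)%:R <= e].
  move=> e0; have /cvgryPge/(_ (Num.max 0 e^-1)) := t_oo.
  apply: filterS => j; rewrite ge_max => /andP[t0 te].
  have tl : e^-1 <= lam n (t_ j).
    apply: (le_trans te); apply: le_trans (expR_ge1Dx _).
    rewrite -[d]addn1 natrD mulrDl mul1r addrA lerDr addr_ge0// mulr_ge0//.
  have lV : (lam n (t_ j))^-1 <= e by rewrite -[e]invrK lef_pV2 ?posrE ?invr_gt0.
  split=> //; apply: le_trans lV; rewrite ler_pdivrMr ?ltr0n//.
  rewrite -(ler_pM2l (l0 j)) mulrA divff ?gt_eqF// mul1r -expr2.
  exact/ltW/truncnS_gt.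
have sminP : exists2 smin, 0 < smin & forall k, smin <= s ord0 k.
  exists (\big[Num.min/1]_k s ord0 k); first by apply: lt_bigmin.
  by move=> k; apply: bigmin_le_cond.
have [smin smin0 sminP'] := sminP.
have G := gridmean_cvg a0 smin0 sminP' (fun j => ltn0Sn _) t_large f_nice mu_inv x0.
have v0 : 0 < vol by apply: prodr_gt0.
pose rho : R := \sum_k (`|a ord0 k| + `|s ord0 k|).
have rhoP k : `|a ord0 k| + `|s ord0 k| <= rho.
  by rewrite /rho (bigD1 k)//= lerDl sumr_ge0// => i _; rewrite addr_ge0.
have regD w : hbox a (a + s) w -> reg (a ord0 ord0) rho w.
  move=> h; split; first by have /andP[] := h ord0.
  move=> k; have := h k; rewrite mxE => /andP[h1 h2]; apply: le_trans (rhoP k).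
  rewrite ler_norml; apply/andP; split.
    apply: le_trans h1; rewrite lerNl; apply: (@le_trans _ _ `|a ord0 k|); last by rewrite lerDl.
    by rewrite -normrN ler_norm.
  by apply: (le_trans (ltW h2)); rewrite lerD// ler_norm.
apply/cvgrPdist_le => e e0.
have e2 : 0 < e / 2 / vol by rewrite !divr_gt0.
have [del del0 H] := Hc_close fu rho e2 a0.
have dS : 0 < del / (rho + 1) by rewrite divr_gt0// ltr_pwDr// sumr_ge0// => k _; rewrite addr_ge0.
have /cvgrPdist_le/(_ _ e2) G' := G.
apply: filterS2 G' (t_large _ dS) => j Gj [t0 _ lm].
have := @riemann R d L LE a s (m_ j) s0 (ltn0Sn _) _ (e / 2 / vol) (bmf_Hc (t_ j)).
set I1 := \int[L]_(w in _) _; rewrite -[cellmean _]/(gridmean a s t_ m_ f j x0) -/vol.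
move=> /(_ _)-h.
have {}h : `|I1 - vol * gridmean a s t_ m_ f j x0| <= e / 2 / vol * vol.
  apply: h => i w wi.
  have mR : (0 : R) < (m_ j)%:R by rewrite ltr0n.
  have ww k : `|w ord0 k - gpt (m_ j) a s (fun k => (i k)%:Z) ord0 k| <= del / lam n (t_ j).
    have := wi k; rewrite !mxE -!pmulrn -[(i k).+1%:R]natr1 => /andP[w1 w2].
    rewrite ger0_norm ?subr_ge0//.
    apply: (@le_trans _ _ (s ord0 k / (m_ j)%:R)).
      rewrite lerBlDl; apply: (le_trans (ltW w2)); rewrite le_eqVlt; apply/orP; left; apply/eqP; ring.
    rewrite ler_pdivlMr// mulrAC -mulrA -ler_pdivlMl//.
    apply: (le_trans lm); rewrite mulrC ler_pM2r//.
    rewrite lef_pV2 ?posrE//; last by rewrite ltr_pwDr// sumr_ge0// => b _; rewrite addr_ge0.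
    apply: (@le_trans _ _ rho); last by rewrite lerDl.
    by apply: le_trans (rhoP k); rewrite (gtr0_norm (s0 k)) lerDr.
  rewrite distrC -/(Hc _ _ _ _); apply: H => //.
    by apply: regD; exact: (@cell_sub R d a s (m_ j) s0 (ltn0Sn _) i).
    apply: regD; apply: (@cell_sub R d a s (m_ j) s0 (ltn0Sn _) i) => k.
    by rewrite lexx /= !mxE ltrD2l ltr_pM2l// ltr_pM2r ?invr_gt0// ltr_nat.
  by move=> k; rewrite distrC; exact: ww.
set g := gridmean a s t_ m_ f j x0 in h *.
have -> : vol * (\int[mu]_x f x) - I1 = vol * ((\int[mu]_x f x) - g) - (I1 - vol * g) by ring.
apply: (le_trans (ler_normB _ _)); rewrite (splitr e) lerD//; last first.
  by apply: (le_trans h); rewrite divfK// gt_eqF.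
rewrite normrM gtr0_norm// mulrC -ler_pdivlMr//.
Qed.

End BoxLimit.

Import HBSimple.

(** * Weak limits against absolutely continuous measures *)

Section WeakLimit.
Context d (T : measurableType d) (R : realType) (L : {sigma_finite_measure set T -> \bar R}).
Variables (D : set T).
Hypotheses (mD : measurable D) (LD : (L D < +oo)%E).
Variables (H : nat -> T -> R) (c : R).
Hypotheses (bH : forall j, bmf (H j)) (H01 : forall j x, 0 <= H j x <= 1) (c01 : 0 <= c <= 1).
Local Notation E g := (\int[L]_(x in D) g x).

(** Weak convergence of [H j] to the constant [c], tested against [g] on [D]. *)
Definition equidistributed (g : T -> R) := E (fun x => H j x * g x) @[j --> \oo] --> c * E g.

Lemma bmf_indic (B : set T) : measurable B -> bmf (\1_B : T -> R).
Proof.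
move=> mB; split; first exact: measurable_indic.
by exists 1 => x; rewrite indicE; case: (_ \in _); rewrite ?normr1 ?normr0.
Qed.

Lemma equidistributedD g h : bmf g -> bmf h -> equidistributed g -> equidistributed h ->
  equidistributed (fun x => g x + h x).
Proof.
move=> bg bh eg eh; rewrite /equidistributed meanD// mulrDr.
have -> : (fun j => E (fun x => H j x * (g x + h x))) = (fun j => E (fun x => H j x * g x) + E (fun x => H j x * h x)).
  apply/funext => j; rewrite -meanD//; [|exact: bmfM|exact: bmfM].
  by apply: eq_Rintegral => x _; rewrite mulrDr.
exact: cvgD.
Qed.

Lemma equidistributedZ k g : bmf g -> equidistributed g -> equidistributed (fun x => k * g x).
Proof.
move=> bg eg; rewrite /equidistributed meanZ// mulrCA.
have -> : (fun j => E (fun x => H j x * (k * g x))) = (fun j => k * E (fun x => H j x * g x)).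
  apply/funext => j; rewrite -meanZ//; last exact: bmfM.
  by apply: eq_Rintegral => x _; rewrite mulrCA.
exact: cvgMl_tmp.
Qed.

Lemma equidistributed_sum (I : Type) (s : seq I) (F : I -> T -> R) : (forall i, bmf (F i)) ->
  (forall i, equidistributed (F i)) -> equidistributed (fun x => \sum_(i <- s) F i x).
Proof.
move=> bF eF; elim: s => [|i s IH].
  rewrite /equidistributed; under eq_fun do under eq_Rintegral do rewrite big_nil mulr0.
  under eq_Rintegral do rewrite big_nil.
  by rewrite mean_cst// mul0r mulr0; exact: cvg_cst.
have -> : (fun x => \sum_(k <- i :: s) F k x) = (fun x => F i x + \sum_(k <- s) F k x).
  by apply/funext => x; rewrite big_cons.
by apply: equidistributedD => //; exact: bmf_sum.
Qed.

Lemma equidistributed_approx (g : T -> R) : bmf g ->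
  (forall e, 0 < e -> exists h, [/\ bmf h, equidistributed h & forall j, `|E (fun x => H j x * g x) - E (fun x => H j x * h x)| <= e /\ `|E g - E h| <= e]) ->
  equidistributed g.
Proof.
move=> bg ap; apply/cvgrPdist_le => e e0; have e3 : 0 < e / 3 by rewrite divr_gt0.
have [h [bh eh gh]] := ap _ e3.
move/cvgrPdist_le: eh => /(_ _ e3); apply: filterS => j hj; have [g1 g2] := gh j.
have -> : c * E g - E (fun x => H j x * g x) = c * (E g - E h) + (c * E h - E (fun x => H j x * h x)) -
   (E (fun x => H j x * g x) - E (fun x => H j x * h x)) by ring.
apply: (le_trans (ler_normB _ _)).
have -> : e = e / 3 + e / 3 + e / 3 by field.
rewrite lerD//; apply: (le_trans (ler_normD _ _)); rewrite lerD//.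
rewrite normrM; have /andP[c0 c1] := c01; rewrite ger0_norm//.
by apply: le_trans g2; rewrite ler_piMl.
Qed.

Lemma mean_Hdiff j g h e : bmf g -> bmf h -> (forall x, g x <= h x) -> E h - E g <= e ->
  `|E (fun x => H j x * h x) - E (fun x => H j x * g x)| <= e.
Proof.
move=> bg bh gh eh; rewrite -meanB//; [|exact: bmfM|exact: bmfM].
have b1 : bmf (fun x => H j x * h x - H j x * g x) by apply: bmfB; exact: bmfM.
have b2 : bmf (fun x => h x - g x) by exact: bmfB.
apply: le_trans eh; rewrite -meanB// ger0_norm; last first.
  apply: Rintegral_ge0 => x _; rewrite -mulrBr mulr_ge0 ?subr_ge0//.
  by have /andP[] := H01 j x.
apply: mean_le => // x _; rewrite -mulrBr ler_piMl ?subr_ge0//.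
by have /andP[] := H01 j x.
Qed.

(** A monotone class argument. Increasing unions are admissible because [0 <= H j <= 1] bounds the
    error of truncating the union by the measure of what is left out, uniformly in [j]. *)
Lemma equidistributed_borel (G : set (set T)) : setI_closed G ->
  (forall B, measurable B -> (<<s G >>) B) -> (forall B, G B -> measurable B /\ equidistributed \1_B) ->
  equidistributed \1_setT ->
  forall B, measurable B -> equidistributed \1_B.
Proof.
move=> GI sG GE eT B mB.
pose Z := [set B | measurable B /\ equidistributed \1_B].
suff : Z B by case.
have lam : lambda_system setT Z.
  split=> //.
  - move=> A A' A'A [mA eA] [mA' eA']; split; first exact: measurableD.
    have -> : \1_(A `\` A') = (fun x => \1_A x + -1 * \1_A' x) :> (T -> R).
      apply/funext => x; rewrite !indicE in_setD mulN1r.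
      case: (boolP (x \in A')) => [/set_mem/A'A/mem_set ->|_]; first by rewrite subrr.
      by rewrite andbT subr0.
    apply: equidistributedD; [exact: bmf_indic|by apply: bmfZ; exact: bmf_indic|by []|].
    by apply: equidistributedZ => //; exact: bmf_indic.
  move=> F ndF ZF; have mF k : measurable (F k) by case: (ZF k).
  have mU : measurable (\bigcup_k F k) by exact: bigcupT_measurable.
  split=> //; apply: equidistributed_approx; first exact: bmf_indic.
  move=> e e0.
  have cF : E (\1_(F k)) @[k --> \oo] --> E (\1_(\bigcup_k F k)).
    apply: (@mean_cvg _ _ _ L D mD LD (fun k => \1_(F k)) _ 1).
    - by move=> k; exact: bmf_indic.
    - exact: measurable_indic.
    - by move=> k x; rewrite indicE; case: (_ \in _); rewrite ?normr1 ?normr0.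
    move=> x _; have [[k _ Fkx]|nF] := pselect ((\bigcup_k F k) x).
      rewrite [X in _ --> X]indicE mem_set; last by exists k.
      apply: cvg_near_cst; exists k => // l /= kl; rewrite indicE mem_set//.
      by have /subsetPset := ndF _ _ kl; apply.
    rewrite [X in _ --> X]indicE memNset//; apply: cvg_near_cst; exists 0 => // l _.
    by rewrite indicE memNset// => Flx; apply: nF; exists l.
  move/cvgrPdist_le: cF => /(_ _ e0)[k _ /(_ k (leqnn k))/= hk].
  exists (\1_(F k)); split; [exact: bmf_indic|by case: (ZF k)|].
  move=> j; split=> //; apply: mean_Hdiff; [exact: bmf_indic|exact: bmf_indic| |].
    move=> x; rewrite !indicE; case: (boolP (x \in F k)) => [xF|_]; last by rewrite ler0n.
    by rewrite mem_set//; exists k => //; exact: set_mem.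
  exact: le_trans (ler_norm _) hk.
apply: (lambda_system_subset GI lam) => //; last exact: sG.
Qed.

(** The Radon-Nikodym density is approximated in L^1 by simple functions, and the bound on [H j]
    makes the error uniform in [j]. *)
Lemma equidistributed_ac (nu : {finite_measure set T -> \bar R}) : nu `<< L ->
  (forall B, measurable B -> equidistributed \1_B) ->
  \int[nu]_(x in D) H j x @[j --> \oo] --> c * fine (nu D).
Proof.
move=> nuL eB.
have sf_eq (g : {sfun T >-> R}) : bmf (g : T -> R) /\ equidistributed g.
  have gE : g = (fun x => \sum_(y <- finmap.enum_fset (fset_set (range g))) y * \1_(g @^-1` [set y]) x) :> (T -> R).
    by apply/funext => x; rewrite [LHS]fimfunE fsbig_finite.
  have mg (y : R) : measurable (g @^-1` [set y]).
    by rewrite -[X in measurable X]setTI; apply: measurable_funP.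
  rewrite gE; split; first by apply: bmf_sum => y; apply: bmfZ; exact: bmf_indic.
  apply: equidistributed_sum => y; first by apply: bmfZ; exact: bmf_indic.
  by apply: equidistributedZ; [exact: bmf_indic|exact: eB].
pose g := Radon_Nikodym (charge_of_finite_measure nu) L.
have nuL' : charge_of_finite_measure nu `<< L by exact: nuL.
have gi : L.-integrable D g.
  by apply: (integrableS measurableT mD) => //; exact: (Radon_Nikodym_integrable nuL').
have [s_ [si _ sl]] := approximation_sfun_integrable mD gi.
have nuD : (nu D < +oo)%E by rewrite -ge0_fin_numE ?measure_ge0// fin_num_measure.
have RN (F : T -> R) : bmf F -> (\int[nu]_(x in D) (F x)%:E = \int[L]_(x in D) ((F x)%:E * g x))%E.
  move=> bF; apply/esym; apply: (Radon_Nikodym_change_of_variables nuL mD (f := EFin \o F)).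
  exact: bmf_integrable.
have gfin x : g x \is a fin_num by exact: Radon_Nikodym_fin_num.
pose gR x := fine (g x).
have gE x : g x = (gR x)%:E by rewrite fineK.
have gRi : L.-integrable D (EFin \o gR) by apply: eq_integrable gi => // x _; rewrite gE.
have mul_int (F h : T -> R) : bmf F -> (forall x, 0 <= F x <= 1) -> L.-integrable D (EFin \o h) ->
    L.-integrable D (EFin \o (fun x => F x * h x)).
  move=> [mF _] F01 hi; have /measurable_int/measurable_EFinP mh := hi.
  apply: le_integrable hi => //.
    by apply/measurable_EFinP; apply: measurable_funM => //; exact: measurable_funTS.
  move=> x _ /=; rewrite lee_fin normrM; have /andP[f0 f1] := F01 x.
  by rewrite ler_piMl// ger0_norm.
have key (F : T -> R) (e : R) k : bmf F -> (forall x, 0 <= F x <= 1) ->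
    (\int[L]_(z in D) `|g z - (s_ k z)%:E| <= e%:E)%E ->
    `|\int[nu]_(x in D) F x - E (fun x => F x * s_ k x)| <= e.
  move=> bF F01 ge.
  have -> : \int[nu]_(x in D) F x = E (fun x => F x * gR x).
    by rewrite /Rintegral RN//; congr fine; apply: eq_integral => x _; rewrite gE.
  rewrite -RintegralB//; [|exact: mul_int|exact: mul_int].
  rewrite -lee_fin; apply: le_trans ge.
  have di : L.-integrable D (EFin \o (fun x => gR x - s_ k x)).
    by have := integrableB mD gRi (si k); apply: eq_integrable => // x _ /=; rewrite EFinB.
  rewrite EFin_normr_Rintegral//; last first.
    have := mul_int _ _ bF F01 di; apply: eq_integrable => // x _ /=.
    by rewrite mulrBr.
  have mdF : measurable_fun D (fun x => (F x * gR x - F x * s_ k x)%:E).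
    apply/measurable_EFinP; apply: measurable_funB; apply/measurable_EFinP.
      by have /measurable_int := mul_int _ _ bF F01 gRi.
    by have /measurable_int := mul_int _ _ bF F01 (si k).
  apply: (le_trans (le_abse_integral _ _ _)) => //.
  apply: ge0_le_integral => //.
  - exact: measurableT_comp.
  - apply: measurableT_comp => //; apply: emeasurable_funB; first by have /measurable_int := gi.
    by have /measurable_int := si k.
  move=> x _; rewrite gE -EFinB !abse_EFin lee_fin -mulrBr normrM.
  by have /andP[f0 f1] := F01 x; rewrite ler_piMl// ger0_norm.
apply/cvgrPdist_le => e e0; have e3 : 0 < e / 3 by rewrite divr_gt0.
have [k hk] : exists k, (\int[L]_(z in D) `|g z - (s_ k z)%:E| <= (e / 3)%:E)%E.
  move/fine_cvgP: sl => [[k1 _ h1] /cvgrPdist_le/(_ _ e3)[k2 _ h2]].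
  exists (maxn k1 k2); have := h2 _ (leq_maxr k1 k2); rewrite sub0r normrN => h.
  by rewrite -[leLHS](fineK (h1 _ (leq_maxl k1 k2))) lee_fin (le_trans (ler_norm _) h).
have [bs es] := sf_eq (s_ k).
move/cvgrPdist_le: es => /(_ _ e3); apply: filterS => j hj.
have k1 := key _ _ _ (bH j) (H01 j) hk.
have k2 : `|fine (nu D) - E (s_ k)| <= e / 3.
  have one01 (x : T) : 0 <= (1 : R) <= 1 by rewrite ler01 lexx.
  have := key (fun=> 1) _ _ (@bmf_cst _ T R 1) one01 hk; rewrite Rintegral_cst// mul1r.
  by have -> : E (fun x => 1 * s_ k x) = E (s_ k) by apply: eq_Rintegral => x _; rewrite mul1r.
have -> : c * fine (nu D) - \int[nu]_(x in D) H j x = c * (fine (nu D) - E (s_ k)) +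
   (c * E (s_ k) - E (fun x => H j x * s_ k x)) - (\int[nu]_(x in D) H j x - E (fun x => H j x * s_ k x)) by ring.
apply: (le_trans (ler_normB _ _)).
have -> : e = e / 3 + e / 3 + e / 3 by field.
rewrite lerD//; apply: (le_trans (ler_normD _ _)); rewrite lerD//.
rewrite normrM; have /andP[c0 c1] := c01; rewrite ger0_norm//.
by apply: le_trans k2; rewrite ler_piMl.
Qed.

End WeakLimit.

Section FiniteMeasurePack.
Context d (T : measurableType d) (R : realType) (m : {measure set T -> \bar R}).
Hypothesis m_fin : (m setT < +oo)%E.
Let m' : set T -> \bar R := m.
HB.instance Definition _ := Measure.on m'.
Let m'_fin : fin_num_fun m'.
Proof.
move=> U mU; rewrite ge0_fin_numE ?measure_ge0//; apply: le_lt_trans m_fin.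
by apply: le_measure => //; rewrite inE.
Qed.
HB.instance Definition _ := Measure_isFinite.Build d T R m' m'_fin.
Definition finite_measure_of : {finite_measure set T -> \bar R} := m'.
End FiniteMeasurePack.

Section Horospheres.
Variables (R : realType) (n : nat).
Local Notation d := n.+1.
Local Notation X := (SLQ_SLA R d).
Local Notation RT := (measurableTypeR R).
Variable lambda : probability (borel 'rV[R]_n) R.
Hypothesis lambda_ac : lambda `<< @lebesgue_rV R n.

(* The cone over lambda: scaling turns it into a measure on R^d that is absolutely
   continuous, and [xw] recovers the point of R^n. *)
Definition cone (p : RT * borel 'rV[R]_n) : borel 'rV[R]_d := row_mx p.1%:M (p.1 *: p.2).

Lemma measurable_cone : measurable_fun setT cone.
Proof.
apply: measurable_rV => i; rewrite /cone; have [j ->|->] := unliftP ord0 i.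
  under eq_fun do rewrite row_mx_tl mxE.
  by apply: measurable_funM; [exact: measurable_fst|exact: (measurableT_comp (measurable_coord j) measurable_snd)].
under eq_fun do rewrite row_mx_hd.
exact: measurable_fst.
Qed.

Lemma xw_cone p : p.1 != 0 -> xw (cone p) = p.2.
Proof. by move=> p0; apply/rowP => j; rewrite mxE /cone row_mx_tl row_mx_hd mxE mulrC mulKf. Qed.

(** The law of the first coordinate [w_0]. The interval avoids 0, as [xw] requires, and has length
    1, so that no normalizing factor appears. *)
Let U : probability RT R := uniform_prob (ltr1n R 2).
Definition cone_measure := measure_function_pushforward__canonical__measure_function_Measure
  (U \x lambda)%E measurable_cone.

Lemma integral_cone (F : borel 'rV[R]_d -> \bar R) : measurable_fun setT F -> (forall w, 0 <= F w)%E ->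
  (\int[cone_measure]_w F w = \int[@lebesgue_measure R]_(s in `[1%R, 2%R]) \int[lambda]_x F (cone (s, x)))%E.
Proof.
move=> mF F0; have mFc : measurable_fun setT (F \o cone) by exact: measurableT_comp measurable_cone.
rewrite ge0_integral_pushforward//; last exact: measurable_cone.
rewrite (@fubini_tonelli1 _ _ _ _ _ U lambda)//; last by move=> x; exact: F0.
rewrite integral_uniform; last 2 first.
- by apply: measurable_fun_fubini_tonelli_F => // x; exact: F0.
- by move=> x; apply: integral_ge0 => y _; exact: F0.
have -> : (2%:R - 1)^-1 = 1 :> R by rewrite (_ : 2%:R - 1 = 1) ?invr1//; ring.
by rewrite mul1e.
Qed.

Lemma cone_measureT : cone_measure setT = 1%E.
Proof.
rewrite /cone_measure /= /pushforward preimage_setT -setXTT product_measure1E//.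
rewrite [X in (_ * X)%E](_ : _ = 1%E) ?mule1; [exact: (probability_setT U)|exact: (probability_setT lambda)].
Qed.

Lemma lebesgue_12 : @lebesgue_measure R `[1%R, 2%R]%classic = 1%E.
Proof. by rewrite lebesgue_measure_itv /= lte_fin ltr1n -EFinB; congr EFin; ring. Qed.

Lemma cone_measureE (A : set (borel 'rV[R]_d)) : measurable A ->
  cone_measure A = (\int[@lebesgue_measure R]_(s in `[1%R, 2%R]) lambda [set x | A (cone (s, x))])%E.
Proof.
move=> mA; rewrite -[A in LHS]setIT -integral_indic// integral_cone; last 2 first.
- by apply/measurable_EFinP; exact: measurable_indic.
- by move=> w; rewrite lee_fin.
apply: eq_integral => s _.
have mAs : measurable [set x : borel 'rV[R]_n | A (cone (s, x))].
  rewrite -[X in measurable X]setTI.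
  by apply: (measurableT_comp measurable_cone (pair1_measurable s)).
by rewrite -[in RHS](setIT [set x | _]) -integral_indic.
Qed.

(** Almost every slice of a null set is null. The slice at height [s] pulls back to its dilate by
    [1 / s], which is null as well and therefore has [lambda]-measure 0. *)
Lemma cone_ac (L : {measure set (borel 'rV[R]_d) -> \bar R}) :
  (forall B, measurable B -> L B = lebesgue_rV B) -> cone_measure `<< L.
Proof.
move=> LE; apply/null_content_dominatesP => A mA; move=> LA.
have [Z [mZ Z0 AZ]] : exists Z : set (measurableTypeR R), [/\ measurable Z, lebesgue_measure Z = 0%E &
    forall x, ~ Z x -> lebesgue_rV [set v : 'rV[R]_n | A (row_mx x%:M v)] = 0%E].
  by apply: lebesgue_rV_null_sections => //; rewrite -LE.
have mAs s : measurable [set x : borel 'rV[R]_n | A (cone (s, x))].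
  rewrite -[X in measurable X]setTI.
  by apply: (measurableT_comp measurable_cone (pair1_measurable s)).
rewrite cone_measureE// -(integral0 (@lebesgue_measure R) `[1%R, 2%R]%classic).
have [Ln LnE] := lebesgue_rV_measure R n.
apply: ge0_ae_eq_integral => //.
  apply: measurable_funTS.
  have -> : (fun s => lambda [set x | A (cone (s, x))]) = lambda \o xsection (cone @^-1` A).
    by apply/funext => s /=; congr (lambda _); apply/seteqP; split=> x /=; rewrite /xsection /= inE.
  apply: measurable_fun_xsection; rewrite -[X in measurable X]setTI; exact: measurable_cone.
exists Z; split=> // s /= /not_implyP[]; rewrite in_itv /= => /andP[s1 _] As.
apply: contrapT => /AZ As0; apply: As; have s0 : 0 < s by exact: lt_le_trans s1.
have := lebesgue_rV_null_scale s0 (measurable_row_section s mA) As0.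
rewrite -LnE; last exact: (mAs s).
move=> h; have /lambda_ac/(_ _ (mAs s)) : null_set (@lebesgue_rV R n) [set x | A (cone (s, x))].
  move=> B mB sB; rewrite -LnE//.
  by apply: (subset_measure0 mB (mAs s) sB).
by apply.
Qed.

Variables (f : X -> R) (x0 : X).
Hypothesis f_nice : nice f.
Variable mu : probability (borel X) R.
Hypothesis mu_inv : is_invariant mu.
Variable t_ : nat -> R.
Hypothesis t_oo : t_ j @[j --> \oo] --> +oo.

(** [Hc] depends on [w] only through [xw w], so the average over [w_0] changes nothing. *)
Lemma horo_mean t : \int[lambda]_x horo f x0 t x = \int[cone_measure]_w Hc f t w x0.
Proof.
have b := bmf_horo f_nice x0 t; have b' := bmf_Hc f_nice x0 t.
rewrite /Rintegral integral_cone; last 2 first.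
- by apply/measurable_EFinP; case: b'.
- by move=> w; rewrite lee_fin; have /andP[] := horo01 f_nice x0 t (xw w).
congr fine.
transitivity (\int[@lebesgue_measure R]_(s in `[1%R, 2%R]) (cst (\int[lambda]_x (horo f x0 t x)%:E) s))%E.
  rewrite integral_cst// [X in (_ * X)%E](_ : _ = 1%E) ?mule1//; exact: lebesgue_12.
apply: eq_integral => s; rewrite inE /= in_itv /= => /andP[s1 _].
by apply: eq_integral => x _; rewrite HcE xw_cone// gt_eqF// (lt_le_trans ltr01).
Qed.

Theorem horo_limit : \int[lambda]_x horo f x0 (t_ j) x @[j --> \oo] --> \int[mu]_x f x.
Proof.
have [L LE] := lebesgue_rV_measure R d.
have cfin : (cone_measure setT < +oo)%E by rewrite cone_measureT ltry.
pose nu := finite_measure_of cfin.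
have nuL : nu `<< L by exact: cone_ac.
pose c := \int[mu]_x f x.
have f01 x : 0 <= f x <= 1 by case: f_nice.
have c01 : 0 <= c <= 1.
  apply/andP; split; first by apply: Rintegral_ge0 => x _; have /andP[] := f01 x.
  apply: (le_trans (ler_norm _)).
  have : `|c| <= 1 * fine (mu setT).
    apply: mean_abs_le => //; [exact: mu_fin|exact: nice_bmf|].
    by move=> x _; have /andP[h1 h2] := f01 x; rewrite ger0_norm.
  by rewrite muT mulr1.
(* The box [D K] will be [1, 3[ times the n-th power of [-K-1, K+1[. It has [w_0 >= 1], as
   [box_limit] needs, and these boxes exhaust the support of the cone measure, where [w_0 <= 2]. *)
pose a (K : nat) : 'rV[R]_d := \row_k if k == ord0 then 1 else - K.+1%:R.
pose s (K : nat) : 'rV[R]_d := \row_k if k == ord0 then 2 else 2 * K.+1%:R.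
have s0 K k : 0 < s K ord0 k by rewrite mxE; case: ifP => // _; rewrite mulr_gt0.
pose D K := hbox (a K) (a K + s K).
have mD K : measurable (D K : set (borel _)) by exact: measurable_hbox.
have LD K : (L (D K) < +oo)%E by rewrite (hbox_vol LE (a K) (s0 K)) ltry.
pose H j (w : 'rV[R]_d) := Hc f (t_ j) w x0.
have bH j : bmf (H j : borel 'rV[R]_d -> R) by exact: bmf_Hc.
have H01 j w : 0 <= H j w <= 1 by exact: f01.
have indH (g : 'rV[R]_d -> R) (B : set (borel 'rV[R]_d)) K :
    \int[L]_(w in D K) (g w * \1_B w) = \int[L]_(w in B `&` D K) g w.
  rewrite Rintegral_mkcondl; apply: eq_Rintegral => w _; rewrite patchE indicE.
  by case: (w \in B); rewrite ?mulr1 ?mulr0.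
have eq_box K (B : set (borel 'rV[R]_d)) p q : B `&` D K = hbox p q -> 1 <= p ord0 ord0 ->
    equidistributed L (D K) H c (\1_B : borel 'rV[R]_d -> R).
  move=> BD p0; rewrite /equidistributed.
  have -> : \int[L]_(x in D K) (\1_B x : R) = fine (L (B `&` D K)).
    transitivity (\int[L]_(x in D K) (1 * \1_B x)); first by apply: eq_Rintegral => w _; rewrite mul1r.
    rewrite (indH (fun=> 1) B K) Rintegral_cst ?mul1r// BD; exact: measurable_hbox.
  under eq_fun do rewrite indH.
  rewrite BD; have [pq|/existsNP[k /negP]] := pselect (forall k, p ord0 k < q ord0 k); last first.
    rewrite -leNgt => qp; have -> : hbox p q = set0.
      by apply/seteqP; split=> // w /(_ k)/andP[w1 w2]; move: (le_lt_trans w1 w2); rewrite ltNge qp.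
    rewrite measure0 mulr0; under eq_fun do rewrite Rintegral_set0.
    exact: cvg_cst.
  have -> : q = p + (q - p) by rewrite addrC subrK.
  have qp0 k : 0 < (q - p) ord0 k by rewrite !mxE subr_gt0.
  rewrite (hbox_vol LE p qp0) mulrC; apply: (box_limit f_nice x0 mu_inv LE t_oo) => //.
  exact: lt_le_trans p0.
have main K : \int[nu]_(w in D K) H j w @[j --> \oo] --> c * fine (nu (D K)).
  apply: (equidistributed_ac (mD K) (LD K) bH H01 c01 nuL).
  apply: (equidistributed_borel (mD K) (LD K) bH H01 c01 (G := @hboxes R d)).
  - by move=> _ _ [p [q ->]] [p' [q' ->]]; rewrite hboxI; eexists; eexists.
  - exact: borel_hboxes.
  - move=> _ [p [q ->]]; split; first exact: measurable_hbox.
    apply: eq_box; first exact: hboxI.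
    by rewrite !mxE eqxx le_max lexx orbT.
  by apply: (@eq_box K setT (a K) (a K + s K)); rewrite ?setTI// mxE eqxx.
have DU : nu (\bigcup_K D K) = 1%E.
  rewrite -[LHS]/(cone_measure (\bigcup_K D K)) cone_measureE; last exact: bigcupT_measurable.
  transitivity (\int[@lebesgue_measure R]_(s in `[1%R, 2%R]) cst 1%E s)%E; last first.
    rewrite integral_cst// mul1e; exact: lebesgue_12.
  apply: eq_integral => u.
  rewrite inE /= in_itv /= => /andP[u1 u2].
  rewrite (_ : [set x | _] = setT) ?probability_setT//.
  apply/seteqP; split=> // x _ /=.
  have w0 : cone (u, x) ord0 ord0 = u by exact: row_mx_hd.
  have wj j : cone (u, x) ord0 (lift ord0 j) = u * x ord0 j by rewrite /cone row_mx_tl mxE.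
  move: (cone (u, x)) w0 wj => w w0 wj.
  exists (Num.truncn (\sum_k `|u * x ord0 k|)) => // k; rewrite !mxE.
  have [j ->|->] := unliftP ord0 k.
    rewrite wj eq_sym (negPf (neq_lift _ _)).
    have h : `|u * x ord0 j| < (Num.truncn (\sum_k `|u * x ord0 k|)).+1%:R.
      apply: le_lt_trans (truncnS_gt _); rewrite (bigD1 j)//= lerDl.
      by rewrite sumr_ge0.
    move: h; rewrite ltr_norml => /andP[/ltW h1 h2]; rewrite h1 /=.
    by apply: lt_le_trans h2 _; rewrite mulr_natl mulr2n addKr.
  rewrite w0 eqxx u1 /=; apply: (le_lt_trans u2).
  by rewrite -natr1 (_ : 1%:R = 1)// ltrDr.
have cD : nu (D K) @[K --> \oo] --> 1%E.
  rewrite -DU; apply: nondecreasing_cvg_mu => //; first exact: bigcupT_measurable.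
  move=> K K' KK'; apply/subsetPset => w h k; have := h k; rewrite !mxE; case: ifP => // _.
  have KR : K.+1%:R <= K'.+1%:R :> R by rewrite ler_nat.
  move=> /andP[h1 h2]; apply/andP; split; first by apply: le_trans h1; rewrite lerN2.
  by apply: (lt_le_trans h2); rewrite ![2 * _]mulr_natl !mulr2n !addKr.
apply/cvgrPdist_le => e e0; have e3 : 0 < e / 3 by rewrite divr_gt0.
have nufin B : measurable B -> nu B \is a fin_num by move=> mB; exact: fin_num_measure.
have [K hK] : exists K, 1 - fine (nu (D K)) <= e / 3.
  move/fine_cvgP: cD => [_ /cvgrPdist_le/(_ _ e3)[K _ /(_ K (leqnn K)) h]].
  by exists K; apply: le_trans (ler_norm _) h.
move/cvgrPdist_le: (main K) => /(_ _ e3); apply: filterS => j hj.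
have nuT : nu setT = 1%E by exact: cone_measureT.
have nuTfin : (nu setT < +oo)%E by rewrite nuT ltry.
have nuD : fine (nu (~` D K)) = 1 - fine (nu (D K)).
  have := @measureD _ _ _ nu setT (D K) measurableT (mD K) nuTfin; rewrite setTD setTI => ->.
  by rewrite fineB ?nufin//; congr (_ - _); exact: (congr1 fine nuT).
rewrite horo_mean -[\int[cone_measure]_w _]/(\int[nu]_w H j w).
have -> : \int[nu]_w H j w = \int[nu]_(w in D K) H j w + \int[nu]_(w in ~` D K) H j w.
  rewrite -Rintegral_setU ?setUv//; first exact: measurableC.
    by apply: bmf_integrable.
  by apply/disj_setPS => w [].
have tail : `|\int[nu]_(w in ~` D K) H j w| <= e / 3.
  apply: le_trans hK; rewrite -nuD -[leRHS]mul1r; apply: mean_abs_le => //; first exact: measurableC.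
    by apply: le_lt_trans nuTfin; apply: le_measure; rewrite ?inE//; exact: measurableC.
  by move=> w _; have /andP[h1 h2] := H01 j w; rewrite ger0_norm.
set I1 := \int[nu]_(w in D K) _ in hj *; set I2 := \int[nu]_(w in _) _ in tail *.
have -> : c - (I1 + I2) = (c * fine (nu (D K)) - I1) + c * (1 - fine (nu (D K))) - I2 by ring.
apply: (le_trans (ler_normB _ _)).
have -> : e = e / 3 + e / 3 + e / 3 by field.
rewrite lerD//; apply: (le_trans (ler_normD _ _)); rewrite lerD//.
have /andP[c0 c1] := c01.
rewrite normrM ger0_norm// -nuD ger0_norm ?fine_ge0// nuD.
by apply: le_trans hK; rewrite ler_piMl// -nuD fine_ge0.
Qed.

End Horospheres.

(** * Counting lattice points *)

Local Open Scope card_scope.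

Section Cardinality.
Variable T : pointedType.
Implicit Types S : set T.

Lemma card_ge_seqP r S : (`I_r #<= S) <-> exists s : seq T, [/\ uniq s, size s = r & forall v, v \in s -> S v].
Proof.
split.
  move=> /pcard_leP[f]; exists (map f (iota 0 r)); split; last 2 first.
  - by rewrite size_map size_iota.
  - by move=> v /mapP[i]; rewrite mem_iota /= add0n => ir ->; apply: (@funS _ _ _ _ f).
  rewrite map_inj_in_uniq ?iota_uniq// => i j; rewrite !mem_iota /= !add0n => ir jr.
  by apply: (@inj _ _ _ f); rewrite inE.
move=> [s [us <- sS]]; case: s us sS => [|v0 s] us sS.
  rewrite II0; exact: card_ge0.
have inj : {in `I_(size (v0 :: s)) &, injective (nth v0 (v0 :: s))}.
  by move=> i j /[!inE] i1 j1 /eqP; rewrite nth_uniq// => /eqP.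
apply: (@card_le_trans _ _ _ (nth v0 (v0 :: s) @` `I_(size (v0 :: s)))).
  by move: (inj_card_eq inj); rewrite card_eq_sym card_eq_le => /andP[].
by apply: subset_card_le => _ [i /= ir <-]; apply: sS; exact: mem_nth.
Qed.

End Cardinality.

Section BoundedSets.
Variables (R : realType) (n : nat).
Local Notation d := n.+1.
Local Notation X := (SLQ_SLA R d).
Local Notation G := (SL (adele R) d).
Local Notation delta := (@delta R).
Implicit Types (v w : 'rV[adele R]_d) (g : G) (A B U W : set 'rV[adele R]_d) (q : 'rV[rat]_d).

(** For [0 < D] these sets are compact, and every compact set lies in one of them: see
    [compact_bdd_set] and [compact_bdd]. *)
Definition bdd (C : R) (D : nat) : set 'rV[adele R]_d :=
  [set v | forall i, `|adele_real (v ord0 i)| <= C /\ Zhat (delta D%:R * v ord0 i)].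

Lemma Zhat_dvd (D D' : nat) a : (D %| D')%N -> Zhat (delta D%:R * a) -> Zhat (delta D'%:R * a).
Proof.
move=> /dvdnP[k ->] Da; rewrite natrM.
have -> : delta (k%:R * D%:R) = delta k%:R * delta D%:R by exact: rmorphM.
by rewrite -mulrA; apply: ZhatM => //; exact: Zhat_nat.
Qed.

Lemma bddW C C' D D' : C <= C' -> (D %| D')%N -> bdd C D `<=` bdd C' D'.
Proof.
move=> CC DD v vb i; have [v1 v2] := vb i.
by split; [exact: le_trans CC|exact: Zhat_dvd v2].
Qed.

Lemma adele_real_sum (I : Type) (s : seq I) (F : I -> adele R) :
  adele_real (\sum_(i <- s) F i) = \sum_(i <- s) adele_real (F i).
Proof. exact: (raddf_sum (@adele_real R)). Qed.

Lemma bdd_mulr g C D : (0 < D)%N -> 0 <= C -> exists C' D', [/\ (0 < D')%N, 0 <= C' &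
  forall v, bdd C D v -> bdd C' D' (v *m val g)].
Proof.
move=> D0 C0; have [D2 D20 gD] := SL_den g.
pose b := \sum_i \sum_j `|adele_real (val g i j)|.
have bP i j : `|adele_real (val g i j)| <= b.
  rewrite /b (bigD1 i)//= (bigD1 j)//= -addrA lerDl addr_ge0// ?sumr_ge0// => k _.
  by rewrite sumr_ge0.
have b0 : 0 <= b by rewrite /b sumr_ge0// => k _; rewrite sumr_ge0.
exists (d%:R * (C * b)), (D * D2)%N; split; [by rewrite muln_gt0 D0|by rewrite !mulr_ge0|].
move=> v vb j; rewrite mxE; split.
  rewrite adele_real_sum; apply: (le_trans (ler_norm_sum _ _ _)).
  apply: (@le_trans _ _ (\sum_(i < d) C * b)); last by rewrite sumr_const card_ord mulr_natl.
  apply: ler_sum => i _; rewrite adele_realM normrM ler_pM//.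
  by have [] := vb i.
rewrite mulr_sumr; apply: Zhat_sum => i _; rewrite natrM.
have -> : delta (D%:R * D2%:R) = delta D%:R * delta D2%:R by exact: rmorphM.
by rewrite mulrACA; apply: ZhatM => //; have [] := vb i.
Qed.

Definition qvec g q : 'rV[adele R]_d := map_mx delta q *m val g.

Lemma qvec_inj g : injective (qvec g).
Proof.
move=> q q' /(congr1 (fun v => v *m val g^-1%g)); rewrite /qvec -!mulmxA -SL_valM mulgV SL_val1 !mulmx1.
by move/matrixP => E; apply/matrixP => i j; have := E i j; rewrite !mxE => /delta_inj.
Qed.

Lemma qvec0 g : qvec g 0 = 0.
Proof. by rewrite /qvec map_mx0 mul0mx. Qed.

(** Once [g] is undone, the coordinates of [q] are fractions with a fixed denominator and bounded
    numerators. *)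
Lemma lattice_finite g C D : (0 < D)%N -> finite_set [set q | bdd C D (qvec g q)].
Proof.
move=> D0.
have [C0|Cn] := leP 0 C; last first.
  rewrite (_ : [set q | _] = set0); first exact: finite_set0.
  apply/seteqP; split=> // q /(_ ord0)[h _]; have := le_lt_trans h Cn.
  by rewrite normr_lt0.
have [C' [D' [D'0 C'0 H]]] := bdd_mulr g^-1%g D0 C0.
pose K := (Num.truncn (C' * D'%:R)).+1.
pose mk (F : {ffun 'I_d -> 'I_(K + K)}) : 'rV[rat]_d := \row_i (((F i)%:Z - K%:Z)%:~R / D'%:R).
apply: (@sub_finite_set _ _ (mk @` setT)); last by apply: finite_image; exact: finite_finset.
move=> q /H; rewrite /qvec -mulmxA -SL_valM mulgV SL_val1 mulmx1 => qb.
have D'q : (D'%:R : rat) != 0 by rewrite pnatr_eq0 -lt0n.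
have zP i : exists z : int, D'%:R * q ord0 i = z%:~R.
  have [_] := qb i; rewrite mxE.
  have -> : delta D'%:R * delta (q ord0 i) = delta (D'%:R * q ord0 i) by apply/esym; exact: rmorphM.
  exact: Zhat_delta.
have [z zE] := choice zP.
have qE i : q ord0 i = (z i)%:~R / D'%:R by rewrite -zE mulrC mulKf.
have zK i : `|z i| < K%:Z.
  have [h _] := qb i; rewrite mxE adele_real_delta qE in h.
  rewrite -(ltr_int R) intr_norm; apply: le_lt_trans (truncnS_gt _).
  rewrite -ler_pdivrMr ?ltr0n//; apply: le_trans h.
  by rewrite fmorph_div /= ratr_int ratr_nat normrM normfV (ger0_norm (ler0n R D')).
have kP i : (absz (z i + K%:Z)%R < K + K)%N.
  by have := zK i; lia.
exists [ffun i => Ordinal (kP i)] => //; apply/rowP => i.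
rewrite !mxE ffunE /= qE; congr (_%:~R / _).
by have := zK i; lia.
Qed.

Lemma close0_bdd C D v w : (0 < D)%N -> bdd C D v -> closeM 0 v w -> bdd (C + 1) D w.
Proof.
move=> D0 vb vw i; have [v1 v2] := vb i; have [c1 c2] := vw ord0 i; split.
  rewrite -[adele_real (w _ _)](subrK (adele_real (v ord0 i))) addrC.
  apply: (le_trans (ler_normD _ _)); rewrite lerD//.
  rewrite distrC (le_trans (ltW c1))// invf_le1 ?ltr0n ?fct_gt0//.
  by rewrite ler1n fct_gt0.
have /(cong_Zhat (fct_gt0 0)) : cong (fct 0) (delta D%:R * w ord0 i) (delta D%:R * v ord0 i).
  have h : Zhat (delta 1%:R * delta D%:R) by rewrite -[delta 1%:R]/(delta 1) rmorph1 mul1r; exact: Zhat_nat.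
  by apply: (@cong_mul _ 1 (fct 0)) => //; [exact: fct_gt0|rewrite mul1n; exact: cong_sym].
by apply.
Qed.

Lemma compact_bdd A : compact A -> exists C D, [/\ (0 < D)%N, 0 <= C & A `<=` bdd C D].
Proof.
move=> /compact_near_coveringP/(_ nat \oo (fun k v => bdd k%:R (fct k) v) _)[].
  move=> v Av; have : exists k, bdd k%:R (fct k) v.
    have hD i : exists D, (0 < D)%N /\ Zhat (delta D%:R * v ord0 i).
      by have [D] := adele_den (v ord0 i); exists D.
    have [D DP] := choice hD.
    pose K := (\sum_i (D i + (Num.truncn `|adele_real (v ord0 i)|).+1))%N.
    exists K => i.
    have Ki : (D i + (Num.truncn `|adele_real (v ord0 i)|).+1 <= K)%N by rewrite /K (bigD1 i)//= leq_addr.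
    split.
      apply: (le_trans (ltW (truncnS_gt _))); rewrite ler_nat.
      by apply: leq_trans Ki; rewrite leq_addl.
    have [Di0 DiZ] := DP i; apply: Zhat_dvd DiZ; apply: dvdn_fct; rewrite Di0 /=.
    by apply: leq_trans Ki; rewrite leq_addr.
  move=> [k vk].
  exists ([set w | closeM 0 v w], [set l | (k.+1 <= l)%N]) => /=.
    by split; [exact: nbhs_closeM|exists k.+1].
  move=> [w l] /= [vw kl]; have := close0_bdd (fct_gt0 k) vk vw.
  apply: bddW; last by apply: fct_dvd; exact: ltnW.
  by rewrite natr1 ler_nat.
move=> k _ /(_ k (leqnn k)) h; exists k%:R, (fct k); split=> //; exact: fct_gt0.
Qed.

Lemma bdd_interior C D : (0 < D)%N -> bdd C D `<=` (bdd (C + 1) D)°.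
Proof.
move=> D0 v vb; apply: filterS (nbhs_closeM 0 v) => w; exact: close0_bdd.
Qed.

Definition lattice_points A (x : X) := (A `&` coset_lattice x) `\ (0 : 'rV[adele R]_d).

Lemma lattice_points_piX A g : lattice_points A (piX g) = qvec g @` [set q | q <> 0 /\ A (qvec g q)].
Proof.
rewrite /lattice_points coset_latticeE; apply/seteqP; split=> v.
  move=> [[Av [q _ qv]] v0]; exists q => //; split; last by rewrite /qvec qv.
  by move=> q0; apply: v0; rewrite /= -qv q0 -/(qvec g 0) qvec0.
move=> [q [q0 Aq] <-]; split; first by split=> //; exists q.
by move=> /= h; apply: q0; apply: (@qvec_inj g); rewrite qvec0.
Qed.

Lemma count_piX r A g : (`I_r #<= lattice_points A (piX g)) <->
  exists s : seq 'rV[rat]_d, [/\ uniq s, size s = r & forall q, q \in s -> q <> 0 /\ A (qvec g q)].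
Proof.
have inj : {in [set q | q <> 0 /\ A (qvec g q)] &, injective (qvec g)} by move=> q q' _ _; exact: qvec_inj.
have := inj_card_eq inj; rewrite card_eq_le lattice_points_piX => /andP[h1 h2].
rewrite -card_ge_seqP; split=> h; exact: card_le_trans h _.
Qed.

Lemma open_piX (B : set X) : open (@piX R n @^-1` B) -> open B.
Proof. by rewrite {2}/open /= /quotient_open. Qed.

Lemma open_count r U : open U -> open [set x : X | `I_r #<= lattice_points U x].
Proof.
move=> oU; apply: open_piX.
rewrite openE => g /= /count_piX[s [us ss sU]]; apply/SL_closeP.
suff [k hk] : exists k, forall h, closeM k (val g) (val h) -> forall q, q \in s -> U (qvec h q).
  exists k => h gh; apply/count_piX; exists s; split=> // q qs.
  by split; [have [] := sU q qs|exact: hk].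
elim: s sU {us ss} => [|q s IH] sU; first by exists 0.
have [k hk] := IH (fun q' qs => sU q' (@mem_behead _ (q :: s) _ qs)).
have [_ Uq] := sU q (mem_head _ _).
have [l1 hl1] := closeM_nbhs (open_nbhs_nbhs (conj oU Uq)).
have [l hl] := closeM_mull d l1 (map_mx delta q).
exists (maxn k l) => h gh q'; rewrite inE => /orP[/eqP ->|].
  apply: hl1; apply: hl => i j; apply: close_mono (gh i j); exact: leq_maxr.
by apply: hk => i j; apply: close_mono (gh i j); exact: leq_maxl.
Qed.

Lemma lattice_points_finite A x C D : (0 < D)%N -> A `<=` bdd C D -> finite_set (lattice_points A x).
Proof.
move=> D0 AC; have [g ->] := piX_repr x; rewrite lattice_points_piX; apply: finite_image.
by apply: sub_finite_set (lattice_finite g C D0) => q [_ /AC].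
Qed.

Lemma count_finite (T : pointedType) (S : set T) : finite_set S ->
  exists s : seq T, [/\ uniq s, S = [set` s] & forall r, (`I_r #<= S) <-> (r <= size s)%N].
Proof.
move=> /finite_seqP[s0 ->]; exists (undup s0); split; first exact: undup_uniq.
  by apply/seteqP; split=> v /=; rewrite mem_undup.
move=> r; rewrite card_ge_seqP; split.
  move=> [s [us <- ss]]; apply: uniq_leq_size => // v /ss /=; by rewrite mem_undup.
move=> rs; exists (take r (undup s0)); split.
- by apply: take_uniq; exact: undup_uniq.
- by rewrite size_takel.
by move=> v /mem_take; rewrite mem_undup.
Qed.

(** The count in a difference is expressed through conditions on the two counts separately, the
    witness being the size of [S']. This makes the counting condition stable under proper
    differences in [measurable_count]. *)
Lemma count_setD (T : pointedType) (S S' : set T) r : finite_set S -> S' `<=` S ->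
  (`I_r #<= S `\` S') <-> exists k, ~ (`I_k.+1 #<= S') /\ (`I_(k + r) #<= S).
Proof.
move=> fS S'S; have [s [us sE sr]] := count_finite fS.
have [s' [us' s'E s'r]] := count_finite (sub_finite_set S'S fS).
have [s'' [us'' s''E s''r]] := count_finite (finite_setD S' fS).
have sz : size s = (size s' + size s'')%N.
  rewrite -size_cat; apply/perm_size/uniq_perm => //.
    rewrite cat_uniq us' us'' andbT /=; apply/hasPn => v.
    have -> : (v \in s'') = (v \in [set` s'']) by apply/idP/idP; rewrite inE.
    rewrite -s''E inE => -[_ nv]; apply/negP => vs'; apply: nv; rewrite s'E //.
  move=> v; rewrite mem_cat.
  have mE (t : seq T) : (v \in t) = (v \in [set` t]) by apply/idP/idP; rewrite inE.
  rewrite !mE -sE -s'E -s''E in_setD.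
  by case: (boolP (v \in S')) => [/set_mem/S'S/mem_set ->|_] //=; rewrite andbT.
rewrite s''r; split=> [h|[k]].
  exists (size s'); split; first by rewrite s'r ltnn.
  by rewrite sr sz leq_add2l.
rewrite s'r sr sz => -[/negP]; rewrite -leqNgt => h1 h2.
by rewrite -(leq_add2l k); apply: leq_trans h2 _; rewrite leq_add2r.
Qed.

(** A Dynkin class argument starting from open sets. All sets are cut down to the bounded open set
    [W], because [count_setD] needs finite counts. *)
Lemma measurable_count r A C D : (0 < D)%N -> measurable (A : set (borel 'rV[adele R]_d)) -> A `<=` bdd C D ->
  measurable ([set x | `I_r #<= lattice_points A x] : set (borel X)).
Proof.
move=> D0 mA AC; pose W := (bdd (C + 1) D)°.
have oW : open W by exact: open_interior.
have WC : W `<=` bdd (C + 1) D by exact: interior_subset.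
have AW : A `<=` W by move=> v /AC; exact: bdd_interior.
pose Z := [set B : set 'rV[adele R]_d | forall r, measurable ([set x | `I_r #<= lattice_points (B `&` W) x] : set (borel X))].
suff : Z A by move/(_ r); rewrite setIidl.
have fW B x : finite_set (lattice_points (B `&` W) x).
  by apply: (lattice_points_finite x D0 (C := C + 1)) => v [_ /WC].
have lam : lambda_system setT Z.
  split=> //.
  - move=> r'; rewrite setTI; apply: sub_sigma_algebra; exact: open_count.
  - move=> B B' B'B ZB ZB' r'.
    have ptD x : lattice_points ((B `\` B') `&` W) x = lattice_points (B `&` W) x `\` lattice_points (B' `&` W) x.
      apply/seteqP; split=> v.
        by move=> [[[[Bv nB'] Wv] xv] v0]; split=> // -[[[]]].
      by move=> [[[[Bv Wv] xv] v0] nv]; split=> //; split=> //; split=> //; split=> // B'v; apply: nv.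
    have -> : [set x : X | `I_r' #<= lattice_points ((B `\` B') `&` W) x] =
        \bigcup_k ([set x : X | `I_(k + r') #<= lattice_points (B `&` W) x] `\`
                   [set x : X | `I_k.+1 #<= lattice_points (B' `&` W) x]).
      apply/seteqP; split=> x /=.
        rewrite ptD; have sub : lattice_points (B' `&` W) x `<=` lattice_points (B `&` W) x.
          by move=> v [[[B'v Wv] xv] v0]; split=> //; split=> //; split=> //; exact: B'B.
        by move=> /(count_setD r' (fW B x) sub)[k [h1 h2]]; exists k.
      move=> [k _ [h1 h2]].
      rewrite ptD; have sub : lattice_points (B' `&` W) x `<=` lattice_points (B `&` W) x.
        by move=> v [[[B'v Wv] xv] v0]; split=> //; split=> //; split=> //; exact: B'B.
      by apply/(count_setD r' (fW B x) sub); exists k.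
    by apply: bigcupT_measurable => k; apply: measurableD; [exact: ZB|exact: ZB'].
  move=> F ndF ZF r'.
  have -> : [set x : X | `I_r' #<= lattice_points (\bigcup_k F k `&` W) x] =
      \bigcup_k [set x : X | `I_r' #<= lattice_points (F k `&` W) x].
    apply/seteqP; split=> x /=; last first.
      move=> [k _ h]; apply: card_le_trans h _; apply: subset_card_le.
      by move=> v [[[Fv Wv] xv] v0]; split=> //; split=> //; split=> //; exists k.
    move=> /card_ge_seqP[s [us ss sF]].
    have [k hk] : exists k, forall v, v \in s -> lattice_points (F k `&` W) x v.
      elim: s sF {us ss} => [|v s IH] sF; first by exists 0.
      have [|k hk] := IH; first by move=> v' vs; apply: sF; rewrite inE vs orbT.
      have [[[[l _ Fl] Wv] xv] v0] := sF v (mem_head _ _).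
      exists (maxn k l) => v'; rewrite inE => /orP[/eqP ->|/hk].
        by split=> //; split=> //; split=> //; have /subsetPset := ndF _ _ (leq_maxr k l); apply.
      move=> [[[Fv Wv'] xv'] v0']; split=> //; split=> //; split=> //.
      by have /subsetPset := ndF _ _ (leq_maxl k l); apply.
    by exists k => //; apply/card_ge_seqP; exists s.
  by apply: bigcupT_measurable => k; exact: ZF.
apply: (@lambda_system_subset _ (@open 'rV[adele R]_d) _ setT Z lam) => //.
- by move=> B B'; exact: openI.
- by move=> U oU r'; apply: sub_sigma_algebra; apply: open_count; exact: openI.
Qed.

End BoundedSets.

(** * Test functions *)

Section TestFunctions.
Variables (R : realType) (n : nat).
Local Notation d := n.+1.
Local Notation X := (SLQ_SLA R d).
Local Notation G := (SL (adele R) d).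
Local Notation delta := (@delta R).
Local Notation V := 'rV[adele R]_d.
Implicit Types (v w : V) (g h k : G) (x : X) (phi : V -> R) (r : nat).

Definition rdist_le (e : R) v w := forall i, `|adele_real (v ord0 i) - adele_real (w ord0 i)| <= e.
Definition same_finite v w := forall i p, adele_padic p (v ord0 i) = adele_padic p (w ord0 i).
Definition same_real v w := forall i, adele_real (v ord0 i) = adele_real (w ord0 i).
Definition congV (N : nat) v w := forall i, cong N (v ord0 i) (w ord0 i).

(** The conditions that make the soft count of [phi] a [nice] function. [tame_lip] concerns a
    variation of the real coordinates with the finite ones fixed, [tame_level] the opposite. *)
Record tame phi : Prop := Tame {
  tame01 : forall v, 0 <= phi v <= 1;
  tame_supp : exists C D, [/\ (0 < D)%N, 0 <= C & forall v, phi v != 0 -> bdd C D v];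
  tame_lip : exists2 K, 0 <= K & forall e v w, same_finite v w -> rdist_le e v w -> phi v - phi w <= K * e;
  tame_level : exists2 N, (0 < N)%N & forall v w, same_real v w -> congV N v w -> phi v = phi w }.

Definition level_set phi (c : R) := [set v : V | c <= phi v].

Definition soft_count_set phi r x :=
  [set c : R | 0 <= c <= 1 /\ (c = 0 \/ `I_r #<= lattice_points (level_set phi c) x)].
(* The largest level that is reached at [r] nonzero lattice points: a continuous substitute for
   the indicator function of having [r] lattice points in a set. *)
Definition soft_count phi r x : R := sup (soft_count_set phi r x).

Lemma soft_count_has_sup phi r x : has_sup (soft_count_set phi r x).
Proof. by split; [exists 0; split; [rewrite lexx ler01|left]|exists 1 => c [/andP[]]]. Qed.

Lemma soft_count_ge phi r x c : 0 <= c <= 1 -> `I_r #<= lattice_points (level_set phi c) x ->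
  c <= soft_count phi r x.
Proof. by move=> c01 h; apply: sup_upper_bound; [exact: soft_count_has_sup|split=> //; right]. Qed.

Lemma soft_count_le phi r x y : 0 <= y ->
  (forall c, 0 < c <= 1 -> `I_r #<= lattice_points (level_set phi c) x -> c <= y) -> soft_count phi r x <= y.
Proof.
move=> y0 h; apply: sup_le_ub; first by have [] := soft_count_has_sup phi r x.
move=> c [/andP[c0 c1] [->//|hc]]; have [->//|cn0] := eqVneq c 0.
by apply: h => //; rewrite c1 andbT lt_neqAle eq_sym cn0.
Qed.

Lemma soft_count01 phi r x : 0 <= soft_count phi r x <= 1.
Proof.
apply/andP; split; last by apply: soft_count_le => // c /andP[].
by apply: sup_upper_bound; [exact: soft_count_has_sup|split; [rewrite lexx ler01|left]].
Qed.

(** If every lattice point loses at most [e], so does the highest level reached by [r] of them.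
    Using [h] and its inverse gives a two-sided bound. *)
Lemma soft_count_act phi r x h (e : R) : 0 <= e -> (forall v, coset_lattice x v -> phi v - e <= phi (v *m val h)) ->
  soft_count phi r x <= soft_count phi r (x ** h) + e.
Proof.
move=> e0; have [g ->] := piX_repr x; rewrite piX_act => H.
apply: soft_count_le; first by rewrite addr_ge0//; have /andP[] := soft_count01 phi r (piX (g * h)%g).
move=> c /andP[c0 c1] hc; rewrite -lerBlDr; have [ce|ce] := leP (c - e) 0.
  by apply: (le_trans ce); have /andP[] := soft_count01 phi r (piX (g * h)%g).
apply: soft_count_ge; first by rewrite ltW//= lerBlDr (le_trans c1)// lerDl.
move: hc => /count_piX[s [us ss sc]]; apply/count_piX; exists s; split=> // q /sc[q0 cq]; split=> //.
rewrite /level_set /qvec SL_valM mulmxA /=; apply: le_trans (H _ _); first by rewrite lerB.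
by rewrite coset_latticeE; exists q.
Qed.

Lemma Zhat_prod (I : Type) (s : seq I) (F : I -> adele R) : (forall i, Zhat (F i)) -> Zhat (\prod_(i <- s) F i).
Proof. by move=> ZF; elim/big_ind: _ => //; [exact: Zhat1|exact: ZhatM]. Qed.

Lemma Zhat_det m (A : 'M[adele R]_m) : (forall i j, Zhat (A i j)) -> Zhat (\det A).
Proof.
move=> ZA; apply: Zhat_sum => s _; apply: ZhatM; last exact: Zhat_prod.
by case: (perm.odd_perm s); rewrite ?expr1 ?expr0; [apply: ZhatN|]; exact: Zhat1.
Qed.

Lemma Zhat_inv k : (forall i j, Zhat (val k i j)) -> forall i j, Zhat (val k^-1%g i j).
Proof.
move=> Zk i j; rewrite [val k^-1%g]/(\adj (val k)) mxE /cofactor; apply: ZhatM.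
  elim: (_ + _)%N => [|m IH]; first by rewrite expr0; exact: Zhat1.
  by rewrite exprS mulN1r; exact: ZhatN.
by apply: Zhat_det => a b; rewrite !mxE.
Qed.

Lemma bdd_int_mul C D k v : (forall i j, Zhat (val k i j)) -> re_SL k = 1%g ->
  bdd C D v -> bdd C D (v *m val k).
Proof.
move=> Zk rk vb j; split.
  suff -> : adele_real ((v *m val k) ord0 j) = adele_real (v ord0 j) by have [] := vb j.
  rewrite mxE adele_real_sum (bigD1 j)//= big1 ?addr0 => [|i ij]; rewrite adele_realM;
    have /(congr1 (fun M => fun_of_matrix (val M))) := rk.
    by move=> /(congr1 (fun f => f j j)); rewrite !mxE eqxx => ->; rewrite mulr1.
  by move=> /(congr1 (fun f => f i j)); rewrite !mxE (negPf ij) => ->; rewrite mulr0.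
rewrite mxE mulr_sumr; apply: Zhat_sum => i _; rewrite mulrA; apply: ZhatM => //.
by have [] := vb i.
Qed.

Lemma nice_soft_count phi r : tame phi -> nice (soft_count phi r).
Proof.
case=> p01 [C [D [D0 C0 supp]]] [K K0 lip] [N N0 lev]; split; first exact: soft_count01.
  move=> e e0.
  (* The first bound serves when only the image of [v] is known to be bounded: the sum [S] of the
     real absolute values then satisfies [S <= d * C + S / 2]. The second brings the Lipschitz error
     below [e]. *)
  pose del := Num.min (2 * d%:R)^-1 (e / (K * (2 * d%:R * C) + 1)).
  have d0 : (0 : R) < 2 * d%:R by rewrite mulr_gt0.
  have B0 : 0 < K * (2 * d%:R * C) + 1 by rewrite ltr_wpDl// !mulr_ge0.
  have del0 : 0 < del by rewrite lt_min invr_gt0 d0 divr_gt0.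
  exists del => // g ng x.
  have fin v : same_finite v (v *m val (iotaSL g)).
    move=> i p; have := iota_padic g p => /(congr1 (mulmx (map_mx (@adele_padic R p) v))).
    by rewrite mulmx1 -map_mxM => /matrixP/(_ ord0 i); rewrite !mxE.
  have close v : bdd C D v \/ bdd C D (v *m val (iotaSL g)) -> rdist_le (2 * d%:R * C * del) v (v *m val (iotaSL g)).
    move=> vb; pose S := \sum_i `|adele_real (v ord0 i)|.
    have dS i : `|adele_real (v ord0 i) - adele_real ((v *m val (iotaSL g)) ord0 i)| <= S * del.
      have -> : adele_real ((v *m val (iotaSL g)) ord0 i) = \sum_j adele_real (v ord0 j) * val g j i.
        rewrite mxE adele_real_sum; apply: eq_bigr => j _; rewrite adele_realM; congr (_ * _).
        by have /matrixP/(_ j i) := iota_real g; rewrite mxE.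
      have -> : adele_real (v ord0 i) = \sum_j adele_real (v ord0 j) * (j == i)%:R.
        rewrite (bigD1 i)//= eqxx mulr1 big1 ?addr0// => j ji; by rewrite (negPf ji) mulr0.
      rewrite -sumrB; apply: (le_trans (ler_norm_sum _ _ _)); rewrite /S mulr_suml.
      apply: ler_sum => j _; rewrite -mulrBr normrM distrC; apply: ler_wpM2l => //; exact: ng.
    have SC : S <= 2 * d%:R * C.
      case: vb => vb.
        apply: (@le_trans _ _ (\sum_(i < d) C)); first by apply: ler_sum => i _; have [] := vb i.
        by rewrite sumr_const card_ord -[C *+ d]mulr_natl -mulrA ler_peMl ?mulr_ge0// ler1n.
      have : S <= \sum_(i < d) (C + S * del).
        apply: ler_sum => i _; have [h _] := vb i.
        rewrite -[adele_real (v ord0 i)](subrK (adele_real ((v *m val (iotaSL g)) ord0 i))) addrC.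
        by apply: (le_trans (ler_normD _ _)); rewrite lerD.
      rewrite sumr_const card_ord -[(C + _) *+ d]mulr_natl.
      have S0 : 0 <= S by rewrite /S sumr_ge0.
      have h : d%:R * (S * del) <= S / 2.
        rewrite mulrCA ler_wpM2l//; apply: (@le_trans _ _ (d%:R * (2 * d%:R)^-1)).
          by rewrite ler_wpM2l// /del ge_min lexx.
        by rewrite invfM mulrCA divff ?mulr1// pnatr_eq0.
      move: h; rewrite mulrDr -[2 * _ * C]mulrA; move: (d%:R * C) (d%:R * _) => p q; lra.
    by move=> i; apply: (le_trans (dS i)); rewrite ler_pM2r.
  have Ke : K * (2 * d%:R * C * del) <= e.
    rewrite mulrA; apply: (@le_trans _ _ ((K * (2 * d%:R * C) + 1) * del)).
      by rewrite ler_pM2r// lerDl.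
    by rewrite mulrC -ler_pdivlMr// /del ge_min lexx orbT.
  have key v : `|phi v - phi (v *m val (iotaSL g))| <= e.
    have [z1|n1] := eqVneq (phi v) 0; first have [z2|n2] := eqVneq (phi (v *m val (iotaSL g))) 0.
    - by rewrite z1 z2 subrr normr0 ltW.
    - have h := close v (or_intror (supp _ n2)).
      rewrite ler_norml lerNl opprB !(le_trans _ Ke)//; first exact: lip.
      apply: lip; first by move=> i p; apply/esym; exact: fin.
      by move=> i; rewrite distrC.
    have h := close v (or_introl (supp _ n1)).
    rewrite ler_norml lerNl opprB !(le_trans _ Ke)//; first exact: lip.
    apply: lip; first by move=> i p; apply/esym; exact: fin.
    by move=> i; rewrite distrC.
  rewrite ler_norml; apply/andP; split.
    rewrite lerNl opprB lerBlDl; apply: soft_count_act; first exact: ltW.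
    by move=> v _; rewrite lerBlDl addrC -lerBlDl; have := key v; rewrite ler_norml => /andP[].
  have xE : x = x ** iotaSL g ** (iotaSL g)^-1%g by rewrite actK.
  rewrite lerBlDl {2}xE; apply: soft_count_act; first exact: ltW.
  move=> v _; have := key (v *m val (iotaSL g)^-1%g); rewrite -mulmxA -SL_valM mulVg SL_val1 mulmx1.
  by rewrite ler_norml => /andP[h _]; move: h; rewrite lerNl opprB lerBlDl addrC -lerBlDl.
(* Points of the support have denominators dividing [D], so a congruence modulo [D * N] on [k] is
   needed to move them by a multiple of [N]. *)
exists (D * N)%N; first by rewrite muln_gt0 D0.
move=> k kN rk x.
have Zk i j : Zhat (val k i j).
  apply: (@cong_Zhat _ (D * N) _ (i == j)%:R); [by rewrite muln_gt0 D0|exact: kN|exact: Zhat_bool].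
have Zk' := Zhat_inv Zk.
have rk' : re_SL k^-1%g = 1%g by apply: (mulgI (re_SL k)); rewrite -re_SLM mulgV rk mulg1; apply: val_inj; rewrite /= map_mx1.
have key v : phi (v *m val k) = phi v.
  have [vb|nvb] := pselect (bdd C D v); last first.
    have z1 : phi v = 0 by apply: contrapT => /eqP /supp.
    have [//|/supp/(bdd_int_mul Zk' rk')] := eqVneq (phi (v *m val k)) 0; first by rewrite z1.
    by rewrite -mulmxA -SL_valM mulgV SL_val1 mulmx1.
  apply: lev.
    move=> j; rewrite mxE adele_real_sum (bigD1 j)//= big1 ?addr0 => [|i ij]; rewrite adele_realM;
      have /(congr1 (fun M => fun_of_matrix (val M))) := rk.
      by move=> /(congr1 (fun f => f j j)); rewrite !mxE eqxx => ->; rewrite mulr1.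
    by move=> /(congr1 (fun f => f i j)); rewrite !mxE (negPf ij) => ->; rewrite mulr0.
  move=> j; have -> : v ord0 j = \sum_i v ord0 i * (i == j)%:R.
    by rewrite (bigD1 j)//= eqxx mulr1 big1 ?addr0// => i ij; rewrite (negPf ij) mulr0.
  rewrite mxE; apply: cong_sum => i _; apply: (cong_mul D0 N0) => //; have [] := vb i => //.
apply/eqP; rewrite eq_le; apply/andP; split.
  have xE : x = x ** k ** k^-1%g by rewrite actK.
  rewrite {2}xE -[leRHS]addr0; apply: soft_count_act => // v _.
  by rewrite subr0 -(key (v *m _)) -mulmxA -SL_valM mulVg SL_val1 mulmx1.
by rewrite -[leRHS]addr0; apply: soft_count_act => // v _; rewrite subr0 key.
Qed.

Implicit Types (B : set V).

Definition bump_set (k : nat) B v :=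
  [set c : R | 0 <= c <= 1 /\ (c = 0 \/ exists a, [/\ B a, congV (fct k) a v & rdist_le ((1 - c) / (fct k)%:R) a v])].
(* Equal to 1 on [B] and supported on the points close to [B]. *)
Definition bump (k : nat) B v : R := sup (bump_set k B v).

Let fk (k : nat) : (0 : R) < (fct k)%:R. Proof. by rewrite ltr0n fct_gt0. Qed.

Lemma bump_has_sup (k : nat) B v : has_sup (bump_set k B v).
Proof. by split; [exists 0; split; [rewrite lexx ler01|left]|exists 1 => c [/andP[]]]. Qed.

Lemma bump_ge (k : nat) B v c : bump_set k B v c -> c <= bump k B v.
Proof. by move=> h; apply: sup_upper_bound => //; exact: bump_has_sup. Qed.

Lemma bump_le (k : nat) B v y : 0 <= y -> (forall c a, 0 < c <= 1 -> B a -> congV (fct k) a v ->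
  rdist_le ((1 - c) / (fct k)%:R) a v -> c <= y) -> bump k B v <= y.
Proof.
move=> y0 h; apply: sup_le_ub; first by have [] := bump_has_sup k B v.
move=> c [/andP[c0 c1] [->//|[a [Ba av rv]]]]; have [->//|cn0] := eqVneq c 0.
by apply: (h c a) => //; rewrite c1 andbT lt_neqAle eq_sym cn0.
Qed.

Lemma bump01 (k : nat) B v : 0 <= bump k B v <= 1.
Proof.
apply/andP; split; last by apply: bump_le => // c a /andP[].
by apply: bump_ge; split; [rewrite lexx ler01|left].
Qed.

Lemma bump1 (k : nat) B v : B v -> bump k B v = 1.
Proof.
move=> Bv; apply/eqP; rewrite eq_le; have /andP[_ ->] := bump01 k B v; apply: bump_ge.
split; [by rewrite ler01 lexx|right]; exists v; split=> // i; first exact: cong_refl.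
by rewrite !subrr normr0 mul0r.
Qed.

Lemma bump_close (k : nat) B v : bump k B v != 0 -> exists2 a, B a & closeM k a v.
Proof.
move=> b0; apply: contrapT => H; case/eqP: b0; apply/eqP; rewrite eq_le.
have /andP[-> _] := bump01 k B v; rewrite andbT; apply: bump_le => // c a /andP[c0 c1] Ba cav rav.
case: H; exists a => // i j; rewrite ord1; split; last exact: cav.
apply: le_lt_trans (rav j) _; rewrite ltr_pdivrMr// mulVf ?gt_eqF// ltrBlDr ltrDl//.
Qed.

Lemma bump_lip (k : nat) B e v w : same_finite v w -> rdist_le e v w -> bump k B v - bump k B w <= (fct k)%:R * e.
Proof.
move=> fvw rvw; have e0 : 0 <= e by apply: le_trans (rvw ord0).
have [bw0 bw1] := andP (bump01 k B w).
rewrite lerBlDr; apply: bump_le => [|c a /andP[c0 c1] Ba cav rav].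
  by rewrite addr_ge0// mulr_ge0// ltW.
rewrite -lerBlDl; have [h|h] := leP (c - (fct k)%:R * e) 0; first exact: le_trans bw0.
apply: bump_ge; split; first by rewrite ltW//= lerBlDr (le_trans c1)// lerDl mulr_ge0// ltW.
right; exists a; split=> // i.
  rewrite congE => p; have := cav i; rewrite congE => /(_ p).
  by rewrite !adele_padicM !adele_padicB (fvw i p).
have -> : adele_real (a ord0 i) - adele_real (w ord0 i) =
   (adele_real (a ord0 i) - adele_real (v ord0 i)) + (adele_real (v ord0 i) - adele_real (w ord0 i)) by rewrite subrKA.
apply: (le_trans (ler_normD _ _)).
have -> : (1 - (c - (fct k)%:R * e)) / (fct k)%:R = (1 - c) / (fct k)%:R + e by field; rewrite gt_eqF.
by rewrite lerD.
Qed.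

Lemma bump_level (k : nat) B v w : same_real v w -> congV (fct k) v w -> bump k B v = bump k B w.
Proof.
move=> rvw cvw; congr sup; apply/seteqP; split=> c [c01 h]; split=> //.
  case: h => [->|[a [Ba cav rav]]]; [by left|right]; exists a; split=> // i; last by rewrite -rvw.
  by apply: cong_trans (cav i) (cvw i).
case: h => [->|[a [Ba cav rav]]]; [by left|right]; exists a; split=> // i; last by rewrite rvw.
by apply: cong_trans (cav i) (cong_sym (cvw i)).
Qed.

Lemma tame_bump (k : nat) B C D : (0 < D)%N -> 0 <= C -> B `<=` bdd C D -> tame (bump k B).
Proof.
move=> D0 C0 BC; split.
- exact: bump01.
- exists (C + 1), D; split; [by []|by rewrite addr_ge0|move=> v /bump_close[a Ba av]].
  apply: (close0_bdd D0 (BC _ Ba)) => i j; exact: close_mono (av i j).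
- exists (fct k)%:R; first exact: ltW.
  by move=> e v w; exact: bump_lip.
by exists (fct k); [exact: fct_gt0|move=> v w; exact: bump_level].
Qed.

(** The inner counterpart of [bump]: it vanishes off [B] and equals 1 at the points that are not
    close to the complement of [B]. *)
Lemma tame_cobump (k : nat) B C D : (0 < D)%N -> 0 <= C -> B `<=` bdd C D -> tame (fun v => 1 - bump k (~` B) v).
Proof.
move=> D0 C0 BC; split.
- by move=> v; have /andP[h1 h2] := bump01 k (~` B) v; rewrite subr_ge0 h2 lerBlDr lerDl.
- exists C, D; split=> // v; have [Bv _|nB] := pselect (B v); first exact: BC.
  by rewrite bump1// subrr eqxx.
- exists (fct k)%:R; first exact: ltW.
  move=> e v w fvw rvw.
  have -> : 1 - bump k (~` B) v - (1 - bump k (~` B) w) = bump k (~` B) w - bump k (~` B) v by ring.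
  apply: bump_lip; first by move=> i p; rewrite fvw.
  by move=> i; rewrite distrC.
by exists (fct k); [exact: fct_gt0|move=> v w rvw cvw; rewrite (bump_level _ rvw cvw)].
Qed.

End TestFunctions.

(** * Local compactness and Haar measure *)

Section AdeleLimit.
Variable R : realType.
Local Notation delta := (@delta R).

Lemma padic_norm_le (p : primeT) (u : padic_seq p) (c : rat) k :
  (forall j, (k <= j)%N -> padic_abs (val p) (val u j) <= c) -> padic_norm (\pi_(Qp p) u) <= c.
Proof.
move=> h; rewrite leNgt; apply/negP => lt.
have e0 : 0 < padic_norm (\pi_(Qp p) u) - c by rewrite subr_gt0.
have [N /(_ (maxn k N) (leq_maxr _ _))] := padic_normP u e0.
rewrite ltr_distl => /andP[h1 _]; move: h1; rewrite subKr ltNge h//; exact: leq_maxl.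
Qed.

(** The [z k] form a Cauchy sequence at every prime because [k!] tends to 0 there. Subtracting [z 0]
    makes all terms integral, [fct 0] being 1, so that the limits at all primes form an adele. *)
Lemma adele_limit (z : nat -> rat) : (forall k l, (k <= l)%N -> exists u : int, z l - z k = u%:~R * (fct k)%:R) ->
  exists a : adele R, forall k, cong (fct k) a (delta (z k)).
Proof.
move=> zP; pose y k := z k - z 0%N.
have yint k (p : primeT) : padic_abs (val p) (y k) <= 1.
  have [u] := zP 0%N k (leq0n _); rewrite /y => ->.
  by rewrite padic_absM ?(valP p)// -[leRHS]mulr1 ler_pM ?padic_abs_ge0 ?(padic_abs_int (valP p))// (padic_abs_int (valP p) (Posz _)).
have yd k l (p : primeT) : (k <= l)%N -> padic_abs (val p) (y l - y k) <= padic_abs (val p) (fct k)%:R.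
  move=> kl; have -> : y l - y k = z l - z k by rewrite /y; ring.
  have [u ->] := zP k l kl; rewrite padic_absM ?(valP p)// ler_piMl ?padic_abs_ge0//.
  exact: padic_abs_int (valP p) _.
have yC (p : primeT) : y \in padic_cauchy p.
  apply/asboolP => e e0; have [K hK] := padic_abs_fct p e0; exists K => i j Ki Kj.
  have -> : y i - y j = (y i - y K) - (y j - y K) by ring.
  apply: (le_lt_trans (padic_absB (valP p) _ _)); rewrite gt_max.
  by rewrite !(le_lt_trans (yd _ _ p _) (hK K (leqnn K))).
pose Y p : padic_seq p := exist _ y (yC p).
have Yint p : \pi_(Qp p) (Y p) \in @padic_int p.
  by apply: (@padic_norm_le p (Y p) 1 0%N) => j _; exact: yint.
have br : ((0 : R), (fun p => \pi_(Qp p) (Y p))) \in @restricted R.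
  apply/asboolP; rewrite (_ : [set p | _] = set0); first exact: finite_set0.
  by apply/seteqP; split=> p //=; rewrite Yint.
pose b : adele R := exist (fun x => x \in @restricted R) _ br.
exists (b + delta (z 0%N)) => k; rewrite congE => p.
rewrite adele_padicM adele_padicB adele_padicD !adele_padic_delta.
have fN0 : ((fct k)%:R : rat) != 0 by rewrite pnatr_eq0 -lt0n fct_gt0.
rewrite padic_scale_int//.
have -> : adele_padic p b + rat_Qp p (z 0%N) - rat_Qp p (z k) = \pi_(Qp p) (Y p + rat_seq p (z 0%N) - rat_seq p (z k)).
  by rewrite !piE.
apply: (@padic_norm_le _ _ _ k) => j kj.
have -> : val (Y p + rat_seq p (z 0%N) - rat_seq p (z k)) j = y j - y k.
  change (z j - z 0%N + z 0%N - z k = z j - z 0%N - (z k - z 0%N)); ring.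
exact: yd.
Qed.

End AdeleLimit.

Section LocalCompactness.
Variables (R : realType) (n : nat).
Local Notation d := n.+1.
Local Notation delta := (@delta R).
Local Notation V := 'rV[adele R]_d.

Lemma cong_delta (N : nat) (q q' : rat) : (0 < N)%N ->
  cong N (delta q) (delta q') <-> exists u : int, q' - q = u%:~R * N%:R.
Proof.
move=> N0; have NN0 : (N%:R : rat) != 0 by rewrite pnatr_eq0 -lt0n.
have E : delta N%:R^-1 * (delta q - delta q') = delta (N%:R^-1 * (q - q')).
  have -> : delta q - delta q' = delta (q - q') by apply/esym; exact: rmorphB.
  by apply/esym; exact: rmorphM.
rewrite congE E; split=> [/Zhat_delta[u hu]|[u hu]].
  exists (- u); rewrite -[q' - q]opprB -(mulVKf NN0 (q - q')) hu rmorphN /=; ring.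
have -> : N%:R^-1 * (q - q') = (- u)%:~R by rewrite -[q - q']opprB hu rmorphN /= mulrN mulrC mulfK.
exact: Zhat_int.
Qed.

Lemma ultra_cover (T : Type) (F : set_system T) (I : finType) (A : I -> set T) (B : set T) :
  UltraFilter F -> F B -> B `<=` [set x | exists i, A i x] -> exists i, F (A i).
Proof.
move=> FU FB cov; apply: contrapT => /forallNP nA.
have FC i : F (~` A i) by have [/nA|] := in_ultra_setVsetC (A i) FU.
have : F (B `&` [set x | forall i, (~` A i) x]) by apply: filterI => //; exact: filter_forall.
by move=> /filter_ex[x [/cov[i Ai] /(_ i)]].
Qed.

Lemma ultra_fmap (T U : Type) (f : T -> U) (F : set_system T) :
  UltraFilter F -> UltraFilter (f @ F).
Proof.
move=> FU; split; first exact: fmap_proper_filter.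
move=> G GF FG; apply/seteqP; split=> // A GA.
have [//|FnA] := in_ultra_setVsetC (f @^-1` A) FU.
have /filter_ex [? []] // : G (A `&` ~` A) by apply: filterI => //; exact: FG.
Qed.

Lemma cong_with_real (N : nat) (r : R) (a b : adele R) : cong N a b -> cong N (with_real r a) b.
Proof. by rewrite !congE => h p; have := h p; rewrite !adele_padicM !adele_padicB. Qed.

(** At the real place an ultrafilter converges inside a segment. Modulo [k!] a coordinate has at
    most [D * k!] classes, so the ultrafilter selects one for each [k]; the choices are coherent and
    [adele_limit] assembles them. *)
Lemma compact_bdd_set (C : R) (D : nat) : (0 < D)%N -> compact (@bdd R n C D).
Proof.
move=> D0; rewrite compact_ultra => F FU FB.
have DN0 : (D%:R : rat) != 0 by rewrite pnatr_eq0 -lt0n.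
have coord (i : 'I_d) : exists a : adele R, forall k, F [set v : V | aclose k a (v ord0 i)].
  have [x [xC Fx]] : exists x, `|x| <= C /\ forall P, nbhs x P -> F [set v : V | P (adele_real (v ord0 i))].
    have : compact `[- C, C]%classic by exact: segment_compact.
    rewrite compact_ultra => /(_ ((fun v : V => adele_real (v ord0 i)) @ F) (ultra_fmap _ FU))[].
      apply: (@filterS _ F _ (bdd C D)) => // v /(_ i)[].
      by rewrite ler_norml /= in_itv.
    move=> x [xC Fx]; exists x; split; first by move: xC; rewrite /= in_itv /= ler_norml.
    exact: Fx.
  have res k : exists z : rat, F [set v : V | cong (fct k) (v ord0 i) (delta z)].
    pose K := (D * fct k)%N.
    have [|r Fr] := @ultra_cover _ F 'I_K (fun r => [set v : V | cong (fct k) (v ord0 i) (delta (r%:R / D%:R))]) _ FU FB; last by exists (r%:R / D%:R).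
    move=> v /(_ i)[_ Dv]; have [q vq] := adele_density (v ord0 i) (fct_gt0 k).
    have [u uE] : exists u : int, D%:R * q = u%:~R.
      apply: (@Zhat_delta R); have -> : delta (D%:R * q) = delta D%:R * delta q by exact: rmorphM.
      apply: (cong_Zhat (fct_gt0 k) _ Dv).
      apply: cong_mull_int (cong_sym vq); exact: Zhat_nat.
    have K0 : (0 < K)%N by rewrite muln_gt0 D0 fct_gt0.
    have rK : (`|(u %% K%:Z)%Z|%N < K)%N.
      rewrite -ltz_nat gez0_abs ?modz_ge0 ?eqz_nat -?lt0n//.
      by apply: ltz_pmod.
    exists (Ordinal rK); apply: cong_trans vq _; apply/(cong_delta _ _ (fct_gt0 k)).
    exists (- (u %/ K%:Z)%Z).
    have -> : q = u%:~R / D%:R by rewrite -uE mulrC mulKf.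
    have -> : (`|(u %% K%:Z)%Z|%N)%:R = ((u %% K%:Z)%Z)%:~R :> rat.
      by rewrite pmulrn gez0_abs// modz_ge0// eqz_nat -lt0n.
    have -> : u%:~R = (u %/ K%:Z)%Z%:~R * (D%:R * (fct k)%:R) + (u %% K%:Z)%Z%:~R :> rat.
      by rewrite {1}(divz_eq u K%:Z) rmorphD rmorphM /= -[(K%:Z)%:~R]pmulrn natrM.
    by rewrite rmorphN /=; field.
  have [z zF] := choice res.
  have [|a aP] := @adele_limit R z; last first.
    exists (with_real x a) => k.
    have /Fx F1 : nbhs x (fun y => `|x - y| < (fct k)%:R^-1).
      apply/nbhs_ballP; exists (fct k)%:R^-1; first by rewrite /= invr_gt0 ltr0n fct_gt0.
      by move=> y; rewrite /ball /=.
    apply: (@filterS _ F _ _ _ _ (filterI F1 (zF k))) => v [h1 h2]; split; first exact: h1.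
    by apply: cong_with_real; apply: cong_trans (aP k) (cong_sym h2).
  move=> k l kl; have [v [vk vl]] := filter_ex (filterI (zF k) (zF l)).
  apply/(@cong_delta (fct k) (z k) (z l) (fct_gt0 k)).
  apply: cong_trans (cong_sym vk) _; apply: cong_dvd vl; [exact: fct_gt0|exact: fct_dvd].
have [a aP] := choice coord; pose A : V := \row_i a i.
have FA k : F [set v | closeM k A v].
  have FF : F [set v | forall i, aclose k (a i) (v ord0 i)] by apply: filter_forall => i; exact: aP.
  by apply: (@filterS _ F _ _ _ _ FF) => v h i j; rewrite ord1 mxE.
exists A; split; last by move=> P /closeM_nbhs[k kP]; exact: filterS kP (FA k).
move=> i; split.
  rewrite leNgt; apply/negP => lt.
  have e0 : 0 < `|adele_real (A ord0 i)| - C by rewrite subr_gt0.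
  pose k := (Num.truncn (`|adele_real (A ord0 i)| - C)^-1).+1.
  have [v [vb vA]] := filter_ex (filterI FB (FA k)).
  have [h1 _] := vb i; have [h2 _] := vA ord0 i.
  have h3 : (fct k)%:R^-1 <= `|adele_real (A ord0 i)| - C.
    rewrite -[leRHS]invrK lef_pV2 ?posrE ?invr_gt0 ?ltr0n ?fct_gt0//.
    rewrite (le_trans (ltW (truncnS_gt _)))// ler_nat; exact: fct_ge.
  have := ler_normB (adele_real (A ord0 i)) (adele_real (A ord0 i) - adele_real (v ord0 i)).
  have h4 := ler_distD (adele_real (v ord0 i)) (adele_real (A ord0 i)) 0.
  move: h4; rewrite !subr0 => h4 _; move: h1 h2 h3 h4; move: `|_| `|_| `|_| (_^-1) => p q r s h1 h2 h3 h4.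
  lra.
have [v [vb vA]] := filter_ex (filterI FB (FA 0)).
have [_ h1] := vb i; have [_ h2] := vA ord0 i.
apply: (cong_Zhat (fct_gt0 0) _ h1); apply: cong_mull_int h2; exact: Zhat_nat.
Qed.

End LocalCompactness.

Lemma fct0 : fct 0 = 1%N.
Proof. by rewrite /fct (svalP fct_subproof) fact0. Qed.

Section HaarTiling.
Variables (R : realType) (n : nat).
Local Notation d := n.+1.
Local Notation delta := (@delta R).
Local Notation V := 'rV[adele R]_d.
Local Notation BV := (borel 'rV[adele R]_d).
Implicit Types (u v w : V) (N : set V).

Lemma open_closeM (B : set V) : (forall v, B v -> exists k, [set w | closeM k v w] `<=` B) -> open B.
Proof.
move=> h; rewrite openE => v /h[k kB]; apply: (filterS kB); exact: nbhs_closeM.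
Qed.

Lemma open_real_coord (U : set R) (i : 'I_d) : open U -> open [set v : V | U (adele_real (v ord0 i))].
Proof.
move=> oU; apply: open_closeM => v Uv.
have /nbhs_ballP[e e0 eU] : nbhs (adele_real (v ord0 i)) U by exact: open_nbhs_nbhs.
exists (Num.truncn e^-1).+1 => w /(_ ord0 i)[h _]; apply: eU.
rewrite /ball /=; apply: (lt_le_trans h); rewrite -[leRHS]invrK lef_pV2 ?posrE ?invr_gt0 ?ltr0n ?fct_gt0//.
by rewrite (le_trans (ltW (truncnS_gt _)))// ler_nat; exact: fct_ge.
Qed.

Lemma open_cong k v : open [set w : V | forall i, cong (fct k) (v ord0 i) (w ord0 i)].
Proof.
apply: open_closeM => w vw; exists k => w' ww' i.
exact: cong_trans (vw i) (ww' ord0 i).2.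
Qed.

Lemma measurable_real_coord i : measurable_fun setT (fun v : BV => adele_real (v ord0 i)).
Proof.
by apply: continuous_borelR; apply/continuousP => U oU; exact: open_real_coord.
Qed.

Lemma open_close_ball k v : open [set u : V | closeM k v u].
Proof.
rewrite openE => u vu.
have oi (i : 'I_d) : nbhs u [set w : V | ball (adele_real (v ord0 i)) (fct k)%:R^-1 (adele_real (w ord0 i))].
  apply: open_nbhs_nbhs; split; last exact: (vu ord0 i).1.
  by apply: open_real_coord; exact: (@ball_open _ R^o).
have [oa ob] := (filter_forall _ oi, nbhs_closeM k u).
apply: filterS (filterI oa ob) => w [wa wb] i j; rewrite ord1; split; first exact: wa.
exact: cong_trans (vu ord0 j).2 (wb ord0 j).2.
Qed.

(** Half open in the real directions, with [v] as corner, so that translates can tile. *)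
Definition cube k v : set V :=
  [set u | forall i, 0 <= adele_real (u ord0 i) - adele_real (v ord0 i) < (fct k)%:R^-1 /\ cong (fct k) (v ord0 i) (u ord0 i)].

Lemma measurable_cube k v : measurable (cube k v : set BV).
Proof.
have -> : cube k v = [set w : V | forall i, cong (fct k) (v ord0 i) (w ord0 i)] `&`
    \bigcap_(i in [set: 'I_d]) [set u : V | `[adele_real (v ord0 i), adele_real (v ord0 i) + (fct k)%:R^-1[%classic (adele_real (u ord0 i))].
  apply/seteqP; split=> u /=.
    move=> h; split=> [i|i _]; have [h1 h2] := h i => //=.
    by move: h1; rewrite in_itv /= subr_ge0 ltrBlDl.
  by move=> [h1 h2] i; split=> //; have := h2 i I; rewrite /= in_itv /= subr_ge0 ltrBlDl.
apply: measurableI; first by apply: sub_sigma_algebra; exact: open_cong.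
apply: fin_bigcap_measurable => // i _.
have := @measurable_real_coord i measurableT _ (measurable_itv `[adele_real (v ord0 i), adele_real (v ord0 i) + (fct k)%:R^-1[).
by rewrite setTI.
Qed.

Lemma cube_translate k v w : cube k (v + w) = [set u + w | u in cube k v].
Proof.
have cD a b c : cong (fct k) (a + c) b <-> cong (fct k) a (b - c) by rewrite !congE opprB addrA.
apply/seteqP; split=> [u h|_ [u h <-]].
  exists (u - w); last by rewrite subrK.
  by move=> i; have := h i; rewrite !mxE adele_realB adele_realD => -[h1 /cD h2]; split=> //; move: h1; rewrite opprD addrA addrAC.
move=> i; have [h1 h2] := h i; rewrite !mxE !adele_realD; split; first by move: h1; rewrite opprD addrACA subrr addr0.
by apply/cD; rewrite addrK.
Qed.

Lemma cube_close k v u w : cube k v u -> cube k w u -> closeM k v w.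
Proof.
move=> vu wu i j; rewrite ord1; have [v1 v2] := vu j; have [w1 w2] := wu j; split.
  by rewrite ltr_norml; lra.
exact: cong_trans v2 (cong_sym w2).
Qed.

Lemma cube_sub k v : cube k v `<=` [set u | closeM k v u].
Proof. by move=> u h i j; rewrite ord1; have [/andP[h1 h2] h3] := h j; split=> //; rewrite distrC ger0_norm. Qed.

Lemma measurable_bdd (C : R) D : measurable (@bdd R n C D : set BV).
Proof.
have -> : @bdd R n C D = [set w : V | forall i, Zhat (delta D%:R * w ord0 i)] `&`
    \bigcap_(i in [set: 'I_d]) [set u : V | `[- C, C]%classic (adele_real (u ord0 i))].
  apply/seteqP; split=> u /=.
    by move=> h; split=> [i|i _]; have [h1 h2] := h i => //=; move: h1; rewrite in_itv /= ler_norml.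
  by move=> [h1 h2] i; split=> //; have := h2 i I; rewrite /= in_itv /= ler_norml.
apply: measurableI.
  apply: sub_sigma_algebra; apply: open_closeM => v h; exists 0%N => w vw i.
  apply: (cong_Zhat (fct_gt0 0) _ (h i)); apply: cong_mull_int; first exact: Zhat_nat.
  exact: cong_sym (vw ord0 i).2.
apply: fin_bigcap_measurable => // i _.
have := @measurable_real_coord i measurableT _ (measurable_itv `[- C, C]).
by rewrite setTI.
Qed.

Variable m : {measure set BV -> \bar R}.
Hypothesis m_haar : is_haar m.

Lemma haar_cube k v : m (cube k v) = m (cube k 0).
Proof.
have [_ _ inv] := m_haar.
by rewrite -[v]add0r cube_translate; apply: inv; exact: measurable_cube.
Qed.

Lemma haar_bdd (C : R) D : (0 < D)%N -> (m (@bdd R n C D) < +oo)%E.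
Proof. by move=> D0; have [_ h _] := m_haar; apply: h; exact: compact_bdd_set. Qed.

Lemma unit_cube_bdd : cube 0%N 0 `<=` @bdd R n 1 1.
Proof.
move=> u h i; have [h1 h2] := h i; move: h1 h2; rewrite !mxE adele_real0 subr0 fct0 invr1 => /andP[h1 h2] h3.
split; first by rewrite ger0_norm// ltW.
apply: ZhatM; first exact: Zhat_nat.
by apply: (cong_Zhat _ (cong_sym h3)); [|exact: Zhat0].
Qed.

Lemma unit_cube_fin : (m (cube 0%N 0) < +oo)%E.
Proof.
apply: le_lt_trans (haar_bdd 1 (isT : 0 < 1)%N).
by apply: le_measure; rewrite ?inE; [exact: measurable_cube|exact: measurable_bdd|exact: unit_cube_bdd].
Qed.

(** Countably many rational translates cover the space: a rational matches the finite places, then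
    adding an integer adjusts the real one. *)
Lemma unit_cube_gt0 : (0 < m (cube 0%N 0))%E.
Proof.
rewrite lt0e measure_ge0 andbT; apply/eqP => U0.
have [mT _ _] := m_haar; apply: mT; apply/eqP; rewrite eq_le measure_ge0 andbT.
pose F (q : 'rV[rat]_d) := cube 0%N (map_mx delta q : V).
have cov : [set: V] `<=` \bigcup_k (if unpickle k is Some q then F q else set0).
  move=> v _; have hq i : exists q : rat, cube 0%N (\row_j delta q : V) (\row_j v ord0 i).
    have [q qv] := adele_density (v ord0 i) (fct_gt0 0).
    pose z := Num.floor (adele_real (v ord0 i) - ratr q).
    exists (q + z%:~R) => j; rewrite !mxE adele_real_delta rmorphD /= ratr_int; split.
      have := floor_itv (adele_real (v ord0 i) - ratr q); rewrite -/z fct0 invr1 rmorphD /= => /andP[h1 h2].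
      by apply/andP; split; lra.
    apply: cong_trans (cong_sym qv); rewrite fct0; apply: cong_sym; apply/cong_delta => //.
    by exists z; rewrite mulr1; ring.
  have [q qP] := choice hq; exists (pickle (\row_i q i)) => //; rewrite pickleK /F => i.
  by have := qP i i; rewrite !mxE.
have mF k : measurable ((if unpickle k is Some q then F q else set0) : set BV).
  by case: unpickle => // q; exact: measurable_cube.
apply: (le_trans (measure_sigma_subadditive m mF measurableT cov)).
rewrite eseries0// => k _ _; case: unpickle => // q; first by rewrite /F haar_cube.
Qed.

Definition cubes k (s : seq V) := [set u | exists2 v, v \in s & cube k v u].

Lemma cubes_cons k v s : cubes k (v :: s) = cube k v `|` cubes k s.
Proof.
apply/seteqP; split=> u /=.
  by move=> [w]; rewrite inE => /orP[/eqP ->|ws] wu; [left|right; exists w].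
by move=> [vu|[w ws wu]]; [exists v; rewrite ?mem_head|exists w; rewrite ?inE ?ws ?orbT].
Qed.

Lemma measurable_cubes k s : measurable (cubes k s : set BV).
Proof.
elim: s => [|v s IH]; first by rewrite (_ : cubes k [::] = set0)//; apply/seteqP; split=> u // [].
by rewrite cubes_cons; apply: measurableU => //; exact: measurable_cube.
Qed.

Lemma haar_cubes_le k s : (m (cubes k s) <= (size s)%:R%:E * m (cube k 0))%E.
Proof.
elim: s => [|v s IH].
  by rewrite mul0e (_ : cubes k [::] = set0) ?measure0//; apply/seteqP; split=> u // [].
rewrite cubes_cons.
have h : (m (cube k v `|` cubes k s) <= m (cube k v) + m (cubes k s))%E.
  by apply: measureU2; [exact: measurable_cube|exact: measurable_cubes].
apply: (le_trans h).
by rewrite haar_cube /= -natr1 EFinD ge0_muleDl ?lee_fin// mul1e addeC leeD2r.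
Qed.

(** The unit cube is cut into [k! ^ d] real subcubes times [k! ^ d] residue classes. This bounds the
    measure of a small cube from below. *)
Lemma unit_cube_le k : (m (cube 0%N 0) <= ((fct k) ^ (d + d))%:R%:E * m (cube k 0))%E.
Proof.
pose I : finType := ({ffun 'I_d -> 'I_(fct k)} * {ffun 'I_d -> 'I_(fct k)})%type.
pose w (i : I) : V := \row_j with_real ((i.1 j)%:R / (fct k)%:R) (delta (i.2 j)%:R).
have f0 : (0 < (fct k)%:R :> R)%R by rewrite ltr0n fct_gt0.
have cov : cube 0%N 0 `<=` cubes k [seq w i | i <- enum {: I}].
  move=> u uU.
  have hr j : exists r : 'I_(fct k), (0 <= adele_real (u ord0 j) - r%:R / (fct k)%:R < (fct k)%:R^-1)%R.
    have [] := uU j; rewrite mxE adele_real0 subr0 fct0 invr1 => /andP[u0 u1] _.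
    have t0 : (0 <= adele_real (u ord0 j) * (fct k)%:R)%R by rewrite mulr_ge0// ltW.
    have /andP[t1 t2] := truncn_itv t0; set t := Num.truncn _ in t1 t2.
    have tk : (t < fct k)%N.
      by rewrite -(ltr_nat R); apply: (le_lt_trans t1); rewrite gtr_pMl.
    exists (Ordinal tk) => /=; rewrite subr_ge0 ler_pdivrMr// t1 /=.
    by rewrite ltrBlDr -{1}[(_^-1)%R]mul1r -mulrDl ltr_pdivlMr// addrC natr1.
  have hs j : exists s : 'I_(fct k), cong (fct k) (delta s%:R) (u ord0 j).
    have [q qu] := adele_density (u ord0 j) (fct_gt0 k).
    have [z qz] : exists z : int, q = z%:~R.
      apply: (@Zhat_delta R); apply: (cong_Zhat (fct_gt0 k) (cong_sym qu)).
      have [_ h] := uU j; apply: (cong_Zhat _ (cong_sym h)); first exact: fct_gt0.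
      by rewrite mxE; exact: Zhat0.
    have rK : (`|(z %% (fct k)%:Z)%Z|%N < fct k)%N.
      rewrite -ltz_nat gez0_abs ?modz_ge0 ?eqz_nat -?lt0n ?fct_gt0//.
      by apply: ltz_pmod; rewrite ltz_nat fct_gt0.
    exists (Ordinal rK); apply: cong_trans (cong_sym qu); apply/cong_delta; first exact: fct_gt0.
    exists (z %/ (fct k)%:Z)%Z.
    have -> : ((Ordinal rK : nat)%:R = ((z %% (fct k)%:Z)%Z)%:~R :> rat)%R.
      by rewrite pmulrn gez0_abs// modz_ge0// eqz_nat -lt0n fct_gt0.
    by rewrite qz {1}(divz_eq z (fct k)%:Z) rmorphD rmorphM /= addrK.
  have [r rP] := choice hr; have [s sP] := choice hs.
  exists (w ([ffun j => r j], [ffun j => s j])); first by apply: map_f; rewrite mem_enum.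
  move=> j; rewrite !mxE !ffunE; split; first exact: rP.
  exact/cong_with_real/sP.
have h : (m (cube 0%N 0) <= m (cubes k [seq w i | i <- enum {: I}]))%E.
  by apply: le_measure; rewrite ?inE; [exact: measurable_cube|exact: measurable_cubes|].
apply: (le_trans h).
apply: (le_trans (haar_cubes_le _ _)).
by rewrite size_map -cardE card_prod !card_ffun !card_ord expnD.
Qed.

Lemma haar_cubes_disjoint k s : uniq s ->
  {in s &, forall v w, v != w -> cube k v `&` cube k w = set0} ->
  m (cubes k s) = ((size s)%:R%:E * m (cube k 0))%E.
Proof.
elim: s => [|v s IH] /=.
  by move=> _ _; rewrite mul0e (_ : cubes k [::] = set0) ?measure0//; apply/seteqP; split=> u // [].
move=> /andP[vs us] dis; rewrite cubes_cons.
have -> : m (cube k v `|` cubes k s) = (m (cube k v) + m (cubes k s))%E; last first.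
  rewrite IH//; last by move=> a b as_ bs; apply: dis; rewrite inE ?as_ ?bs orbT.
  by rewrite haar_cube -natr1 EFinD ge0_muleDl ?lee_fin// mul1e addeC.
apply: measureU; [exact: measurable_cube|exact: measurable_cubes|].
apply/seteqP; split=> // u [vu [w ws wu]].
rewrite -(dis v w _ _ _); first by split.
- exact: mem_head.
- by rewrite inE ws orbT.
- by apply: contraNneq vs => ->.
Qed.

(** A maximal family of disjoint cubes with corners in [N] is taken. By maximality each point of [N]
    is close to a corner. By disjointness the number of cubes is at most the measure of a
    neighbourhood of [N] divided by that of one cube, and these neighbourhoods shrink to [N], a
    closed set. *)
Lemma null_cover N (C e : R) D : (0 < D)%N -> closed N -> N `<=` @bdd R n C D -> m N = 0%E -> 0 < e ->
  \forall k \near \oo, exists s : seq V, [/\ N `<=` [set u | exists2 v, v \in s & closeM k v u],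
    (forall v, v \in s -> N v) & (size s)%:R <= e * (fct k)%:R ^+ (d + d)].
Proof.
move=> D0 cN ND N0 e0.
pose O k := [set u : V | exists2 v, N v & closeM k v u].
have oO k : open (O k).
  have -> : O k = \bigcup_(v in N) [set u | closeM k v u] by apply/seteqP; split=> u [v]; exists v.
  apply: bigcup_open => v _; exact: open_close_ball.
have mO k : measurable (O k : set BV) by exact: sub_sigma_algebra.
have OD : O 0%N `<=` @bdd R n (C + 1) D by move=> u [v Nv]; exact: close0_bdd (ND _ Nv).
have NE : \bigcap_k O k = N.
  apply/seteqP; split=> u; last by move=> Nu k _; exists u => //; exact: closeM_refl.
  move=> uO; rewrite ((closure_id N).1 cN) => P /closeM_nbhs[k kP].
  have [v Nv vu] := uO k I; exists v; split=> //; apply: kP => i j.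
  by have [h1 h2] := vu i j; split; [rewrite distrC|exact: cong_sym].
have lim : m (O k) @[k --> \oo] --> 0%E.
  rewrite -N0 -NE; apply: nonincreasing_cvg_mu => //.
  - apply: le_lt_trans (haar_bdd (C + 1) D0).
    by apply: le_measure; rewrite ?inE//; exact: measurable_bdd.
  - by rewrite NE -[N]setCK; apply: measurableC; apply: sub_sigma_algebra; exact: closed_openC.
  - move=> k l kl; apply/subsetPset => u [v Nv vu]; exists v => // i j; exact: close_mono kl (vu i j).
have U0 := unit_cube_gt0; have Ufin := unit_cube_fin.
have mUE : m (cube 0%N 0) = (fine (m (cube 0%N 0)))%:E by rewrite fineK// ge0_fin_numE// measure_ge0.
have u0 : 0 < fine (m (cube 0%N 0)) by rewrite fine_gt0// U0.
have lim' : fine (m (O k)) @[k --> \oo] --> (0 : R) by apply: fine_cvg; exact: lim.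
move/cvgrPdist_lt: lim' => /(_ _ (mulr_gt0 e0 u0)).
apply: filterS => k /=; rewrite sub0r normrN ger0_norm ?fine_ge0// => kl.
have Ofin : (m (O k) < +oo)%E.
  apply: le_lt_trans (haar_bdd (C + 1) D0).
  apply: le_measure; rewrite ?inE//; first exact: measurable_bdd.
  by apply: subset_trans OD => u [v Nv vu]; exists v => // i j; exact: close_mono (leq0n k) (vu i j).
have OE : m (O k) = (fine (m (O k)))%:E by rewrite fineK// ge0_fin_numE// measure_ge0.
pose good s := [/\ uniq s, {in s &, forall v w : V, v != w -> cube k v `&` cube k w = set0} & forall v, v \in s -> N v].
have bound s : good s -> (size s)%:R <= e * (fct k)%:R ^+ (d + d).
  move=> [us dis sN].
  have h1 : ((size s)%:R%:E * m (cube k 0) <= m (O k))%E.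
    rewrite -haar_cubes_disjoint//; apply: le_measure; rewrite ?inE//; first exact: measurable_cubes.
    by move=> u [v vs vu]; exists v; [exact: sN|exact: cube_sub].
  have h2 := unit_cube_le k.
  have h3 : ((size s)%:R%:E * m (cube 0%N 0) <= ((fct k) ^ (d + d))%:R%:E * m (O k))%E.
    apply: (le_trans (lee_wpmul2l _ h2)); first by rewrite lee_fin.
    by rewrite muleCA; apply: lee_wpmul2l; rewrite ?lee_fin.
  move: h3; rewrite mUE OE -!EFinM lee_fin => h3.
  rewrite -(ler_pM2r u0); apply: (le_trans h3); rewrite mulrAC -natrX mulrC.
  by rewrite ler_wpM2r// ltW.
have [K hK] : exists K, forall s, good s -> (size s <= K)%N.
  exists (Num.truncn (e * (fct k)%:R ^+ (d + d))).+1 => s /bound h.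
  by rewrite -(ler_nat R); apply: (le_trans h); apply: ltW; exact: truncnS_gt.
have [s [gs smax]] : exists s, good s /\ forall s', good s' -> (size s' <= size s)%N.
  pose P j := `[< exists2 s, good s & size s = j >].
  have exP : exists j, P j by exists 0%N; apply/asboolP; exists [::].
  have Pb j : P j -> (j <= K)%N by move=> /asboolP[s gs <-]; exact: hK.
  have [j /asboolP[s gs sj] jmax] := ex_maxnP exP Pb.
  exists s; split=> // s' gs'; rewrite sj; apply: jmax; apply/asboolP; by exists s'.
exists s; split; [|by case: gs|exact: bound].
move=> u Nu; apply: contrapT => nu.
suff /smax : good (u :: s) by rewrite /= ltnn.
have nus : u \notin s by apply/negP => us; apply: nu; exists u => //; exact: closeM_refl.
have dis v : v \in s -> cube k v `&` cube k u = set0.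
  by move=> vs; apply/seteqP; split=> // w [vw uw]; apply: nu; exists v => //; exact: cube_close vw uw.
have [us dd sN] := gs; split=> /=; first by rewrite nus.
  move=> a b; rewrite !inE => /orP[/eqP ->|as_] /orP[/eqP ->|bs]; rewrite ?eqxx//.
  - by move=> _; rewrite setIC; exact: dis.
  - by move=> _; exact: dis.
  - exact: dd.
by move=> v; rewrite inE => /orP[/eqP ->|/sN].
Qed.

End HaarTiling.

(** * Lattices meeting a null set *)

Section Counting.
Variable R : realType.
Local Notation leb := (@lebesgue_measure R).

Lemma int_window (a c b l : R) : 0 < b -> 0 <= l -> exists p1 : int, exists K : nat,
  K%:R <= 2 * l / b + 1 /\
  forall p : int, `|a + b * p%:~R - c| <= l -> exists2 i, (i < K)%N & p = p1 + i%:Z.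
Proof.
move=> b0 l0; pose y := (c - l - a) / b; pose z := 2 * l / b.
have z0 : 0 <= z by rewrite divr_ge0 ?mulr_ge0// ltW.
exists (Num.ceil y), (Num.truncn z).+1; split.
  by rewrite -natr1 lerD2r; have /andP[] := truncn_itv z0.
move=> p; rewrite ler_norml => /andP[h1 h2].
have py : y <= p%:~R by rewrite ler_pdivrMr// mulrC; lra.
have pz : p%:~R - y <= z.
  have E : (p%:~R - y) * b = a + b * p%:~R - c + l by rewrite mulrBl divfK ?gt_eqF//; ring.
  by rewrite -(ler_pM2r b0) E divfK ?gt_eqF//; lra.
have cp : Num.ceil y <= p by rewrite ceil_le_int.
exists `|p - Num.ceil y|%N; last by rewrite gez0_abs ?subr_ge0//; lia.
rewrite ltnS truncn_ge_nat// -[_%:R]/((`|p - Num.ceil y|%N : int)%:~R) gez0_abs ?subr_ge0//.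
by rewrite rmorphB /=; apply: le_trans pz; rewrite lerD2l lerN2; exact: ceil_ge.
Qed.

Lemma lebesgue_centered_le (u r : R) : 0 <= r -> (leb `[(u - r)%R, (u + r)%R]%classic <= (2 * r)%:E)%E.
Proof.
move=> r0; rewrite lebesgue_measure_itv /= lte_fin; case: ifPn => _.
  by rewrite -EFinB lee_fin; lra.
by rewrite lee_fin mulr_ge0.
Qed.

(** As [x] stays in [0, 1] and [rho <= 1 <= b], at most [|q| / b + 3] integers [p] matter, and each
    confines [x] to an interval of length [2 * rho / |q|]. The product is at most [8 * rho] divided
    by the minimum of [b] and [|q|]. *)
Lemma strip_cover (a c rho b q : R) : 1 <= b -> 0 <= rho <= 1 -> q != 0 ->
  exists A : set R, [/\ measurable A, (leb A <= (8 * rho / Num.min b `|q|)%:E)%E &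
    forall x, 0 <= x <= 1 -> forall p : int, `|a + b * p%:~R - q * x - c| <= rho -> A x].
Proof.
move=> b1 /andP[r0 r1] q0; have b0 : 0 < b by lra.
have nq0 : 0 < `|q| by rewrite normr_gt0.
have l0 : 0 <= rho + `|q| / 2 by rewrite addr_ge0// divr_ge0.
have [p1 [K [Kl Kp]]] := @int_window a (c + q / 2) b _ b0 l0.
pose J i : set R := `[(a + b * (p1 + i%:Z)%:~R - c) / q - rho / `|q|, (a + b * (p1 + i%:Z)%:~R - c) / q + rho / `|q|]%classic.
have mJ i : measurable (J i) by exact: measurable_itv.
have bA : measurable (\big[setU/set0]_(i < K) J i) by exact: bigsetU_measurable.
exists (\big[setU/set0]_(i < K) J i); split=> //.
- have h : (leb (\big[setU/set0]_(i < K) J i) <= \sum_(i < K) leb (J i))%E.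
    by apply: content_subadditive => // i _; exact: mJ.
  apply: (le_trans h).
  have Jl (i : 'I_K) (_ : true) : (leb (J i) <= (2 * rho / `|q|)%:E)%E.
    by apply: le_trans (lebesgue_centered_le _ _) _; [rewrite divr_ge0|rewrite mulrA].
  rewrite (le_trans (lee_sum _ Jl))// sumEFin lee_fin sumr_const card_ord -[_ *+ K]mulr_natl.
  have Kb : K%:R * b <= `|q| + 3 * b.
    have := ler_wpM2r (ltW b0) Kl; rewrite mulrDl divfK ?gt_eqF// mul1r; lra.
  have [bq|qb] := leP b `|q|.
    rewrite -(ler_pM2r (mulr_gt0 b0 nq0)).
    have -> : K%:R * (2 * rho / `|q|) * (b * `|q|) = K%:R * b * (2 * rho) by field; rewrite gt_eqF.
    have -> : 8 * rho / b * (b * `|q|) = 4 * `|q| * (2 * rho) by field; rewrite gt_eqF.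
    by apply: ler_wpM2r; [rewrite mulr_ge0|lra].
  have K4 : K%:R <= 4 :> R by rewrite -(ler_pM2r b0); lra.
  have -> : 8 * rho / `|q| = 4 * (2 * rho / `|q|) by ring.
  by apply: ler_wpM2r => //; rewrite divr_ge0// mulr_ge0.
move=> x /andP[x0 x1] p h.
have [|i iK pE] := Kp p.
  have -> : a + b * p%:~R - (c + q / 2) = (a + b * p%:~R - q * x - c) + q * (x - 2^-1) by field.
  apply: (le_trans (ler_normD _ _)); apply: lerD => //; rewrite normrM ler_pM2l//.
  by rewrite ler_norml; lra.
rewrite (bigD1 (Ordinal iK))//=; left; rewrite /J /= in_itv /= -pE.
set y := a + b * _; rewrite -ler_distl ler_pdivlMr// -normrM mulrBl divfK// distrC.
by have -> : y - c - x * q = y - q * x - c by ring.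
Qed.

Variable n : nat.
Local Notation d := n.+1.

(** For each leading coordinate [q i] the conditions on the coordinates of [x] decouple, whence the
    power [n]. The value 0 of [q i] is a filler marking indices to be ignored. *)
Lemma slab_cover (L : {measure set (borel 'rV[R]_n) -> \bar R}) (LE : forall B, measurable B -> L B = lebesgue_rV B)
  (K : nat) (a c : 'I_n -> R) (b g rho : R) (q : 'I_K -> R) :
  1 <= b -> 0 <= rho <= 1 -> 0 < g -> (forall i, q i != 0 -> g <= Num.min b `|q i|) ->
  exists B : set (borel 'rV[R]_n), [/\ measurable B, (L B <= (K%:R * (8 * rho / g) ^+ n)%:E)%E &
    forall i (x : 'rV[R]_n), q i != 0 -> (forall j, 0 <= x ord0 j <= 1) ->
      forall p : 'I_n -> int, (forall j, `|a j + b * (p j)%:~R - q i * x ord0 j - c j| <= rho) -> B x].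
Proof.
move=> b1 r01 g0 gq; have /andP[r0 r1] := r01.
have hA (i : 'I_K) (j : 'I_n) : exists A : set R, [/\ measurable A, (leb A <= (8 * rho / g)%:E)%E &
    q i != 0 -> forall x, 0 <= x <= 1 -> forall p : int, `|a j + b * p%:~R - q i * x - c j| <= rho -> A x].
  have [q0|q0] := eqVneq (q i) 0; first by exists set0; split=> //; rewrite measure0 lee_fin divr_ge0 ?mulr_ge0// ltW.
  have [A [mA lA hA]] := strip_cover (a j) (c j) b1 r01 q0.
  exists A; split=> //; apply: (le_trans lA); rewrite lee_fin ler_wpM2l ?mulr_ge0//.
  by rewrite lef_pV2 ?posrE ?gq// (lt_le_trans g0 (gq _ q0)).
have [A' AP'] := choice (fun ij : 'I_K * 'I_n => hA ij.1 ij.2).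
pose A i j := A' (i, j); have AP i j := AP' (i, j).
pose S i : set (borel 'rV[R]_n) := [set x : 'rV[R]_n | forall j, A i j (x ord0 j)].
have mS i : measurable (S i).
  have -> : S i = \bigcap_(j in [set: 'I_n]) [set x : 'rV[R]_n | A i j (x ord0 j)].
    by apply/seteqP; split=> x /= h j => [_|]; [exact: h|exact: h].
  apply: fin_bigcap_measurable => // j _.
  by have [mA _ _] := AP i j; have := @measurable_coord R n j measurableT _ mA; rewrite setTI.
have LS i : (L (S i) <= ((8 * rho / g) ^+ n)%:E)%E.
  rewrite LE// /S lebesgue_rV_box; last by move=> j; have [] := AP i j.
  rewrite -[n in _ ^+ n]card_ord -prodr_const -prodEFin.
  have [] // : (0 <= \prod_(j < n) leb (A i j) /\ \prod_(j < n) leb (A i j) <= \prod_(j in 'I_n) (8 * rho / g)%:E)%E.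
  elim/big_ind2: _ => [|x1 x2 y1 y2 [h1 h2] [h3 h4]|j _]; first by rewrite lee_fin.
    by split; [exact: mule_ge0|exact: lee_pmul].
  by rewrite measure_ge0; have [_ -> _] := AP i j.
pose F k : set (borel 'rV[R]_n) := if insub k is Some i then S i else set0.
have mF k : measurable (F k) by rewrite /F; case: insub.
exists (\big[setU/set0]_(k < K) F k); split; first exact: bigsetU_measurable.
  have h : (L (\big[setU/set0]_(k < K) F k) <= \sum_(k < K) L (F k))%E.
    by apply: content_subadditive => //; exact: bigsetU_measurable.
  apply: (le_trans h); have Fle (k : 'I_K) (_ : true) : (L (F k) <= ((8 * rho / g) ^+ n)%:E)%E by rewrite /F valK.
  by rewrite (le_trans (lee_sum _ Fle))// sumEFin lee_fin sumr_const card_ord -[_ *+ K]mulr_natl.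
move=> i x q0 x01 p h; rewrite (bigD1 i)//=; left; rewrite /F valK => j.
by have [_ _ H] := AP i j; exact: H (h j).
Qed.

Lemma common_denominator (a : 'I_d -> rat) : exists2 D : nat, (0 < D)%N & forall i, exists z : int, D%:R * a i = z%:~R.
Proof.
exists (\prod_i `|denq (a i)|)%N.
  by rewrite prodn_gt0// => i; rewrite absz_gt0 denq_neq0.
move=> i; exists ((\prod_(j | j != i) `|denq (a j)|)%N%:Z * numq (a i)).
rewrite (bigD1 i)//= natrM rmorphM /= -[((_ : nat)%:Z)%:~R]pmulrn mulrAC -[RHS]mulrC; congr (_ * _).
by rewrite -{2}[a i]divq_num_den mulrCA pmulrn gez0_abs// divff ?mulr1// intr_eq0 denq_neq0.
Qed.

(** The powers of [T] cancel: about [T ^+ n] leading coordinates, each accounting for a set of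
    measure of order [1 / T ^+ n]. *)
Lemma hit_scaling (N T : R) : N != 0 -> T != 0 ->
  3 * (2 / N) * T ^+ n / N * (8 * 2 / N ^+ 2 / T) ^+ n = 3 * 8 ^+ n * 2 ^+ d / N ^+ (d + d).
Proof.
move=> N0 T0; have Nn : N ^+ n != 0 by rewrite expf_neq0.
have Tn : T ^+ n != 0 by rewrite expf_neq0.
have -> : (8 * 2 / N ^+ 2 / T) ^+ n = 8 ^+ n * 2 ^+ n / (N ^+ n * N ^+ n) / T ^+ n.
  by rewrite !expr_div_n exprMn -exprM mul2n -addnn exprD.
have -> : N ^+ (d + d) = N * N * (N ^+ n * N ^+ n) by rewrite exprD exprS; ring.
rewrite exprS; move: Nn Tn; move: (N ^+ n) (T ^+ n) (8 ^+ n) (2 ^+ n) => u w x y u0 w0.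
by field; rewrite u0 w0 N0.
Qed.

(** The first summand comes from leading coordinates of size at least [N], the 1 from the smaller
    ones, whose share is negligible for large [T]. *)
Definition hit_const : R := 3 * 8 ^+ n * 2 ^+ d + 1.

(** Here [T] is [expR t], and vectors of one class modulo [N] are sorted by the leading coordinate
    [q_0]. If [|q_0| >= N], the number of values is of order [T ^+ n / N ^+ 2] and [slab_cover]
    applies to each. If [0 < |q_0| < N], there are at most three values, bounded below by [1 / D],
    and their share tends to 0. If [q_0 = 0], some other coordinate is at least [1 / D] in absolute
    value and is expanded out of the box. *)
Lemma orbit_hits (L : {measure set (borel 'rV[R]_n) -> \bar R}) (LE : forall B, measurable B -> L B = lebesgue_rV B)
  (N : nat) (a : 'I_d -> rat) (c : 'I_d -> R) : (0 < n)%N -> (0 < N)%N ->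
  exists T0 : R, forall T, T0 <= T -> exists B : set (borel 'rV[R]_n),
  [/\ measurable B, (L B <= (hit_const / N%:R ^+ (d + d))%:E)%E &
    forall (x : 'rV[R]_n) (q : 'rV[rat]_d), (forall j, 0 <= x ord0 j <= 1) -> q != 0 ->
      (forall i, exists p : int, q ord0 i = a i + N%:R * p%:~R) ->
      `|c ord0 - ratr (q ord0 ord0) / T ^+ n| <= 2 / N%:R ->
      (forall j, `|c (lift ord0 j) - (ratr (q ord0 (lift ord0 j)) - ratr (q ord0 ord0) * x ord0 j) * T| <= 2 / N%:R) ->
      B x].
Proof.
move=> n0 N0; have [D D0 Da] := common_denominator a.
have NR : (0 : R) < N%:R by rewrite ltr0n.
have NR1 : (1 : R) <= N%:R by rewrite ler1n.
have DR : (0 : R) < D%:R by rewrite ltr0n.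
have DR1 : (1 : R) <= D%:R by rewrite ler1n.
pose s : R := 2 / N%:R; have s0 : 0 < s by rewrite divr_gt0.
pose S := \sum_i `|c i|; have S0 : 0 <= S by rewrite sumr_ge0.
pose E := 3 * (8 * s * D%:R) ^+ n * N%:R ^+ (d + d).
have E0 : 0 <= E by rewrite !mulr_ge0// ?exprn_ge0// ?mulr_ge0// ltW.
have Ns0 : 0 <= N%:R / s by rewrite divr_ge0// ltW.
have SD0 : 0 <= (S + s) * D%:R by rewrite mulr_ge0 ?addr_ge0// ltW.
exists (1 + s + (S + s) * D%:R + N%:R / s + E + 1) => T TT.
have T1 : 1 <= T by lra.
have Ts : s <= T by lra.
have TS : (S + s) * D%:R < T by lra.
have TN : N%:R / s <= T by lra.
have TE : E <= T by lra.
have T0 : 0 < T by lra.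
(* This is where [0 < n] enters. *)
have TW : T <= T ^+ n by rewrite -{1}[T]expr1 ler_weXn2l.
have W0 : 0 < T ^+ n by rewrite exprn_gt0.
pose rho := s / T; have r01 : 0 <= rho <= 1 by apply/andP; split; [rewrite divr_ge0// ltW|rewrite ler_pdivrMr// mul1r].
have den (q : 'rV[rat]_d) i : (exists p : int, q ord0 i = a i + N%:R * p%:~R) -> q ord0 i != 0 -> D%:R^-1 <= `|ratr (q ord0 i)| :> R.
  move=> [p qE] q0; have [z zE] := Da i.
  have qD : D%:R * q ord0 i = (z + D%:Z * (N%:Z * p))%:~R by rewrite qE mulrDr zE !rmorphD !rmorphM.
  have qD0 : z + D%:Z * (N%:Z * p) != 0.
    by rewrite -(intr_eq0 rat) -qD mulf_neq0// pnatr_eq0 -lt0n.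
  rewrite -(ler_pM2l DR) divff ?gt_eqF// -{1}(ger0_norm (ltW DR)) -normrM.
  have -> : D%:R * ratr (q ord0 i) = ratr (D%:R * q ord0 i) :> R by rewrite rmorphM /= ratr_nat.
  by rewrite qD ratr_int -intr_norm ler1z -gtz0_ge1 normr_gt0.
pose aj j : R := ratr (a (lift ord0 j)); pose cj j := c (lift ord0 j) / T.
pose a0 : R := ratr (a ord0).
have [p1 [K1 [K1l K1p]]] := @int_window a0 (c ord0 * T ^+ n) N%:R (s * T ^+ n) NR (ltW (mulr_gt0 s0 W0)).
have [p2 [K2 [K2l K2p]]] := @int_window a0 0 N%:R N%:R NR (ltW NR).
(* Values outside the intended range are replaced by the filler 0 of [slab_cover]. *)
pose q1 (i : 'I_K1) := let y := a0 + N%:R * (p1 + i%:Z)%:~R in if N%:R <= `|y| then y else 0.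
pose q2 (i : 'I_K2) := let y := a0 + N%:R * (p2 + i%:Z)%:~R in if D%:R^-1 <= `|y| then y else 0.
have [|B1 [mB1 LB1 hB1]] := @slab_cover L LE K1 aj cj N%:R N%:R rho q1 NR1 r01 NR.
  by move=> i; rewrite /q1 /=; case: ifP => [h _|]; rewrite ?eqxx// le_min lexx.
have [||B2 [mB2 LB2 hB2]] := @slab_cover L LE K2 aj cj N%:R D%:R^-1 rho q2 NR1 r01.
- by rewrite invr_gt0.
- move=> i; rewrite /q2 /=; case: ifP => [h _|]; rewrite ?eqxx// le_min h andbT.
  by apply: le_trans NR1; rewrite invf_le1.
exists (B1 `|` B2); split; first exact: measurableU.
- have h : (L (B1 `|` B2) <= L B1 + L B2)%E by exact: measureU2.
  apply: (le_trans h); apply: (le_trans (leeD LB1 LB2)); rewrite -EFinD lee_fin.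
  have Nd : 0 < N%:R ^+ (d + d) :> R by rewrite exprn_gt0.
  have h2 : K2%:R * (8 * rho / D%:R^-1) ^+ n <= 1 / N%:R ^+ (d + d).
    have -> : 8 * rho / D%:R^-1 = 8 * s * D%:R / T by rewrite invrK /rho; field; rewrite gt_eqF.
    have K23 : K2%:R <= 3 :> R by rewrite (le_trans K2l)// mulfK ?gt_eqF// natr1.
    rewrite expr_div_n ler_pdivlMr//.
    apply: (@le_trans _ _ (E / T ^+ n)); last by rewrite ler_pdivrMr// mul1r (le_trans TE).
    have -> : E / T ^+ n = 3 * ((8 * s * D%:R) ^+ n / T ^+ n) * N%:R ^+ (d + d) by rewrite /E mulrAC mulrA.
    apply: ler_wpM2r; first exact: ltW.
    apply: ler_wpM2r => //.
    by rewrite divr_ge0 ?exprn_ge0 ?mulr_ge0// ltW.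
  have h1 : K1%:R * (8 * rho / N%:R) ^+ n <= 3 * 8 ^+ n * 2 ^+ d / N%:R ^+ (d + d).
    have K13 : K1%:R <= 3 * s * T ^+ n / N%:R.
      have h3 : 1 <= s * T ^+ n / N%:R.
        by rewrite ler_pdivlMr// mul1r mulrC -ler_pdivrMr// (le_trans TN).
      have -> : 3 * s * T ^+ n / N%:R = 2 * (s * T ^+ n) / N%:R + s * T ^+ n / N%:R by field; rewrite gt_eqF.
      by apply: (le_trans K1l); rewrite lerD2l.
    apply: (@le_trans _ _ (3 * s * T ^+ n / N%:R * (8 * rho / N%:R) ^+ n)).
      apply: ler_wpM2r => //; apply: exprn_ge0; apply: divr_ge0; last exact: ltW.
      by apply: mulr_ge0 => //; case/andP: r01.
    rewrite le_eqVlt; apply/orP; left; apply/eqP.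
    have -> : 8 * rho / N%:R = 8 * 2 / N%:R ^+ 2 / T by rewrite /rho /s; field; rewrite !gt_eqF.
    by rewrite /s; apply: hit_scaling; rewrite gt_eqF.
  have -> : hit_const / N%:R ^+ (d + d) = 3 * 8 ^+ n * 2 ^+ d / N%:R ^+ (d + d) + 1 / N%:R ^+ (d + d) by rewrite -mulrDl.
  exact: lerD.
move=> x q x01 q0 qp q00 qj.
have E00 : exists2 p0 : int, ratr (q ord0 ord0) = a0 + N%:R * p0%:~R & true.
  by have [p ->] := qp ord0; exists p => //; rewrite rmorphD rmorphM /= ratr_nat ratr_int.
have [p0 p0E _] := E00.
have hp : forall j, exists p : int, `|aj j + N%:R * p%:~R - ratr (q ord0 ord0) * x ord0 j - cj j| <= rho.
  move=> j; have [p pE] := qp (lift ord0 j); exists p.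
  have -> : aj j + N%:R * p%:~R = ratr (q ord0 (lift ord0 j)) by rewrite pE rmorphD rmorphM /= ratr_nat ratr_int.
  rewrite /rho ler_pdivlMr// -[X in _ * X <= _](gtr0_norm T0) -normrM mulrBl /cj divfK ?gt_eqF// distrC.
  exact: qj.
have [pj pjP] := choice hp.
have {}q00 : `|ratr (q ord0 ord0) - c ord0 * T ^+ n| <= s * T ^+ n.
  rewrite distrC -[X in _ <= s * X](gtr0_norm W0) -ler_pdivrMr ?normr_gt0 ?gt_eqF// -normfV -normrM mulrBl mulfK ?gt_eqF//.
have [Q0|Q0] := eqVneq (q ord0 ord0) 0.
  have [i qi0] : exists i, q ord0 i != 0.
    by apply/existsP; apply: contraNT q0 => /existsPn h; apply/eqP/matrixP => i j; rewrite ord1 mxE; apply/eqP/negPn/h.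
  have [j ij|ij] := unliftP ord0 i; last by move: qi0; rewrite ij Q0 eqxx.
  have := den q i (qp i) qi0; have := qj j; rewrite -ij Q0 rmorph0 mul0r subr0 => h1 h2.
  have h3 : `|c i| <= S by rewrite /S (bigD1 i)//= lerDl sumr_ge0.
  have h4 : `|ratr (q ord0 i) * T| <= S + s.
    have -> : ratr (q ord0 i) * T = c i - (c i - ratr (q ord0 i) * T) by ring.
    by apply: (le_trans (ler_normB _ _)); exact: lerD.
  have : (S + s) * D%:R < (S + s) * D%:R.
    apply: (lt_le_trans TS); rewrite -ler_pdivrMr//; apply: le_trans h4.
    by rewrite normrM (gtr0_norm T0) mulrC ler_pM2r.
  by rewrite ltxx.
have Qd := den q ord0 (qp ord0) Q0.
have QR : ratr (q ord0 ord0) != 0 :> R by rewrite fmorph_eq0.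
have [Nq|qN] := leP N%:R `|ratr (q ord0 ord0) : R|.
  have [|i iK pE] := K1p p0; first by rewrite -p0E.
  left; have qE : q1 (Ordinal iK) = ratr (q ord0 ord0) by rewrite /q1 /= -pE -p0E Nq.
  by apply: (hB1 (Ordinal iK) x _ x01 pj); rewrite qE.
have [|i iK pE] := K2p p0; first by rewrite -p0E subr0 ltW.
right; have qE : q2 (Ordinal iK) = ratr (q ord0 ord0) by rewrite /q2 /= -pE -p0E Qd.
by apply: (hB2 (Ordinal iK) x _ x01 pj); rewrite qE.
Qed.

End Counting.

Lemma mean_indic d (T : measurableType d) (R : realType) (m : {measure set T -> \bar R}) (B : set T) :
  measurable B -> \int[m]_x (\1_B x : R) = fine (m B).
Proof. by move=> mB; rewrite /Rintegral integral_indic// setIT. Qed.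

Section UniformProbability.
Variables (R : realType) (N : nat) (L : {measure set (borel 'rV[R]_N) -> \bar R}).
Hypothesis LE : forall B, measurable B -> L B = lebesgue_rV B.
Definition unit_box : set (borel 'rV[R]_N) := hbox 0 (const_mx 1).

Lemma measurable_unit_box : measurable unit_box.
Proof. exact: measurable_hbox. Qed.

Definition uniform_box : set (borel 'rV[R]_N) -> \bar R := mrestr L measurable_unit_box.
HB.instance Definition _ := Measure.on uniform_box.

Lemma uniform_boxT : uniform_box setT = 1%E.
Proof.
rewrite /uniform_box /mrestr setTI LE; last exact: measurable_unit_box.
rewrite hbox_lebesgue => [|i]; last by rewrite !mxE.
by rewrite big1// => i _; rewrite !mxE subr0.
Qed.

HB.instance Definition _ := Measure_isProbability.Build _ _ _ uniform_box uniform_boxT.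

Lemma uniform_probability : exists lam : probability (borel 'rV[R]_N) R,
  lam `<< @lebesgue_rV R N /\ forall B, lam B = L (B `&` unit_box).
Proof.
exists uniform_box; split=> // B lB A mA AB; apply/eqP; rewrite eq_le measure_ge0 andbT.
rewrite -(lB A mA AB) -LE//= /uniform_box /mrestr.
by apply: le_measure; rewrite ?inE//; apply: measurableI => //; exact: measurable_unit_box.
Qed.

End UniformProbability.

Section RealCoordinates.
Variables (R : realType) (n : nat).
Local Notation d := n.+1.
Local Notation delta := (@delta R).

Lemma qvec_real (h : SL R d) (q : 'rV[rat]_d) i :
  adele_real (qvec (iotaSL h) q ord0 i) = \sum_j ratr (q ord0 j) * val h j i.
Proof.
rewrite /qvec mxE adele_real_sum; apply: eq_bigr => j _.
rewrite adele_realM mxE adele_real_delta; congr (_ * _).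
by have /matrixP/(_ j i) := iota_real h; rewrite mxE.
Qed.

Lemma qvec_padic p (h : SL R d) (q : 'rV[rat]_d) i :
  adele_padic p (qvec (iotaSL h) q ord0 i) = adele_padic p (delta (q ord0 i)).
Proof.
rewrite /qvec mxE raddf_sum /= (bigD1 i)//= big1 ?addr0 => [|j ji]; rewrite adele_padicM mxE.
  have /matrixP/(_ i i) := iota_padic h p; rewrite !mxE eqxx => ->; exact: mulr1.
have /matrixP/(_ j i) := iota_padic h p; rewrite !mxE (negPf ji) => ->; exact: mulr0.
Qed.

Lemma qvec_flow_hd (x : 'rV[R]_n) t (q : 'rV[rat]_d) :
  adele_real (qvec (iotaSL (unip_mx x * Phi n t)%g) q ord0 ord0) = ratr (q ord0 ord0) / expR t ^+ n.
Proof.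
rewrite qvec_real big_ord_recl big1 ?addr0 => [|j _]; rewrite mulmx_Phi.
  by rewrite unip00 mul1r /phi eqxx expRN -expRM_natl.
by rewrite unipi0 mul0r mulr0.
Qed.

Lemma qvec_flow_tl (x : 'rV[R]_n) t (q : 'rV[rat]_d) j :
  adele_real (qvec (iotaSL (unip_mx x * Phi n t)%g) q ord0 (lift ord0 j)) =
  (ratr (q ord0 (lift ord0 j)) + ratr (q ord0 ord0) * x ord0 j) * expR t.
Proof.
rewrite qvec_real big_ord_recl (bigD1 j)// big1 ?addr0 => [|k kj]; rewrite !mulmx_Phi.
  by rewrite unip0j unipij eqxx /phi eq_sym (negPf (neq_lift _ _)) /= addr0; ring.
by rewrite unipij (negPf kj) mul0r mulr0.
Qed.

End RealCoordinates.

Section NullSets.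
Variables (R : realType) (n : nat).
Local Notation d := n.+1.
Local Notation X := (SLQ_SLA R d).
Local Notation V := 'rV[adele R]_d.
Local Notation delta := (@delta R).
Variable m : {measure set (borel V) -> \bar R}.
Hypothesis m_haar : is_haar m.
Variable mu : probability (borel X) R.
Hypothesis mu_inv : is_invariant mu.
Hypothesis n_gt0 : (0 < n)%N.

Lemma cell_hits (L : {measure set (borel 'rV[R]_n) -> \bar R}) (LE : forall B, measurable B -> L B = lebesgue_rV B)
  k (z : V) : \forall j \near \oo, exists B : set (borel 'rV[R]_n),
  [/\ measurable B, (L B <= (hit_const R n / (fct k)%:R ^+ (d + d))%:E)%E &
    forall (x : 'rV[R]_n) (q : 'rV[rat]_d) (a : V), unit_box x -> q != 0 -> closeM k z a ->
      closeM k a (qvec (iotaSL (unip_mx (- x) * Phi n j%:R)%g) q) -> B x].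
Proof.
have [a az] := choice (fun i => adele_density (z ord0 i) (fct_gt0 k)).
have [T0 hT] := orbit_hits LE a (fun i => adele_real (z ord0 i)) n_gt0 (fct_gt0 k).
exists (Num.truncn T0).+1 => // j /= jT.
have [|B [mB LB hB]] := hT (expR j%:R).
  apply: le_trans (expR_ge1Dx _); rewrite ltW// (lt_le_trans (truncnS_gt _))//.
  by rewrite (@le_trans _ _ j%:R) ?ler_nat// lerDr.
exists B; split=> // x q b xb q0 zb bq.
have fk0 : (0 : R) < (fct k)%:R by rewrite ltr0n fct_gt0.
have dist i : `|adele_real (z ord0 i) - adele_real (qvec (iotaSL (unip_mx (- x) * Phi n j%:R)%g) q ord0 i)| <= 2 / (fct k)%:R.
  have [h1 _] := zb ord0 i; have [h2 _] := bq ord0 i.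
  apply: (le_trans (ler_distD (adele_real (b ord0 i)) _ _)).
  by rewrite mulr_natl mulr2n; apply: lerD; exact: ltW.
apply: (hB x q) => //.
- by move=> i; have := xb i; rewrite !mxE => /andP[-> /ltW].
- move=> i; have [_ h1] := zb ord0 i; have [_ h2] := bq ord0 i.
  have h3 : cong (fct k) (delta (a i)) (delta (q ord0 i)).
    apply: cong_trans (cong_sym (az i)) _; apply: cong_trans h1 _; move: h2; rewrite !congE => h2 p.
    by have := h2 p; rewrite !adele_padicM !adele_padicB qvec_padic.
  have [u uE] := (cong_delta _ _ _ (fct_gt0 k)).1 h3.
  by exists u; rewrite mulrC -uE addrC subrK.
- by have := dist ord0; rewrite qvec_flow_hd.
- by move=> i; have := dist (lift ord0 i); rewrite qvec_flow_tl mxE mulrN.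
Qed.

Lemma lattice_avoids_null (N : set V) (C : R) D : (0 < D)%N -> 0 <= C -> closed N -> N `<=` bdd C D -> m N = 0%E ->
  mu [set x | `I_1 #<= lattice_points N x] = 0%E.
Proof.
move=> D0 C0 cN ND N0.
have mN : measurable (N : set (borel V)).
  by rewrite -[N]setCK; apply: measurableC; apply: sub_sigma_algebra; exact: closed_openC.
have mbad : measurable ([set x | `I_1 #<= lattice_points N x] : set (borel X)) by exact: measurable_count mN ND.
set bad := [set x | _] in mbad *.
have [L LE] := lebesgue_rV_measure R n.
have [lam0 [lam0_ac lam0E]] := uniform_probability LE.
suff small (e : R) : 0 < e -> fine (mu bad) <= e * hit_const R n.
  have fb : (mu bad < +oo)%E by apply: le_lt_trans (mu_fin mu); apply: le_measure; rewrite ?inE.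
  rewrite -[LHS]fineK ?ge0_fin_numE//; congr EFin; apply/eqP; rewrite eq_le fine_ge0// andbT.
  have hc : 0 < hit_const R n by rewrite ltr_wpDl// !mulr_ge0 ?exprn_ge0.
  apply/ler_addgt0Pl => e e0; rewrite addr0.
  by have := small (e / hit_const R n) (divr_gt0 e0 hc); rewrite divfK ?gt_eqF.
move=> e0.
(* The scale [k] is fixed here and the time [j] tends to infinity afterwards: the bound on hits
   holds only beyond a time that depends on the finitely many cells. *)
have [k _ /(_ k (leqnn k)) [s [cov sN ssz]]] := null_cover m_haar D0 cN ND N0 e0.
pose f := soft_count (bump k N) 1 : X -> R.
have nf : nice f by apply: nice_soft_count; exact: tame_bump ND.
have bf := nice_bmf nf.
have step1 : fine (mu bad) <= \int[mu]_x f x.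
  rewrite -mean_indic//; apply: mean_le => //; [exact: mu_fin|exact: bmf_indic|].
  move=> x _; rewrite indicE; case: (boolP (x \in bad)) => [/set_mem xb|_]; last by have /andP[] := soft_count01 (bump k N) 1 x.
  apply: soft_count_ge; first by rewrite ler01 lexx.
  apply: card_le_trans xb _; apply: subset_card_le => v [[Nv xv] v0]; split=> //; split=> //.
  by rewrite /level_set /= bump1.
have lim : \int[lam0]_x horo f (piX 1%g) j%:R x @[j --> \oo] --> \int[mu]_x f x.
  apply: (@horo_limit _ _ lam0 lam0_ac f (piX 1%g) nf mu mu_inv (fun j => j%:R)); exact: cvgr_idn.
apply: (le_trans step1); rewrite -(cvg_lim (@norm_hausdorff _ R^o) lim).
have hits : \forall j \near \oo, forall z, z \in s -> exists B : set (borel 'rV[R]_n),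
  [/\ measurable B, (L B <= (hit_const R n / (fct k)%:R ^+ (d + d))%:E)%E &
    forall (x : 'rV[R]_n) (q : 'rV[rat]_d) (a : V), unit_box x -> q != 0 -> closeM k z a ->
      closeM k a (qvec (iotaSL (unip_mx (- x) * Phi n j%:R)%g) q) -> B x].
  elim: (s) => [|z s' IH]; first by apply: nearW => j z.
  move: IH (cell_hits LE k z); apply: filterS2 => j h1 h2 z'; rewrite inE => /orP[/eqP ->//|]; exact: h1.
apply: limr_le; first by apply/cvg_ex; exists (\int[mu]_x f x).
move: hits; apply: filterS => j hB.
have [B [mB LB BP]] : exists B : set (borel 'rV[R]_n), [/\ measurable B,
    (L B <= ((size s)%:R * (hit_const R n / (fct k)%:R ^+ (d + d)))%:E)%E &
    forall (x : 'rV[R]_n) (q : 'rV[rat]_d) (a z : V), z \in s -> unit_box x -> q != 0 -> closeM k z a ->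
      closeM k a (qvec (iotaSL (unip_mx (- x) * Phi n j%:R)%g) q) -> B x].
  elim: (s) hB => [|z s' IH] hB.
    by exists set0; split=> //; rewrite measure0 mul0r.
  have [|B [mB LB BP]] := IH; first by move=> z' zs; apply: hB; rewrite inE zs orbT.
  have [B' [mB' LB' BP']] := hB z (mem_head _ _).
  exists (B `|` B'); split; first exact: measurableU.
    have h : (L (B `|` B') <= L B + L B')%E by exact: measureU2.
    by apply: (le_trans h); apply: (le_trans (leeD LB LB')); rewrite -EFinD lee_fin /= -[in leRHS]natr1 [leRHS]mulrDl mul1r.
  move=> x q a z'; rewrite inE => /orP[/eqP ->|zs] xb q0 za aq; first by right; exact: BP' za aq.
  by left; exact: BP zs xb q0 za aq.
(* Hits are controlled only for [x] in the unit box, so its complement is added; [lam0] gives it no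
   mass. *)
have mB' : measurable (B `|` ~` @unit_box R n).
  by apply: measurableU => //; apply: measurableC; exact: measurable_unit_box.
have le1 : \int[lam0]_x horo f (piX 1%g) j%:R x <= \int[lam0]_x (\1_(B `|` ~` @unit_box R n) x : R).
  have lamfin : (lam0 setT < +oo)%E by rewrite probability_setT ltry.
  apply: (@mean_le _ _ _ lam0 setT measurableT lamfin (horo f (piX 1%g) j%:R) _ (bmf_horo nf (piX 1%g) j%:R) (bmf_indic R mB')).
  move=> x _; rewrite indicE; case: (boolP (x \in _)) => [_|/negP nB]; first by have /andP[] := horo01 nf (piX 1%g) j%:R x.
  apply: soft_count_le => // c /andP[c0 c1]; rewrite piX_act mul1g => /card_ge_seqP[[|v s'] [_ sz sv]] //.
  have := sv v (mem_head _ _); rewrite lattice_points_piX => -[q [q0 cq] _]; exfalso; apply: nB; apply/mem_set.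
  have [xb|nxb] := pselect (unit_box x); last by right.
  left; have [a Na aq] : exists2 a, N a & closeM k a (qvec (iotaSL (unip_mx (- x) * Phi n j%:R)%g) q).
    by apply: bump_close; rewrite gt_eqF// (lt_le_trans c0).
  have [z zs za] := cov _ Na.
  by apply: (BP x q a z) => //; apply/eqP.
apply: (le_trans le1); rewrite mean_indic//.
have lamB : lam0 (B `|` ~` @unit_box R n) = L (B `&` @unit_box R n) by rewrite lam0E setIUl setICl setU0.
rewrite (congr1 fine lamB).
have LBB : (L (B `&` @unit_box R n) <= L B)%E.
  by apply: le_measure; rewrite ?inE//; apply: measurableI => //; exact: measurable_unit_box.
have := le_trans LBB LB; set y := L _; move=> yle.
have hc : 0 < hit_const R n by rewrite ltr_wpDl// !mulr_ge0 ?exprn_ge0.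
have fk0 : (0 : R) < (fct k)%:R ^+ (d + d) by rewrite exprn_gt0// ltr0n fct_gt0.
have yf : y \is a fin_num by rewrite ge0_fin_numE ?measure_ge0// (le_lt_trans yle)// ltry.
have : fine y <= (size s)%:R * (hit_const R n / (fct k)%:R ^+ (d + d)) by rewrite -lee_fin fineK.
move=> h; apply: (le_trans h); by rewrite mulrCA [leRHS]mulrC ler_pM2l// ler_pdivrMr.
Qed.

End NullSets.

(** * The limit *)

Lemma mean_cvg_ae d (T : measurableType d) (R : realType) (P : probability T R) (bad : set T)
    (f_ : nat -> T -> R) (f : T -> R) : measurable bad -> P bad = 0%E -> (forall j, bmf (f_ j)) -> bmf f ->
  (forall j x, `|f_ j x| <= 1) -> (forall x, ~ bad x -> f_ j x @[j --> \oo] --> f x) ->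
  \int[P]_x f_ j x @[j --> \oo] --> \int[P]_x f x.
Proof.
move=> mbad P0 bf [mf _] f1 fcvg; have Pfin : (P setT < +oo)%E by rewrite probability_setT ltry.
have [] := @dominated_convergence _ _ _ P setT measurableT (fun j x => (f_ j x)%:E) (fun x => (f x)%:E) (fun=> 1%:E).
- by move=> j; apply/measurable_EFinP; exact: (bf j).1.
- exact/measurable_EFinP.
- exists bad; split=> // x h; apply: contrapT => nb; apply: h => _; apply/cvg_EFin; [exact: nearW|exact: fcvg].
- exact: (bmf_integrable measurableT Pfin (bmf_cst T 1)).
- by apply: aeW => x j _; rewrite lee_fin.
move=> fi _ cv; rewrite /Rintegral; apply: fine_cvg.
by rewrite fineK ?integrable_fin_num//; exact: cv.
Qed.

Lemma dist_sandwich (R : realType) (p a a' b b' y e : R) : `|p - a| <= e / 2 -> `|p - b| <= e / 2 ->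
  `|a - a'| <= e / 2 -> `|b - b'| <= e / 2 -> a' <= y -> y <= b' -> `|p - y| <= e.
Proof. by rewrite !ler_norml => /andP[? ?] /andP[? ?] /andP[? ?] /andP[? ?] ? ?; apply/andP; split; lra. Qed.

Section FlowOrbit.
Variables (R : realType) (n : nat).
Local Notation d := n.+1.
Local Notation X := (SLQ_SLA R d).
Local Notation G := (SL (adele R) d).

Lemma closeM_iota k (e : R) (h : SL R d) : e < (fct k)%:R^-1 -> near1 e h ->
  closeM k (val (1%g : G)) (val (iotaSL h)).
Proof.
move=> ek hn i j; rewrite SL_val1; split.
  have /matrixP/(_ i j) := iota_real h; rewrite mxE => ->.
  have -> : adele_real ((1%:M : 'M[adele R]_d) i j) = (i == j)%:R by rewrite mxE; case: (i == j).
  by rewrite distrC; apply: le_lt_trans ek; exact: hn.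
apply: (cong_trans _ (cong_refl _ _)); rewrite congE => p.
rewrite adele_padicM adele_padicB.
have /matrixP/(_ i j) := iota_padic h p; rewrite mxE => ->.
have -> : adele_padic p ((1%:M : 'M[adele R]_d) i j) = (1%:M : 'M[Qp p]_d) i j by rewrite !mxE; case: (i == j).
by rewrite subrr mulr0 rpred0.
Qed.

(** Serves to make the sets of [x] whose [lambda]-measure is taken Borel. *)
Lemma continuous_flow_orbit (x0 : X) t : continuous (fun x : 'rV[R]_n => x0 ** iotaSL (unip_mx (- x) * Phi n t)%g).
Proof.
move=> x P; set y := x0 ** _; have [g yE] := piX_repr y.
rewrite yE => /(continuous_piX (x := g)) /SL_closeP[k kP].
have [k' k'P] := closeM_mull d k (val g).
have e0 : 0 < ((fct k')%:R^-1 / 2 : R) by rewrite divr_gt0 ?invr_gt0 ?ltr0n ?fct_gt0.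
have dl : 0 < ((fct k')%:R^-1 / 2 : R) / lam n t by rewrite divr_gt0// lam_gt0.
have /= := @nbhsx_ballx _ _ x _ dl.
apply: filterS => z [_ xz] /=.
have -> : (unip_mx (- z) * Phi n t = unip_mx (- x) * Phi n t * unip_mx (lam n t *: (x - z)))%g.
  rewrite -mulgA -unip_Phi mulgA unipD; congr (unip_mx _ * _)%g.
  by apply/rowP => i; rewrite !mxE; ring.
rewrite iotaM actM -/y yE piX_act; apply: kP; rewrite SL_valM -[X in closeM _ X _]mulmx1 -(SL_val1 (adele R) d).
apply: k'P; apply: (closeM_iota (e := (fct k')%:R^-1 / 2)).
  by rewrite ltr_pdivrMr// ltr_pMr ?invr_gt0 ?ltr0n ?fct_gt0// ltr1n.
apply: near1_unip; first exact: ltW.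
move=> j; rewrite !mxE normrM gtr0_norm ?lam_gt0//.
have := xz ord0 j; rewrite /ball /= => /ltW.
by rewrite ler_pdivlMr ?lam_gt0// mulrC.
Qed.

End FlowOrbit.

Section Sandwich.
Variables (R : realType) (n : nat).
Local Notation d := n.+1.
Local Notation X := (SLQ_SLA R d).
Local Notation V := 'rV[adele R]_d.
Variables (A : set V) (C : R) (D r : nat).
Hypotheses (D0 : (0 < D)%N) (AC : A `<=` bdd C D).
Let E := [set x : X | `I_r #<= lattice_points A x].
Let lower k : X -> R := soft_count (fun v => 1 - bump k (~` A) v) r.
Let upper k : X -> R := soft_count (bump k A) r.

Lemma lower_le k x : lower k x <= \1_E x.
Proof.
apply: soft_count_le; first by rewrite indicE.
move=> c /andP[c0 c1] h; rewrite indicE mem_set//.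
apply: card_le_trans h _; apply: subset_card_le => v [[hv xv] v0]; split=> //; split=> //.
by apply: contrapT => nA; move: hv; rewrite /level_set /= bump1// subrr leNgt c0.
Qed.

Lemma upper_ge k x : \1_E x <= upper k x.
Proof.
rewrite indicE; have [/set_mem xE|_] := boolP (x \in E); last by have /andP[] := soft_count01 (bump k A) r x.
apply: soft_count_ge; first by rewrite ler01 lexx.
apply: card_le_trans xE _; apply: subset_card_le => v [[Av xv] v0]; split=> //; split=> //.
by rewrite /level_set /= bump1.
Qed.

Lemma closeM_sym k (v w : V) : closeM k v w -> closeM k w v.
Proof. by move=> h i j; have [h1 h2] := h i j; split; [rewrite distrC|exact: cong_sym]. Qed.

(* Away from the boundary each lattice point near A is either interior or exterior. *)
Lemma sandwich_exact x : ~ (`I_1 #<= lattice_points (boundary A) x) ->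
  exists K, forall k, (K <= k)%N -> lower k x = \1_E x /\ upper k x = \1_E x.
Proof.
move=> nb; have fin : finite_set (lattice_points (bdd (C + 1) D) x) by exact: (lattice_points_finite x D0 (C := C + 1)).
have nbd v : lattice_points (bdd (C + 1) D) x v -> ~ boundary A v.
  move=> [[vb xv] v0] bv; apply: nb; apply/card_ge_seqP; exists [:: v]; split=> // w.
  by rewrite inE => /eqP ->; split.
have stab v : lattice_points (bdd (C + 1) D) x v -> exists K, forall k, (K <= k)%N ->
    (A v -> bump k (~` A) v = 0) /\ (~ A v -> bump k A v = 0).
  move=> vL; have nv := nbd v vL; have [cv|ncv] := pselect (closure A v).
    have iv : A° v by apply: contrapT => niv; apply: nv.
    have [K hK] := closeM_nbhs iv; exists K => k Kk; split; last by move/(_ (interior_subset iv)).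
    move=> _; apply/eqP; apply: contraT => /bump_close[a na av]; exfalso; apply: na; apply: hK => i j.
    exact: close_mono Kk (closeM_sym av i j).
  have : nbhs v (~` A).
    by have /open_nbhs_nbhs : open_nbhs v (~` closure A); [split=> //; exact: closed_openC (@closed_closure _ _)|]; apply: filterS => w; apply: contra_not; exact: subset_closure.
  move=> /closeM_nbhs[K hK]; exists K => k Kk; split; first by move=> Av; exfalso; apply: ncv; exact: subset_closure.
  move=> _; apply/eqP; apply: contraT => /bump_close[a Aa av]; exfalso.
  by apply: (hK a) => // i j; exact: close_mono Kk (closeM_sym av i j).
have [K hK] : exists K, forall v, lattice_points (bdd (C + 1) D) x v -> forall k, (K <= k)%N ->
    (A v -> bump k (~` A) v = 0) /\ (~ A v -> bump k A v = 0).
  have /finite_seqP[s sE] := fin; rewrite sE.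
  have {}stab v : v \in s -> exists K, forall k, (K <= k)%N ->
      (A v -> bump k (~` A) v = 0) /\ (~ A v -> bump k A v = 0).
    by move=> vs; apply: stab; rewrite sE.
  elim: (s) stab => [|v s' IH] stab; first by exists 0%N.
  have [w ws|K hK] := IH; first by apply: stab; rewrite inE ws orbT.
  have [K' hK'] := stab v (mem_head _ _); exists (maxn K K') => w /=.
  rewrite inE => /orP[/eqP ->|ws] k; rewrite geq_max => /andP[h1 h2]; first exact: hK'.
  exact: (hK w).
exists K => k Kk; split; apply/eqP; rewrite eq_le; apply/andP; split; [exact: lower_le| | |exact: upper_ge].
- rewrite indicE; have [/set_mem xE|_] := boolP (x \in E); last by have /andP[] := soft_count01 (fun v => 1 - bump k (~` A) v) r x.
  apply: soft_count_ge; first by rewrite ler01 lexx.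
  apply: card_le_trans xE _; apply: subset_card_le => v [[Av xv] v0]; split=> //; split=> //.
  have vL : lattice_points (bdd (C + 1) D) x v by split=> //; split=> //; apply: (bddW (C := C) (D := D)) (AC Av); rewrite ?lerDl.
  by rewrite /level_set /= ((hK v vL k Kk).1 Av) subr0.
- apply: soft_count_le; first by rewrite indicE.
move=> c /andP[c0 c1] h; rewrite indicE mem_set//.
apply: card_le_trans h _; apply: subset_card_le => v [[hv xv] v0]; split=> //; split=> //.
have bv : bump k A v != 0 by rewrite gt_eqF// (lt_le_trans c0).
have vL : lattice_points (bdd (C + 1) D) x v.
  have [a Aa av] := bump_close bv; split=> //; split=> //; apply: (close0_bdd D0 (AC Aa)) => i j.
  exact: close_mono (leq0n k) (av i j).
by apply: contrapT => nA; move: bv; rewrite ((hK v vL k Kk).2 nA) eqxx.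
Qed.

Lemma boundary_closed : closed (boundary A).
Proof.
rewrite /boundary setDE; apply: closedI; first exact: closed_closure.
by apply: open_closedC; exact: open_interior.
Qed.

End Sandwich.

Section Limit.
Variables (R : realType) (n : nat).
Local Notation d := n.+1.
Local Notation X := (SLQ_SLA R d).
Local Notation V := 'rV[adele R]_d.
Variable m : {measure set (borel V) -> \bar R}.
Hypothesis m_haar : is_haar m.
Variable mu : probability (borel X) R.
Hypothesis mu_inv : is_invariant mu.
Hypothesis n_gt0 : (0 < n)%N.
Variables (A : set V) (r : nat).
Hypothesis A_borel : measurable (A : set (borel V)).
Hypothesis A_bounded : precompact A.
Hypothesis A_bdry : m (boundary A) = 0%E.
Variable lambda : probability (borel 'rV[R]_n) R.
Hypothesis lambda_ac : lambda `<< @lebesgue_rV R n.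
Variable x0 : X.
Let E := [set x : X | `I_r #<= lattice_points A x].
Let orbit t (x : 'rV[R]_n) : X := x0 ** iotaSL (unip_mx (- x) * Phi n t)%g.

Lemma count_limit (t_ : nat -> R) : t_ j @[j --> \oo] --> +oo ->
  lambda (orbit (t_ j) @^-1` E) @[j --> \oo] --> mu E.
Proof.
move=> t_oo; have cA : compact (closure A) by rewrite -precompactE.
have [C [D [D0 C0 clAC]]] := compact_bdd cA.
have AC : A `<=` bdd C D := subset_trans (@subset_closure _ A) clAC.
have bC : boundary A `<=` bdd C D by move=> v [/clAC].
have bad0 := lattice_avoids_null m_haar mu_inv n_gt0 D0 C0 (@boundary_closed R n A) bC A_bdry.
have mb : measurable (boundary A : set (borel V)).
  rewrite -[boundary A]setCK; apply: measurableC; apply: sub_sigma_algebra; apply: closed_openC.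
  exact: boundary_closed.
have mbad := measurable_count 1 D0 mb bC.
have mE : measurable (E : set (borel X)) := measurable_count r D0 A_borel AC.
have mS t : measurable (orbit t @^-1` E : set (borel 'rV[R]_n)).
  by rewrite -[X in measurable X]setTI; exact: (continuous_borel (@continuous_flow_orbit R n x0 t)).
pose lower k : X -> R := soft_count (fun v => 1 - bump k (~` A) v) r.
pose upper k : X -> R := soft_count (bump k A) r.
have nl k : nice (lower k) by apply: nice_soft_count; exact: tame_cobump AC.
have nu k : nice (upper k) by apply: nice_soft_count; exact: tame_bump AC.
have nice1 (f : X -> R) x : nice f -> `|f x| <= 1.
  by move=> [/(_ x)/andP[f0 f1] _ _]; rewrite ger0_norm.
have ex x : ~ (`I_1 #<= lattice_points (boundary A) x) ->
    lower k x @[k --> \oo] --> (\1_E x : R) /\ upper k x @[k --> \oo] --> (\1_E x : R).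
  move=> /(sandwich_exact r D0 AC)[K hK].
  by split; apply: cvg_near_cst; exists K => // k /= /hK[].
have ll : \int[mu]_x lower k x @[k --> \oo] --> \int[mu]_x (\1_E x : R).
  apply: (mean_cvg_ae mbad bad0) => [k||k x|x /ex[]//]; [exact: nice_bmf|exact: bmf_indic|exact: nice1].
have lu : \int[mu]_x upper k x @[k --> \oo] --> \int[mu]_x (\1_E x : R).
  apply: (mean_cvg_ae mbad bad0) => [k||k x|x /ex[]//]; [exact: nice_bmf|exact: bmf_indic|exact: nice1].
have lamfin : (lambda setT < +oo)%E by rewrite probability_setT ltry.
have S1 t : fine (lambda (orbit t @^-1` E)) = \int[lambda]_x (\1_(orbit t @^-1` E) x : R).
  by apply/esym; exact: mean_indic (mS t).
have lo k t : \int[lambda]_x horo (lower k) x0 t x <= fine (lambda (orbit t @^-1` E)).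
  rewrite S1; apply: (@mean_le _ _ _ lambda setT measurableT lamfin (horo (lower k) x0 t) _ (bmf_horo (nl k) x0 t) (bmf_indic R (mS t))).
  by move=> x _; exact: lower_le.
have up k t : fine (lambda (orbit t @^-1` E)) <= \int[lambda]_x horo (upper k) x0 t x.
  rewrite S1; apply: (@mean_le _ _ _ lambda setT measurableT lamfin _ (horo (upper k) x0 t) (bmf_indic R (mS t)) (bmf_horo (nu k) x0 t)).
  by move=> x _; exact: upper_ge.
have main : fine (lambda (orbit (t_ j) @^-1` E)) @[j --> \oo] --> \int[mu]_x (\1_E x : R).
  apply/cvgrPdist_le => e e0; have e20 : 0 < e / 2 by rewrite divr_gt0.
  move/cvgrPdist_le: ll => /(_ _ e20)[k1 _ /(_ k1 (leqnn _)) h1].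
  move/cvgrPdist_le: lu => /(_ _ e20)[k2 _ /(_ k2 (leqnn _)) h2].
  move/cvgrPdist_le: (horo_limit lambda_ac x0 (nl k1) mu_inv t_oo) => /(_ _ e20) H1.
  move/cvgrPdist_le: (horo_limit lambda_ac x0 (nu k2) mu_inv t_oo) => /(_ _ e20) H2.
  move: H1 H2; apply: filterS2 => j H1 H2.
  exact: (dist_sandwich h1 h2 H1 H2 (lo k1 (t_ j)) (up k2 (t_ j))).
have fE (P : set (borel 'rV[R]_n)) : measurable P -> lambda P = (fine (lambda P))%:E.
  by move=> mP; rewrite fineK// fin_num_measure.
have muE : mu E = (\int[mu]_x (\1_E x : R))%:E.
  have -> : \int[mu]_x (\1_E x : R) = fine (mu E) by exact: mean_indic mE.
  by rewrite fineK// fin_num_measure.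
rewrite [X in _ --> X]muE.
have -> : (fun j => lambda (orbit (t_ j) @^-1` E)) = (fun j => (fine (lambda (orbit (t_ j) @^-1` E)))%:E).
  by apply/funext => j; exact: fE (mS (t_ j)).
by apply/cvg_EFin; [exact: nearW|exact: main].
Qed.

End Limit.

Lemma mulmxK_SL (R : realType) (n : nat) (g : SL (adele R) n.+1) :
  cancel (fun v : 'rV[adele R]_n.+1 => v *m val g) (fun v => v *m val g^-1%g).
Proof. by move=> v; rewrite -mulmxA -SL_valM mulgV SL_val1 mulmx1. Qed.

Lemma flow_points (R : realType) (n : nat) (A : set 'rV[adele R]_n.+1) (M : SL (adele R) n.+1) (h : SL R n.+1) r :
  (`I_r #<= ([set a *m val (iotaSL h) | a in A] `&` Qlattice M) `\ (0 : 'rV[adele R]_n.+1)) =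
  (`I_r #<= lattice_points A (piX M ** iotaSL h^-1%g)).
Proof.
have -> : ([set a *m val (iotaSL h) | a in A] `&` Qlattice M) `\ (0 : 'rV[adele R]_n.+1) =
    (fun a => a *m val (iotaSL h)) @` lattice_points A (piX M ** iotaSL h^-1%g).
  have hK : iotaSL h^-1%g = (iotaSL h)^-1%g by exact: iotaV.
  have qE q : qvec (M * iotaSL h^-1%g)%g q *m val (iotaSL h) = qvec M q.
    by rewrite /qvec SL_valM -!mulmxA -SL_valM hK mulVg SL_val1 mulmx1.
  rewrite piX_act lattice_points_piX; apply/seteqP; split=> v.
    move=> [[[a Aa av] [q _ qv]] v0]; exists a => //; exists q.
      have aq : qvec (M * iotaSL h^-1%g)%g q = a.
        apply: (can_inj (mulmxK_SL (iotaSL h))); rewrite qE av; exact: qv.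
      split; last by rewrite aq.
      by move=> q0; apply: v0; rewrite /= -qv q0 -/(qvec M 0) qvec0.
    by apply: (can_inj (mulmxK_SL (iotaSL h))); rewrite qE av; exact: qv.
  move=> [_ [q [q0 Aq] <-] <-]; rewrite qE; split; last by rewrite /= -(qvec0 M) => /qvec_inj.
  by split; [exists (qvec (M * iotaSL h^-1%g)%g q); rewrite ?qE|exists q].
by apply: card_le_eqr; apply: inj_card_eq => a b _ _; exact: (can_inj (mulmxK_SL (iotaSL h))).
Qed.

Local Open Scope card_scope.

(* d = n.+1 *)
Theorem theorem5p1 (R : realType) (n : nat) (d_ge2 : (2 <= n.+1)%N)
    (m : {measure set (borel 'rV[adele R]_n.+1) -> \bar R})
    (m_haar : is_haar m)
    (mu : probability (borel (SLQ_SLA R n.+1)) R)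
    (mu_inv : is_invariant mu)
    (A : set 'rV[adele R]_n.+1)
    (A_borel : measurable (A : set (borel 'rV[adele R]_n.+1)))
    (A_bounded : precompact A)
    (A_bdry : m (boundary A) = 0%E)
    (M : SL (adele R) n.+1) (r : nat)
    (lambda : probability (borel 'rV[R]_n) R)
    (lambda_ac : lambda `<< @lebesgue_rV R n) :
  lambda [set x : 'rV[R]_n |
      `I_r #<= ([set a *m val (iotaSL (Phi n (- t) * unip_mx x)%g) | a in A]
                  `&` Qlattice M) `\ (0 : 'rV[adele R]_n.+1)] @[t --> +oo]
  --> mu [set g : SLQ_SLA R n.+1 |
      `I_r #<= (A `&` coset_lattice g) `\ (0 : 'rV[adele R]_n.+1)].
Proof.
(* The limit is tested along sequences of times, the form in which all the averages above
   converge. *)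
apply/cvge_pinftyP => t_ t_oo.
have -> : (fun j => lambda [set x : 'rV[R]_n |
      `I_r #<= ([set a *m val (iotaSL (Phi n (- t_ j) * unip_mx x)%g) | a in A]
                  `&` Qlattice M) `\ (0 : 'rV[adele R]_n.+1)]) =
    (fun j => lambda ((fun x : 'rV[R]_n => piX M ** iotaSL (unip_mx (- x) * Phi n (t_ j))%g) @^-1`
      [set y | `I_r #<= lattice_points A y])).
  apply/funext => j; congr (lambda _); apply/funext => x.
  have := flow_points A M (Phi n (- t_ j) * unip_mx x)%g r.
  by rewrite invgM -unipN -PhiN opprK => /(congr1 is_true).
have n0 : (0 < n)%N by [].
exact: (count_limit m_haar mu_inv n0 A_borel A_bounded A_bdry lambda_ac (piX M) t_oo).
Qed.
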